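(* Let $n\ge 3$ and let $(M,g,u)$ be a static triple with positive cosmological constant, i.e. $M$ is a connected compact $n$-dimensional smooth manifold with non-empty smooth boundary $\partial M$, $g$ is a smooth Riemannian metric on $M$, and $u\in C^\infty(M)$ satisfies $u\,\mathrm{Ric}=\mathrm{D}^2u+n\,u\,g$ and $\Delta u=-n\,u$ in $M$, $u>0$ in the interior of $M$ and $u=0$ on $\partial M$. Let $N$ be a connected component of $M\setminus\mathrm{MAX}(u)$, and let $\partial N=\partial M\cap N$ be the non-empty and possibly disconnected portion of $\partial M$ that lies in $N$. Then $$\max_{\Sigma\in\pi_0(\partial N)}\kappa(\Sigma)\ \ge\ 1 .$$ Moreover, if equality holds, then, up to a normalization of $u$, the triple $(M,g,u)$ is isometric to the de Sitter solution.
   Context: $\mathrm{Ric}$, $\mathrm{D}$, $\mathrm{D}^2$, $\Delta$ are the Ricci tensor, Levi-Civita connection, Hessian and Laplace-Beltrami operator of $g$. The equations imply that the scalar curvature is $\mathrm{R}\equiv n(n-1)$. It is known that $|\mathrm{D}u|$ is constant and positive on each connected component of $\partial M$. Set $u_{\max}=\max_M u$ and $\mathrm{MAX}(u)=\{p\in M: u(p)=u_{\max}\}$. $\pi_0(\partial N)$ is the set of connected components of $\partial N$. The surface gravity of a connected component $\Sigma$ of $\partial M$ is $\kappa(\Sigma)=|\mathrm{D}u|_{|\Sigma}/u_{\max}$. The de Sitter solution is the triple $(M_0,g_0,u_0)$ with $M_0=\overline{B(0,1)}\subset\mathbb{R}^n$, $g_0=\frac{d|x|\otimes d|x|}{1-|x|^2}+|x|^2g_{\mathbb{S}^{n-1}}$,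 $u_0=\sqrt{1-|x|^2}$, where $g_{\mathbb{S}^{n-1}}$ is the standard round metric and $g_0,u_0$ are extended smoothly through the origin and up to the boundary (so it is a closed round unit hemisphere with its height function). ''Up to a normalization of $u$, $(M,g,u)$ is isometric to $(M_0,g_0,u_0)$'' means that there are a constant $c>0$ and an isometry $\Phi:(M,g)\to(M_0,g_0)$ with $u=c\,u_0\circ\Phi$. *)

(* Defs.v *)
From HB Require Import structures.
From mathcomp Require Import all_boot all_order all_algebra.
From mathcomp Require Import all_classical all_reals all_analysis.

Set Implicit Arguments.
Unset Strict Implicit.
Unset Printing Implicit Defensive.

Import Order.TTheory GRing.Theory Num.Theory.
Import numFieldNormedType.Exports.

Local Open Scope classical_set_scope.
Local Open Scope ring_scope.

Section HalfSpace.
Context {R : realType} {n : nat}.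
Implicit Types (x : 'rV[R]_n) (f : 'rV[R]_n -> R).

(* The coordinate of index 0 of [x]: the sum has exactly one term as soon as
   [n > 0]; this form makes sense for every [n : nat]. *)
Definition coord0 x : R := \sum_(i < n | val i == 0%N) x 0 i.

Definition half_space : set 'rV[R]_n := [set x | 0 <= coord0 x].

Definition iter_partial (s : seq 'I_n) f : 'rV[R]_n -> R :=
  foldr (fun i (h : 'rV[R]_n -> R) x => 'D_(delta_mx 0 i) h x) f s.

Definition smooth_open (U : set 'rV[R]_n) f : Prop :=
  forall (s : seq 'I_n) x, U x -> differentiable (iter_partial s f) x.

(* [f] is C^infty on an arbitrary subset [V]: near each point of [V] it is the
   restriction of a C^infty function defined on an open subset of R^n. *)
Definition smooth_on (V : set 'rV[R]_n) f : Prop :=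
  forall x, V x -> exists (U : set 'rV[R]_n) (F : 'rV[R]_n -> R),
    [/\ open U, U x, smooth_open U F & forall y, U y -> V y -> f y = F y].

(* The i-th partial derivative, taken as a right derivative: at a point of the
   half-space it only involves values of [f] on the half-space, so it is
   meaningful up to the boundary. For [f] smooth on a relatively open subset of
   the half-space it is the usual partial derivative of any smooth extension. *)
Definition partial (i : 'I_n) f x : R :=
  lim ((fun h : R => h^-1 * (f (x + h *: delta_mx 0 i) - f x)) @ 0^'+).

End HalfSpace.

Arguments half_space {R n}.

Section LocalGeometry.
Context {R : realType} {n : nat}.
Variables (G : 'rV[R]_n -> 'M[R]_n) (f : 'rV[R]_n -> R).
Implicit Types (x : 'rV[R]_n) (i j k l m : 'I_n).

(* Gamma^k_{ij} *)
Definition christoffel k i j x : R :=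
  2^-1 * \sum_(l < n) invmx (G x) k l *
    (partial i (fun y => G y j l) x + partial j (fun y => G y i l) x
     - partial l (fun y => G y i j) x).

(* The component along d_l of R(d_i, d_j) d_k
   = D_{d_i} D_{d_j} d_k - D_{d_j} D_{d_i} d_k. *)
Definition riemann l k i j x : R :=
  partial i (christoffel l j k) x - partial j (christoffel l i k) x
  + \sum_(m < n) (christoffel l i m x * christoffel m j k x
                  - christoffel l j m x * christoffel m i k x).

(* Ric(Y, Z) is the trace of X |-> R(X, Y) Z. *)
Definition ricci j k x : R := \sum_(i < n) riemann i k i j x.

Definition hessian i j x : R :=
  partial i (partial j f) x
  - \sum_(k < n) christoffel k i j x * partial k f x.

Definition laplacian x : R :=
  \sum_(i < n) \sum_(j < n) invmx (G x) i j * hessian i j x.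

Definition local_grad_norm x : R :=
  Num.sqrt (\sum_(i < n) \sum_(j < n)
              invmx (G x) i j * partial i f x * partial j f x).

End LocalGeometry.

(* [chart_inv a] is total; only its values on the image of the chart [a] are
   meaningful. *)
Record atlas (R : realType) (n : nat) (M : Type) := Atlas {
  chart_index : Type;
  chart_dom : chart_index -> set M;
  chart : chart_index -> M -> 'rV[R]_n;
  chart_inv : chart_index -> 'rV[R]_n -> M }.

Section Maps.
Context {R : realType} {n : nat} {M M' : topologicalType}.
Variables (A : atlas R n M) (B : atlas R n M') (Phi : M -> M').

Definition chart_image (a : chart_index A) : set 'rV[R]_n :=
  chart a @` chart_dom a.

Definition local_dom (a : chart_index A) (b : chart_index B) : set 'rV[R]_n :=
  chart a @` (chart_dom a `&` Phi @^-1` chart_dom b).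

Definition local_rep (a : chart_index A) (b : chart_index B)
  : 'rV[R]_n -> 'rV[R]_n := chart b \o Phi \o chart_inv a.

Definition smooth_map : Prop :=
  continuous Phi /\
  forall (a : chart_index A) (b : chart_index B) (j : 'I_n),
    smooth_on (local_dom a b) (fun x => local_rep a b x 0 j).

(* A symmetric 2-tensor is the family of its component matrices in the charts
   of the atlas, as functions of the coordinates; this is [Phi^* h = g]. *)
Definition preserves_metric (g : chart_index A -> 'rV[R]_n -> 'M[R]_n)
    (h : chart_index B -> 'rV[R]_n -> 'M[R]_n) : Prop :=
  forall (a : chart_index A) (b : chart_index B) x, local_dom a b x ->
    let J := \matrix_(i < n, j < n)
               partial i (fun y => local_rep a b y 0 j) x in
    g a x = J *m h b (local_rep a b x) *m J^T.

End Maps.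

Section Manifold.
Context {R : realType} {n : nat} {M : topologicalType}.
Variable A : atlas R n M.

Record is_manifold : Prop := IsManifold {
  manifold_hausdorff : hausdorff_space M;
  manifold_second_countable : @second_countable M;
  chart_cover : forall p : M, exists a : chart_index A, chart_dom a p;
  chart_dom_open : forall a : chart_index A, open (chart_dom a);
  chart_image_open : forall a : chart_index A,
    exists2 U : set 'rV[R]_n, open U & chart_image a = U `&` half_space;
  chartK : forall (a : chart_index A) p,
    chart_dom a p -> chart_inv a (chart a p) = p;
  chart_continuous : forall (a : chart_index A) p,
    chart_dom a p -> {for p, continuous (chart a)};
  chart_inv_continuous : forall a : chart_index A,
    {within chart_image a, continuous (chart_inv a)};
  transition_smooth : smooth_map A A id }.

Definition boundary : set M :=
  [set p | exists2 a : chart_index A, chart_dom a p & coord0 (chart a p) = 0].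

Definition smooth_fun (u : M -> R) : Prop :=
  forall a : chart_index A, smooth_on (chart_image a) (u \o chart_inv a).

Definition metric_components : Type :=
  chart_index A -> 'rV[R]_n -> 'M[R]_n.

Record is_riemannian (g : metric_components) : Prop := IsRiemannian {
  metric_smooth : forall (a : chart_index A) (i j : 'I_n),
    smooth_on (chart_image a) (fun x => g a x i j);
  metric_sym : forall (a : chart_index A) x,
    chart_image a x -> (g a x)^T = g a x;
  metric_pos : forall (a : chart_index A) x (v : 'rV[R]_n),
    chart_image a x -> v != 0 -> 0 < (v *m g a x *m v^T) 0 0;
  metric_compatible : preserves_metric id g g }.

(* |Du| at [p], computed in any chart around [p]. *)
Definition grad_norm (g : metric_components) (u : M -> R) (p : M) : R :=
  get [set r | exists2 a : chart_index A, chart_dom a p &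
         r = local_grad_norm (g a) (u \o chart_inv a) (chart a p)].

Record is_static_triple (g : metric_components) (u : M -> R) : Prop :=
  IsStaticTriple {
  static_manifold : is_manifold;
  static_compact : compact [set: M];
  static_connected : connected [set: M];
  static_boundary : boundary !=set0;
  static_metric : is_riemannian g;
  static_smooth : smooth_fun u;
  static_ricci : forall (a : chart_index A) x, chart_image a x ->
    let v := u \o chart_inv a in
    forall i j : 'I_n,
      v x * ricci (g a) i j x = hessian (g a) v i j x + n%:R * v x * g a x i j;
  static_laplacian : forall (a : chart_index A) x, chart_image a x ->
    let v := u \o chart_inv a in
    laplacian (g a) v x = - n%:R * v x;
  static_pos : forall p, (~` boundary) p -> 0 < u p;
  static_zero : forall p, boundary p -> u p = 0 }.

Definition u_max (u : M -> R) : R := sup (range u).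

Definition MAX (u : M -> R) : set M := [set p | u p = u_max u].

(* The common value of |Du| / u_max on [Sigma]. *)
Definition surface_gravity (g : metric_components) (u : M -> R)
    (Sigma : set M) : R :=
  get [set k | forall p, Sigma p -> k = grad_norm g u p / u_max u].

End Manifold.

Definition pi0 {T : topologicalType} (X : set T) : set (set T) :=
  connected_component X @` X.

Definition is_max {R : realType} (X : set R) (m : R) : Prop :=
  X m /\ ubound X m.

Definition riemannian_isometry {R : realType} {n : nat} {M M' : topologicalType}
    (A : atlas R n M) (g : metric_components A)
    (B : atlas R n M') (h : metric_components B) (Phi : M -> M') : Prop :=
  exists Psi : M' -> M,
    [/\ cancel Phi Psi, cancel Psi Phi,
        smooth_map A B Phi, smooth_map B A Psi & preserves_metric Phi g h].

Section DeSitter.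
Context {R : realType} {n : nat}.
Implicit Types (x y : 'rV[R]_n).

(* The square of the Euclidean norm; the library norm on row vectors is the
   sup norm. *)
Definition sqnorm x : R := \sum_(i < n) x 0 i ^+ 2.

Definition closed_ball1 : set 'rV[R]_n := [set x | sqnorm x <= 1].

Lemma closed_ball1_0 : (0 : 'rV[R]_n) \in closed_ball1.
Proof.
by rewrite inE /closed_ball1 /= /sqnorm big1 ?ler01// => i _; rewrite mxE expr0n.
Qed.

Definition deSitter_origin : set_type closed_ball1 :=
  exist _ 0 closed_ball1_0.

Definition to_ball x : set_type closed_ball1 := insubd deSitter_origin x.

Definition deSitter_height x : R := Num.sqrt (1 - sqnorm x).

Definition deSitter_u (p : set_type closed_ball1) : R :=
  deSitter_height (set_val p).

(* The closed ball is identified with the closed unit hemisphere of R x R^n by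
   x |-> (sqrt (1 - |x|^2), x). The smooth structure up to the boundary is the
   one of the hemisphere, for which sqrt (1 - |x|^2) is smooth (it is not the
   one induced by R^n): besides the coordinates x on the open ball, which are
   translated by e_0 to take values in the half-space, the charts are the two
   stereographic projections of the hemisphere from the points +e_0 and -e_0
   of its boundary. These projections are onto the half-space. *)
Inductive deSitter_index := Inner | Stereo of bool.

Definition e0 : 'rV[R]_n := \row_(i < n) (val i == 0%N)%:R.

Definition pole (s : bool) : R := (-1) ^+ s.

Definition deSitter_dom (a : deSitter_index) : set (set_type closed_ball1) :=
  match a with
  | Inner => [set p | sqnorm (set_val p) < 1]
  | Stereo s => [set p | pole s * coord0 (set_val p) < 1]
  end.

Definition deSitter_chart (a : deSitter_index) (p : set_type closed_ball1)
  : 'rV[R]_n :=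
  let x := set_val p in
  match a with
  | Inner => x + e0
  | Stereo s =>
      \row_(i < n) ((if val i == 0%N then deSitter_height x else x 0 i)
                    / (1 - pole s * coord0 x))
  end.

Definition deSitter_chart_inv (a : deSitter_index) y : set_type closed_ball1 :=
  match a with
  | Inner => to_ball (y - e0)
  | Stereo s =>
      to_ball (\row_(i < n)
                 ((if val i == 0%N then pole s * (sqnorm y - 1) else 2 * y 0 i)
                  / (sqnorm y + 1)))
  end.

Definition deSitter_atlas : atlas R n (set_type closed_ball1) :=
  Atlas deSitter_dom deSitter_chart deSitter_chart_inv.

(* On the open ball, d|x|^2 / (1 - |x|^2) + |x|^2 g_{S^{n-1}} has components
   delta_ij + x_i x_j / (1 - |x|^2), since d|x| = sum_i x_i dx_i / |x| and
   |x|^2 g_{S^{n-1}} = sum_i dx_i^2 - d|x|^2. In the stereographic charts the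
   same metric is the conformal form of the round metric. *)
Definition deSitter_metric : metric_components deSitter_atlas :=
  fun a y =>
    match a with
    | Inner => let x := y - e0 in 1%:M + (1 - sqnorm x)^-1 *: (x^T *m x)
    | Stereo _ => (4 / (1 + sqnorm y) ^+ 2)%:M
    end.

End DeSitter.

(* Main.v *)
(* Let W = |Du|^2 + u^2. For a static triple, Bochner's formula gives
     u L W - <Du, D W> = 2 u |D^2 u + u g|^2,   L = Laplace-Beltrami,
   so u > 0 and the weak maximum principle bound W on N by its values on the
   boundary of N and on MAX(u), where W = u_max^2. On a component of the boundary
   W = |Du|^2 is the constant (kappa u_max)^2; hence if kappa <= 1 on all of
   them then W <= u_max^2 on N. Hopf's lemma at a point of MAX(u) where a ball of
   N touches (there dW = 0) and the strong maximum principle turn this into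
   W = u_max^2 and D^2 u = - u g on N. Then the points of MAX(u) in the closure
   of N are strict maxima, hence isolated, so the closure of N is open and
   equals M.

   With v = u / u_max, the metric g / (1 + v)^2 is flat: its vector field
   E = - grad v satisfies D E = id, so its squared curvature norm k satisfies
   E k = - 4 k, and k vanishes where it is maximal. (The maximum may lie on the
   boundary; there E points outwards.) As |E|^2 = (1 - v) / (1 + v), integrating
   the flat connection yields local isometries Y to R^n with
   |Y|^2 = (1 - v) / (1 + v), unique up to rotation. By compactness the inverses
   of the Y patch together over balls of a uniform radius, and this produces an
   isometry of M with the closed unit ball; (1 + v) Y is the isometry with the
   hemisphere. *)

(* Two obstacles shape the proof. Charts take values in a half-space, so derivatives at the boundary
   are one-sided and each formula needs smooth extensions. Tensor calculus is therefore done over an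
   abstract commutative ring with commuting derivations: Bochner's formula, the conformal change and
   the invariance of k become matrix identities, which are then evaluated at points. Next, the
   operator L - <Du, D .> / u of the Bochner formula is singular where u = 0, so maximum principles
   are applied inside only; on the boundary the equation u Ric = D^2 u + n u g itself gives D^2 u =
   0, so |Du| is locally constant there, and continuity does the rest.

   The conformal factor comes from the model. On the hemisphere with height v, stereographic
   projection from the pole v = -1 satisfies |y|^2 = (1 - v) / (1 + v) and g = (1 + v)^2 |dy|^2, and
   - grad v becomes the position field. Accordingly Y is the field E read in a parallel coframe, so
   two local choices differ by an orthogonal map without translation, and their inverses can be
   continued over the ball, which is convex. *)
Require Import Defs.
From HB Require Import structures.
From mathcomp Require Import all_boot all_order all_algebra.
From mathcomp Require Import all_classical all_reals all_analysis.
From mathcomp Require Import ring lra.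

Set Implicit Arguments.
Unset Strict Implicit.
Unset Printing Implicit Defensive.

Import Order.TTheory GRing.Theory Num.Theory.
Import numFieldNormedType.Exports.

Local Open Scope classical_set_scope.
Local Open Scope ring_scope.

(** * Smooth functions on Euclidean space and on relatively open subsets of a half-space *)

Section Differentiability.
Context {R : numFieldType} {V W : normedModType R}.
Implicit Types (f g : V -> W) (x : V).

(** The differential is chosen by [get] among the continuous linear maps with such an expansion, so
    one candidate is enough: [getPex] hands its property to the chosen one. *)
Lemma differentiable_expansion f (l : {linear V -> W}) x : continuous l ->
  f \o shift x = cst (f x) + l +o_ 0 id -> differentiable f x.
Proof.
move=> cl h.
have lE : (l : _ -> _) = f \o shift x - cst (f x) +o_ 0 id.
  apply: eqaddoE; rewrite h addrAC -!addrA addrC !addrA subrK.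
  rewrite -[LHS]addr0 -addrA; congr (_ + _).
  by apply/eqP; rewrite eq_sym addrC addr_eq0 oppo.
apply/diffP => /=.
apply: (@getPex _ (fun (d : {linear V -> W}) => continuous d /\
  forall y, f y = f (lim (nbhs x)) + d (y - lim (nbhs x))
                  +o_(y \near x) (y - lim (nbhs x)))).
exists l; split=> //; apply: eqaddoEx => z.
rewrite lE !addrA lim_id // /(_ \o _) /= subrK [f _ + _]addrC addrK
  -addrA -[LHS]addr0; congr (_ + _).
apply/eqP; rewrite eq_sym addrC addr_eq0 oppox; apply/eqP.
rewrite [in LHS]littleo_center0 (comp_centerK x id).
by rewrite -[- _ in RHS](comp_centerK x).
Qed.

Lemma near_eq_differentiable f g x :
  (\forall y \near x, f y = g y) -> differentiable f x -> differentiable g x.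
Proof.
move=> fg df; have [dfc dfE] := (diff_locallyxP x f).1 df.
apply: (differentiable_expansion dfc); apply/eqaddoP => e e0.
have := df => /diff_locally /eqaddoP /(_ e e0) fe.
have : \forall y \near (0 : V), f (y + x) = g (y + x).
  move: fg; rewrite (near_shift 0) subr0.
  by apply: filterS => y /=; rewrite /shift /=.
move: fe; apply: filterS2 => y /=.
by rewrite !fctE /= /shift /= (nbhs_singleton fg) => + <-.
Qed.

(** The case of zero differential; its uses first subtract the expected linear part. *)
Lemma differentiable_o f x : (forall e : R, 0 < e ->
  \forall h \near (0 : V), `|f (h + x) - f x| <= e * `|h|) -> differentiable f x.
Proof.
move=> hf; have cz : continuous ('d (cst (0 : W)) x : V -> W) by rewrite diff_cst; exact: cst_continuous.
apply: (differentiable_expansion cz); apply/eqaddoP => e e0; rewrite diff_cst.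
by apply: filterS (hf e e0) => h /=; rewrite !fctE /= /shift /= addr0.
Qed.
End Differentiability.

Section SmoothOpen.
Context {R : realType} {n : nat}.
Implicit Types (U : set 'rV[R]_n) (f g : 'rV[R]_n -> R) (x y v : 'rV[R]_n).

Definition pd (i : 'I_n) f : 'rV[R]_n -> R := fun x => 'D_(delta_mx 0 i) f x.

Lemma iter_partial_rcons s i f :
  iter_partial (rcons s i) f = iter_partial s (pd i f).
Proof. by rewrite /iter_partial foldr_rcons. Qed.

Lemma line_is_derive f x v (s : R) : differentiable f (x + s *: v) ->
  is_derive s 1 (fun t => f (x + t *: v)) ('D_v f (x + s *: v)).
Proof.
move=> df.
have d1 : is_diff s (fun t : R => x + t *: v) (fun t : R => t *: v).
  have := @is_diffD R _ _ (cst x) (fun t : R => t *: v) _ _ s (is_diff_cst _ _) (is_diff_scalel _ _).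
  by rewrite /= => H; apply: is_diff_eq; apply/funext => t /=; rewrite !fctE add0r.
have d2 : differentiable (f \o (fun t : R => x + t *: v)) s.
  by apply: differentiable_comp => //; exact: ex_diff.
have -> : (fun t : R => f (x + t *: v)) = f \o (fun t : R => x + t *: v) by [].
apply: DeriveDef; first exact: diff_derivable.
have d3 : differentiable (fun t : R => x + t *: v) s by exact: ex_diff.
rewrite deriveE // diff_comp //= deriveE //; congr ('d f _ _).
rewrite (_ : ('d (fun t : R => x + t *: v) s : R -> _) = fun t => t *: v) ?scale1r //.
exact: diff_val.
Qed.

Lemma MVT_line f x v :
  (forall s : R, 0 <= s <= 1 -> differentiable f (x + s *: v)) ->
  exists2 s : R, 0 < s < 1 & f (x + v) - f x = 'D_v f (x + s *: v).
Proof.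
move=> df.
have [|||c c01 h] := @MVT R (fun t => f (x + t *: v)) (fun t => 'D_v f (x + t *: v)) 0 1.
- exact: ltr01.
- move=> s; rewrite in_itv /= => /andP[s0 s1].
  by apply: line_is_derive; apply: df; rewrite !ltW.
- apply: derivable_within_continuous => s; rewrite in_itv /= => s01.
  by have [] := line_is_derive (df s s01).
exists c; first by move: c01; rewrite in_itv.
by move: h; rewrite scale1r scale0r addr0 subr0 mulr1.
Qed.

Lemma deriveZv f x v (c : R) : differentiable f x ->
  'D_(c *: v) f x = c * 'D_v f x.
Proof. by move=> df; rewrite !deriveE // linearZ. Qed.

Lemma derive_pd f x v : differentiable f x ->
  'D_v f x = \sum_i v 0 i * pd i f x.
Proof.
move=> df; rewrite {1}(row_sum_delta v) deriveE // linear_sum.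
by apply: eq_bigr => i _; rewrite linearZ /= /pd deriveE.
Qed.

Lemma smooth_diff U f x :
  smooth_open U f -> U x -> differentiable f x.
Proof. by move=> sf Ux; exact: (sf [::] x Ux). Qed.

Lemma smooth_pd U f i : smooth_open U f -> smooth_open U (pd i f).
Proof. by move=> sf s x Ux; rewrite -iter_partial_rcons; exact: sf. Qed.

Lemma smooth_sub U U' f : U `<=` U' -> smooth_open U' f -> smooth_open U f.
Proof. by move=> UU' sf s x Ux; apply: sf; exact: UU'. Qed.

(** C^infty is the largest class of functions that are differentiable on [U] and closed, up to
    equality on [U], under partial derivatives. Smoothness is thus proved by exhibiting such a
    class, without following iterated derivatives. *)
Lemma smooth_coind (P : set ('rV[R]_n -> R)) U : open U ->
  (forall f x, P f -> U x -> differentiable f x) ->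
  (forall f i, P f -> exists2 g, P g & forall x, U x -> pd i f x = g x) ->
  forall f, P f -> smooth_open U f.
Proof.
move=> oU Pd Pp f Pf s x Ux.
have [g Pg h] : exists2 g, P g & forall x, U x -> iter_partial s f x = g x.
  elim: s => [|i s [g Pg IH]]; first by exists f.
  have [h Ph hE] := Pp g i Pg.
  exists h => // y Uy; rewrite -hE // /pd /=.
  apply: near_eq_derive.
  by near=> z; apply: IH; near: z; exact: open_nbhs_nbhs.
apply: (@near_eq_differentiable _ _ _ g); last exact: Pd.
by near=> z; rewrite h //; near: z; exact: open_nbhs_nbhs.
Unshelve. all: by end_near. Qed.

Inductive gen_alg (S : set ('rV[R]_n -> R)) : set ('rV[R]_n -> R) :=
| gen_alg_in f : S f -> gen_alg S f
| gen_alg_cst c : gen_alg S (fun=> c)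
| gen_alg_add f g : gen_alg S f -> gen_alg S g -> gen_alg S (fun x => f x + g x)
| gen_alg_mul f g : gen_alg S f -> gen_alg S g -> gen_alg S (fun x => f x * g x).

Lemma gen_alg_sum S (I : Type) (r : seq I) (F : I -> 'rV[R]_n -> R) :
  (forall i, gen_alg S (F i)) -> gen_alg S (fun x => \sum_(i <- r) F i x).
Proof.
move=> h; elim: r => [|a r IH].
  by under eq_fun do rewrite big_nil; exact: gen_alg_cst.
by under eq_fun do rewrite big_cons; exact: gen_alg_add.
Qed.

(** By the product, quotient and chain rules a derivative of a generator is a polynomial in
    generators. The Leibniz rule then makes the generated algebra closed under derivatives, and
    [smooth_coind] applies to it. *)
Lemma smooth_gen_alg (S : set ('rV[R]_n -> R)) U : open U ->
  (forall f x, S f -> U x -> differentiable f x) ->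
  (forall f i, S f -> exists2 g, gen_alg S g & forall x, U x -> pd i f x = g x) ->
  forall f, gen_alg S f -> smooth_open U f.
Proof.
move=> oU Sd Sp.
have D f x : gen_alg S f -> U x -> differentiable f x.
  move=> Sf Ux; elim: Sf => {f} [f Sf|c|f g _ df _ dg|f g _ df _ dg].
  - exact: Sd.
  - exact: differentiable_cst.
  - exact: differentiableD.
  - exact: differentiableM.
apply: smooth_coind => // f i Sf.
elim: Sf => {f} [f Sf|c|f g Sf [f' Sf' f'E] Sg [g' Sg' g'E]|f g Sf [f' Sf' f'E] Sg [g' Sg' g'E]].
- exact: Sp.
- exists (fun=> 0); first exact: gen_alg_cst.
  by move=> x _; rewrite /pd derive_cst.
- exists (fun x => f' x + g' x); first exact: gen_alg_add.
  move=> x Ux; rewrite -f'E // -g'E // /pd (@deriveD _ _ _ f g) //; apply: diff_derivable; exact: D.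
- exists (fun x => f x * g' x + g x * f' x).
    by apply: gen_alg_add; apply: gen_alg_mul.
  move=> x Ux; rewrite -f'E // -g'E // /pd (@deriveM _ _ f g) //; apply: diff_derivable; exact: D.
Qed.

Section Closure.
Variables (U : set 'rV[R]_n) (oU : open U).

Lemma smooth_alg f : gen_alg (smooth_open U) f -> smooth_open U f.
Proof.
apply: smooth_gen_alg => // [g x sg Ux|g i sg].
  exact: smooth_diff sg Ux.
by exists (pd i g) => //; apply/gen_alg_in/smooth_pd.
Qed.

Lemma smooth_cst c : smooth_open U (fun=> c).
Proof. exact/smooth_alg/gen_alg_cst. Qed.

Lemma smooth_openD f g : smooth_open U f -> smooth_open U g ->
  smooth_open U (fun x => f x + g x).
Proof. by move=> sf sg; apply/smooth_alg/gen_alg_add; exact: gen_alg_in. Qed.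

Lemma smooth_openM f g : smooth_open U f -> smooth_open U g ->
  smooth_open U (fun x => f x * g x).
Proof. by move=> sf sg; apply/smooth_alg/gen_alg_mul; exact: gen_alg_in. Qed.

Lemma smooth_openN f : smooth_open U f -> smooth_open U (fun x => - f x).
Proof.
move=> sf; have := smooth_openM (smooth_cst (-1)) sf.
by under eq_fun do rewrite mulN1r.
Qed.

Lemma smooth_openB f g : smooth_open U f -> smooth_open U g ->
  smooth_open U (fun x => f x - g x).
Proof. by move=> sf sg; apply: smooth_openD => //; exact: smooth_openN. Qed.

Lemma smooth_sum (I : Type) (r : seq I) (P : pred I) (F : I -> 'rV[R]_n -> R) :
  (forall i, P i -> smooth_open U (F i)) ->
  smooth_open U (fun x => \sum_(i <- r | P i) F i x).
Proof.
move=> h; elim: r => [|a r IH].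
  by under eq_fun do rewrite big_nil; exact: smooth_cst.
under eq_fun do rewrite big_cons.
case: (boolP (P a)) => Pa //.
by apply: smooth_openD => //; exact: h.
Qed.

Lemma smooth_prod (I : Type) (r : seq I) (P : pred I) (F : I -> 'rV[R]_n -> R) :
  (forall i, P i -> smooth_open U (F i)) ->
  smooth_open U (fun x => \prod_(i <- r | P i) F i x).
Proof.
move=> h; elim: r => [|a r IH].
  by under eq_fun do rewrite big_nil; exact: smooth_cst.
under eq_fun do rewrite big_cons.
case: (boolP (P a)) => Pa //.
by apply: smooth_openM => //; exact: h.
Qed.

Lemma smooth_openV f : (forall x, U x -> f x != 0) -> smooth_open U f ->
  smooth_open U (fun x => (f x)^-1).
Proof.
move=> f0 sf.
(* Since (1 / f)' = - (1 / f)^2 f', adding the single generator 1 / f to the smooth functions is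
   enough. *)
pose S : set ('rV[R]_n -> R) := [set g | smooth_open U g \/ g = (fun x => (f x)^-1)].
have := @smooth_gen_alg S U oU.
apply; last by apply: gen_alg_in; right.
- move=> g x [sg|->] Ux; first exact: smooth_diff sg Ux.
  by apply: differentiableV; [exact: smooth_diff sf Ux|exact: f0].
- move=> g i [sg|->].
    by exists (pd i g) => //; apply: gen_alg_in; left; exact: smooth_pd.
  exists (fun x => (-1) * (((f x)^-1 * (f x)^-1) * pd i f x)).
    apply: gen_alg_mul; first exact: gen_alg_cst.
    apply: gen_alg_mul; last by apply: gen_alg_in; left; exact: smooth_pd.
    by apply: gen_alg_mul; apply: gen_alg_in; right.
  move=> x Ux; rewrite /pd deriveV ?f0 //.
    by rewrite mulN1r scaleNr /GRing.scale /= -exprVn expr2.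
  exact/diff_derivable/(smooth_diff sf Ux).
Qed.

Lemma smooth_coord i : smooth_open U (fun x => x 0 i).
Proof.
pose S : set ('rV[R]_n -> R) := [set g | g = (fun x => x 0 i)].
apply: (@smooth_gen_alg S) => //; last by apply: gen_alg_in.
- by move=> f x -> _; exact: differentiable_coord.
- move=> f j ->; exists (fun=> (delta_mx 0 j : 'rV[R]_n) 0 i); first exact: gen_alg_cst.
  move=> x _; apply: derive_val.
  have := @derive_mx R _ _ _ id x (delta_mx 0 j : 'rV[R]_n) (@derivable_id _ _ _ _).
  rewrite derive_id => /matrixP /(_ 0 i); rewrite [RHS]mxE => h.
  by apply: DeriveDef; [apply/diff_derivable/differentiable_coord|rewrite -h].
Qed.

Lemma smooth_eq f g : (forall x, U x -> f x = g x) ->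
  smooth_open U f -> smooth_open U g.
Proof.
move=> fg sf; apply: (@smooth_coind [set h | smooth_open U h \/ h = g]) => //; last by right.
- move=> h x [sh|->] Ux; first exact: smooth_diff sh Ux.
  apply: (@near_eq_differentiable _ _ _ f); last exact: smooth_diff sf Ux.
  by near=> z; apply: fg; near: z; exact: open_nbhs_nbhs.
- move=> h i [sh|->]; first by exists (pd i h) => //; left; exact: smooth_pd.
  exists (pd i f); first by left; exact: smooth_pd.
  move=> x Ux; apply: near_eq_derive.
  by near=> z; rewrite fg //; near: z; exact: open_nbhs_nbhs.
Unshelve. all: by end_near. Qed.

Lemma smooth_det m (A : 'rV[R]_n -> 'M[R]_m) :
  (forall i j, smooth_open U (fun x => A x i j)) -> smooth_open U (fun x => \det (A x)).
Proof.
move=> sA; apply: smooth_sum => s _; apply: smooth_openM; first exact: smooth_cst.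
by apply: smooth_prod => i _; exact: sA.
Qed.

Lemma smooth_adj m (A : 'rV[R]_n -> 'M[R]_m) i j :
  (forall i j, smooth_open U (fun x => A x i j)) -> smooth_open U (fun x => (\adj (A x)) i j).
Proof.
move=> sA; under eq_fun do rewrite mxE.
apply: smooth_openM; first exact: smooth_cst.
by apply: smooth_det => k l; under eq_fun do rewrite !mxE; exact: sA.
Qed.

Lemma smooth_invmx m (A : 'rV[R]_n -> 'M[R]_m) i j :
  (forall x, U x -> A x \in unitmx) ->
  (forall i j, smooth_open U (fun x => A x i j)) ->
  smooth_open U (fun x => (invmx (A x)) i j).
Proof.
move=> uA sA.
apply: (@smooth_eq (fun x => (\det (A x))^-1 * (\adj (A x)) i j)).
  by move=> x Ux; rewrite /invmx ifT ?uA // [in RHS]mxE.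
apply: smooth_openM; last exact: smooth_adj.
apply: smooth_openV; last exact: smooth_det.
by move=> x Ux; move: (uA x Ux); rewrite unitmxE unitfE.
Qed.

End Closure.
End SmoothOpen.

Section SmoothComp.
Context {R : realType} {n m : nat}.
Implicit Types (Phi : 'rV[R]_n -> 'rV[R]_m) (h : 'rV[R]_m -> R).

Lemma differentiable_rowP Phi x :
  (forall j, differentiable (fun y => Phi y 0 j) x) -> differentiable Phi x.
Proof.
move=> dP.
have -> : Phi = \sum_(j < m) (fun y => Phi y 0 j *: (delta_mx 0 j : 'rV[R]_m)).
  by apply/funext => y; rewrite fct_sumE -row_sum_delta.
apply: differentiable_sum => j; exact: differentiableZl.
Qed.

Lemma pd_comp Phi h x i :
  (forall j, differentiable (fun y => Phi y 0 j) x) ->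
  differentiable h (Phi x) ->
  pd i (h \o Phi) x = \sum_j pd i (fun y => Phi y 0 j) x * pd j h (Phi x).
Proof.
move=> dP dh; have dPhi := differentiable_rowP dP.
rewrite /pd deriveE; last exact: differentiable_comp.
rewrite diff_comp //= -deriveE // derive_pd //.
apply: eq_bigr => j _; congr (_ * _).
rewrite -deriveE // derive_mx; last exact: diff_derivable.
by rewrite mxE.
Qed.

Lemma smooth_comp (U : set 'rV[R]_n) (V : set 'rV[R]_m) Phi h :
  open U -> (forall j, smooth_open U (fun y => Phi y 0 j)) ->
  (forall x, U x -> V (Phi x)) -> smooth_open V h -> smooth_open U (h \o Phi).
Proof.
move=> oU sP UV sh.
(* The chain rule involves only derivatives of the components of [Phi] and the functions
   [pd j k \o Phi], which are generators again. *)
pose S : set ('rV[R]_n -> R) :=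
  [set g | smooth_open U g \/ exists2 k, smooth_open V k & g = k \o Phi].
apply: (@smooth_gen_alg _ _ S) => //; last first.
- by apply: gen_alg_in; right; exists h.
- move=> g i [sg|[k sk ->]].
    by exists (pd i g) => //; apply: gen_alg_in; left; exact: smooth_pd.
  exists (fun x => \sum_j pd i (fun y => Phi y 0 j) x * (pd j k \o Phi) x).
    apply: gen_alg_sum => j; apply: gen_alg_mul; apply: gen_alg_in.
      by left; exact: smooth_pd.
    by right; exists (pd j k) => //; exact: smooth_pd.
  move=> x Ux; rewrite pd_comp // => [j|].
    exact: smooth_diff (sP j) Ux.
  exact: smooth_diff sk (UV x Ux).
- move=> g x [sg|[k sk ->]] Ux; first exact: smooth_diff sg Ux.
  apply: differentiable_comp.
    by apply: differentiable_rowP => j; exact: smooth_diff (sP j) Ux.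
  exact: smooth_diff sk (UV x Ux).
Qed.
End SmoothComp.

Lemma pdE {R : realType} {n : nat} (i : 'I_n) (f : 'rV[R]_n -> R) x :
  pd i f x = 'D_('e_i) f x.
Proof. by []. Qed.
#[global] Opaque pd.

Lemma dist_triangle_lt {R : realType} (e p q c : R) :
  `|q - c| < e -> `|p - c| < e -> `|p - q| <= e + e.
Proof.
move=> qc pc; rewrite -(subrK c p) -addrA.
by apply: (le_trans (ler_normD _ _)); rewrite lerD // ltW // distrC.
Qed.

Lemma continuous_coord {R : realType} {n : nat} i : continuous (fun x : 'rV[R]_n => x 0 i).
Proof. by move=> x; apply/differentiable_continuous/differentiable_coord. Qed.

Lemma continuous_line {R : realType} {V : normedModType R} (x v : V) : continuous (fun t : R => x + t *: v).
Proof. by move=> t; apply: cvgD; [exact: cvg_cst|apply: cvgZr_tmp; exact: cvg_id]. Qed.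

(** * Symmetry of second partial derivatives *)

Section Schwarz.
Context {R : realType} {n : nat}.
Implicit Types (U : set 'rV[R]_n) (f : 'rV[R]_n -> R) (x : 'rV[R]_n).
Notation e i := (delta_mx 0 i : 'rV[R]_n).

Lemma open_near_segment (U : set 'rV[R]_n) x (v w : 'rV[R]_n) : open U -> U x ->
  exists2 d : R, 0 < d & forall s t : R, `|s| <= d -> `|t| <= d -> U (x + s *: v + t *: w).
Proof.
move=> oU Ux.
have /nbhs_ballP[r /= r0 hr] : nbhs x U by exact: open_nbhs_nbhs.
have K0 : 0 < `|v| + `|w| + 1 by rewrite ltr_wpDl // addr_ge0.
exists (r / 2 / (`|v| + `|w| + 1)); first by rewrite !divr_gt0.
move=> s t hs ht; apply: hr; rewrite -ball_normE /ball_ /=.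
rewrite -addrA opprD addNKr normrN.
apply: (@le_lt_trans _ _ (r / 2)); last by rewrite ltr_pdivrMr // ltr_pMr // ltr1n.
apply: (le_trans (ler_normD _ _)); rewrite !normrZ.
apply: (@le_trans _ _ (r / 2 / (`|v| + `|w| + 1) * (`|v| + `|w|))).
  by rewrite mulrDr lerD // ler_wpM2r.
by rewrite mulrAC ler_pdivrMr // ler_wpM2l ?divr_ge0 ?ltW // ltrDl.
Qed.

Lemma MVT0 (h dh : R -> R) (d : R) : 0 < d ->
  (forall s, 0 <= s <= d -> is_derive s 1 h (dh s)) ->
  exists2 s : R, 0 < s < d & h d - h 0 = dh s * d.
Proof.
move=> d0 hd.
have [||c c01 hc] := @MVT R h dh 0 d d0.
- by move=> s; rewrite in_itv /= => /andP[s0 s1]; apply: hd; rewrite !ltW.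
- apply: derivable_within_continuous => s; rewrite in_itv /= => s01.
  by have [] := hd s s01.
by exists c; [move: c01; rewrite in_itv | rewrite hc subr0].
Qed.

(** The second difference over a square of side [d] does not depend on the order of the two
    directions; evaluated in both orders it gives the two mixed derivatives at points near [x], and
    [pdC] follows by continuity. *)
Lemma mixed_diff U f x i j (d : R) : smooth_open U f -> 0 < d ->
  (forall s t : R, `|s| <= d -> `|t| <= d -> U (x + s *: 'e_i + t *: 'e_j)) ->
  exists s t : R, [/\ `|s| <= d, `|t| <= d &
    f (x + d *: 'e_i + d *: 'e_j) - f (x + d *: 'e_i) - (f (x + d *: 'e_j) - f x) =
    pd j (pd i f) (x + s *: 'e_i + t *: 'e_j) * d * d].
Proof.
move=> sf d0 hU.
have zd : `|0 : R| <= d by rewrite normr0 ltW.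
have dd : `|d| <= d by rewrite ger0_norm // ltW.
have nd (s : R) : 0 <= s <= d -> `|s| <= d by move=> /andP[s0 s1]; rewrite ger0_norm.
have D g s t : smooth_open U g -> `|s| <= d -> `|t| <= d ->
    differentiable g (x + s *: 'e_i + t *: 'e_j).
  by move=> sg hs ht; apply: smooth_diff sg _; exact: hU.
have [|s /andP[s0 s1] hs] := @MVT0 (fun s => f (x + d *: 'e_j + s *: 'e_i) - f (x + s *: 'e_i))
  (fun s => pd i f (x + d *: 'e_j + s *: 'e_i) - pd i f (x + s *: 'e_i)) d d0.
  move=> s /nd sd; apply: is_deriveB; apply: line_is_derive.
    by rewrite addrAC; exact: D.
  by have := D f s 0 sf sd zd; rewrite scale0r addr0.
have sd : `|s| <= d by apply: nd; rewrite !ltW.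
have [|t /andP[t0 t1] ht] := @MVT0 (fun t => pd i f (x + s *: 'e_i + t *: 'e_j))
  (fun t => pd j (pd i f) (x + s *: 'e_i + t *: 'e_j)) d d0.
  by move=> t /nd td; apply: line_is_derive; apply: D => //; exact: smooth_pd.
exists s, t; split=> //; first by apply: nd; rewrite !ltW.
move: hs ht; rewrite !scale0r !addr0 (addrAC x (d *: 'e_j)) => -> <-.
by rewrite (addrAC x (d *: 'e_j)) mulrC.
Qed.

Lemma pdC U f x i j : open U -> smooth_open U f -> U x ->
  pd i (pd j f) x = pd j (pd i f) x.
Proof.
move=> oU sf Ux.
suff h (e : R) : 0 < e -> `|pd i (pd j f) x - pd j (pd i f) x| <= e + e.
  apply/eqP; rewrite -subr_eq0 -normr_le0; apply/ler_addgt0Pl => e e0.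
  by rewrite addr0 [leRHS]splitr; apply: h; rewrite divr_gt0.
move=> e0.
have cij : {for x, continuous (pd i (pd j f))}.
  by apply/differentiable_continuous/smooth_diff/Ux/smooth_pd/smooth_pd.
have cji : {for x, continuous (pd j (pd i f))}.
  by apply/differentiable_continuous/smooth_diff/Ux/smooth_pd/smooth_pd.
pose V := U `&` [set y | `|pd i (pd j f) x - pd i (pd j f) y| < e /\ `|pd j (pd i f) x - pd j (pd i f) y| < e].
have Vx : nbhs x V.
  apply: filterI; first exact: open_nbhs_nbhs.
  by apply: filterI; [move/cvgrPdist_lt : cij; exact|move/cvgrPdist_lt : cji; exact].
have [d d0 hd] := @open_near_segment V^° x 'e_i 'e_j (open_interior _) Vx.
have hV s t : `|s| <= d -> `|t| <= d -> V (x + s *: 'e_i + t *: 'e_j).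
  by move=> hs ht; apply: interior_subset; exact: hd.
have hV' s t : `|s| <= d -> `|t| <= d -> V (x + s *: 'e_j + t *: 'e_i).
  by move=> hs ht; rewrite addrAC; exact: hV.
have [s [t [hs ht E1]]] := @mixed_diff U f x i j d sf d0 (fun s t hs ht => (hV s t hs ht).1).
have [s' [t' [hs' ht' E2]]] := @mixed_diff U f x j i d sf d0 (fun s t hs ht => (hV' s t hs ht).1).
have E : pd j (pd i f) (x + s *: 'e_i + t *: 'e_j) = pd i (pd j f) (x + s' *: 'e_j + t' *: 'e_i).
  have d0' : d != 0 by rewrite gt_eqF.
  apply: (mulIf d0'); apply: (mulIf d0'); apply: (etrans (esym E1)); apply: etrans E2.
  rewrite (addrAC x (d *: 'e_j)).
  have aux (a b c e' : R) : a - b - (c - e') = a - c - (b - e') by ring.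
  exact: aux.
have [_ [_ h1]] := hV s t hs ht.
have [_ [h2 _]] := hV' s' t' hs' ht'.
rewrite E in h1.
exact: dist_triangle_lt h1 h2.
Qed.
End Schwarz.

(** * Smooth functions on relatively open subsets of the half-space *)

Section SmoothOn.
Context {R : realType} {n : nat}.
Implicit Types (V : set 'rV[R]_n.+1) (f g : 'rV[R]_n.+1 -> R) (x : 'rV[R]_n.+1).

(* Charts take values in a half-space, so smooth functions on their images live
   on relatively open subsets of the half-space. *)
Definition hopen V := exists2 W : set 'rV[R]_n.+1, open W & V = W `&` half_space.

Lemma coord0E x : Defs.coord0 x = x 0 ord0.
Proof.
rewrite /Defs.coord0 (bigD1 ord0) //= big1 ?addr0 // => i /andP[/eqP i0].
by rewrite -val_eqE /= i0.
Qed.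

Lemma hopenI V W : open W -> hopen V -> hopen (V `&` W).
Proof.
move=> oW [W' oW' ->]; exists (W' `&` W); first exact: openI.
by rewrite setIAC.
Qed.

(** The half-space is stable under positive steps along every axis, including the normal one. This
    is why right derivatives only read values on [V], up to the boundary. *)
Lemma hopen_right V x i : hopen V -> V x -> \forall h \near (0 : R)^'+, V (x + h *: 'e_i).
Proof.
move=> [W oW ->] [Wx hx].
near=> h; split.
  near: h.
  have H : (fun h : R => x + h *: 'e_i) @ (0 : R)^'+ --> x.
    apply: cvg_at_right_filter.
    have : (fun h : R => x + h *: 'e_i) @ (0 : R) --> x + 0 *: 'e_i.
      exact: continuous_line.
    by rewrite scale0r addr0.
  by apply: (H W); exact: open_nbhs_nbhs.
rewrite /half_space /= coord0E !mxE addr_ge0 //; first by move: hx; rewrite /half_space /= coord0E.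
by rewrite mulr_ge0 // ler0n.
Unshelve. all: by end_near. Qed.

Lemma partialE V U f F x i : hopen V -> open U -> U x -> V x -> differentiable F x ->
  (forall y, U y -> V y -> f y = F y) -> partial i f x = pd i F x.
Proof.
move=> oV oU Ux Vx dF fF.
rewrite pdE /partial /derive.
have dv := @diff_derivable _ _ _ F x 'e_i dF.
have c1 : (fun h : R => h^-1 *: ((F \o shift x) (h *: 'e_i) - F x)) @ (0 : R)^'+ -->
    lim ((fun h : R => h^-1 *: ((F \o shift x) (h *: 'e_i) - F x)) @ (0 : R)^').
  by apply: cvg_dnbhs_at_right; exact: dv.
apply/cvg_lim => //; apply: cvg_trans c1; apply: near_eq_cvg.
have oUV : hopen (V `&` U) by exact: hopenI.
near=> h.
have [Vh Uh] : (V `&` U) (x + h *: 'e_i) by near: h; exact: hopen_right.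
by rewrite /shift /= [_ + x]addrC (fF _ Uh Vh) (fF _ Ux Vx).
Unshelve. all: by end_near. Qed.

End SmoothOn.

Section SmoothOnClosure.
Context {R : realType} {n : nat}.
Local Notation vec := 'rV[R]_n.+1.
Implicit Types (V : set vec) (f g : vec -> R) (x : vec).

Lemma smooth_on_ext (I : finType) V (F : I -> vec -> R) x :
  (forall i, smooth_on V (F i)) -> V x ->
  exists (U : set vec) (G : I -> vec -> R),
    [/\ open U, U x, forall i, smooth_open U (G i) &
        forall i y, U y -> V y -> F i y = G i y].
Proof.
move=> sF Vx.
have /choice [UG h] : forall i, exists UG : set vec * (vec -> R),
    [/\ open UG.1, UG.1 x, smooth_open UG.1 UG.2 & forall y, UG.1 y -> V y -> F i y = UG.2 y].
  by move=> i; have [U [G hG]] := sF i x Vx; exists (U, G).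
have : nbhs x (fun y => forall i, (UG i).1 y).
  apply: (@filter_forall _ I (fun i y => (UG i).1 y) (nbhs x) _) => i.
  by have [oU Ux _ _] := h i; exact: open_nbhs_nbhs.
rewrite nbhsE => -[U [oU Ux] UU].
exists U, (fun i => (UG i).2); split => //.
- by move=> i; have [_ _ + _] := h i; apply: smooth_sub => y /UU; exact.
- by move=> i y Uy Vy; have [_ _ _] := h i; apply => //; exact: UU.
Qed.

Lemma smooth_on_sub V V' f : V `<=` V' -> smooth_on V' f -> smooth_on V f.
Proof.
move=> VV' sf x Vx; have [U [F [oU Ux sF fF]]] := sf x (VV' x Vx).
by exists U, F; split => // y Uy Vy; apply: fF => //; exact: VV'.
Qed.

Lemma smooth_on_eq V f g : (forall x, V x -> f x = g x) -> smooth_on V f -> smooth_on V g.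
Proof.
move=> fg sf x Vx; have [U [F [oU Ux sF fF]]] := sf x Vx.
by exists U, F; split => // y Uy Vy; rewrite -fg // fF.
Qed.

Lemma smooth_on_cst V c : smooth_on V (fun=> c).
Proof.
move=> x Vx; exists setT, (fun=> c); split => //; first exact: openT.
by apply: smooth_cst; exact: openT.
Qed.

Lemma smooth_on2 V f g x : smooth_on V f -> smooth_on V g -> V x ->
  exists (U : set vec) (F G : vec -> R),
    [/\ open U, U x, smooth_open U F, smooth_open U G &
        forall y, U y -> V y -> f y = F y /\ g y = G y].
Proof.
move=> sf sg Vx; have [|U [G [oU Ux sG h]]] := @smooth_on_ext bool V (fun b => if b then f else g) x _ Vx; first by case.
by exists U, (G true), (G false); split => // y Uy Vy; rewrite -(h true) // -(h false).
Qed.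

Lemma smooth_onD V f g : smooth_on V f -> smooth_on V g -> smooth_on V (fun x => f x + g x).
Proof.
move=> sf sg x Vx; have [U [F [G [oU Ux sF sG h]]]] := smooth_on2 sf sg Vx.
exists U, (fun x => F x + G x); split => //; first exact: smooth_openD.
by move=> y Uy Vy; have [-> ->] := h y Uy Vy.
Qed.

Lemma smooth_onM V f g : smooth_on V f -> smooth_on V g -> smooth_on V (fun x => f x * g x).
Proof.
move=> sf sg x Vx; have [U [F [G [oU Ux sF sG h]]]] := smooth_on2 sf sg Vx.
exists U, (fun x => F x * G x); split => //; first exact: smooth_openM.
by move=> y Uy Vy; have [-> ->] := h y Uy Vy.
Qed.

Lemma smooth_onN V f : smooth_on V f -> smooth_on V (fun x => - f x).
Proof.
move=> sf; have := smooth_onM (@smooth_on_cst V (-1)) sf.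
by under eq_fun do rewrite mulN1r.
Qed.

Lemma smooth_onB V f g : smooth_on V f -> smooth_on V g -> smooth_on V (fun x => f x - g x).
Proof. by move=> sf sg; apply: smooth_onD => //; exact: smooth_onN. Qed.

Lemma smooth_on_sum V (I : Type) (r : seq I) (P : pred I) (F : I -> vec -> R) :
  (forall i, P i -> smooth_on V (F i)) -> smooth_on V (fun x => \sum_(i <- r | P i) F i x).
Proof.
move=> h; elim: r => [|a r IH].
  by under eq_fun do rewrite big_nil; exact: smooth_on_cst.
under eq_fun do rewrite big_cons.
case: (boolP (P a)) => Pa //.
by apply: smooth_onD => //; exact: h.
Qed.

Lemma smooth_onV V f : (forall x, V x -> f x != 0) -> smooth_on V f ->
  smooth_on V (fun x => (f x)^-1).
Proof.
move=> f0 sf x Vx; have [U [F [oU Ux sF fF]]] := sf x Vx.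
have Fx0 : F x != 0 by rewrite -fF // f0.
have cF : {for x, continuous F}.
  by apply/differentiable_continuous/smooth_diff/Ux.
have : nbhs x (U `&` [set y | F y != 0]).
  apply: filterI; first exact: open_nbhs_nbhs.
  by apply: (cF [set z | z != 0]); apply: open_nbhs_nbhs; split => //; exact: open_neq.
rewrite nbhsE => -[U' [oU' U'x] hU'].
exists U', (fun x => (F x)^-1); split => //.
  apply: smooth_openV => //; first by move=> y /hU' [].
  by apply: smooth_sub sF => y /hU' [].
by move=> y /hU' [Uy _] Vy; rewrite fF.
Qed.

Lemma smooth_on_comp (m : nat) V (V' : set 'rV[R]_m) (Phi : vec -> 'rV[R]_m)
    (h : 'rV[R]_m -> R) :
  (forall j, smooth_on V (fun y => Phi y 0 j)) -> (forall x, V x -> V' (Phi x)) ->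
  smooth_on V' h -> smooth_on V (h \o Phi).
Proof.
move=> sP VV' sh x Vx.
have [U [P [oU Ux sPU PU]]] := smooth_on_ext sP Vx.
have [U' [H [oU' Ux' sH hH]]] := sh _ (VV' x Vx).
pose Q y : 'rV[R]_m := \row_j P j y.
have PQ y : U y -> V y -> Phi y = Q y.
  by move=> Uy Vy; apply/rowP => j; rewrite mxE PU.
have sQ j : smooth_open U (fun y => Q y 0 j) by under eq_fun do rewrite mxE; exact: sPU.
have cQ : {for x, continuous Q}.
  apply: differentiable_continuous; apply: differentiable_rowP => j.
  exact: smooth_diff (sQ j) Ux.
have : nbhs x (U `&` Q @^-1` U').
  apply: filterI; first exact: open_nbhs_nbhs.
  by apply: cQ; apply: open_nbhs_nbhs; split => //; rewrite -PQ.
rewrite nbhsE => -[U2 [oU2 U2x] hU2].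
exists U2, (H \o Q); split => //.
  apply: (@smooth_comp _ _ _ U2 U') => // [j|y /hU2 []//].
  by apply: smooth_sub (sQ j) => y /hU2 [].
by move=> y /hU2 [Uy Q'y] Vy; rewrite /= (PQ y) // hH // -PQ //; exact: VV'.
Qed.

Section Hopen.
Variables (V : set vec) (hV : hopen V).

Lemma partialP f x i : smooth_on V f -> V x ->
  exists (U : set vec) (F : vec -> R),
   [/\ open U, U x, smooth_open U F & forall y, U y -> V y ->
     f y = F y /\ partial i f y = pd i F y].
Proof.
move=> sf Vx; have [U [F [oU Ux sF fF]]] := sf x Vx.
exists U, F; split => // y Uy Vy; split; first exact: fF.
apply: (@partialE _ _ V U) => //; exact: smooth_diff sF Uy.
Qed.

Lemma smooth_on_partial f i : smooth_on V f -> smooth_on V (partial i f).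
Proof.
move=> sf x Vx; have [U [F [oU Ux sF fF]]] := partialP i sf Vx.
exists U, (pd i F); split => //; first exact: smooth_pd.
by move=> y Uy Vy; have [_] := fF y Uy Vy.
Qed.

Lemma partial_eq f g x i : smooth_on V f -> V x -> (forall y, V y -> f y = g y) ->
  partial i g x = partial i f x.
Proof.
move=> sf Vx fg; have [U [F [oU Ux sF fF]]] := partialP i sf Vx.
rewrite (fF x Ux Vx).2; apply: (@partialE _ _ V U) => //.
  exact: smooth_diff sF Ux.
by move=> y Uy Vy; rewrite -fg // (fF y Uy Vy).1.
Qed.

Lemma partialP2 f g x i : smooth_on V f -> smooth_on V g -> V x ->
  exists (U : set vec) (F G : vec -> R),
    [/\ open U /\ U x, differentiable F x, differentiable G x,
        forall y, U y -> V y -> f y = F y /\ g y = G y &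
        partial i f x = pd i F x /\ partial i g x = pd i G x].
Proof.
move=> sf sg Vx; have [U [F [G [oU Ux sF sG h]]]] := smooth_on2 sf sg Vx.
have dF := smooth_diff sF Ux; have dG := smooth_diff sG Ux.
by exists U, F, G; split => //; split; apply: (@partialE _ _ V U) => // y Uy Vy; have [] := h y Uy Vy.
Qed.

Lemma partialD f g x i : smooth_on V f -> smooth_on V g -> V x ->
  partial i (fun y => f y + g y) x = partial i f x + partial i g x.
Proof.
move=> sf sg Vx; have [U [F [G [[oU Ux] dF dG h [-> ->]]]]] := partialP2 i sf sg Vx.
rewrite (@partialE _ _ V U _ (F \+ G) x i) //.
- by rewrite !pdE deriveD //; exact: diff_derivable.
- exact: differentiableD.
- by move=> y Uy Vy; have [-> ->] := h y Uy Vy.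
Qed.

Lemma partialM f g x i : smooth_on V f -> smooth_on V g -> V x ->
  partial i (fun y => f y * g y) x = partial i f x * g x + f x * partial i g x.
Proof.
move=> sf sg Vx; have [U [F [G [[oU Ux] dF dG h [-> ->]]]]] := partialP2 i sf sg Vx.
rewrite (@partialE _ _ V U _ (F * G) x i) //.
- rewrite !pdE deriveM //; try exact: diff_derivable.
  by have [-> ->] := h x Ux Vx; rewrite addrC [_ *: 'D__ F x]mulrC.
- exact: differentiableM.
- by move=> y Uy Vy; have [-> ->] := h y Uy Vy.
Qed.

Lemma partial_cst c x i : V x -> partial i (fun=> c) x = 0.
Proof.
move=> Vx; rewrite (@partialE _ _ V setT _ (fun=> c)) //; last exact: openT.
by rewrite pdE derive_cst.
Qed.

Lemma partialC f x i j : smooth_on V f -> V x ->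
  partial i (partial j f) x = partial j (partial i f) x.
Proof.
move=> sf Vx; have [U [F [oU Ux sF fF]]] := sf x Vx.
have E k y : U y -> V y -> partial k f y = pd k F y.
  move=> Uy Vy; apply: (@partialE _ _ V U) => //; exact: smooth_diff sF Uy.
have D k : differentiable (pd k F) x.
  by apply: smooth_diff Ux; exact: smooth_pd.
have E2 k l : partial k (partial l f) x = pd k (pd l F) x.
  by apply: (@partialE _ _ V U) => //; exact: E.
rewrite E2 E2; exact: pdC oU sF Ux.
Qed.

Lemma smooth_on_within f : smooth_on V f -> {within V, continuous f}.
Proof.
move=> sf; apply/subspace_continuousP => x Vx.
have [U [F [oU Ux sF fF]]] := sf x Vx.
have cF : F @ within V (nbhs x) --> F x.
  apply: cvg_within_filter; apply/differentiable_continuous.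
  exact: smooth_diff sF Ux.
rewrite /from_subspace /= (fF x Ux Vx); apply: cvg_trans cF; apply: near_eq_cvg.
have nU : \forall y \near x, U y by exact: open_nbhs_nbhs.
have : nbhs x (fun y => V y -> F y = f y) by apply: filterS nU => y Uy Vy; rewrite fF.
by [].
Qed.
End Hopen.
End SmoothOnClosure.

(** * Connections over a commutative ring with commuting derivations *)

Section DiffRing.
Variables (A : comPzRingType) (n : nat) (d : 'I_n -> A -> A).
(** The instance in view is the ring of smooth functions on the image of a chart, with its partial
    derivatives; [two_reg] replaces division by 2. *)
Hypotheses (dD : forall i a b, d i (a + b) = d i a + d i b)
  (dM : forall i a b, d i (a * b) = d i a * b + a * d i b)
  (dC : forall i j a, d i (d j a) = d j (d i a))
  (two_reg : forall a : A, a + a = 0 -> a = 0).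

Lemma mxaddE p q (M N : 'M[A]_(p, q)) i j : (M + N) i j = M i j + N i j.
Proof. by rewrite mxE. Qed.
Lemma mxoppE p q (M : 'M[A]_(p, q)) i j : (- M) i j = - M i j.
Proof. by rewrite mxE. Qed.
Lemma mxscaleE p q a (M : 'M[A]_(p, q)) i j : (a *: M) i j = a * M i j.
Proof. by rewrite mxE. Qed.
Lemma mxzeroE p q i j : (0 : 'M[A]_(p, q)) i j = 0.
Proof. by rewrite mxE. Qed.
Definition entE := (mxaddE, mxoppE, mxscaleE, mxzeroE).

Lemma trDE p q (M N : 'M[A]_(p, q)) : (M + N)^T = M^T + N^T.
Proof. by apply/matrixP => i j; rewrite !mxE. Qed.
Lemma trNE p q (M : 'M[A]_(p, q)) : (- M)^T = - M^T.
Proof. by apply/matrixP => i j; rewrite !mxE. Qed.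
Lemma trZE p q a (M : 'M[A]_(p, q)) : (a *: M)^T = a *: M^T.
Proof. by apply/matrixP => i j; rewrite !mxE. Qed.
Lemma mxtrNE p (M : 'M[A]_p) : \tr (- M) = - \tr M.
Proof. by rewrite /mxtrace -sumrN; apply: eq_bigr => i _; rewrite mxE. Qed.

Lemma mxtr_sum (I : Type) (r : seq I) p (F : I -> 'M[A]_p) :
  \tr (\sum_(i <- r) F i) = \sum_(i <- r) \tr (F i).
Proof. by rewrite raddf_sum. Qed.

Lemma d0 i : d i 0 = 0.
Proof. by apply: (addrI (d i 0)); rewrite -dD !addr0. Qed.

Lemma dN i a : d i (- a) = - d i a.
Proof. by apply: (addrI (d i a)); rewrite -dD !subrr d0. Qed.

Lemma dB i a b : d i (a - b) = d i a - d i b.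
Proof. by rewrite dD dN. Qed.

Lemma d1 i : d i 1 = 0.
Proof. by apply: (addrI (d i 1)); rewrite addr0 -[in RHS](mulr1 1) dM mulr1 mul1r. Qed.

Lemma dsum i (I : Type) (r : seq I) (P : pred I) (F : I -> A) :
  d i (\sum_(k <- r | P k) F k) = \sum_(k <- r | P k) d i (F k).
Proof. exact: (big_morph _ (dD i) (d0 i)). Qed.

Definition Dm i p q (M : 'M[A]_(p, q)) : 'M[A]_(p, q) := map_mx (d i) M.

Lemma DmD i p q (M N : 'M[A]_(p, q)) : Dm i (M + N) = Dm i M + Dm i N.
Proof. by apply/matrixP => a b; rewrite !mxE dD. Qed.

Lemma DmN i p q (M : 'M[A]_(p, q)) : Dm i (- M) = - Dm i M.
Proof. by apply/matrixP => a b; rewrite !mxE dN. Qed.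

Lemma DmB i p q (M N : 'M[A]_(p, q)) : Dm i (M - N) = Dm i M - Dm i N.
Proof. by rewrite DmD DmN. Qed.

Lemma DmM i p q r (M : 'M[A]_(p, q)) (N : 'M[A]_(q, r)) :
  Dm i (M *m N) = Dm i M *m N + M *m Dm i N.
Proof.
apply/matrixP => a b; rewrite !mxE dsum -big_split; apply: eq_bigr => k _.
by rewrite dM !mxE.
Qed.

Lemma DmT i p q (M : 'M[A]_(p, q)) : Dm i M^T = (Dm i M)^T.
Proof. by rewrite /Dm map_trmx. Qed.

Lemma DmC i j p q (M : 'M[A]_(p, q)) : Dm i (Dm j M) = Dm j (Dm i M).
Proof. by apply/matrixP => a b; rewrite !mxE dC. Qed.

Lemma Dm1 i p : Dm i (1%:M : 'M[A]_p) = 0.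
Proof.
apply/matrixP => a b; rewrite !mxE; case: (a == b); rewrite ?mulr1n ?mulr0n; [exact: d1|exact: d0].
Qed.

Lemma Dm_tr i p (M : 'M[A]_p) : d i (\tr M) = \tr (Dm i M).
Proof. by rewrite /mxtrace dsum; apply: eq_bigr => k _; rewrite mxE. Qed.

Section Connection.
(** [Gam i j k] stands for Gamma^k_{ij}, so the matrix [Gam i] acts on row vectors. With [tf] (no
    torsion) and [mc] (compatibility with the metric), [Gam] is the Levi-Civita connection of
    [G]. *)
Variables (G H : 'M[A]_n) (Gam : 'I_n -> 'M[A]_n).
Hypotheses (GT : G^T = G) (GH : G *m H = 1%:M).
Hypotheses (tf : forall i j k, Gam i j k = Gam j i k)
  (mc : forall i, Dm i G = Gam i *m G + G *m (Gam i)^T).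

Lemma HG : H *m G = 1%:M. Proof. exact: mulmx1C. Qed.

Lemma HT : H^T = H.
Proof.
rewrite -[LHS]mulmx1 -GH mulmxA -{1}GT -trmx_mul.
by rewrite GH trmx1 mul1mx.
Qed.

Lemma Dm_inv i : Dm i H = - (H *m Gam i) - (Gam i)^T *m H.
Proof.
have h : Dm i H *m G = - (H *m Dm i G).
  by apply/eqP; rewrite -addr_eq0 -DmM HG Dm1.
rewrite -[LHS]mulmx1 -GH mulmxA h mc mulNmx mulmxDr mulmxDl opprD.
by rewrite -(mulmxA H (Gam i *m G)) -(mulmxA (Gam i)) GH mulmx1 (mulmxA H G) HG mul1mx.
Qed.

(** The entry (k, l) is the component along d_l of R(d_i, d_j) d_k. The signs of the two products
    reflect that matrices act on rows, which reverses composition. *)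
Definition curv i j := Dm i (Gam j) - Dm j (Gam i) - Gam i *m Gam j + Gam j *m Gam i.

Lemma curvN i j : curv j i = - curv i j.
Proof. by rewrite /curv; apply/matrixP => a b; rewrite !entE; ring. Qed.

(** The second derivatives of [G] commute; when both are expanded by [mc], their difference is the
    symmetric part of the lowered curvature. *)
Lemma curv_anti i j : (curv i j *m G)^T = - (curv i j *m G).
Proof.
have D2 k l : Dm k (Dm l G) = Dm k (Gam l) *m G + Gam l *m Gam k *m G + Gam l *m G *m (Gam k)^T
    + (Gam k *m G *m (Gam l)^T + G *m ((Gam k)^T *m (Gam l)^T) + G *m (Dm k (Gam l))^T).
  rewrite mc DmD !DmM !mc DmT mulmxDr mulmxDl.
  by apply/matrixP => a b; rewrite !(entE, mulmxA); ring.
apply/eqP; rewrite -addr_eq0; apply/eqP.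
transitivity (Dm i (Dm j G) - Dm j (Dm i G)); last by rewrite DmC subrr.
rewrite !D2 trmx_mul GT /curv
  !(trDE, trNE) !(mulmxDr, mulmxDl, mulmxN, mulNmx) !trmx_mul.
by apply/matrixP => a b; rewrite !(entE, mulmxA); ring.
Qed.

Lemma curv_bianchi1 i j k l : curv i j k l + curv j k i l + curv k i j l = 0.
Proof.
have e a b c : Dm a (Gam b) c l = Dm a (Gam c) b l by rewrite !mxE tf.
have m a b c : (Gam a *m Gam b) c l = (Gam c *m Gam b) a l.
  by rewrite !mxE; apply: eq_bigr => x _; rewrite tf.
rewrite /curv !entE (e i j k) (e j k i) (e k i j) (m i j k) (m j k i) (m k i j)
  (m j i k) (m k j i) (m i k j); ring.
Qed.

Lemma curv_bianchi2 i j k :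
  (Dm i (curv j k) - Gam i *m curv j k + curv j k *m Gam i)
  + (Dm j (curv k i) - Gam j *m curv k i + curv k i *m Gam j)
  + (Dm k (curv i j) - Gam k *m curv i j + curv i j *m Gam k) = 0.
Proof.
rewrite /curv !(DmD, DmN, DmM) (DmC j i) (DmC k i) (DmC k j)
  !(mulmxDr, mulmxDl, mulmxN, mulNmx).
by apply/matrixP => a b; rewrite !(entE, mulmxA); ring.
Qed.

Lemma curv_ricci_id (v : 'cV[A]_n) i j :
  (Dm i (Dm j v - Gam j *m v) - Gam i *m (Dm j v - Gam j *m v))
  - (Dm j (Dm i v - Gam i *m v) - Gam j *m (Dm i v - Gam i *m v)) = - (curv i j *m v).
Proof.
rewrite /curv !(DmD, DmN, DmM) (DmC j i)
  !(mulmxDr, mulmxDl, mulmxN, mulNmx).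
by apply/matrixP => a b; rewrite !(entE, mulmxA); ring.
Qed.

(* A 3-tensor symmetric in its first two indices and antisymmetric in the last
   two vanishes; this gives both Koszul uniqueness and [contr_curv]. *)
Lemma sym_anti_zero (S : 'I_n -> 'I_n -> 'I_n -> A) :
  (forall i j k, S i j k = S j i k) -> (forall i j k, S i j k = - S i k j) ->
  forall i j k, S i j k = 0.
Proof.
move=> s a i j k; apply: two_reg.
have e : S i j k = - S i j k.
  by rewrite [LHS]s [S j i k]a [S j k i]s [S k j i]a [S k i j]s [S i k j]a !opprK.
by rewrite {1}e addNr.
Qed.

Section Hessian.
Variable u : A.
Definition grad_cov (w : A) : 'cV[A]_n := \col_j d j w.
Definition hess (w : A) : 'M[A]_n :=
  \matrix_(i, j) (d i (d j w) - \sum_k Gam i j k * d k w).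
Definition lap (w : A) := \tr (H *m hess w).
Definition ricm : 'M[A]_n := \matrix_(j, k) \sum_i curv i j k i.
Let du := grad_cov u.
Let U := H *m du.
Let h := hess u.
Let s := (du^T *m U) 0 0.

Lemma hess_row w i : (row i (hess w))^T = Dm i (grad_cov w) - Gam i *m grad_cov w.
Proof.
by apply/colP => j; rewrite !mxE; congr (_ - _); apply: eq_bigr => k _; rewrite !mxE.
Qed.

Lemma hess_sym w : (hess w)^T = hess w.
Proof.
apply/matrixP => i j; rewrite !mxE dC; congr (_ - _).
by apply: eq_bigr => k _; rewrite tf.
Qed.

Lemma Dm_grad i : Dm i U = H *m col i h - (Gam i)^T *m U.
Proof.
have -> : col i h = Dm i du - Gam i *m du by rewrite -hess_row tr_row hess_sym.
rewrite /U DmM Dm_inv mulmxDr mulmxDl !mulNmx mulmxN !mulmxA.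
by apply/matrixP => a b; rewrite !entE; ring.
Qed.

Lemma d_norm_grad i : d i s = 2 * (h *m U) i 0.
Proof.
have hE : (h *m U) i 0 = ((col i h)^T *m U) 0 0.
  by rewrite -[h in LHS]hess_sym !mxE; apply: eq_bigr => k _; rewrite !mxE.
have -> : d i s = Dm i (du^T *m U) 0 0 by rewrite mxE.
rewrite DmM DmT Dm_grad.
have -> : Dm i du = col i h + Gam i *m du.
  by rewrite -[h]hess_sym -tr_row hess_row subrK.
rewrite trDE mulmxDl mulmxDr mulmxN trmx_mul.
have -> : du^T *m (H *m col i h) = (col i h)^T *m U.
  have tr11 (M : 'M[A]_1) : M = M^T by apply/matrixP => a b; rewrite !ord1 mxE.
  by rewrite [LHS]tr11 !trmx_mul HT trmxK -mulmxA.
by rewrite hE !entE !mulmxA; ring.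
Qed.

(** The covariant derivative of the Hessian in the direction i. *)
Definition third i := Dm i h - Gam i *m h - h *m (Gam i)^T.

Lemma third_sym i : (third i)^T = third i.
Proof.
rewrite /third !(trDE, trNE) -DmT !trmx_mul trmxK hess_sym.
by apply/matrixP => a b; rewrite !entE; ring.
Qed.

Lemma hess_norm_grad i :
  (row i (hess s))^T = third i *m U + h *m H *m col i h + (third i *m U + h *m H *m col i h).
Proof.
have gs : grad_cov s = h *m U + h *m U.
  by apply/colP => k; rewrite mxE d_norm_grad mxaddE; ring.
rewrite hess_row gs DmD !(DmM i h U) Dm_grad /third mulmxDr !mulmxDl !mulNmx !mulmxDr !mulmxN !mulmxA.
by apply/matrixP => a b; rewrite !entE; ring.
Qed.

Lemma third_ricci i j k : third i k j - third j k i = - (curv i j *m du) k 0.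
Proof.
have cE a : Dm a du - Gam a *m du = col a h by rewrite -hess_row tr_row hess_sym.
have /matrixP /(_ k 0) := curv_ricci_id du i j.
rewrite !cE [RHS]mxoppE => <-; rewrite /third !entE.
have e1 a b : Dm a (col b h) k 0 = Dm a h k b by rewrite !mxE.
have e2 a b : (Gam a *m col b h) k 0 = (Gam a *m h) k b.
  by rewrite !mxE; apply: eq_bigr => l _; rewrite !mxE.
have e3 : (h *m (Gam i)^T) k j = (h *m (Gam j)^T) k i.
  by rewrite !mxE; apply: eq_bigr => l _; rewrite !mxE tf.
by rewrite !e1 !e2 e3; ring.
Qed.

Lemma d_lap k : d k (lap u) = \tr (H *m third k).
Proof.
rewrite /lap Dm_tr DmM Dm_inv /third mulmxDl !mulmxDr !mulNmx !mulmxN !mxtraceD !mxtrNE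
  -[(Gam k)^T *m H *m h]mulmxA [\tr ((Gam k)^T *m _)]mxtrace_mulC !mulmxA; ring.
Qed.

Lemma H_curv i j : H *m curv i j = - ((curv i j)^T *m H).
Proof.
have := curv_anti i j; rewrite trmx_mul GT => e.
rewrite -[LHS]mulmx1 -GH !mulmxA -(mulmxA H) -[curv i j *m G]opprK -e mulmxN mulNmx.
by rewrite mulmxA HG mul1mx.
Qed.

(** The divergence of the Hessian. Exchanging the direction of differentiation with an index of the
    Hessian costs a curvature term by [third_ricci], and the trace of that term is the Ricci
    term. *)
Lemma third_contract k :
  \sum_a \sum_i H a i * third i a k = d k (lap u) + (ricm *m U) k 0.
Proof.
have Hs a b : H a b = H b a by rewrite -[in LHS]HT mxE.
have e i a : third i a k = third k i a - (curv i k *m du) a 0.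
  have ts : third k a i = third k i a by rewrite -[in LHS]third_sym mxE.
  by have := third_ricci i k a => /eqP; rewrite subr_eq addrC => /eqP ->; rewrite ts addrC.
have -> : d k (lap u) = \sum_a \sum_i H a i * third k i a.
  by rewrite d_lap /mxtrace; apply: eq_bigr => a _; rewrite mxE.
have -> : (ricm *m U) k 0 = - \sum_a \sum_i H a i * (curv i k *m du) a 0.
  rewrite exchange_big /= -sumrN mxE.
  transitivity (\sum_i ((curv i k)^T *m U) i 0).
    under [RHS]eq_bigr do rewrite mxE.
    rewrite exchange_big /=; apply: eq_bigr => l _; rewrite mxE mulr_suml.
    by apply: eq_bigr => i _; rewrite [_^T i l]mxE.
  apply: eq_bigr => i _.
  have -> : (curv i k)^T *m U = - (H *m (curv i k *m du)).
    by rewrite mulmxA H_curv mulNmx opprK /U mulmxA.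
  by rewrite mxoppE mxE; congr (- _); apply: eq_bigr => a _; rewrite Hs.
rewrite -sumrN -big_split; apply: eq_bigr => a _ /=.
by rewrite -sumrN -big_split; apply: eq_bigr => i _ /=; rewrite e; ring.
Qed.

(** The trace of [hess_norm_grad]: the terms in [third] are handled by [third_contract], the
    quadratic ones are |D^2 u|^2. *)
Lemma bochner : lap s =
  2 * (\sum_k U k 0 * (d k (lap u) + (ricm *m U) k 0) + \tr (H *m h *m H *m h)).
Proof.
pose Y := \matrix_(i, a) (third i *m U) a 0.
have hs : hess s = Y + h *m H *m h + (Y + h *m H *m h).
  apply/matrixP => i a.
  have -> : hess s i a = (row i (hess s))^T a 0 by rewrite !mxE.
  have e : (h *m H *m col i h) a 0 = (h *m H *m h) i a.
    have sm : (h *m H *m h)^T = h *m H *m h by rewrite !trmx_mul HT hess_sym mulmxA.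
    rewrite -[in RHS]sm [RHS]mxE [LHS]mxE [RHS]mxE.
    by apply: eq_bigr => l _; rewrite !mxE.
  by rewrite hess_norm_grad !mxaddE e [Y i a]mxE.
have tY : \tr (H *m Y) = \sum_k U k 0 * (d k (lap u) + (ricm *m U) k 0).
  transitivity (\sum_k U k 0 * (\sum_a \sum_i H a i * third i a k)); last first.
    by apply: eq_bigr => k _; rewrite third_contract.
  rewrite /mxtrace.
  under [RHS]eq_bigr do rewrite mulr_sumr.
  rewrite [RHS]exchange_big /=; apply: eq_bigr => a _; rewrite mxE.
  under [RHS]eq_bigr do rewrite mulr_sumr.
  rewrite [RHS]exchange_big /=; apply: eq_bigr => i _; rewrite !mxE mulr_sumr.
  by apply: eq_bigr => k _; ring.
by rewrite /lap hs !mulmxDr !mxtraceD tY !mulmxA; ring.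
Qed.

Lemma hessD w1 w2 : hess (w1 + w2) = hess w1 + hess w2.
Proof.
apply/matrixP => i j; rewrite !mxE !dD.
rewrite addrACA -opprD -big_split; congr (_ - _).
by apply: eq_bigr => k _ /=; rewrite dD mulrDr.
Qed.

Lemma lap_sq : lap (u * u) = 2 * (u * lap u + s).
Proof.
have -> : lap (u * u) = \tr (H *m (u *: h + u *: h + (du *m du^T + du *m du^T))).
  congr (\tr (H *m _)); apply/matrixP => i j; rewrite !entE ![(_ *m _) i j]mxE !big_ord1 !mxE.
  rewrite dM dD !dM.
  have -> : \sum_k Gam i j k * d k (u * u) =
      2 * (u * \sum_k Gam i j k * d k u).
    by rewrite !mulr_sumr; apply: eq_bigr => k _; rewrite dM; ring.
  ring.
rewrite !mulmxDr !mxtraceD -!scalemxAr !linearZ /=.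
have -> : \tr (H *m (du *m du^T)) = s.
  by rewrite mulmxA mxtrace_mulC /mxtrace big_ord1.
by rewrite /lap; ring.
Qed.

Hypotheses (ricE : u *: ricm = h + (n%:R * u) *: G) (lapE : lap u = - n%:R * u).
Let w := s + u * u.

Lemma dnat i m : d i m%:R = 0.
Proof. by elim: m => [|m IH]; rewrite ?d0 // -addn1 natrD dD IH d1 addr0. Qed.

(** Multiplied by u, the Ricci term of Bochner's formula becomes D^2 u (Du, Du) + n u |Du|^2, and
    its second summand cancels <D (lap u), Du> = - n |Du|^2. The trace condition [lapE] completes
    the square: |D^2 u + u g|^2 = |D^2 u|^2 - n u^2. *)
Lemma static_bochner :
  u * lap w - \sum_k U k 0 * d k w =
  2 * (u * \tr ((H *m (h + u *: G)) *m (H *m (h + u *: G)))).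
Proof.
(* D^2 u (Du, Du), the only term that survives besides the square. *)
pose q := (U^T *m h *m U) 0 0.
have Us : (U^T *m G *m U) 0 0 = s.
  by rewrite trmx_mul HT -(mulmxA du^T) HG mulmx1.
have sE : \sum_k U k 0 * d k u = s.
  by rewrite /s mxE; apply: eq_bigr => k _; rewrite !mxE mulrC.
have E1 : u * \sum_k U k 0 * (d k (lap u) + (ricm *m U) k 0) = q.
  have -> : u * (\sum_k U k 0 * (d k (lap u) + (ricm *m U) k 0)) =
     u * \sum_k U k 0 * d k (lap u) + (U^T *m (u *: ricm) *m U) 0 0.
    rewrite -scalemxAr -scalemxAl mxscaleE -mulrDr; congr (_ * _).
    rewrite -mulmxA [(U^T *m _) 0 0]mxE -big_split; apply: eq_bigr => k _.
    by rewrite [U^T _ _]mxE /=; ring.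
  rewrite ricE mulmxDr mulmxDl -scalemxAr -scalemxAl mxaddE mxscaleE Us -/q.
  have -> : \sum_k U k 0 * d k (lap u) = - n%:R * s.
    rewrite -sE mulr_sumr; apply: eq_bigr => k _.
    by rewrite lapE dM dN dnat; ring.
  by ring.
have E2 : \sum_k U k 0 * d k w = 2 * q + 2 * (u * s).
  have -> : q = \sum_k U k 0 * (h *m U) k 0.
    by rewrite /q -mulmxA mxE; apply: eq_bigr => k _; rewrite [U^T _ _]mxE.
  rewrite -sE !mulr_sumr -big_split; apply: eq_bigr => k _ /=.
  by rewrite /w dD d_norm_grad dM; ring.
have tHG : \tr (H *m G) = n%:R by rewrite HG mxtrace1.
have E3 : \tr ((H *m (h + u *: G)) *m (H *m (h + u *: G))) =
    \tr (H *m h *m H *m h) - n%:R * (u * u).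
  have -> : H *m (h + u *: G) = H *m h + u%:M by rewrite mulmxDr -scalemxAr HG scalemx1.
  rewrite mulmxDl !mulmxDr !mul_scalar_mx !mul_mx_scalar !mxtraceD !mxtraceZ mxtrace_scalar.
  by rewrite -/(lap u) lapE mulmxA; ring.
have E4 : u * lap s = 2 * (q + u * \tr (H *m h *m H *m h)).
  by rewrite bochner mulrCA mulrDr E1.
by rewrite E2 E3 /lap hessD mulmxDr mxtraceD -!/(lap _) lap_sq lapE mulrDr E4; ring.
Qed.
End Hessian.

(** * The conformal change by 1 / (1 + v) *)

Section Conformal.
Variables (v iom : A).
Hypothesis iomE : iom * (1 + v) = 1.
Let dv := grad_cov v.
Let U := H *m dv.
Hypotheses (hessE : hess v = - v *: G) (normE : (dv^T *m U) 0 0 = 1 - v * v).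

Definition conf_metric : 'M[A]_n := (iom * iom) *: G.
Definition conf_inv : 'M[A]_n := ((1 + v) * (1 + v)) *: H.
(** The classical formula for the Levi-Civita connection of e^{2 phi} G with phi = - log (1 + v).
    Only the differential of phi occurs, and it is [- iom * d i v]. *)
Definition conf_conn i : 'M[A]_n :=
  Gam i - iom *: ((d i v)%:M + dv *m (delta_mx i 0 : 'cV_n)^T - col i G *m U^T).
Definition conf_field : 'cV[A]_n := - U.

Lemma d_iom i : d i iom = - (iom * iom * d i v).
Proof.
have e : d i iom * (1 + v) = - (iom * d i v).
  by apply/eqP; rewrite -addr_eq0 -[d i v]add0r -(d1 i) -dD -dM iomE d1.
by rewrite -[LHS]mulr1 -iomE mulrCA e; ring.
Qed.

Lemma conf_metric_sym : conf_metric^T = conf_metric.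
Proof. by rewrite /conf_metric linearZ /= GT. Qed.

Lemma conf_metric_inv : conf_metric *m conf_inv = 1%:M.
Proof.
rewrite /conf_metric /conf_inv -scalemxAl -scalemxAr scalerA GH.
have -> : iom * iom * ((1 + v) * (1 + v)) = (iom * (1 + v)) * (iom * (1 + v)) by ring.
by rewrite iomE mulr1 scale1r.
Qed.

Lemma conf_conn_tf i j k : conf_conn i j k = conf_conn j i k.
Proof.
have Gs : G i j = G j i by rewrite -[in LHS]GT mxE.
rewrite /conf_conn !entE tf !(mxE, big_ord1) Gs eqxx !andbT !(eq_sym k).
by case: (i == k); case: (j == k); rewrite ?mulr1n ?mulr0n; ring.
Qed.

Lemma conf_conn_mc i : Dm i conf_metric = conf_conn i *m conf_metric + conf_metric *m (conf_conn i)^T.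
Proof.
have UG : U^T *m G = dv^T by rewrite trmx_mul HT -mulmxA HG mulmx1.
have eG : (delta_mx i 0 : 'cV[A]_n)^T *m G = (col i G)^T.
  by rewrite tr_col GT rowE trmx_delta.
set X := (d i v)%:M + dv *m (delta_mx i 0 : 'cV_n)^T - col i G *m U^T.
have XG : X *m G = d i v *: G + dv *m (col i G)^T - col i G *m dv^T.
  by rewrite mulmxDl mulmxDl mulNmx -!mulmxA UG eG mul_scalar_mx.
have GX : G *m X^T = d i v *: G + col i G *m dv^T - dv *m (col i G)^T.
  by rewrite -[in LHS]GT -trmx_mul XG !(trDE, trNE, trZE) !trmx_mul !trmxK GT.
have -> : Dm i conf_metric = (iom * iom) *: (Dm i G) - (2 * iom * iom * iom * d i v) *: G.
  by apply/matrixP => a b; rewrite !entE !mxE !dM d_iom; ring.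
rewrite /conf_conn -/X /conf_metric mc trDE trNE trZE
  -!scalemxAr -!scalemxAl mulmxDl mulmxDr mulNmx mulmxN -scalemxAl -scalemxAr XG GX.
by apply/matrixP => a b; rewrite !entE; ring.
Qed.

(** The Hessian - v G contributes v to D E and the conformal correction contributes
    [iom * (1 - v * v)], which is 1 - v by [normE]; the sum is the identity. *)
Lemma conf_field_cov i : Dm i conf_field + (conf_conn i)^T *m conf_field = delta_mx i 0.
Proof.
have dUE : (col i G)^T *m U = (d i v)%:M.
  rewrite tr_col GT -row_mul mulmxA GH mul1mx.
  by apply/matrixP => a b; rewrite !ord1 !mxE.
have He : H *m col i (hess v) = - v *: (delta_mx i 0 : 'cV_n).
  have -> : col i (hess v) = - v *: col i G by rewrite hessE; apply/colP => k; rewrite !mxE.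
  by rewrite -scalemxAr colE mulmxA HG mul1mx.
have nE : dv^T *m U = (1 - v * v)%:M by rewrite [LHS]mx11_scalar normE.
have XU : ((d i v)%:M + dv *m (delta_mx i 0 : 'cV_n)^T - col i G *m U^T)^T *m U
    = (1 - v * v) *: (delta_mx i 0 : 'cV_n).
  rewrite !(trDE, trNE) !trmx_mul !trmxK tr_scalar_mx mulmxDl mulmxDl mulNmx mul_scalar_mx
  -(mulmxA (delta_mx i 0)) nE mul_mx_scalar -(mulmxA U (col i G)^T U) dUE.
  by rewrite [U *m _%:M]mul_mx_scalar addrAC subrr add0r.
rewrite /conf_field DmN Dm_grad He /conf_conn trDE trNE trZE mulmxN mulmxDl mulNmx -scalemxAl XU
  -/dv -/U; apply/matrixP => a b; rewrite !entE.
have e1 : iom * (1 - v * v) = 1 - v.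
  have -> : iom * (1 - v * v) = (iom * (1 + v)) * (1 - v) by ring.
  by rewrite iomE mul1r.
by rewrite mulrA e1; ring.
Qed.

Lemma conf_field_norm : (conf_field^T *m conf_metric *m conf_field) 0 0 = (1 - v) * iom.
Proof.
rewrite /conf_field trNE mulNmx mulmxN mulNmx opprK -scalemxAr -scalemxAl mxscaleE.
have -> : U^T *m G *m U = dv^T *m U by rewrite trmx_mul HT -(mulmxA dv^T H G) HG mulmx1.
rewrite normE.
have -> : iom * iom * (1 - v * v) = (iom * (1 + v)) * ((1 - v) * iom) by ring.
by rewrite iomE mul1r.
Qed.
End Conformal.

(** * Curvature in the presence of a field with D E = id *)

Section Flat.
Variable E : 'cV[A]_n.
Hypothesis covE : forall i, Dm i E + (Gam i)^T *m E = delta_mx i 0.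

(** The identity is parallel, so the second covariant derivatives of [E] commute, and their
    commutator R(d_i, d_j) E vanishes. *)
Lemma curvE i j : (curv i j)^T *m E = 0.
Proof.
have dE k : Dm k E = delta_mx k 0 - (Gam k)^T *m E by rewrite -covE addrK.
have ge : (Gam j)^T *m (delta_mx i 0 : 'cV[A]_n) = (Gam i)^T *m (delta_mx j 0 : 'cV_n).
  apply/colP => k; rewrite -!colE !mxE; exact: tf.
have dd k l : Dm k (delta_mx l 0 : 'cV[A]_n) = 0.
  apply/matrixP => a b; rewrite !mxE; case: (_ && _); rewrite ?mulr1n ?mulr0n; [exact: d1|exact: d0].
have e k l : Dm k (Dm l E) = - ((Dm k (Gam l))^T *m E) - ((Gam l)^T *m (delta_mx k 0 : 'cV_n)
      - (Gam l)^T *m (Gam k)^T *m E).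
  by rewrite dE DmB dd DmM DmT dE mulmxDr mulmxN mulmxA sub0r opprD.
have := DmC i j E; rewrite !e ge => /matrixP h; apply/matrixP => a b.
have := h a b; rewrite /curv !(trDE, trNE, mulmxDl, mulNmx) !trmx_mul !entE => /eqP.
rewrite -subr_eq0 => /eqP h0; rewrite -[RHS]oppr0 -h0; ring.
Qed.

(** The lowered tensor <R(E, d_i) d_j, d_l> is antisymmetric in j, l by [curv_anti], and symmetric
    in i, j by the first Bianchi identity together with [curvE]; such a tensor vanishes. *)
Lemma contr_curv j : \sum_k E k 0 *: curv k j = 0.
Proof.
pose P i j l := (\sum_k E k 0 *: (curv k i *m G)) j l.
have PE i k l : P i k l = \sum_m E m 0 * (curv m i *m G) k l.
  by rewrite /P summxE; apply: eq_bigr => m _; rewrite mxscaleE.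
have anti i k l : P i k l = - P i l k.
  rewrite !PE -sumrN; apply: eq_bigr => m _.
  by have /matrixP /(_ l k) := curv_anti m i; rewrite [LHS]mxE mxoppE => ->; ring.
have sym i k l : P i k l = P k i l.
  rewrite !PE; apply/eqP; rewrite -subr_eq0 -sumrB; apply/eqP.
  transitivity (\sum_m E m 0 * (curv i k *m G) m l * (-1)); last first.
    have : (E^T *m (curv i k *m G)) 0 l = 0.
      have : (E^T *m curv i k)^T = 0 by rewrite trmx_mul trmxK curvE.
      by move=> /(congr1 trmx); rewrite trmxK trmx0 => h; rewrite mulmxA h mul0mx mxE.
    by rewrite -mulr_suml mxE; under eq_bigr do rewrite mxE; move=> ->; rewrite mul0r.
  apply: eq_bigr => m _.
  have b : (curv i k *m G) m l + (curv k m *m G) i l + (curv m i *m G) k l = 0.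
    rewrite !mxE -!big_split big1 //= => q _.
    by rewrite -!mulrDl curv_bianchi1 mul0r.
  rewrite -mulrBr -mulrA; congr (_ * _).
  have -> : (curv m k *m G) i l = - (curv k m *m G) i l by rewrite curvN mulNmx mxoppE.
  by apply/eqP; rewrite opprK mulrN1 -addr_eq0 -[X in _ == X]b; apply/eqP; ring.
have P0 := sym_anti_zero sym anti.
have : \sum_k E k 0 *: (curv k j *m G) = 0.
  by apply/matrixP => a b; rewrite [RHS]mxE; exact: (P0 j a b).
move=> h; rewrite -[LHS]mulmx1 -GH mulmxA mulmx_suml.
by under eq_bigr do rewrite -scalemxAl; rewrite h mul0mx.
Qed.

Definition dE (a : A) : A := \sum_m E m 0 * d m a.
Definition DE p q (M : 'M[A]_(p, q)) : 'M[A]_(p, q) := map_mx dE M.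

Lemma dED a b : dE (a + b) = dE a + dE b.
Proof. by rewrite /dE -big_split; apply: eq_bigr => m _; rewrite dD mulrDr. Qed.

Lemma dEM a b : dE (a * b) = dE a * b + a * dE b.
Proof.
rewrite /dE mulr_suml mulr_sumr -big_split; apply: eq_bigr => m _.
by rewrite dM /=; ring.
Qed.

Lemma dE0 : dE 0 = 0.
Proof. by rewrite /dE big1 // => m _; rewrite d0 mulr0. Qed.

Lemma DEM p q r (M : 'M[A]_(p, q)) (N : 'M[A]_(q, r)) : DE (M *m N) = DE M *m N + M *m DE N.
Proof.
apply/matrixP => a b; rewrite !mxE (big_morph _ dED dE0) -big_split; apply: eq_bigr => k _.
by rewrite dEM !mxE.
Qed.

Lemma dE_tr p (M : 'M[A]_p) : dE (\tr M) = \tr (DE M).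
Proof. by rewrite /mxtrace (big_morph _ dED dE0); apply: eq_bigr => k _; rewrite mxE. Qed.

Lemma DEE p q (M : 'M[A]_(p, q)) : DE M = \sum_m E m 0 *: Dm m M.
Proof. by apply/matrixP => a b; rewrite mxE summxE; apply: eq_bigr => m _; rewrite !mxE. Qed.

Definition GamE : 'M[A]_n := \sum_m E m 0 *: Gam m.

Lemma GamE_col i m : ((Gam i)^T *m E) m 0 = GamE i m.
Proof.
by rewrite mxE summxE; apply: eq_bigr => k _; rewrite !mxE tf mulrC.
Qed.

Lemma DE_inv : DE H = - (H *m GamE) - GamE^T *m H.
Proof.
rewrite DEE; under eq_bigr do rewrite Dm_inv scalerBr scalerN scalemxAr scalemxAl -linearZ.
by rewrite sumrB sumrN -mulmx_sumr -mulmx_suml -linear_sum.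
Qed.

(** Covariantly this is D_E R = - 2 R, from the second Bianchi identity contracted with [E]: since
    R(E, .) = 0 and D E = id, each of the two terms where [E] sits inside the curvature leaves a
    copy of R. The [GamE] terms are the Christoffel corrections of the indices. *)
Lemma DE_curv i j : DE (curv i j) =
  GamE *m curv i j - curv i j *m GamE - (curv i j + curv i j)
  + \sum_m GamE i m *: curv m j + \sum_m GamE j m *: curv i m.
Proof.
have sumZ (c : 'I_n -> A) (Q : 'I_n -> 'M[A]_n) k :
    Dm k (\sum_m c m *: Q m) = \sum_m d k (c m) *: Q m + \sum_m c m *: Dm k (Q m).
  rewrite -big_split /=; apply/matrixP => a b; rewrite mxE !summxE dsum.
  by apply: eq_bigr => m _; rewrite !entE !mxE dM.
have dEk k m : d k (E m 0) = (m == k)%:R - GamE k m.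
  have /matrixP /(_ m 0) := covE k; rewrite !entE GamE_col [Dm _ _ _ _]mxE [RHS]mxE andbT => <-.
  by rewrite addrK.
have contr' k : \sum_m E m 0 *: curv k m = 0.
  by under eq_bigr do rewrite curvN scalerN; rewrite sumrN contr_curv oppr0.
have pick k (Q : 'I_n -> 'M[A]_n) : \sum_m d k (E m 0) *: Q m = Q k - \sum_m GamE k m *: Q m.
  rewrite -sumrN (bigD1 k) //= [in RHS](bigD1 k) //= addrA; congr (_ + _).
    by rewrite dEk eqxx scalerBl scale1r.
  by apply: eq_bigr => m /negPf mk; rewrite dEk mk sub0r scaleNr.
have Dk k (Q : 'I_n -> 'M[A]_n) : \sum_m E m 0 *: Q m = 0 ->
    \sum_m E m 0 *: (Dm k (Q m) - Gam k *m Q m + Q m *m Gam k) = \sum_m GamE k m *: Q m - Q k.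
  move=> Q0; under eq_bigr do rewrite scalerDr scalerBr scalemxAr scalemxAl.
  rewrite big_split sumrB -mulmx_sumr -mulmx_suml /= Q0 mulmx0 mul0mx subr0 addr0.
  have := sumZ (fun m => E m 0) Q k; rewrite Q0 pick => h.
  have D0 : Dm k (0 : 'M[A]_n) = 0 by apply/matrixP => a b; rewrite !mxE d0.
  by move/eqP: h; rewrite D0 eq_sym addrC addr_eq0 opprB => /eqP.
have b2 : \sum_m E m 0 *: ((Dm i (curv j m) - Gam i *m curv j m + curv j m *m Gam i)
  + (Dm j (curv m i) - Gam j *m curv m i + curv m i *m Gam j)
  + (Dm m (curv i j) - Gam m *m curv i j + curv i j *m Gam m)) = 0.
  by rewrite big1 // => m _; rewrite curv_bianchi2 scaler0.
move: b2; under eq_bigr do rewrite 2!scalerDr.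
rewrite !big_split /= (Dk i (curv j)) // (Dk j (fun m => curv m i)) ?contr_curv //.
have -> : \sum_m E m 0 *: (Dm m (curv i j) - Gam m *m curv i j + curv i j *m Gam m)
   = DE (curv i j) - GamE *m curv i j + curv i j *m GamE.
  rewrite DEE /GamE mulmx_suml mulmx_sumr -sumrB -big_split; apply: eq_bigr => m _ /=.
  by rewrite scalerDr scalerBr -scalemxAl -scalemxAr.
have -> : \sum_m GamE i m *: curv j m = - \sum_m GamE i m *: curv m j.
  by rewrite -sumrN; apply: eq_bigr => m _; rewrite curvN scalerN.
have -> : \sum_m GamE j m *: curv m i = - \sum_m GamE j m *: curv i m.
  by rewrite -sumrN; apply: eq_bigr => m _; rewrite curvN scalerN.
rewrite (curvN i j) => /matrixP h; apply/matrixP => a b; have := h a b.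
rewrite !entE => h0; apply/eqP; rewrite -subr_eq0; apply/eqP; rewrite -[RHS]h0; ring.
Qed.

(** The inverse metric is parallel, so the Christoffel corrections of [T] cancel in the trace. *)
Lemma dE_contract (T Rm : 'M[A]_n) : DE T = Rm + GamE *m T + T *m GamE^T ->
  dE (\tr (H *m T)) = \tr (H *m Rm).
Proof.
move=> h; rewrite dE_tr DEM DE_inv h mulmxDl !mulmxDr !mulNmx !mxtraceD !mxtrNE.
rewrite -[GamE^T *m H *m T]mulmxA [\tr (GamE^T *m _)]mxtrace_mulC !mulmxA; ring.
Qed.

(* [kappa] is the squared norm of the curvature tensor, written with traces of
   the curvature endomorphisms. *)
Definition kapT j l : 'M[A]_n := \matrix_(i, k) \tr (curv i j *m curv k l).
Definition kapS : 'M[A]_n := \matrix_(j, l) \tr (H *m kapT j l).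
Definition kappa : A := - \tr (H *m kapS).

(** [kappa] is quadratic in the curvature and its contractions use parallel tensors only: - 2 for
    each factor makes - 4. *)
Lemma dE_kappa : dE kappa = - 4 * kappa.
Proof.
have trc (X Y Z1 Z2 W1 W2 : 'M[A]_n) :
    \tr ((GamE *m X - X *m GamE - (X + X) + Z1 + Z2) *m Y) +
    \tr (X *m (GamE *m Y - Y *m GamE - (Y + Y) + W1 + W2)) =
    - 4 * \tr (X *m Y) + \tr (Z1 *m Y) + \tr (Z2 *m Y) + \tr (X *m W1) + \tr (X *m W2).
  rewrite !(mulmxDl, mulmxDr, mulNmx, mulmxN) !(mxtraceD, mxtrNE) !mulmxA
  [\tr (X *m Y *m GamE)]mxtrace_mulC !mulmxA; ring.
have DT j l : DE (kapT j l) = (- 4 *: kapT j l + \sum_m GamE j m *: kapT m l + \sum_m GamE l m *: kapT j m)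
   + GamE *m kapT j l + kapT j l *m GamE^T.
  apply/matrixP => i k; rewrite [LHS]mxE [kapT j l i k]mxE dE_tr DEM !DE_curv mxtraceD.
  have sl (c : 'I_n -> A) (Q : 'I_n -> 'M[A]_n) (Y : 'M[A]_n) :
     \tr ((\sum_m c m *: Q m) *m Y) = \sum_m c m * \tr (Q m *m Y).
    by rewrite mulmx_suml raddf_sum; apply: eq_bigr => m _ /=; rewrite -scalemxAl mxtraceZ.
  have sr (c : 'I_n -> A) (Q : 'I_n -> 'M[A]_n) (Y : 'M[A]_n) :
     \tr (Y *m (\sum_m c m *: Q m)) = \sum_m c m * \tr (Y *m Q m).
    by rewrite mulmx_sumr raddf_sum; apply: eq_bigr => m _ /=; rewrite -scalemxAr mxtraceZ.
  rewrite -mxtraceD mxtraceD trc !sl !sr !entE.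
  have -> : (\sum_m GamE j m *: kapT m l) i k = \sum_m GamE j m * \tr (curv i m *m curv k l).
    by rewrite summxE; apply: eq_bigr => m _; rewrite !mxE.
  have -> : (\sum_m GamE l m *: kapT j m) i k = \sum_m GamE l m * \tr (curv i j *m curv k m).
    by rewrite summxE; apply: eq_bigr => m _; rewrite !mxE.
  have -> : (GamE *m kapT j l) i k = \sum_m GamE i m * \tr (curv m j *m curv k l).
    by rewrite mxE; apply: eq_bigr => m _; rewrite [kapT _ _ _ _]mxE.
  have -> : (kapT j l *m GamE^T) i k = \sum_m GamE k m * \tr (curv i j *m curv m l).
    by rewrite mxE; apply: eq_bigr => m _; rewrite [kapT _ _ _ _]mxE [GamE^T _ _]mxE mulrC.
  by rewrite [kapT j l i k]mxE; ring.
have DS : DE kapS = - 4 *: kapS + GamE *m kapS + kapS *m GamE^T.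
  apply/matrixP => j l; rewrite [LHS]mxE [kapS j l]mxE (dE_contract (DT j l)).
  rewrite !mulmxDr !mxtraceD !mulmx_sumr !mxtr_sum -scalemxAr mxtraceZ !entE [kapS j l]mxE.
  congr (_ + _ + _).
    by rewrite [(GamE *m kapS) j l]mxE; apply: eq_bigr => m _; rewrite -scalemxAr mxtraceZ [kapS _ _]mxE.
  rewrite [(kapS *m GamE^T) j l]mxE; apply: eq_bigr => m _.
  by rewrite -scalemxAr mxtraceZ [kapS _ _]mxE [GamE^T _ _]mxE mulrC.
have dEN a : dE (- a) = - dE a.
  by apply: (addrI (dE a)); rewrite -dED !subrr dE0.
by rewrite /kappa dEN (dE_contract DS) -scalemxAr mxtraceZ; ring.
Qed.
End Flat.

Section Koszul.
Variable Gam' : 'I_n -> 'M[A]_n.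
Hypotheses (tf' : forall i j k, Gam' i j k = Gam' j i k)
  (mc' : forall i, Dm i G = Gam' i *m G + G *m (Gam' i)^T).

(** The difference of two such connections, lowered by [G], is symmetric in its first two indices by
    [tf], [tf'] and antisymmetric in the last two by [mc], [mc']. *)
Lemma koszul i : Gam' i = Gam i.
Proof.
pose S i j k := ((Gam' i - Gam i) *m G) j k.
have sym a b c : S a b c = S b a c.
  by rewrite /S !mxE; apply: eq_bigr => k _; rewrite !entE tf tf'.
have anti a b c : S a b c = - S a c b.
  apply/eqP; rewrite -addr_eq0; apply/eqP; rewrite /S.
  have -> : ((Gam' a - Gam a) *m G) c b = (G *m (Gam' a - Gam a)^T) b c.
    by rewrite -[in RHS]GT -trmx_mul [RHS]mxE.
  rewrite trDE trNE mulmxDl mulmxDr mulNmx mulmxN !entE.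
  have /matrixP /(_ b c) := mc' a; rewrite mc !entE => h.
  have aux (p q r t : A) : p + q = r + t -> r - p + (t - q) = 0.
    move=> pq; have -> : r - p + (t - q) = (r + t) - (p + q) by ring.
    by rewrite pq subrr.
  exact: aux h.
have S0 := sym_anti_zero sym anti.
have : (Gam' i - Gam i) *m G = 0 by apply/matrixP => a b; rewrite -/(S i a b) S0 mxE.
move=> /(congr1 (mulmx^~ H)); rewrite -mulmxA GH mulmx1 mul0mx => /eqP.
by rewrite subr_eq0 => /eqP.
Qed.
End Koszul.
End Connection.
End DiffRing.

(** * Naturality of the curvature under coordinate changes *)

Section Pullback.
Variables (A B : comPzRingType) (n : nat) (d : 'I_n -> A -> A) (d' : 'I_n -> B -> B).
Hypotheses (dD : forall i a b, d i (a + b) = d i a + d i b)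
  (dM : forall i a b, d i (a * b) = d i a * b + a * d i b)
  (dC : forall i j a, d i (d j a) = d j (d i a))
  (two_reg : forall a : A, a + a = 0 -> a = 0).
(** [phi] models composition with a change of coordinates and [J] its Jacobian matrix: [dphi] is the
    chain rule and [Jsym] the symmetry of second derivatives. *)
Variables (phi : {rmorphism B -> A}) (J K : 'M[A]_n).
Hypotheses (dphi : forall i f, d i (phi f) = \sum_m J i m * phi (d' m f))
  (Jsym : forall i j k, d k (J i j) = d i (J k j)) (JK : J *m K = 1%:M).
Variables (G H : 'M[A]_n) (Gam : 'I_n -> 'M[A]_n).
Hypotheses (GT : G^T = G) (GH : G *m H = 1%:M)
  (tf : forall i j k, Gam i j k = Gam j i k)
  (mc : forall i, Dm d i G = Gam i *m G + G *m (Gam i)^T).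
Variables (G' H' : 'M[B]_n) (Gam' : 'I_n -> 'M[B]_n).
Hypotheses (GH' : G' *m H' = 1%:M)
  (tf' : forall i j k, Gam' i j k = Gam' j i k)
  (mc' : forall i, Dm d' i G' = Gam' i *m G' + G' *m (Gam' i)^T).
Local Notation ph := (map_mx phi).
Hypothesis GJ : G = J *m ph G' *m J^T.

Lemma KJ : K *m J = 1%:M. Proof. exact: mulmx1C. Qed.

Lemma Dm_phi i p q (M : 'M[B]_(p, q)) : Dm d i (ph M) = \sum_m J i m *: ph (Dm d' m M).
Proof.
by apply/matrixP => a b; rewrite !mxE dphi summxE; apply: eq_bigr => m _; rewrite !mxE.
Qed.

Lemma DmJ i j k : Dm d i J j k = Dm d j J i k.
Proof. by rewrite !mxE Jsym. Qed.

(** The transformed symbols satisfy the two conditions that characterize the connection of [G], so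
    [koszul] identifies them with [Gam]. *)
Lemma pull_conn i : Gam i *m J = Dm d i J + \sum_m J i m *: (J *m ph (Gam' m)).
Proof.
pose Ga i := (Dm d i J + \sum_m J i m *: (J *m ph (Gam' m))) *m K.
suff -> : Gam i = Ga i by rewrite /Ga -mulmxA KJ mulmx1.
have GaJ k : Ga k *m J = Dm d k J + \sum_m J k m *: (J *m ph (Gam' m)).
  by rewrite /Ga -mulmxA KJ mulmx1.
apply/esym; apply: (koszul two_reg GT GH tf mc).
- move=> a b c; rewrite !mxE; apply: eq_bigr => k _; congr (_ * _).
  rewrite !mxaddE DmJ !summxE; congr (_ + _).
  under eq_bigr do rewrite mxscaleE mxE mulr_sumr.
  rewrite exchange_big /=; apply: eq_bigr => m _; rewrite mxscaleE mxE mulr_sumr.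
  by apply: eq_bigr => q _; rewrite !mxE tf'; ring.
- move=> k; rewrite GJ (DmM dD dM) (DmM dD dM) DmT Dm_phi.
  have -> : Ga k *m (J *m ph G' *m J^T) = (Ga k *m J) *m ph G' *m J^T by rewrite !mulmxA.
  have -> : J *m ph G' *m J^T *m (Ga k)^T = J *m ph G' *m (Ga k *m J)^T.
    by rewrite [(Ga k *m J)^T]trmx_mul mulmxA.
  rewrite GaJ mulmxDl mulmxDl trDE mulmxDr.
  have -> : J *m (\sum_m J k m *: ph (Dm d' m G')) *m J^T =
     (\sum_m J k m *: (J *m ph (Gam' m))) *m ph G' *m J^T +
     J *m ph G' *m (\sum_m J k m *: (J *m ph (Gam' m)))^T.
    rewrite mulmx_sumr !mulmx_suml raddf_sum mulmx_sumr -big_split /=.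
    apply: eq_bigr => m _; rewrite mc' trZE -!scalemxAr -!scalemxAl -scalerDr.
    have phT : ph (Gam' m)^T = (ph (Gam' m))^T by apply/matrixP => a b; rewrite !mxE.
    by rewrite trmx_mul map_mxD !map_mxM phT mulmxDr mulmxDl !mulmxA.
  by rewrite mulmxDl; apply/matrixP => a b; rewrite !entE; ring.
Qed.

(** Differentiate [pull_conn] and antisymmetrize: the second derivatives of [J] cancel, and what
    remains is tensorial. *)
Lemma pull_curv i j : curv d Gam i j *m J =
  \sum_l \sum_m (J i l * J j m) *: (J *m ph (curv d' Gam' l m)).
Proof.
pose S k := \sum_m J k m *: (J *m ph (Gam' m)).
have DJ k : Dm d k J = Gam k *m J - S k by rewrite pull_conn addrK.
pose T a b := \sum_l \sum_m (J a l * J b m) *: (J *m ph (Dm d' l (Gam' m))).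
pose Q a b := \sum_l \sum_m (J a l * J b m) *: (J *m ph (Gam' l) *m ph (Gam' m)).
have DS a b : Dm d a (S b) = \sum_m d a (J b m) *: (J *m ph (Gam' m))
    + \sum_m J b m *: (Dm d a J *m ph (Gam' m)) + T a b.
  have dsm (I : finType) (F : I -> 'M[A]_n) : Dm d a (\sum_m F m) = \sum_m Dm d a (F m).
    apply/matrixP => x y; rewrite mxE !summxE (dsum dD); apply: eq_bigr => m _.
    by rewrite mxE.
  have dsc c (M : 'M[A]_n) : Dm d a (c *: M) = d a c *: M + c *: Dm d a M.
    by apply/matrixP => x y; rewrite !entE !mxE dM.
  rewrite /S dsm /T exchange_big -!big_split; apply: eq_bigr => m _ /=.
  rewrite dsc (DmM dD dM) Dm_phi scalerDr -!addrA; congr (_ + (_ + _)).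
  rewrite mulmx_sumr scaler_sumr; apply: eq_bigr => l _.
  by rewrite -scalemxAr scalerA mulrC.
have SJ a b : \sum_m J b m *: (Dm d a J *m ph (Gam' m)) = Gam a *m S b - Q a b.
  rewrite /S mulmx_sumr /Q exchange_big -sumrB; apply: eq_bigr => m _ /=.
  rewrite DJ mulmxDl mulNmx scalerBr -scalemxAr mulmxA; congr (_ - _).
  rewrite /S mulmx_suml scaler_sumr; apply: eq_bigr => l _.
  by rewrite -scalemxAl scalerA mulrC.
have sJ : \sum_m d i (J j m) *: (J *m ph (Gam' m)) = \sum_m d j (J i m) *: (J *m ph (Gam' m)).
  by apply: eq_bigr => m _; rewrite Jsym.
have DD : Dm d i (Dm d j J) = Dm d j (Dm d i J) by rewrite DmC.
have E a b : Dm d a (Gam b *m J) = Dm d a (Gam b) *m J + Gam b *m (Gam a *m J - S a).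
  by rewrite (DmM dD dM) DJ.
have RHSE : \sum_l \sum_m (J i l * J j m) *: (J *m ph (curv d' Gam' l m)) =
   T i j - T j i - Q i j + Q j i.
  have sw F : \sum_l \sum_m (J j l * J i m) *: (F l m : 'M[A]_n) = \sum_l \sum_m (J i l * J j m) *: F m l.
    by rewrite exchange_big; apply: eq_bigr => l _; apply: eq_bigr => m _; rewrite mulrC.
  rewrite /T (sw (fun l m => J *m ph (Dm d' l (Gam' m)))) /Q (sw (fun l m => J *m ph (Gam' l) *m ph (Gam' m))).
  rewrite -!sumrB -!big_split /=; apply: eq_bigr => l _.
  rewrite -!sumrB -!big_split /=; apply: eq_bigr => m _.
  rewrite -!scalerBr -scalerDr /curv; congr (_ *: _).
  by rewrite !map_mxD !map_mxN !map_mxM !mulmxDr !mulmxN !mulmxA.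
rewrite RHSE.
have X a b : Dm d a (Dm d b J) = Dm d a (Gam b) *m J + Gam b *m (Gam a *m J - S a) - Dm d a (S b).
  by rewrite [in LHS]DJ (DmB dD) E.
move: DD; rewrite !X !DS !SJ sJ /curv => /matrixP h; apply/matrixP => x y; have := h x y.
rewrite !(mulmxDl, mulNmx, mulmxDr, mulmxN) !mulmxA !entE => h0.
by apply/eqP; rewrite -subr_eq0; apply/eqP; move/eqP: h0; rewrite -subr_eq0 => /eqP h0; rewrite -[RHS]h0; ring.
Qed.

(** A complete contraction: each factor [J] of the curvature meets the inverse [K] contained in the
    inverse metric. *)
Lemma pull_kappa : kappa d H Gam = phi (kappa d' H' Gam').
Proof.
have HE : H = K^T *m ph H' *m K.
  rewrite -[LHS]mulmx1.
  have <- : G *m (K^T *m ph H' *m K) = 1%:M.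
    rewrite GJ !mulmxA -(mulmxA _ J^T) -trmx_mul KJ trmx1 mulmx1 -(mulmxA J) -map_mxM GH'.
    by rewrite map_mx1 mulmx1 JK.
  by rewrite mulmxA (HG GH) mul1mx.
have cE i j : curv d Gam i j = \sum_l \sum_m (J i l * J j m) *: (J *m ph (curv d' Gam' l m) *m K).
  rewrite -[LHS]mulmx1 -JK mulmxA pull_curv mulmx_suml; apply: eq_bigr => l _.
  by rewrite mulmx_suml; apply: eq_bigr => m _; rewrite -scalemxAl.
have TE j p : kapT d Gam j p = \sum_m \sum_q (J j m * J p q) *: (J *m ph (kapT d' Gam' m q) *m J^T).
  apply/matrixP => i k; rewrite mxE !cE.
  transitivity (\sum_l \sum_m \sum_l' \sum_q (J i l * J j m * (J k l' * J p q)) *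
      phi (\tr (curv d' Gam' l m *m curv d' Gam' l' q))).
    rewrite mulmx_suml raddf_sum; apply: eq_bigr => l _ /=.
    rewrite mulmx_suml raddf_sum; apply: eq_bigr => m _ /=.
    rewrite mulmx_sumr raddf_sum; apply: eq_bigr => l' _ /=.
    rewrite mulmx_sumr raddf_sum; apply: eq_bigr => q _ /=.
    rewrite -scalemxAl -scalemxAr scalerA mxtraceZ; congr (_ * _).
    rewrite -!mulmxA (mulmxA K J) KJ mul1mx mxtrace_mulC -!mulmxA KJ mulmx1.
    by rewrite -map_mxM /mxtrace rmorph_sum; apply: eq_bigr => x _; rewrite mxE.
  rewrite summxE exchange_big; apply: eq_bigr => m _ /=.
  rewrite summxE.
  transitivity (\sum_l \sum_q \sum_l' J i l * J j m * (J k l' * J p q) *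
      phi (\tr (curv d' Gam' l m *m curv d' Gam' l' q))).
    by apply: eq_bigr => l _; rewrite exchange_big.
  rewrite exchange_big; apply: eq_bigr => q _ /=.
  rewrite mxscaleE mxE mulr_sumr exchange_big; apply: eq_bigr => l' _ /=.
  rewrite mxE mulr_suml mulr_sumr; apply: eq_bigr => l _; rewrite !mxE.
  ring.
have SE : kapS d H Gam = J *m ph (kapS d' H' Gam') *m J^T.
  apply/matrixP => j p; rewrite mxE TE mulmx_sumr raddf_sum [RHS]mxE.
  under [RHS]eq_bigr do rewrite [(J *m _) _ _]mxE mulr_suml.
  rewrite [RHS]exchange_big; apply: eq_bigr => m _ /=.
  rewrite mulmx_sumr raddf_sum; apply: eq_bigr => q _ /=.
  rewrite -scalemxAr mxtraceZ HE.
  have -> : K^T *m ph H' *m K *m (J *m ph (kapT d' Gam' m q) *m J^T) =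
    K^T *m (ph H' *m (K *m J) *m ph (kapT d' Gam' m q) *m J^T) by rewrite !mulmxA.
  rewrite KJ mulmx1 mxtrace_mulC -(mulmxA _ J^T) -trmx_mul KJ trmx1 mulmx1 -map_mxM.
  have -> : \tr (ph (H' *m kapT d' Gam' m q)) = phi (\tr (H' *m kapT d' Gam' m q)).
    by rewrite /mxtrace rmorph_sum; apply: eq_bigr => x _; rewrite mxE.
  by rewrite ![in RHS]mxE; ring.
rewrite /kappa SE HE rmorphN; congr (- _).
have -> : K^T *m ph H' *m K *m (J *m ph (kapS d' H' Gam') *m J^T) =
    K^T *m (ph H' *m (K *m J) *m ph (kapS d' H' Gam') *m J^T) by rewrite !mulmxA.
rewrite KJ mulmx1 mxtrace_mulC -(mulmxA _ J^T) -trmx_mul KJ trmx1 mulmx1 -map_mxM.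
by rewrite /mxtrace rmorph_sum; apply: eq_bigr => x _; rewrite mxE.
Qed.
End Pullback.

(** * Linear ordinary differential equations with smooth parameters *)

Section RealAux.
Context {R : realType}.
Implicit Types (f df : R -> R) (s t r : R).

Lemma is_derive_continuous f (a : R) s : is_derive s 1 f a -> {for s, continuous f}.
Proof.
move=> [h _]; apply: differentiable_continuous; exact/derivable1_diffP.
Qed.

Lemma is_derive_within f df s t :
  (forall x, s <= x <= t -> is_derive x 1 f (df x)) -> {within `[s, t], continuous f}.
Proof.
move=> h; apply: derivable_within_continuous => x; rewrite in_itv /= => xst.
by have [] := h x xst.
Qed.

Lemma ge0_derive_le f df s t : s <= t ->
  (forall x, s <= x <= t -> is_derive x 1 f (df x)) ->
  (forall x, s <= x <= t -> 0 <= df x) -> f s <= f t.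
Proof.
rewrite le_eqVlt => /predU1P[-> //|st] h p.
have [|c] := @MVT _ f df s t st _ (is_derive_within h).
  by move=> x; rewrite in_itv /= => /andP[x1 x2]; apply: h; rewrite !ltW.
rewrite in_itv /= => /andP[c1 c2] e.
by rewrite -subr_ge0 e mulr_ge0 ?subr_ge0 ?(ltW st) // p // !ltW.
Qed.

Lemma is_derive0_eq f s t : s <= t ->
  (forall x, s <= x <= t -> is_derive x 1 f 0) -> f s = f t.
Proof.
move=> st h; apply/le_anti/andP; split.
  exact: (@ge0_derive_le f (fun=> 0) _ _ st h).
rewrite -lerN2; apply: (@ge0_derive_le (fun x => - f x) (fun=> - 0) _ _ st).
  by move=> x xst; apply: is_deriveN; exact: h.
by move=> x _; rewrite oppr0.
Qed.

Lemma primitive_itv f r : 0 < r -> continuous f ->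
  exists2 F : R -> R, F 0 = 0 & forall s, `|s| < r -> is_derive s 1 F (f s).
Proof.
move=> r0 cf.
pose P (x : R) := (\int[lebesgue_measure]_(t in [set` `[- r, x]]) (f t))%R.
exists (fun x => P x - P 0); first by rewrite subrr.
move=> s; rewrite ltr_norml => /andP[s1 s2].
have int : lebesgue_measure.-integrable `[- r, r] (EFin \o f).
  apply: continuous_compact_integrable; first exact: segment_compact.
  exact: continuous_subspaceT.
have [dP P'] := @continuous_FTC1_closed R f (- r) s r s2 int s1 (cf s).
rewrite -[f s]subr0; apply: is_deriveB.
have e : 'D_1 P s = f s by rewrite -derive1E; exact: P'.
exact: (DeriveDef dP e).
Qed.

Lemma primitive_eq f (F G : R -> R) r : F 0 = 0 -> G 0 = 0 ->
  (forall s, `|s| < r -> is_derive s 1 F (f s)) ->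
  (forall s, `|s| < r -> is_derive s 1 G (f s)) -> forall s, `|s| < r -> F s = G s.
Proof.
move=> F0 G0 dF dG s sr.
suff : F s - G s = F 0 - G 0 by rewrite F0 G0 subrr => /eqP; rewrite subr_eq0 => /eqP.
have D (x : R) : `|x| < r -> is_derive x 1 (fun y => F y - G y) 0.
  by move=> xr; rewrite -(subrr (f x)); apply: is_deriveB; [exact: dF|exact: dG].
move: sr; rewrite ltr_norml => /andP[s1 s2].
have [s0|s0] := leP 0 s.
  apply/esym/(@is_derive0_eq (fun y => F y - G y) 0 s s0) => x /andP[x0 xs]; apply: D.
  by rewrite ger0_norm // (le_lt_trans xs).
apply: (@is_derive0_eq (fun y => F y - G y) s 0 (ltW s0)) => x /andP[x0 xs]; apply: D.
by rewrite ler0_norm //; lra.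
Qed.

Lemma primitive f : continuous f ->
  exists2 F : R -> R, F 0 = 0 & forall s, is_derive s 1 F (f s).
Proof.
move=> cf.
have /choice [F hF] : forall k : nat, exists F : R -> R,
    F 0 = 0 /\ forall s, `|s| < k.+1%:R -> is_derive s 1 F (f s).
  by move=> k; have [F F0 dF] := @primitive_itv f k.+1%:R (ltr0Sn _ _) cf; exists F.
(* The index of an interval that contains x in its interior; primitives over two such intervals
   agree because both vanish at 0. *)
pose N (x : R) := (Num.truncn `|x|).+1.
have FF k l x : `|x| < k.+1%:R -> `|x| < l.+1%:R -> F k x = F l x.
  move=> xk xl.
  wlog kl : k l xk xl / (k <= l)%N.
    move=> H; have [kl|/ltnW lk] := leqP k l; first exact: H.
    by apply/esym; exact: H.
  have [Fk0 dFk] := hF k; have [Fl0 dFl] := hF l.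
  apply: (@primitive_eq f _ _ k.+1%:R Fk0 Fl0 dFk _ _ xk).
  move=> s sk; apply: dFl; apply: lt_le_trans sk _.
  by rewrite ler_nat.
exists (fun x => F (N x) x); first by have [] := hF (N 0).
move=> s; have sN : `|s| < (N s).+1%:R.
  by rewrite (lt_trans (truncnS_gt _)) // ltr_nat.
have [_ /(_ s sN) d] := hF (N s).
apply: near_eq_is_derive d.
have : \forall y \near s, `|y| < (N s).+1%:R.
  have c : {for s, continuous (fun y : R => `|y|)} by exact: norm_continuous.
  by apply: (c [set z | z < (N s).+1%:R]); apply: open_nbhs_nbhs; split => //; exact: open_lt.
apply: filterS => y yN; apply: FF => //.
by rewrite (lt_trans (truncnS_gt _)) // ltr_nat.
Qed.

(** Nested intervals centred at [u k]. The explicit rate is what makes the pointwise limits of the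
    Picard iteration continuous. *)
Lemma geometric_limit (u : nat -> R) c :
  (forall k, `|u k.+1 - u k| <= c * 2^-1 ^+ k) ->
  exists l, forall k, `|l - u k| <= 2 * c * 2^-1 ^+ k.
Proof.
move=> h.
pose e k : R := 2^-1 ^+ k.
have eS k : e k.+1 = e k / 2 by rewrite /e exprS mulrC.
have e0 k : 0 <= e k by rewrite exprn_ge0 // invr_ge0 // ler0n.
have c0 : 0 <= c by have := h 0%N; rewrite expr0 mulr1; apply: le_trans.
pose v k := u k - 2 * c * e k; pose w k := u k + 2 * c * e k.
have vS k : v k <= v k.+1.
  by have := h k; rewrite ler_norml /v eS -/(e k) => /andP[h1 _]; lra.
have wS k : w k.+1 <= w k.
  by have := h k; rewrite ler_norml /w eS -/(e k) => /andP[_ h1]; lra.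
have vm k l : (k <= l)%N -> v k <= v l.
  by move=> /subnK <-; elim: (l - k)%N => // i; rewrite addSn => /le_trans; apply.
have wm k l : (k <= l)%N -> w l <= w k.
  by move=> /subnK <-; elim: (l - k)%N => // i IH; rewrite addSn (le_trans _ IH).
have vw k : v k <= w k.
  by rewrite /v /w lerD2l ge0_cp // ?mulr_ge0.
have vwkl k l : v k <= w l.
  apply: (@le_trans _ _ (v (maxn k l))); first by rewrite vm // leq_maxl.
  by rewrite (le_trans (vw _)) // wm // leq_maxr.
exists (sup (range v)) => k.
have hs : has_sup (range v).
  split; first by exists (v 0%N); exists 0%N.
  by exists (w 0%N) => _ [l _ <-].
have l1 : v k <= sup (range v) by apply: ub_le_sup; [by case: hs|exists k].
have l2 : sup (range v) <= w k by apply: ge_sup; [by case: hs|move=> _ [l _ <-]].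
by rewrite ler_norml; move: l1 l2; rewrite /v /w -/(e k); lra.
Qed.

(* Picard iteration is a contraction for the norm [sup |f s| / expw l s], [l]
   large, hence converges on the whole line. *)
Definition expw (l s : R) := expR (l * s) + expR (- (l * s)).

Lemma expw_gt1 l s : 1 <= expw l s.
Proof.
rewrite /expw; have [h|h] := leP 0 (l * s).
  have := expR_ge1Dx (l * s); have := expR_ge0 (- (l * s)); lra.
have := expR_ge1Dx (- (l * s)); have := expR_ge0 (l * s); lra.
Qed.

Lemma is_derive_mull (a x : R) : is_derive x 1 (fun s : R => a * s) a.
Proof.
have := @is_deriveZ R R^o R^o id a x 1 1 (is_derive_id _ _).
by rewrite /GRing.scale /= mulr1.
Qed.

Lemma is_derive_expM (a x : R) : is_derive x 1 (fun s => expR (a * s)) (a * expR (a * x)).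
Proof. by rewrite mulrC; exact: (is_derive1_comp (is_derive_expR _) (is_derive_mull a x)). Qed.

(** Integration against this weight gains a factor 1 / l: the primitive of [expw l] vanishing at 0
    is (e^{ls} - e^{-ls}) / l, bounded by [expw l s] / l on both sides of 0. *)
Lemma expw_bound f df (l c s : R) : 0 < l -> f 0 = 0 ->
  (forall t, `|t| <= `|s| -> is_derive t 1 f (df t)) ->
  (forall t, `|t| <= `|s| -> `|df t| <= c * expw l t) -> `|f s| <= c / l * expw l s.
Proof.
move=> l0 f0 D b.
have c0 : 0 <= c.
  have := b s (lexx _); have := expw_gt1 l s => e1 e2.
  have : 0 <= c * expw l s by exact: le_trans e2.
  by rewrite pmulr_lge0 // (lt_le_trans ltr01).
pose chi s := c / l * (expR (l * s) - expR (- l * s)).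
have dchi (x : R) : is_derive x 1 chi (c * expw l x).
  have h := is_deriveB (is_derive_expM l x) (is_derive_expM (- l) x).
  have := @is_deriveZ R R^o R^o _ (c / l) x 1 _ h.
  rewrite /GRing.scale /= /expw !mulNr opprK -mulrDr mulrA divfK ?gt_eqF //.
have mono (e : R) a d : `|e| = 1 -> a <= d -> (forall x, a <= x <= d -> `|x| <= `|s|) ->
    chi a - e * f a <= chi d - e * f d.
  move=> e1 ad ads; apply: (@ge0_derive_le (fun x => chi x - e * f x) (fun x => c * expw l x - e * df x) a d ad).
    move=> x /ads xs; apply: is_deriveB; exact: (@is_deriveZ R R^o R^o _ e x 1 _ (D x xs)).
  move=> x /ads /b h; rewrite subr_ge0; apply: le_trans h.
  by apply: le_trans (ler_norm _) _; rewrite normrM e1 mul1r.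
have chi0 : chi 0 = 0 by rewrite /chi !mulr0 subrr mulr0.
have cl : 0 <= c / l by rewrite divr_ge0 // ltW.
have p1 := expR_ge0 (l * s); have p2 := expR_ge0 (- (l * s)).
have chis : `|chi s| <= c / l * expw l s.
  rewrite /chi normrM (ger0_norm cl) ler_wpM2l // ler_norml /expw mulNr; lra.
have n1 : `|-1 : R| = 1 by rewrite normrN normr1.
move: chis; rewrite !ler_norml; have [s0|s0] := leP 0 s.
  have ads x : 0 <= x <= s -> `|x| <= `|s| by move=> /andP[h1 h2]; rewrite !ger0_norm.
  by have := mono 1 _ _ (normr1 _) s0 ads; have := mono (-1) _ _ n1 s0 ads; rewrite chi0 f0; lra.
have ads x : s <= x <= 0 -> `|x| <= `|s| by move=> /andP[h1 h2]; rewrite !ler0_norm ?lerN2 // ltW.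
by have := mono 1 _ _ (normr1 _) (ltW s0) ads; have := mono (-1) _ _ n1 (ltW s0) ads; rewrite chi0 f0; lra.
Qed.
End RealAux.

Section LinearODE.
Context {R : realType}.
Variable (I : finType).
Implicit Types (B : I -> I -> R -> R) (z dz : I -> R -> R).

Lemma continuous_sumR (J : finType) (T : topologicalType) (f : J -> T -> R) x :
  (forall a, {for x, continuous (f a)}) -> {for x, continuous (fun t => \sum_a f a t)}.
Proof. by move=> h; apply: (cvg_big _) => [|a _]; [exact: add_continuous|exact: h]. Qed.

Lemma sum_bound (J : finType) (f : J -> R) c : (forall a, `|f a| <= c) ->
  `|\sum_a f a| <= #|J|%:R * c.
Proof.
move=> h; apply: (le_trans (ler_norm_sum _ _ _)).
apply: (le_trans (ler_sum _ (fun a _ => h a))).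
by rewrite sumr_const mulr_natl.
Qed.

Lemma sqr_sum_le (J : finType) (f : J -> R) :
  (\sum_a f a) ^+ 2 <= #|J|%:R * \sum_a f a ^+ 2.
Proof.
set Q := \sum_a f a ^+ 2.
have e : \sum_a \sum_b (f a ^+ 2 + f b ^+ 2) = Q *+ #|J| + Q *+ #|J|.
  under eq_bigr do rewrite big_split /= sumr_const.
  by rewrite big_split /= sumr_const -sumrMnl.
have h : 2 * (\sum_a f a) ^+ 2 <= Q *+ #|J| + Q *+ #|J|.
  rewrite -e expr2 mulr_suml mulr_sumr; apply: ler_sum => a _.
  rewrite mulr_sumr mulr_sumr; apply: ler_sum => b _.
  by have := sqr_ge0 (f a - f b); nra.
by move: h; rewrite -[Q *+ _]mulr_natl; lra.
Qed.

Lemma linear_ode B (K : R) (z0 : I -> R) : (forall a b, continuous (B a b)) ->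
  (forall (a b : I) (s : R), `|B a b s| <= K) ->
  exists z : I -> R -> R, (forall a, z a 0 = z0 a) /\
    forall (a : I) (s : R), is_derive s 1 (z a) (\sum_b B a b s * z b s).
Proof.
move=> cB bB.
(* A primitive is attached to every function at once; the value at a discontinuous one is
   arbitrary. *)
have /choice [prim hprim] : forall f : R -> R, exists F : R -> R,
    continuous f -> F 0 = 0 /\ forall s : R, is_derive s 1 F (f s).
  move=> f; have [cf|ncf] := pselect (continuous f); last by exists f.
  by have [F F0 dF] := primitive cf; exists F.
have primE f : continuous f -> prim f 0 = 0 by move=> /hprim [].
have primD (f : R -> R) (s : R) : continuous f -> is_derive s 1 (prim f) (f s) by move=> /hprim [].
pose N : R := #|I|%:R.
have [/eqP I0|I1] := boolP (#|I| == 0%N).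
  exists (fun a _ => z0 a); split => // a s.
  by have := card0_eq I0 a; rewrite inE.
have K0 : 0 <= K.
  move: I1; rewrite -lt0n => /card_gt0P [a _]; exact: le_trans (bB a a 0).
(* Then N K / l <= 1 / 2, so the Picard map halves weighted distances, and l >= 1 serves for the
   first step. *)
pose l := 2 * (N * K) + 1.
have NK0 : 0 <= N * K by rewrite mulr_ge0 // ler0n.
have l0 : 0 < l by rewrite /l; lra.
have l1 : 1 <= l by rewrite /l; lra.
pose rhs (y : I -> R -> R) a s := \sum_b B a b s * y b s.
have crhs y a : (forall b, continuous (y b)) -> continuous (rhs y a).
  by move=> cy s; apply: continuous_sumR => b; apply: cvgM; [exact: cB|exact: cy].
pose step (y : I -> R -> R) a s := z0 a + prim (rhs y a) s.
have dstep y a (s : R) : (forall b, continuous (y b)) -> is_derive s 1 (step y a) (rhs y a s).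
  move=> cy; rewrite -[rhs y a s]add0r; apply: is_deriveD; apply: primD; exact: crhs.
have cstep y a : (forall b, continuous (y b)) -> continuous (step y a).
  by move=> cy s; exact: is_derive_continuous (dstep y a s cy).
pose Z k := iter k step (fun a _ => z0 a).
have cZ k a : continuous (Z k a).
  elim: k a => [|k IH] a; first by move=> s; exact: cvg_cst.
  exact: cstep.
have rhs_bound y y' a s c : (forall b, `|y b s - y' b s| <= c) -> `|rhs y a s - rhs y' a s| <= N * (K * c).
  move=> h; rewrite /rhs -sumrB; apply: sum_bound => b.
  by rewrite -mulrBr normrM ler_pM.
have step_bound y y' c : (forall b, continuous (y b)) -> (forall b, continuous (y' b)) ->
    (forall (b : I) (s : R), `|y b s - y' b s| <= c * expw l s) ->
    forall (a : I) (s : R), `|step y a s - step y' a s| <= c / 2 * expw l s.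
  move=> cy cy' h a s.
  have c0 : 0 <= c.
    have := h a 0; have := expw_gt1 l 0 => e1 e2.
    have : 0 <= c * expw l 0 by exact: le_trans e2.
    by rewrite pmulr_lge0 // (lt_le_trans ltr01).
  have e0 t : 0 <= expw l t by apply: le_trans (expw_gt1 _ _).
  apply: (@le_trans _ _ ((N * K * c) / l * expw l s)).
    apply: (@expw_bound R (fun s => step y a s - step y' a s) (fun s => rhs y a s - rhs y' a s)) => //.
    - by rewrite /step !primE ?subrr //; exact: crhs.
    - by move=> t _; apply: is_deriveB; exact: dstep.
    - by move=> t _; rewrite -!mulrA; apply: rhs_bound => b; exact: h.
  rewrite ler_wpM2r // ler_pdivrMr //.
  have -> : c / 2 * l = N * K * c + c / 2 by rewrite /l; field.
  by rewrite lerDl divr_ge0.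
have [c c0 hc] : exists2 c, 0 <= c & forall (a : I) (s : R), `|Z 1%N a s - Z 0%N a s| <= c * expw l s.
  pose c := N * (K * \sum_b `|z0 b|).
  have c0 : 0 <= c by rewrite !mulr_ge0 // ?ler0n // sumr_ge0.
  exists c => // a s; apply: (@le_trans _ _ (c / l * expw l s)).
    apply: (@expw_bound R (fun s => Z 1%N a s - Z 0%N a s) (rhs (Z 0%N) a)) => //.
    - by rewrite /= /step primE ?addr0 ?subrr //; apply: crhs => b; exact: (cZ 0%N b).
    - move=> t _; rewrite -[rhs _ a t]subr0; apply: is_deriveB; first exact: (dstep (Z 0%N)).
    - move=> t _; apply: (@le_trans _ _ (c * 1)); last by rewrite ler_wpM2l // expw_gt1.
      rewrite mulr1 /c; apply: sum_bound => b; rewrite normrM ler_pM //.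
      by rewrite (bigD1 b) //= lerDl sumr_ge0.
  rewrite ler_wpM2r //; first by apply: le_trans (expw_gt1 _ _).
  by rewrite ler_pdivrMr // ler_peMr.
have hZ k a s : `|Z k.+1 a s - Z k a s| <= c * expw l s * 2^-1 ^+ k.
  rewrite mulrAC; elim: k a s => [|k IH] a s; first by rewrite expr0 mulr1; exact: hc.
  have := step_bound (Z k.+1) (Z k) _ (cZ _) (cZ _) IH a s.
  by rewrite exprSr mulrA.
have /choice [z hz] : forall a, exists f : R -> R, forall s k, `|f s - Z k a s| <= 2 * (c * expw l s) * 2^-1 ^+ k.
  move=> a.
  have /choice [f hf] : forall s, exists y : R, forall k, `|y - Z k a s| <= 2 * (c * expw l s) * 2^-1 ^+ k.
    by move=> s; apply: geometric_limit => k; exact: hZ.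
  by exists f.
have small (e C : R) : 0 < e -> exists k, C * 2^-1 ^+ k < e.
  move=> e0; have : (fun k => C * 2^-1 ^+ k) @ \oo --> C * 0.
    apply: cvgM; first exact: cvg_cst.
    by apply: cvg_expr; rewrite ger0_norm ?invr_ge0 ?ler0n // invf_lt1 ?ltr1n.
  rewrite mulr0 => /cvgrPdist_lt /(_ e e0) [k _ /(_ k (leqnn k))] /=.
  rewrite sub0r normrN => h; exists k; exact: le_lt_trans (ler_norm _) h.
have cz a : continuous (z a).
  move=> s; apply/cvgrPdist_lt => e e0.
  have ce : {for s, continuous (expw l)}.
    have -> : expw l = (fun s => expR (l * s)) \+ (fun s => expR (- l * s)).
      by apply/funext => t; rewrite /expw /= mulNr.
    by apply: continuousD; exact: is_derive_continuous (is_derive_expM _ _).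
  have [k hk] := small (e / 3) (2 * `|c| * (expw l s + 1)) ltac:(by rewrite divr_gt0).
  have bz (t : R) : expw l t <= expw l s + 1 -> `|z a t - Z k a t| < e / 3.
    move=> ht; apply: le_lt_trans hk; apply: (le_trans (hz a t k)).
    rewrite ler_wpM2r ?exprn_ge0 ?invr_ge0 ?ler0n // mulrA ler_pM //.
    - by rewrite mulr_ge0.
    - by apply: le_trans (expw_gt1 _ _).
    - by rewrite ler_wpM2l // ler_norm.
  have n1 : \forall t \near s, expw l t < expw l s + 1.
    by apply: (ce [set y | y < expw l s + 1]); apply: open_nbhs_nbhs; split; [exact: open_lt|rewrite /= ltrDl].
  have n2 : \forall t \near s, `|Z k a s - Z k a t| < e / 3.
    by have /cvgrPdist_lt := cZ k a s; apply; rewrite divr_gt0.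
  near=> t.
  have h1 : `|z a s - Z k a s| < e / 3 by apply: bz; rewrite lerDl.
  have h2 : `|z a t - Z k a t| < e / 3 by apply: bz; apply: ltW; near: t.
  have h3 : `|Z k a s - Z k a t| < e / 3 by near: t.
  move: h1 h2 h3; rewrite !ltr_norml => /andP[? ?] /andP[? ?] /andP[? ?]; apply/andP; split; lra.
(* Both z and its Picard image are within C 2^{-k} of the iterate of index k + 1, for every k. *)
have zE a s : z a s = step z a s.
  apply/eqP; rewrite -subr_eq0 -normr_le0; apply/ler_addgt0Pl => e e0; rewrite addr0.
  have [k hk] := small e (2 * (2 * c * expw l s)) e0.
  have h1 : `|z a s - Z k.+1 a s| <= 2 * c * expw l s * 2^-1 ^+ k.+1.
    by rewrite -!mulrA [c * (_ * _)]mulrA !mulrA -(mulrA 2); exact: hz.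
  have h2 : `|step z a s - step (Z k) a s| <= 2 * c * 2^-1 ^+ k / 2 * expw l s.
    apply: step_bound => // b t; apply: (le_trans (hz b t k)).
    by rewrite -!mulrA [expw _ _ * _]mulrC.
  have h3 : 2 * c * 2^-1 ^+ k / 2 * expw l s = c * expw l s * 2^-1 ^+ k by field.
  have h4 : 2 * c * expw l s * 2^-1 ^+ k.+1 = c * expw l s * 2^-1 ^+ k.
    by rewrite exprS; field.
  rewrite h3 in h2; rewrite h4 in h1.
  have h5 : z a s - step z a s = (z a s - Z k.+1 a s) - (step z a s - step (Z k) a s).
    by rewrite /= opprB addrA subrK.
  rewrite h5; apply: (le_trans (ler_normB _ _)).
  by move: h1 h2 hk; rewrite -!mulrA; lra.
exists z; split => [a|a s]; first by rewrite zE /step primE ?addr0 //; exact: crhs.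
have -> : z a = step z a by apply/funext => t; exact: zE.
exact: dstep.
Unshelve. all: by end_near. Qed.

(** The constant precedes the functions and the bounds [delta], [eta]. Applied to increments of
    solutions, data of order |t| give Lipschitz dependence on parameters, and data of order t^2 give
    differentiability. *)
Lemma gronwall (r K : R) : 0 <= K -> exists2 C : R, 0 <= C & forall z dz (delta eta : R),
  0 <= delta -> 0 <= eta ->
  (forall (a : I) (s : R), `|s| < r -> is_derive s 1 (z a) (dz a s)) ->
  (forall (a : I) (s : R), `|s| < r -> `|dz a s| <= K * (\sum_b `|z b s|) + eta) ->
  (forall a, `|z a 0| <= delta) ->
  forall (a : I) (s : R), `|s| < r -> `|z a s| <= C * (delta + eta).
Proof.
move=> K0; pose N : R := #|I|%:R; pose l := 2 * (N * K) + 1.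
have NK0 : 0 <= N * K by rewrite mulr_ge0 // ler0n.
have l0 : 0 < l by rewrite /l; lra.
exists (2 * (2 * expR (l * r))); first by rewrite !mulr_ge0 // expR_ge0.
move=> z dz delta eta d0 e0 D b i0 a s sr.
have sub (t : R) : `|t| <= `|s| -> `|t| < r by move=> /le_lt_trans; apply.
have w0 t : 0 < expw l t by apply: lt_le_trans (expw_gt1 _ _).
have /choice [M0 hM0] : forall c, exists y : R, forall t : R, `|t| <= `|s| -> `|z c t| <= y.
  move=> c; have [||t _ ht] := @EVT_max R (fun t => `|z c t|) (- `|s|) `|s|.
  - by rewrite ge0_cp.
  - move=> t; apply: (@continuous_comp _ _ _ (from_subspace _ (z c)) (fun t : R => `|t|)); last exact: norm_continuous.
    by apply: is_derive_within => x xs; apply: D; apply: sub; rewrite ler_norml.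
  by exists `|z c t| => x xs; apply: ht; rewrite in_itv /= -ler_norml.
pose X := [set x | exists c t, `|t| <= `|s| /\ x = `|z c t| / expw l t].
have Xs : has_sup X.
  split; first by exists (`|z a s| / expw l s), a, s.
  exists (\sum_c M0 c) => _ [c [t [ts ->]]].
  have h c' : 0 <= M0 c' by apply: le_trans (hM0 c' t ts).
  rewrite ler_pdivrMr //; apply: (le_trans (hM0 c t ts)).
  apply: (@le_trans _ _ (\sum_c M0 c * 1)); last by rewrite -mulr_suml ler_wpM2l ?expw_gt1 // sumr_ge0.
  by rewrite -mulr_suml mulr1 (bigD1 c) //= lerDl sumr_ge0.
have zM c t : `|t| <= `|s| -> `|z c t| <= sup X * expw l t.
  by move=> ts; rewrite -ler_pdivrMr //; apply: sup_upper_bound => //; exists c, t.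
set M := sup X in zM.
(* [M] is the supremum of |z| / [expw l]; since l = 2 N K + 1 the term N K M / l on the right can be
   absorbed. *)
have hM : M <= delta + (N * (K * M) + eta) / l.
  apply: ge_sup; first by case: Xs.
  move=> _ [c [t [ts ->]]]; rewrite ler_pdivrMr // mulrDl.
  have := @expw_bound R (fun t => z c t - z c 0) (fun t => dz c t - 0) l (N * (K * M) + eta) t l0 (subrr _).
  have tt (x : R) : `|x| <= `|t| -> `|x| <= `|s| by move=> /le_trans; apply.
  move=> /(_ (fun x xt => is_deriveB (D c x (sub x (tt x xt))) (is_derive_cst _ _ _))) h.
  rewrite -[z c t](subrK (z c 0)) addrC; apply: (le_trans (ler_normD _ _)); apply: lerD.
    by rewrite (le_trans (i0 c)) // ler_peMr // expw_gt1.
  apply: h => x xt; rewrite subr0; apply: (le_trans (b c x (sub x (tt x xt)))).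
  rewrite mulrDl; apply: lerD; last by rewrite ler_peMr // expw_gt1.
  have -> : N * (K * M) * expw l x = K * (N * (M * expw l x)) by ring.
  rewrite ler_wpM2l // /N mulr_natl -sumr_const; apply: ler_sum => c' _.
  by apply: zM; exact: tt.
have M2 : M <= 2 * (delta + eta).
  have : M * l <= (delta + (N * (K * M) + eta) / l) * l by rewrite ler_wpM2r // ltW.
  rewrite mulrDl divfK ?gt_eqF // mulrA /l; move: (N * K) NK0 => k k0 h.
  have : 0 <= k * (delta + eta) by rewrite mulr_ge0 // addr_ge0.
  have : 0 <= k * eta by rewrite mulr_ge0.
  nra.
apply: (le_trans (zM a s (lexx _))).
have ws : expw l s <= 2 * expR (l * r).
  have := ltW sr; rewrite ler_norml => /andP[s1 s2].
  have h1 : expR (l * s) <= expR (l * r) by rewrite ler_expR ler_wpM2l // ltW.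
  have h2 : expR (- (l * s)) <= expR (l * r) by rewrite ler_expR -mulrN ler_wpM2l ?(ltW l0) //; lra.
  by rewrite /expw; lra.
rewrite [leRHS](_ : _ = 2 * (delta + eta) * (2 * expR (l * r))); last by ring.
apply: (le_trans (ler_wpM2r (ltW (w0 s)) M2)).
by rewrite ler_wpM2l // mulr_ge0 // addr_ge0.
Qed.
End LinearODE.

(** * Cubes and estimates along coordinate directions *)

Section Cube.
Context {R : realType} {n : nat}.
Implicit Types (c x y : 'rV[R]_n) (r : R).

(** Cubes are used because they are products: every line in a coordinate direction through a cube
    meets it in an interval of the same length, as wanted by equations along lines and by estimates
    one coordinate at a time. *)
Definition cube c r : set 'rV[R]_n := [set x | forall i, `|x 0 i - c 0 i| < r].
Definition ccube c r : set 'rV[R]_n := [set x | forall i, `|x 0 i - c 0 i| <= r].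

Lemma coord_le_norm (w : 'rV[R]_n) (i : 'I_n) : `|w 0 i| <= `|w|.
Proof.
by rewrite [leRHS]/Num.norm /= mx_normrE; apply: (le_bigmax _ (fun ij : 'I_1 * 'I_n => `|w ij.1 ij.2|) (0, i)).
Qed.

Lemma norm_le_coord (w : 'rV[R]_n) (a : R) : 0 <= a -> (forall i, `|w 0 i| <= a) -> `|w| <= a.
Proof.
move=> a0 hw; rewrite [leLHS]/Num.norm /= mx_normrE; apply/bigmax_leP; split => // -[i j] _ /=.
by rewrite ord1.
Qed.

Lemma open_cube c r : open (cube c r).
Proof.
rewrite openE => x cx; rewrite /interior /cube.
apply: (@filter_forall _ _ (fun i (y : 'rV[R]_n) => `|y 0 i - c 0 i| < r) (nbhs x) _) => i.
have h : {for x, continuous (fun y : 'rV[R]_n => `|y 0 i - c 0 i|)}.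
  apply: (@continuous_comp _ _ _ (fun y : 'rV[R]_n => y 0 i - c 0 i) (fun t : R => `|t|)).
    by apply: continuousB; [exact: continuous_coord|exact: cst_continuous].
  exact: norm_continuous.
by apply: (h [set z | z < r]); apply: open_nbhs_nbhs; split; [exact: open_lt|exact: cx].
Qed.

Lemma cubeW c r : cube c r `<=` ccube c r.
Proof. by move=> x h i; exact: ltW. Qed.

Lemma compact_ccube c r : compact (ccube c r).
Proof.
apply: bounded_closed_compact.
  exists (`|c| + `|r|); split; first exact: num_real.
  move=> M hM x cx /=; apply: ltW; apply: le_lt_trans hM.
  apply: norm_le_coord => [|i]; first by rewrite addr_ge0.
  rewrite -(subrK (c 0 i) (x 0 i)) addrC; apply: (le_trans (ler_normD _ _)).
  by rewrite lerD ?coord_le_norm // (le_trans (cx i)) // ler_norm.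
have -> : ccube c r = \bigcap_(i in [set: 'I_n]) [set x | `|x 0 i - c 0 i| <= r].
  by apply/seteqP; split => x h i; [move=> _; exact: h|exact: (h i Logic.I)].
apply: closed_bigI => i _.
apply: (@closed_comp _ _ (fun x : 'rV[R]_n => `|x 0 i - c 0 i|) [set z | z <= r]); last exact: closed_le.
move=> x _; apply: (@continuous_comp _ _ _ (fun y : 'rV[R]_n => y 0 i - c 0 i) (fun t : R => `|t|)).
  by apply: continuousB; [exact: continuous_coord|exact: cst_continuous].
exact: norm_continuous.
Qed.

Lemma within_compact_bounded (K : set 'rV[R]_n) (f : 'rV[R]_n -> R) : compact K ->
  {within K, continuous f} -> exists2 C : R, 0 <= C & forall x, K x -> `|f x| <= C.
Proof.
move=> cK cf; have [K0|K0] := eqVneq K set0.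
  by exists 0 => // x; rewrite K0.
have [||x _ hx] := @EVT_max_rV R n (fun x => `|f x|) K _ cK.
- exact/set0P.
- move=> x; apply: (@continuous_comp _ _ _ (from_subspace K f) (fun t : R => `|t|)); first exact: cf.
  exact: norm_continuous.
by exists `|f x| => // y Ky; apply: hx; rewrite inE.
Qed.

Lemma smooth_bounded (J : finType) (U : set 'rV[R]_n) (f : J -> 'rV[R]_n -> R) c r :
  (forall j, smooth_open U (f j)) -> ccube c r `<=` U ->
  exists2 C : R, 0 <= C & forall j x, ccube c r x -> `|f j x| <= C.
Proof.
move=> sf cU; have /choice [C hC] : forall j, exists C : R, forall x, ccube c r x -> `|f j x| <= C.
  move=> j; have [|C _ hC] := within_compact_bounded (f := f j) (@compact_ccube c r); last by exists C.
  apply: continuous_in_subspaceT => x; rewrite inE => /cU Ux.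
  exact/differentiable_continuous/(smooth_diff (sf j)).
exists (\sum_j `|C j|) => [|j x cx]; first exact: sumr_ge0.
rewrite (le_trans (hC j x cx)) // (le_trans (ler_norm _)) // (bigD1 j) //= lerDl; exact: sumr_ge0.
Qed.

Lemma cube_center x (e : R) : 0 < e -> cube x e x.
Proof. by move=> e0 i; rewrite subrr normr0. Qed.

Lemma nbhs_cube x (P : set 'rV[R]_n) : nbhs x P -> exists2 e : R, 0 < e & cube x e `<=` P.
Proof.
move=> /nbhs_ballP [e /= e0 he]; exists (e / 2) => [|y hy]; first by rewrite divr_gt0.
apply: he; rewrite -ball_normE /ball_ /= distrC.
apply: (@le_lt_trans _ _ (e / 2)); last by lra.
apply: norm_le_coord => [|i]; first by rewrite divr_ge0 // ltW.
by rewrite !mxE ltW.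
Qed.

Lemma cube_nbhs x (e : R) : 0 < e -> nbhs x (cube x e).
Proof. by move=> e0; apply: open_nbhs_nbhs; split; [exact: open_cube|exact: cube_center]. Qed.

Lemma cube_convex c r x y (t : R) : cube c r x -> cube c r y -> 0 <= t <= 1 -> cube c r (x + t *: (y - x)).
Proof.
move=> cx cy /andP[t0 t1] i; rewrite !mxE.
have -> : x 0 i + t * (y 0 i - x 0 i) - c 0 i = (1 - t) * (x 0 i - c 0 i) + t * (y 0 i - c 0 i) by ring.
apply: (le_lt_trans (ler_normD _ _)); rewrite !normrM (ger0_norm t0) (@ger0_norm _ (1 - t)) ?subr_ge0 //.
have := cx i; have := cy i; move: (`|x 0 i - _|) (`|y 0 i - _|) => p q; case: (leP p q); nra.
Qed.

Lemma cube_along c r x j (t s : R) : cube c r x -> cube c r (x + t *: 'e_j) -> 0 <= s <= 1 ->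
  cube c r (x + s *: (t *: 'e_j)).
Proof. by move=> Qx Qt s01; have := cube_convex Qx Qt s01; rewrite addrAC subrr add0r. Qed.

Lemma cube_lipschitz c r (f : 'rV[R]_n -> R) (C : R) x y : 0 <= C ->
  (forall z j (t : R), cube c r z -> cube c r (z + t *: 'e_j) -> `|f (z + t *: 'e_j) - f z| <= C * `|t|) ->
  cube c r x -> cube c r y -> `|f y - f x| <= C * n%:R * `|y - x|.
Proof.
move=> C0 hC Qx Qy; pose h := y - x.
(* The path from [x] to [y] that changes one coordinate at a time: the first [m] coordinates are
   already those of [y]. *)
pose hm (m : nat) : 'rV[R]_n := x + \row_(i < n) (if (i < m)%N then h 0 i else 0).
have Qm m : cube c r (hm m).
  move=> i; rewrite !mxE; case: ifP => _; last by rewrite addr0; exact: Qx.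
  by rewrite addrC subrK; exact: Qy.
have hS (m : 'I_n) : hm m.+1 = hm m + h 0 m *: 'e_m.
  rewrite /hm -addrA; congr (x + _); apply/rowP => i; rewrite !mxE eqxx /= ltnS leq_eqVlt.
  have [->|im] := eqVneq i m; first by rewrite eqxx ltnn /= mulr1 add0r.
  by rewrite -val_eqE /= in im; rewrite (negPf im) /= mulr0 addr0.
have h0 : hm 0%N = x by apply/rowP => i; rewrite !mxE addr0.
have hN : hm n = y by apply/rowP => i; rewrite !mxE ltn_ord addrC subrK.
have -> : f y - f x = \sum_(m < n) (f (hm m.+1) - f (hm m)).
  by rewrite -(big_mkord xpredT (fun m => f (hm m.+1) - f (hm m))) telescope_sumr // h0 hN.
apply: (le_trans (ler_norm_sum _ _ _)).
have -> : C * n%:R * `|y - x| = \sum_(m < n) C * `|h|.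
  by rewrite sumr_const card_ord -mulr_natl /h; ring.
apply: ler_sum => m _; rewrite hS; apply: le_trans (hC _ _ _ _ _) _ => //; first by rewrite -hS.
by rewrite ler_wpM2l // coord_le_norm.
Qed.

End Cube.

Section LineDerivative.
Context {R : realType} {n : nat}.
Implicit Types (f : 'rV[R]_n -> R) (x y v : 'rV[R]_n).

Lemma is_derive_lineP f y v (s l : R) :
  is_derive s 1 (fun t : R => f (y + t *: v)) l <-> is_derive (y + s *: v) v f l.
Proof.
have E : (fun h : R => h^-1 *: (((fun t : R => f (y + t *: v)) \o shift s) (h *: 1) - f (y + s *: v)))
   = (fun h : R => h^-1 *: ((f \o shift (y + s *: v)) (h *: v) - f (y + s *: v))).
  apply/funext => h; congr (_ *: (_ - _)); rewrite /shift /=; congr f.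
  by rewrite [h *: 1]mulr1 scalerDl addrCA addrC.
split=> -[d e]; apply: DeriveDef; rewrite -?e /derivable /derive.
- by rewrite -E.
- by rewrite -E.
- by rewrite E.
- by rewrite E.
Qed.

Lemma quad_is_derive f x v (l C r : R) : 0 < r ->
  (forall t : R, `|t| < r -> `|f (x + t *: v) - f x - t * l| <= C * t ^+ 2) ->
  is_derive x v f l.
Proof.
move=> r0 h.
have H : (fun t : R => t^-1 *: ((f \o shift x) (t *: v) - f x)) @ 0^' --> l.
  apply/cvgrPdist_le => e e0; near=> t.
  have t0 : t != 0 by near: t; exact: nbhs_dnbhs_neq.
  have tr : `|t| < r.
    near: t; apply: dnbhs0_lt => //.
  have te : `|t| < e / (`|C| + 1) by near: t; apply: dnbhs0_lt; rewrite divr_gt0 // ltr_wpDl.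
  have -> : l - t^-1 *: ((f \o shift x) (t *: v) - f x) = - t^-1 * (f (x + t *: v) - f x - t * l).
    rewrite /shift /= [_ + x]addrC /GRing.scale /=; field; exact: t0.
  rewrite normrM normrN normfV mulrC ler_pdivrMr ?normr_gt0 //.
  apply: (le_trans (h t tr)); rewrite -[t ^+ 2]real_normK ?num_real // expr2 mulrA ler_wpM2r //.
  move: te; rewrite ltr_pdivlMr ?ltr_wpDl // => /ltW; apply: le_trans.
  by rewrite mulrC ler_wpM2l // (le_trans (ler_norm _)) // lerDl.
apply: DeriveDef; first by apply/cvg_ex; exists l.
exact/cvg_lim.
Unshelve. all: by end_near. Qed.

Lemma MVT_scaled (f df : R -> R) (a t : R) :
  (forall s : R, 0 <= s <= 1 -> is_derive (a + t * s) 1 f (df (a + t * s))) ->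
  exists2 s : R, 0 <= s <= 1 & f (a + t) - f a = df (a + t * s) * t.
Proof.
move=> D; have [|s /andP[s0 s1]] := @MVT0 R (fun s => f (a + t * s)) (fun s => df (a + t * s) * t) 1 ltr01.
  move=> s /D h; apply: (is_derive1_comp h (g := fun s => a + t * s)).
  rewrite -[X in is_derive _ _ _ X]add0r; apply: is_deriveD; exact: is_derive_mull.
by rewrite mulr1 mulr0 addr0 mulr1 => e; exists s => //; rewrite !ltW.
Qed.

Lemma differentiable_C1 f (g : 'I_n -> 'rV[R]_n -> R) (Q : set 'rV[R]_n) x : open Q -> Q x ->
  (forall y i, Q y -> is_derive y 'e_i f (g i y)) ->
  (forall i, {for x, continuous (g i)}) -> differentiable f x.
Proof.
move=> oQ Qx D cg.
(* Without this linear part the partial derivatives are small near [x], and [cube_lipschitz] bounds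
   the increment with a small constant. *)
pose L (y : 'rV[R]_n) : R := \sum_i g i x * y 0 i.
have dL y : differentiable L y.
  have -> : L = \sum_(i < n) (fun y => g i x * y 0 i).
    by apply/funext => z; rewrite fct_sumE.
  apply: differentiable_sum => i.
  apply: (@differentiableM _ _ (cst (g i x)) (fun y => y 0 i)); first exact: differentiable_cst.
  exact: differentiable_coord.
suff dk : differentiable (f \- L) x.
  have -> : f = (f \- L) \+ L by apply/funext => y /=; rewrite subrK.
  exact: differentiableD.
apply: differentiable_o => e e0.
pose e' := e / n.+1%:R.
have e'0 : 0 < e' by rewrite divr_gt0.
have : \forall y \near x, Q y /\ forall i, `|g i x - g i y| < e'.
  apply: filterI; first exact: open_nbhs_nbhs.
  apply: (@filter_forall _ _ (fun i y => `|g i x - g i y| < e') (nbhs x) _) => i.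
  by have /cvgrPdist_lt := cg i; apply.
move=> /nbhs_cube [d d0 hd].
have B0 : \forall h \near (0 : 'rV[R]_n), `|h| < d by have := @nbhs0_lt R _ d d0; apply.
apply: filterS B0 => h hd'.
have ch : cube x d (h + x) by move=> i; rewrite mxE addrK (le_lt_trans (coord_le_norm h i)).
suff hl : `|(f \- L) (h + x) - (f \- L) x| <= e' * n%:R * `|h + x - x|.
  apply: (le_trans hl); rewrite addrK ler_wpM2r // /e' mulrAC ler_pdivrMr ?ltr0Sn //.
  by rewrite ler_wpM2l ?(ltW e0) // ler_nat leqnSn.
apply: (@cube_lipschitz R n x d) => //; [exact: ltW| |exact: cube_center].
move=> z j t cz ct.
have [|s s01 fE] := @MVT_scaled (fun t => f (z + t *: 'e_j)) (fun t => g j (z + t *: 'e_j)) 0 t.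
  move=> s s01; apply/is_derive_lineP; apply: D.
  by rewrite add0r mulrC -scalerA; exact: (hd _ (cube_along cz ct s01)).1.
have -> : (f \- L) (z + t *: 'e_j) - (f \- L) z = (g j (z + s *: (t *: 'e_j)) - g j x) * t.
  have LE : L (z + t *: 'e_j) = L z + g j x * t.
    rewrite /L (bigD1 j) //= [in RHS](bigD1 j) //= !mxE !eqxx mulr1 mulrDr addrAC; congr (_ + _ + _).
    by apply: eq_bigr => i ij; rewrite !mxE (negPf ij) andbF mulr0 addr0.
  move: fE; rewrite /= LE !add0r scale0r addr0 scalerA [s * t]mulrC => fE; rewrite opprB addrACA [f _ + _]addrC; move: fE; move: (g j _) (f _) (f z) (L z) => *; lra.
rewrite normrM ler_wpM2r // distrC ltW //; exact: (hd _ (cube_along cz ct s01)).2.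
Qed.
End LineDerivative.

(** * Smooth dependence on parameters *)

Section ParamODE.
Context {R : realType} {n : nat}.
Variables (U : set 'rV[R]_n) (c : 'rV[R]_n) (r : R) (d : 'I_n).
Hypotheses (oU : open U) (r0 : 0 < r) (cU : ccube c r `<=` U).
Local Notation Q := (cube c r).
Local Notation ev := ('e_d : 'rV[R]_n).

(** One ordinary differential equation for each line in the direction [d], with initial value [V0]
    on the slice x_d = c_d. The other coordinates are parameters, and no regularity across the lines
    is assumed. *)
Definition line_sol (I : finType) (B : I -> I -> 'rV[R]_n -> R) (V0 V : I -> 'rV[R]_n -> R) :=
  forall y, Q y -> y 0 d = c 0 d -> (forall a, V a y = V0 a y) /\
    forall a (s : R), `|s| < r ->
      is_derive s 1 (fun s : R => V a (y + s *: ev)) (\sum_b B a b (y + s *: ev) * V b (y + s *: ev)).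

Definition base (x : 'rV[R]_n) := x - (x 0 d - c 0 d) *: ev.

Lemma base_d x : (base x) 0 d = c 0 d.
Proof. by rewrite !mxE !eqxx mulr1 opprB addrCA subrr addr0. Qed.

Lemma base_cube x : Q x -> Q (base x).
Proof.
move=> Qx i; have [->|id] := eqVneq i d; first by rewrite base_d subrr normr0.
by rewrite !mxE (negPf id) andbF mulr0 subr0.
Qed.

Lemma base_line x : base x + (x 0 d - c 0 d) *: ev = x.
Proof. by rewrite subrK. Qed.

Lemma line_d (y : 'rV[R]_n) (s : R) : y 0 d = c 0 d -> (y + s *: ev) 0 d - c 0 d = s.
Proof. by move=> yd; rewrite !mxE !eqxx mulr1 yd addrAC subrr add0r. Qed.

Lemma base_id (y : 'rV[R]_n) (s : R) : y 0 d = c 0 d -> base (y + s *: ev) = y.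
Proof. by move=> yd; rewrite /base line_d // addrK. Qed.

Lemma line_cube y (s : R) : Q y -> y 0 d = c 0 d -> `|s| < r -> Q (y + s *: ev).
Proof.
move=> Qy yd sr i; have [->|id] := eqVneq i d; first by rewrite line_d.
by rewrite !mxE (negPf id) andbF mulr0 addr0.
Qed.

Lemma line_ccube y (s : R) : Q y -> y 0 d = c 0 d -> `|s| <= r -> ccube c r (y + s *: ev).
Proof.
move=> Qy yd sr i; have [->|id] := eqVneq i d; first by rewrite line_d.
by rewrite !mxE (negPf id) andbF mulr0 addr0; exact: ltW.
Qed.

Lemma smooth_lip (J : finType) (f : J -> 'rV[R]_n -> R) : (forall a, smooth_open U (f a)) ->
  exists2 C : R, 0 <= C & forall a x (j : 'I_n) (t : R), Q x -> Q (x + t *: 'e_j) ->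
    `|f a (x + t *: 'e_j) - f a x| <= C * `|t|.
Proof.
move=> sf; have [C C0 hC] := smooth_bounded (fun p : J * 'I_n => smooth_pd p.2 (sf p.1)) cU.
exists C => // a x j t Qx Qt.
have D s : 0 <= s <= 1 -> differentiable (f a) (x + s *: (t *: 'e_j)).
  by move=> s01; apply: (smooth_diff (sf a)); apply/cU/cubeW; exact: cube_along.
have [s /andP[s0 s1] ->] := MVT_line D.
have s01 : 0 <= s <= 1 by rewrite !ltW.
rewrite deriveZv; last exact: D.
rewrite -pdE normrM mulrC ler_wpM2r //.
by apply: (hC (a, j)); apply/cubeW; exact: cube_along.
Qed.

Lemma smooth_taylor (J : finType) (f : J -> 'rV[R]_n -> R) : (forall a, smooth_open U (f a)) ->
  exists2 C : R, 0 <= C & forall a x (j : 'I_n) (t : R), Q x -> Q (x + t *: 'e_j) ->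
    `|f a (x + t *: 'e_j) - f a x - t * pd j (f a) x| <= C * t ^+ 2.
Proof.
move=> sf; have [C C0 hC] := smooth_lip (fun p : J * 'I_n => smooth_pd p.2 (sf p.1)).
exists C => // a x j t Qx Qt.
have D s : 0 <= s <= 1 -> differentiable (f a) (x + s *: (t *: 'e_j)).
  by move=> s01; apply: (smooth_diff (sf a)); apply/cU/cubeW; exact: cube_along.
have [s /andP[s0 s1] ->] := MVT_line D.
have s01 : 0 <= s <= 1 by rewrite !ltW.
rewrite deriveZv; last exact: D.
rewrite -pdE -mulrBr normrM -[t ^+ 2]real_normK ?num_real // expr2 mulrCA ler_wpM2l //.
rewrite scalerA; apply: le_trans (hC (a, j) x j (s * t) Qx _) _.
  by rewrite -scalerA; exact: cube_along.
by rewrite ler_wpM2l // normrM ger0_norm ?(ltW s0) // ler_piMl // ltW.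
Qed.

Section System.
Variables (I : finType) (B : I -> I -> 'rV[R]_n -> R) (V0 : I -> 'rV[R]_n -> R).
Hypotheses (sB : forall a b, smooth_open U (B a b)) (sV0 : forall a, smooth_open U (V0 a)).

Lemma B_bound : exists2 K : R, 0 <= K & forall a b x, ccube c r x -> `|B a b x| <= K.
Proof.
have [K K0 h] := smooth_bounded (fun ab : I * I => sB ab.1 ab.2) cU.
by exists K => // a b x cx; exact: (h (a, b)).
Qed.

Lemma line_sol_exists : exists V, line_sol B V0 V.
Proof.
have [K K0 bK] := B_bound.
(* Coefficients are controlled on the closed cube only; clamping the time to [- r, r] makes them
   continuous and bounded on the whole line and changes nothing inside. *)
pose cl (s : R) := Order.max (- r) (Order.min r s).
have clr s : `|cl s| <= r.
  rewrite ler_norml /cl le_max lexx /= ge_max ge_min lexx /= andbT.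
  by have := r0; lra.
have clE s : `|s| < r -> cl s = s.
  rewrite ltr_norml => /andP[s1 s2]; rewrite /cl min_r ?(ltW s2) // max_r //; exact: ltW.
have ccl : continuous cl.
  move=> s; apply: (@continuous_max _ _ (cst (- r)) (fun s => Order.min r s) s); first exact: cvg_cst.
  by apply: (@continuous_min _ _ (cst r) id s); [exact: cvg_cst|exact: cvg_id].
have /choice [z hz] : forall y, exists z : I -> R -> R, Q y -> y 0 d = c 0 d ->
    (forall a, z a 0 = V0 a y) /\ forall a (s : R), is_derive s 1 (z a) (\sum_b B a b (y + cl s *: ev) * z b s).
  move=> y; have [[Qy yd]|nQ] := pselect (Q y /\ y 0 d = c 0 d); last first.
    by exists (fun _ _ => 0) => Qy yd; case: nQ.
  have cB a b : continuous (fun s => B a b (y + cl s *: ev)).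
    move=> s; apply: (@continuous_comp _ _ _ (fun s : R => y + cl s *: ev) (B a b)).
      by apply: cvgD; [exact: cvg_cst|apply: cvgZr_tmp; exact: ccl].
    apply/differentiable_continuous/(smooth_diff (sB a b))/cU.
    exact: line_ccube.
  have bB a b s : `|B a b (y + cl s *: ev)| <= K by apply: bK; exact: line_ccube.
  have [z [z0 dz]] := linear_ode (fun a => V0 a y) cB bB.
  by exists z.
exists (fun a x => z (base x) a (x 0 d - c 0 d)) => y Qy yd.
have [z0 dz] := hz y Qy yd; split => [a|a s sr].
  by rewrite -[in LHS](addr0 y) -(scale0r ev) base_id // line_d.
have -> : (fun s : R => z (base (y + s *: ev)) a ((y + s *: ev) 0 d - c 0 d)) = z y a.
  by apply/funext => t; rewrite base_id // line_d.
have := dz a s; rewrite clE // => h.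
by under eq_bigr do rewrite base_id // line_d //.
Qed.

Variable (V : I -> 'rV[R]_n -> R).
Hypothesis hV : line_sol B V0 V.

Lemma line_sol_bound : exists2 M : R, 0 <= M & forall a x, Q x -> `|V a x| <= M.
Proof.
have [K K0 bK] := B_bound.
have [M0 M00 bM0] := smooth_bounded sV0 cU.
have [C C0 hC] := @gronwall R I r K K0.
exists (C * (M0 + 0)); first by rewrite mulr_ge0 // addr0.
move=> a x Qx; have Qb := base_cube Qx.
have [V0b dV] := hV Qb (base_d x).
rewrite -(base_line x); apply: (hC (fun a s => V a (base x + s *: ev)) (fun a s => \sum_b B a b (base x + s *: ev) * V b (base x + s *: ev))) => //.
- move=> e s sr; rewrite addr0; apply: (le_trans (ler_norm_sum _ _ _)).
  rewrite mulr_sumr; apply: ler_sum => b _; rewrite normrM ler_wpM2r //.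
  by apply: bK; apply: cubeW; apply: line_cube => //; exact: base_d.
- by move=> e; rewrite scale0r addr0 V0b; apply: bM0; exact: cubeW.
Qed.

Lemma line_sol_unique V' : line_sol B V0 V' -> forall a x, Q x -> V' a x = V a x.
Proof.
move=> hV' a x Qx; have [K K0 bK] := B_bound.
have [C C0 hC] := @gronwall R I r K K0.
have Qb := base_cube Qx; have bd := base_d x.
have [V0b dV] := hV Qb bd; have [V0b' dV'] := hV' _ Qb bd.
apply/eqP; rewrite -subr_eq0 -normr_le0 -(mulr0 C) -[X in C * X](addr0 0) -(base_line x).
apply: (hC (fun a s => V' a (base x + s *: ev) - V a (base x + s *: ev))
  (fun a s => \sum_b B a b (base x + s *: ev) * V' b (base x + s *: ev)
     - \sum_b B a b (base x + s *: ev) * V b (base x + s *: ev))) => //.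
- by move=> e s sr; apply: is_deriveB; [exact: dV'|exact: dV].
- move=> e s sr; rewrite addr0 -sumrB; apply: (le_trans (ler_norm_sum _ _ _)).
  rewrite mulr_sumr; apply: ler_sum => b _; rewrite -mulrBr normrM ler_wpM2r //.
  by apply: bK; apply: cubeW; exact: line_cube.
- by move=> e; rewrite scale0r addr0 V0b V0b' subrr normr0.
Qed.

Lemma base_along x (j : 'I_n) (t : R) : j != d -> base (x + t *: 'e_j) = base x + t *: 'e_j.
Proof.
move=> jd; rewrite /base !mxE [(d == j)]eq_sym (negPf jd) andbF mulr0 addr0.
by rewrite addrAC.
Qed.

(** Across the lines the difference of two neighbouring solutions solves the system up to an error
    of order |t|, so [gronwall] applies; along [d] the equation bounds the derivative. *)
Lemma line_sol_lip : exists2 C : R, 0 <= C &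
  forall a x (j : 'I_n) (t : R), Q x -> Q (x + t *: 'e_j) -> `|V a (x + t *: 'e_j) - V a x| <= C * `|t|.
Proof.
have [K K0 bK] := B_bound; have [M M0 bM] := line_sol_bound.
have [L L0 bL] := smooth_lip (fun ab : I * I => sB ab.1 ab.2).
have [L' L'0 bL'] := smooth_lip sV0.
have [C C0 hC] := @gronwall R I r K K0.
pose N : R := #|I|%:R.
exists (C * (L' + N * (L * M)) + N * (K * M)).
  by rewrite !(addr_ge0, mulr_ge0).
move=> a x j t Qx; have [->|jd] := eqVneq j d => Qt; last first.
  apply: (@le_trans _ _ (C * (L' * `|t| + N * (L * `|t| * M)))); last first.
    rewrite mulrDl -[leLHS]addr0 lerD //; last by rewrite !mulr_ge0.
    by rewrite le_eqVlt; apply/orP; left; apply/eqP; ring.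
  have Qb := base_cube Qx; have bd := base_d x.
  have Qb' := base_cube Qt; have bd' := base_d (x + t *: 'e_j).
  have [V0b dV] := hV Qb bd; have [V0b' dV'] := hV Qb' bd'.
  rewrite -{2}(base_line x) -(base_line (x + t *: 'e_j)).
  have -> : (x + t *: 'e_j) 0 d - c 0 d = x 0 d - c 0 d.
    by rewrite !mxE [(d == j)]eq_sym (negPf jd) andbF mulr0 addr0.
  have lineE s : base (x + t *: 'e_j) + s *: ev = base x + s *: ev + t *: 'e_j.
    by rewrite base_along // addrAC.
  apply: (hC (fun a s => V a (base (x + t *: 'e_j) + s *: ev) - V a (base x + s *: ev))
    (fun a s => \sum_b B a b (base (x + t *: 'e_j) + s *: ev) * V b (base (x + t *: 'e_j) + s *: ev)
       - \sum_b B a b (base x + s *: ev) * V b (base x + s *: ev))) => //.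
  - by rewrite mulr_ge0.
  - by rewrite !mulr_ge0.
  - by move=> e s sr; apply: is_deriveB; [exact: dV'|exact: dV].
  - move=> e s sr.
    have Q1 : Q (base x + s *: ev) by exact: line_cube.
    have Q2 : Q (base x + s *: ev + t *: 'e_j) by rewrite -lineE; exact: line_cube.
    rewrite lineE; set y := base x + s *: ev in Q1 Q2 *; set y' := y + _ in Q2 *.
    have -> : \sum_b B e b y' * V b y' - \sum_b B e b y * V b y =
       \sum_b B e b y * (V b y' - V b y) + \sum_b (B e b y' - B e b y) * V b y'.
      by rewrite -big_split -sumrB; apply: eq_bigr => b _ /=; ring.
    apply: (le_trans (ler_normD _ _)); apply: lerD.
      rewrite mulr_sumr; apply: (le_trans (ler_norm_sum _ _ _)); apply: ler_sum => b _.
      by rewrite normrM ler_wpM2r //; apply: bK; exact: cubeW.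
    apply: sum_bound => b; rewrite normrM ler_pM //; last exact: bM.
    exact: (bL (e, b)).
  - move=> e; rewrite !scale0r !addr0 V0b V0b' base_along //; apply: bL' => //.
    by rewrite -base_along.
apply: (@le_trans _ _ (N * (K * M) * `|t|)); last first.
  by rewrite ler_wpM2r // lerDr !(mulr_ge0, addr_ge0).
have [xd dV] : (x 0 d - c 0 d = x 0 d - c 0 d) /\ _ := conj erefl (hV (base_cube Qx) (base_d x)).2.
rewrite -{1 2}(base_line x) -addrA -scalerDl.
set s0 := x 0 d - c 0 d.
have inr s : 0 <= s <= 1 -> `|s0 + t * s| < r.
  by move=> s01; have := cube_along Qx Qt s01 d; rewrite !mxE !eqxx mulr1 /s0 [s * t]mulrC addrAC.
have [|s sb ->] := @MVT_scaled R (fun s => V a (base x + s *: ev)) (fun s => \sum_b B a b (base x + s *: ev) * V b (base x + s *: ev)) s0 t.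
  by move=> s sb; apply: dV; exact: inr.
rewrite normrM ler_wpM2r //; apply: sum_bound => b.
have Qs : Q (base x + (s0 + t * s) *: ev) by apply: line_cube; [exact: base_cube|exact: base_d|exact: inr].
by rewrite normrM ler_pM //; [apply: bK; exact: cubeW|exact: bM].
Qed.

Lemma line_sol_continuous a x : Q x -> {for x, continuous (V a)}.
Proof.
move=> Qx; have [C C0 hC] := line_sol_lip.
apply/(@cvgrPdist_lt _ _ _ (nbhs x)) => e e0.
have e'0 : 0 < e / (C * n%:R + 1) by rewrite divr_gt0 // ltr_wpDl // mulr_ge0.
have nQ : \forall y \near x, Q y by apply: open_nbhs_nbhs; split; [exact: open_cube|].
near=> y; have Qy : Q y by near: y.
rewrite distrC; apply: (le_lt_trans (cube_lipschitz C0 (hC a) Qx Qy)).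
apply: (@le_lt_trans _ _ ((C * n%:R + 1) * `|x - y|)); first by rewrite distrC ler_wpM2r // lerDl.
by rewrite mulrC -ltr_pdivlMr // ltr_wpDl // mulr_ge0.
Unshelve. all: by end_near. Qed.

Lemma line_sol_is_derive a x : Q x -> is_derive x ev (V a) (\sum_b B a b x * V b x).
Proof.
move=> Qx; have [_ dV] := hV (base_cube Qx) (base_d x).
by have /is_derive_lineP := dV a _ (Qx d); rewrite base_line.
Qed.

Section Derivative.
Variable j : 'I_n.
Hypothesis jd : j != d.
(** The variational system: differentiating V' = B V in the j-th variable gives a linear system for
    the derivative (index [inl]) coupled to a copy of V (index [inr]). *)
Definition ext_B (a b : I + I) : 'rV[R]_n -> R :=
  match a, b with
  | inl a, inl b => B a b
  | inl a, inr b => pd j (B a b)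
  | inr a, inl b => fun=> 0
  | inr a, inr b => B a b
  end.
Definition ext_V0 (a : I + I) : 'rV[R]_n -> R :=
  match a with inl a => pd j (V0 a) | inr a => V0 a end.
Variable W : I + I -> 'rV[R]_n -> R.
Hypothesis hW : line_sol ext_B ext_V0 W.

Lemma ext_inr : line_sol B V0 (fun a => W (inr a)).
Proof.
move=> y Qy yd; have [W0 dW] := hW Qy yd; split => [a|a s sr]; first by rewrite W0.
have := dW (inr a) s sr; rewrite big_sumType /= big1 ?add0r // => b _.
by rewrite mul0r.
Qed.
End Derivative.
End System.

(** The remainder V(x + t e_j) - V(x) - t W(x) solves the system up to terms of order t^2, by the
    Taylor estimates for the coefficients and the Lipschitz bound for V; [gronwall] makes it of
    order t^2 itself. *)
Lemma line_sol_deriv (I : finType) B V0 V j (W : I + I -> 'rV[R]_n -> R) :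
  (forall a b, smooth_open U (B a b)) -> (forall a, smooth_open U (V0 a)) -> j != d ->
  line_sol B V0 V -> line_sol (ext_B B j) (ext_V0 V0 j) W ->
  forall a x, Q x -> is_derive x 'e_j (V a) (W (inl a) x).
Proof.
move=> sB sV0 jd hV hW a x Qx.
have sB' p q : smooth_open U (ext_B B j p q).
  case: p q => p [] q /=; [exact: sB|exact/smooth_pd|exact: smooth_cst|exact: sB].
have [K K0 bK] := B_bound sB; have [M M0 bM] := line_sol_bound sB sV0 hV.
have [C1 C10 bC1] := line_sol_lip sB sV0 hV.
have [L L0 bL] := smooth_taylor (fun ab : I * I => sB ab.1 ab.2).
have [L' L'0 bL'] := smooth_taylor sV0.
have [K1 K10 bK1] := B_bound (fun a b => smooth_pd j (sB a b)).
have [C C0 hC] := @gronwall R I r K K0.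
pose N : R := #|I|%:R.
have WV b y : Q y -> W (inr b) y = V b y.
  by move=> Qy; exact: (line_sol_unique sB hV (ext_inr hW)).
have /nbhs_ballP [e /= e0 he] : nbhs x Q by apply: open_nbhs_nbhs; split; [exact: open_cube|].
apply: (@quad_is_derive _ _ _ _ _ _ (C * (L' + N * (L * M + K1 * C1))) e) => // t te.
have Qt : Q (x + t *: 'e_j).
  apply: he; rewrite -ball_normE /ball_ /= opprD addNKr normrN.
  apply: le_lt_trans te; apply: norm_le_coord => // i; rewrite !mxE eqxx /=.
  by case: (i == j); rewrite ?mulr1 ?mulr0 ?normr0.
have t20 : 0 <= t ^+ 2 by rewrite sqr_ge0.
have -> : C * (L' + N * (L * M + K1 * C1)) * t ^+ 2 =
  C * (L' * t ^+ 2 + N * (L * t ^+ 2 * M + `|t| * K1 * (C1 * `|t|))).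
  by rewrite -[t ^+ 2]real_normK ?num_real //; ring.
have Qb := base_cube Qx; have bd := base_d x.
have Qb' := base_cube Qt; have bd' := base_d (x + t *: 'e_j).
have [V0b dV] := hV _ Qb bd; have [V0b' dV'] := hV _ Qb' bd'; have [W0b dW] := hW _ Qb bd.
rewrite -{2 3}(base_line x) -(base_line (x + t *: 'e_j)).
have -> : (x + t *: 'e_j) 0 d - c 0 d = x 0 d - c 0 d.
  by rewrite !mxE [(d == j)]eq_sym (negPf jd) andbF mulr0 addr0.
have lineE s : base (x + t *: 'e_j) + s *: ev = base x + s *: ev + t *: 'e_j.
  by rewrite base_along // addrAC.
apply: (hC (fun a s => V a (base (x + t *: 'e_j) + s *: ev) - V a (base x + s *: ev) - t * W (inl a) (base x + s *: ev))
  (fun a s => \sum_b B a b (base (x + t *: 'e_j) + s *: ev) * V b (base (x + t *: 'e_j) + s *: ev)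
     - \sum_b B a b (base x + s *: ev) * V b (base x + s *: ev)
     - t * \sum_b ext_B B j (inl a) b (base x + s *: ev) * W b (base x + s *: ev))) => //.
- by rewrite mulr_ge0.
- apply: mulr_ge0 => //; apply: addr_ge0; first by apply: mulr_ge0 => //; apply: mulr_ge0.
  by apply: mulr_ge0; apply: mulr_ge0.
- move=> b s sr; apply: is_deriveB; first by apply: is_deriveB; [exact: dV'|exact: dV].
  exact: (@is_deriveZ R R^o R^o _ t s 1 _ (dW (inl b) s sr)).
- move=> f s sr.
  have Q1 : Q (base x + s *: ev) by exact: line_cube.
  have Q2 : Q (base x + s *: ev + t *: 'e_j) by rewrite -lineE; exact: line_cube.
  rewrite lineE; set y := base x + s *: ev in Q1 Q2 *; set y' := y + _ in Q2 *.
  rewrite big_sumType /=.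
  have -> : \sum_b B f b y' * V b y' - \sum_b B f b y * V b y
      - t * (\sum_b B f b y * W (inl b) y + \sum_b pd j (B f b) y * W (inr b) y) =
     \sum_b B f b y * (V b y' - V b y - t * W (inl b) y) +
     \sum_b ((B f b y' - B f b y - t * pd j (B f b) y) * V b y' + t * pd j (B f b) y * (V b y' - V b y)).
    rewrite mulrDr !mulr_sumr opprD -!sumrN -!big_split; apply: eq_bigr => b _ /=.
    by rewrite WV //; ring.
  apply: (le_trans (ler_normD _ _)); apply: lerD.
    rewrite mulr_sumr; apply: (le_trans (ler_norm_sum _ _ _)); apply: ler_sum => b _.
    by rewrite normrM ler_wpM2r //; apply: bK; exact: cubeW.
  apply: sum_bound => b; apply: (le_trans (ler_normD _ _)); apply: lerD.
    by rewrite normrM ler_pM //; [exact: (bL (f, b))|exact: bM].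
  rewrite !normrM ler_pM ?mulr_ge0 //; last exact: bC1.
  by rewrite ler_wpM2l //; apply: bK1; exact: cubeW.
- move=> b; rewrite !scale0r !addr0 V0b V0b' W0b base_along //; apply: bL' => //.
  by rewrite -base_along.
Qed.

(* This class is closed under partial derivatives up to sums and products: in
   the direction [d] by the equation itself, in the other ones because the
   differentiated system is again a system of the same kind ([ext_B]). *)
Definition sol_class : set ('rV[R]_n -> R) := [set f | smooth_open Q f \/
  exists (I : finType) (B : I -> I -> 'rV[R]_n -> R) V0 V a,
  [/\ forall a b, smooth_open U (B a b), forall a, smooth_open U (V0 a), line_sol B V0 V & f = V a]].

Lemma smooth_cube f : smooth_open U f -> smooth_open Q f.
Proof. by apply: smooth_sub => x Qx; apply: cU; exact: cubeW. Qed.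

Lemma sol_class_pd f i : sol_class f ->
  exists2 g, gen_alg sol_class g & forall x, Q x -> is_derive x 'e_i f (g x) /\ {for x, continuous g}.
Proof.
move=> [sf|[I [B [V0 [V [a [sB sV0 hV ->]]]]]]].
  exists (pd i f); first by apply: gen_alg_in; left; exact: smooth_pd.
  move=> x Qx; split; last first.
    by apply/differentiable_continuous/(smooth_diff _ Qx)/smooth_pd.
  rewrite pdE; apply: DeriveDef => //; apply: diff_derivable.
  exact: smooth_diff sf Qx.
have [->|id] := eqVneq i d.
  exists (fun x => \sum_b B a b x * V b x).
    apply: gen_alg_sum => b; apply: gen_alg_mul; apply: gen_alg_in.
      by left; exact: smooth_cube.
    by right; exists I, B, V0, V, b.
  move=> x Qx; split; first exact: line_sol_is_derive hV _ _ Qx.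
  apply: continuous_sumR => b; have cV : {for x, continuous (V b)} by exact: (line_sol_continuous sB sV0 hV).
  apply: (@continuousM _ _ (B a b) (V b)) => //.
  apply/differentiable_continuous/(smooth_diff (sB a b))/cU; exact: cubeW.
have sB' p q : smooth_open U (ext_B B i p q).
  case: p q => p [] q /=; [exact: sB|exact/smooth_pd|exact: smooth_cst|exact: sB].
have sV0' p : smooth_open U (ext_V0 V0 i p) by case: p => p /=; [exact: smooth_pd|].
have [W hW] := @line_sol_exists _ _ (ext_V0 V0 i) sB'.
exists (W (inl a)).
  by apply: gen_alg_in; right; exists (I + I)%type, (ext_B B i), (ext_V0 V0 i), W, (inl a).
move=> x Qx; split; last exact: (line_sol_continuous sB' sV0' hW).
exact: (line_sol_deriv sB sV0 id hV hW).
Qed.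

Lemma sol_class_smooth f : sol_class f -> smooth_open Q f.
Proof.
move=> Sf; apply: (@smooth_gen_alg _ _ sol_class); last exact: gen_alg_in.
- exact: open_cube.
- move=> {Sf}f x Sf Qx.
  have /choice [g hg] : forall i, exists g, forall x, Q x -> is_derive x 'e_i f (g x) /\ {for x, continuous g}.
    by move=> i; have [g _ h] := sol_class_pd i Sf; exists g.
  apply: (@differentiable_C1 _ _ f g Q) => //; first exact: open_cube.
    by move=> y i Qy; have [] := hg i y Qy.
  by move=> i; have [] := hg i x Qx.
- move=> {Sf}f i Sf; have [g Sg h] := sol_class_pd i Sf.
  exists g => // x Qx; rewrite pdE; have [[_ ->]] := h x Qx; by [].
Qed.

Theorem linear_ode_smooth (I : finType) (B : I -> I -> 'rV[R]_n -> R) (V0 : I -> 'rV[R]_n -> R) :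
  (forall a b, smooth_open U (B a b)) -> (forall a, smooth_open U (V0 a)) ->
  exists V : I -> 'rV[R]_n -> R, [/\ forall a, smooth_open Q (V a),
    forall a x, Q x -> x 0 d = c 0 d -> V a x = V0 a x &
    forall a x, Q x -> pd d (V a) x = \sum_b B a b x * V b x].
Proof.
move=> sB sV0; have [V hV] := @line_sol_exists _ _ V0 sB.
exists V; split.
- by move=> a; apply: sol_class_smooth; right; exists I, B, V0, V, a.
- by move=> a x Qx xd; have [+ _] := hV x Qx xd.
- by move=> a x Qx; rewrite pdE; have [_ ->] := line_sol_is_derive hV a Qx.
Qed.
End ParamODE.

(** * The differential ring of smooth functions *)

Section SmoothRing.
Context {R : realType} {n : nat}.
Local Notation vec := 'rV[R]_n.+1.
Implicit Types (V : set vec) (f : vec -> R).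

(* Smooth functions on [V], normalized to vanish off [V] so that they form a
   ring whose unit is the indicator of [V]. *)
Definition smooth_pred V : {pred vec -> R} :=
  fun f => `[< smooth_on V f /\ forall x, ~ V x -> f x = 0 >].

Lemma smooth_predP V f : f \in smooth_pred V <-> smooth_on V f /\ forall x, ~ V x -> f x = 0.
Proof. by split => [/asboolP|h]; [|apply/asboolP]. Qed.

Fact smooth_pred_zmod V : zmod_closed (smooth_pred V).
Proof.
split=> [|f g /smooth_predP[sf f0] /smooth_predP[sg g0]]; apply/smooth_predP; split.
- exact: smooth_on_cst.
- by [].
- exact: smooth_onB.
- by move=> x Vx; change (f x - g x = 0); rewrite f0 // g0 // subrr.
Qed.

HB.instance Definition _ V := GRing.isZmodClosed.Build _ (smooth_pred V) (smooth_pred_zmod V).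

Record smooth_ring V := SmoothRing { smooth_val :> vec -> R; _ : smooth_val \in smooth_pred V }.

HB.instance Definition _ V := [isSub for @smooth_val V].
HB.instance Definition _ V := [Choice of smooth_ring V by <:].
HB.instance Definition _ V := [SubChoice_isSubZmodule of smooth_ring V by <:].

Fact smooth_ring_subproof V f : smooth_on V f -> (fun x => if `[< V x >] then f x else 0) \in smooth_pred V.
Proof.
move=> sf; apply/smooth_predP; split; last by move=> x Vx; case: asboolP.
by apply: smooth_on_eq sf => x Vx; case: asboolP.
Qed.

Definition to_smooth V f (sf : smooth_on V f) : smooth_ring V := SmoothRing (smooth_ring_subproof sf).

Lemma to_smoothE V f (sf : smooth_on V f) x : V x -> to_smooth sf x = f x.
Proof. by move=> Vx /=; case: asboolP. Qed.
#[global] Opaque to_smooth.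

Lemma smooth_ringP V (a : smooth_ring V) : smooth_on V a.
Proof. by have /smooth_predP [] := valP a. Qed.

Lemma smooth_ring0 V (a : smooth_ring V) x : ~ V x -> a x = 0.
Proof. by have /smooth_predP [_] := valP a; apply. Qed.

Lemma sring_eq V (a b : smooth_ring V) : (forall x, V x -> a x = b x) -> a = b.
Proof.
move=> ab; apply/val_inj/funext => x; have [Vx|nVx] := pselect (V x); first exact: ab.
by change (a x = b x); rewrite !smooth_ring0.
Qed.

Definition smooth_ring1 V : smooth_ring V := to_smooth (@smooth_on_cst _ _ V 1).
Definition smooth_ring_mul V (a b : smooth_ring V) : smooth_ring V :=
  to_smooth (smooth_onM (smooth_ringP a) (smooth_ringP b)).

Lemma smooth_mulE V (a b : smooth_ring V) x : smooth_ring_mul a b x = a x * b x.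
Proof.
have [Vx|nVx] := pselect (V x); first exact: to_smoothE.
by rewrite smooth_ring0 // (smooth_ring0 a nVx) mul0r.
Qed.

Lemma smooth_addE V (a b : smooth_ring V) x : (a + b) x = a x + b x.
Proof. by []. Qed.

Fact smooth_mulA V : associative (@smooth_ring_mul V).
Proof. by move=> a b c; apply: sring_eq => x Vx; rewrite !smooth_mulE mulrA. Qed.
Fact smooth_mulC V : commutative (@smooth_ring_mul V).
Proof. by move=> a b; apply: sring_eq => x Vx; rewrite !smooth_mulE mulrC. Qed.
Fact smooth_mul1 V : left_id (smooth_ring1 V) (@smooth_ring_mul V).
Proof. by move=> a; apply: sring_eq => x Vx; rewrite smooth_mulE to_smoothE // mul1r. Qed.
Fact smooth_mulDl V : left_distributive (@smooth_ring_mul V) +%R.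
Proof. by move=> a b c; apply: sring_eq => x Vx; rewrite smooth_addE !smooth_mulE mulrDl. Qed.

HB.instance Definition _ V := GRing.Zmodule_isComPzRing.Build (smooth_ring V)
  (@smooth_mulA V) (@smooth_mulC V) (@smooth_mul1 V) (@smooth_mulDl V).

Section Eval.
Variables (V : set vec) (x : vec) (Vx : V x).
(** The proof that x lies in [V] is an argument because evaluation is a ring morphism at such points
    only: the unit of the ring vanishes elsewhere. *)
Definition eval_in of V x := fun a : smooth_ring V => a x.
Local Notation ev := (eval_in Vx).
Fact eval_in_additive : zmod_morphism ev. Proof. by []. Qed.
Fact eval_in_multiplicative : monoid_morphism ev.
Proof. by split=> [|a b]; [exact: to_smoothE|exact: smooth_mulE]. Qed.
HB.instance Definition _ := GRing.isZmodMorphism.Build _ _ ev eval_in_additive.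
HB.instance Definition _ := GRing.isMonoidMorphism.Build _ _ ev eval_in_multiplicative.
End Eval.

Section Derivation.
Variables (V : set vec) (hV : hopen V).

Definition deriv_ring (i : 'I_n.+1) (a : smooth_ring V) : smooth_ring V :=
  to_smooth (@smooth_on_partial R n V hV _ i (smooth_ringP a)).

Lemma deriv_ringE i a x : V x -> deriv_ring i a x = partial i a x.
Proof. exact: to_smoothE. Qed.
#[global] Opaque deriv_ring.

Lemma deriv_ringD i a b : deriv_ring i (a + b) = deriv_ring i a + deriv_ring i b.
Proof.
apply: sring_eq => x Vx; rewrite smooth_addE !deriv_ringE //.
exact: (partialD hV i (smooth_ringP a) (smooth_ringP b) Vx).
Qed.

Lemma deriv_ringM i a b : deriv_ring i (a * b) = deriv_ring i a * b + a * deriv_ring i b.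
Proof.
apply: sring_eq => x Vx; rewrite smooth_addE.
have -> : (deriv_ring i a * b) x = partial i a x * b x by rewrite -(deriv_ringE i a Vx) -smooth_mulE.
have -> : (a * deriv_ring i b) x = a x * partial i b x by rewrite -(deriv_ringE i b Vx) -smooth_mulE.
rewrite deriv_ringE // -(partialM hV i (smooth_ringP a) (smooth_ringP b) Vx).
apply: (partial_eq hV i _ Vx); last by move=> y _; exact/esym/smooth_mulE.
exact: smooth_onM (smooth_ringP a) (smooth_ringP b).
Qed.

Lemma deriv_ringC i j a : deriv_ring i (deriv_ring j a) = deriv_ring j (deriv_ring i a).
Proof.
apply: sring_eq => x Vx.
rewrite (deriv_ringE i (deriv_ring j a) Vx) (deriv_ringE j (deriv_ring i a) Vx).
have E k l : partial k (deriv_ring l a) x = partial k (partial l a) x.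
  apply: (partial_eq hV k _ Vx); first exact: smooth_on_partial (smooth_ringP a).
  by move=> y Vy; exact/esym/deriv_ringE.
rewrite (E i j) (E j i); exact: (partialC hV i j (smooth_ringP a) Vx).
Qed.

Lemma smooth_ring_two_reg (a : smooth_ring V) : a + a = 0 -> a = 0.
Proof.
move=> aa; apply: sring_eq => x Vx.
have := congr1 (fun b : smooth_ring V => b x) aa; rewrite smooth_addE.
change (a x + a x = 0 -> a x = 0); lra.
Qed.
End Derivation.
End SmoothRing.

Section SmoothMatrices.
Context {R : realType} {n : nat}.
Local Notation vec := 'rV[R]_n.+1.
Implicit Types (V : set vec).

Definition smooth_mx V p q (M : vec -> 'M[R]_(p, q)) := forall i j, smooth_on V (fun x => M x i j).

Definition ring_mx V p q M (sM : @smooth_mx V p q M) : 'M[smooth_ring V]_(p, q) :=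
  \matrix_(i, j) to_smooth (sM i j).

Lemma ring_mxE V p q M (sM : @smooth_mx V p q M) x (Vx : V x) : map_mx (eval_in Vx) (ring_mx sM) = M x.
Proof. by apply/matrixP => i j; rewrite !mxE; exact: to_smoothE. Qed.

Lemma ring_mx_inj V p q (M N : 'M[smooth_ring V]_(p, q)) :
  (forall x (Vx : V x), map_mx (eval_in Vx) M = map_mx (eval_in Vx) N) -> M = N.
Proof.
move=> h; apply/matrixP => i j; apply: sring_eq => x Vx.
by have /matrixP /(_ i j) := h x Vx; rewrite !mxE.
Qed.

Lemma smooth_mx_ring V p q (M : 'M[smooth_ring V]_(p, q)) : smooth_mx V (fun x => map_mx (fun a : smooth_ring V => a x) M).
Proof. by move=> i j; apply: smooth_on_eq (smooth_ringP (M i j)) => x _; rewrite mxE. Qed.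

Lemma smooth_mx_eq V p q (M N : vec -> 'M[R]_(p, q)) : (forall x, V x -> M x = N x) -> smooth_mx V M -> smooth_mx V N.
Proof. by move=> h sM i j; apply: smooth_on_eq (sM i j) => x Vx; rewrite h. Qed.

Lemma smooth_mxM V p q r (M : vec -> 'M[R]_(p, q)) (N : vec -> 'M[R]_(q, r)) :
  smooth_mx V M -> smooth_mx V N -> smooth_mx V (fun x => M x *m N x).
Proof.
move=> sM sN i j; apply: (@smooth_on_eq _ _ _ (fun x => \sum_k M x i k * N x k j)); first by move=> x _; rewrite mxE.
by apply: smooth_on_sum => k _; apply: smooth_onM.
Qed.

Lemma smooth_on_det V p (M : vec -> 'M[R]_p) : smooth_mx V M -> smooth_on V (fun x => \det (M x)).
Proof.
move=> sM; apply: smooth_on_eq (smooth_ringP (\det (ring_mx sM))) => x Vx.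
by rewrite -(ring_mxE sM Vx) det_map_mx.
Qed.

Lemma smooth_mx_inv V p (M : vec -> 'M[R]_p) :
  (forall x, V x -> M x \in unitmx) -> smooth_mx V M -> smooth_mx V (fun x => invmx (M x)).
Proof.
move=> uM sM; have sa : smooth_mx V (fun x => \adj (M x)).
  apply: smooth_mx_eq (smooth_mx_ring (\adj (ring_mx sM))) => x Vx.
  by rewrite -(ring_mxE sM Vx) -map_mx_adj.
move=> i j; apply: (@smooth_on_eq _ _ _ (fun x => (\det (M x))^-1 * (\adj (M x)) i j)).
  by move=> x Vx; rewrite /invmx uM // mxscaleE.
apply: smooth_onM => //; apply: smooth_onV; last exact: smooth_on_det.
by move=> x Vx; have := uM x Vx; rewrite unitmxE unitfE.
Qed.

Lemma eval_Dm V (hV : hopen V) i p q (M : 'M[smooth_ring V]_(p, q)) x (Vx : V x) :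
  map_mx (eval_in Vx) (Dm (deriv_ring hV) i M) = \matrix_(a, b) partial i (M a b) x.
Proof. by apply/matrixP => a b; rewrite !mxE; exact: deriv_ringE. Qed.

Lemma eval_Dm_ring V (hV : hopen V) i p q M (sM : @smooth_mx V p q M) x (Vx : V x) :
  map_mx (eval_in Vx) (Dm (deriv_ring hV) i (ring_mx sM)) = \matrix_(a, b) partial i (fun y => M y a b) x.
Proof.
rewrite eval_Dm; apply/matrixP => a b; rewrite !mxE.
by apply: (partial_eq hV i (sM a b) Vx) => y Vy; exact/esym/to_smoothE.
Qed.

Lemma partial_to_smooth V (hV : hopen V) i f (sf : smooth_on V f) x : V x ->
  deriv_ring hV i (to_smooth sf) x = partial i f x.
Proof.
move=> Vx; rewrite deriv_ringE //.
by apply: (partial_eq hV i sf Vx) => y Vy; exact/esym/to_smoothE.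
Qed.
End SmoothMatrices.

(** * The Levi-Civita connection of a chart *)

Section LocalRing.
Context {R : realType} {n : nat}.
Variables (V : set 'rV[R]_n.+1) (hV : hopen V) (G : 'rV[R]_n.+1 -> 'M[R]_n.+1).
Hypotheses (sG : smooth_mx V G) (GT : forall x, V x -> (G x)^T = G x)
  (Gu : forall x, V x -> G x \in unitmx).
Local Notation d := (deriv_ring hV).

Let sH : smooth_mx V (fun x => invmx (G x)) := smooth_mx_inv Gu sG.
Definition metric_ring : 'M[smooth_ring V]_n.+1 := ring_mx sG.
Definition inverse_ring : 'M[smooth_ring V]_n.+1 := ring_mx sH.

Lemma metric_ringT : metric_ring^T = metric_ring.
Proof.
apply/matrixP => i j; apply: sring_eq => x Vx.
by rewrite !mxE !to_smoothE // -[in LHS](GT Vx) mxE.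
Qed.

Lemma metric_ringV : metric_ring *m inverse_ring = 1%:M.
Proof. by apply: ring_mx_inj => x Vx; rewrite map_mxM map_mx1 !ring_mxE mulmxV // Gu. Qed.

Lemma smooth_christoffel k i j : smooth_on V (christoffel G k i j).
Proof.
apply: smooth_onM; first exact: smooth_on_cst.
apply: smooth_on_sum => l _; apply: smooth_onM; first exact: sH.
by apply: smooth_onB; [apply: smooth_onD|]; apply: (smooth_on_partial hV); exact: sG.
Qed.

Definition conn_ring i : 'M[smooth_ring V]_n.+1 := \matrix_(j, k) to_smooth (smooth_christoffel k i j).

Lemma conn_ringE i j k x : V x -> conn_ring i j k x = christoffel G k i j x.
Proof. by move=> Vx; rewrite mxE to_smoothE. Qed.

Lemma christoffel_sym k i j x : V x -> christoffel G k i j x = christoffel G k j i x.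
Proof.
move=> Vx; congr (_ * _); apply: eq_bigr => l _; congr (_ * (_ - _)); first by rewrite addrC.
apply: (partial_eq hV l (sG j i) Vx) => y Vy; by rewrite -[in LHS](GT Vy) mxE.
Qed.

Lemma conn_ring_tf i j k : conn_ring i j k = conn_ring j i k.
Proof. by apply: sring_eq => x Vx; rewrite !conn_ringE // christoffel_sym. Qed.

(** Lowering the last index removes the inverse metric; compatibility with the metric is then the
    sum of two such expressions. *)
Lemma christoffel_lower i j m x : V x ->
  \sum_k christoffel G k i j x * G x k m =
  2^-1 * (partial i (fun y => G y j m) x + partial j (fun y => G y i m) x - partial m (fun y => G y i j) x).
Proof.
move=> Vx; pose t l := partial i (fun y => G y j l) x + partial j (fun y => G y i l) x - partial l (fun y => G y i j) x.
rewrite -/(t m).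
have -> : \sum_k christoffel G k i j x * G x k m = 2^-1 * ((\row_l t l) *m (invmx (G x) *m G x)) 0 m.
  rewrite mulmxA mxE mulr_sumr; apply: eq_bigr => k _; rewrite /christoffel -mulrA; congr (_ * (_ * _)).
  rewrite mxE; apply: eq_bigr => l _; rewrite mxE mulrC; congr (_ * _).
  have := GT Vx; move/(congr1 invmx); rewrite -trmx_inv => /matrixP /(_ l k).
  by rewrite mxE => ->.
by rewrite mulVmx ?Gu // mulmx1 mxE.
Qed.

Lemma conn_ring_mc i : Dm d i metric_ring = conn_ring i *m metric_ring + metric_ring *m (conn_ring i)^T.
Proof.
apply: ring_mx_inj => x Vx; rewrite eval_Dm_ring map_mxD !map_mxM -map_trmx !ring_mxE.
have Gs : forall y a b, V y -> G y a b = G y b a by move=> y a b Vy; rewrite -[in LHS](GT Vy) mxE.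
apply/matrixP => a b; rewrite !mxE.
have -> : \sum_k (map_mx (eval_in Vx) (conn_ring i)) a k * G x k b = \sum_k christoffel G k i a x * G x k b.
  by apply: eq_bigr => k _; rewrite mxE /eval_in conn_ringE.
have -> : \sum_k G x a k * ((map_mx (eval_in Vx) (conn_ring i))^T) k b = \sum_k christoffel G k i b x * G x k a.
  by apply: eq_bigr => k _; rewrite !mxE mulrC Gs //; congr (_ * _); rewrite /eval_in to_smoothE.
rewrite !christoffel_lower //.
have E l p q : partial l (fun y => G y p q) x = partial l (fun y => G y q p) x.
  by apply: (partial_eq hV l (sG q p) Vx) => y Vy; rewrite Gs.
rewrite (E i b a) (E a i b) (E b i a).
by move: (partial _ _ _) (partial _ _ _) (partial _ _ _) => p q r; field.
Qed.

Lemma eval_hess f (sf : smooth_on V f) i j x (Vx : V x) :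
  eval_in Vx (hess d conn_ring (to_smooth sf) i j) = hessian G f i j x.
Proof.
rewrite mxE rmorphB /= rmorph_sum /hessian; congr (_ - _).
  rewrite /eval_in deriv_ringE //.
  apply: (partial_eq hV i _ Vx); first exact: smooth_on_partial.
  by move=> y Vy; rewrite partial_to_smooth.
apply: eq_bigr => k _; rewrite rmorphM /=; congr (_ * _); first by rewrite /eval_in conn_ringE.
by rewrite /eval_in partial_to_smooth.
Qed.

Lemma eval_lap f (sf : smooth_on V f) x (Vx : V x) :
  eval_in Vx (lap d inverse_ring conn_ring (to_smooth sf)) = laplacian G f x.
Proof.
rewrite /lap /mxtrace rmorph_sum /= /laplacian.
under eq_bigr => i _ do rewrite mxE rmorph_sum /=.
apply: eq_bigr => i _; apply: eq_bigr => j _.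
have -> : hess d conn_ring (to_smooth sf) j i = hess d conn_ring (to_smooth sf) i j.
  have hs := hess_sym (@deriv_ringC _ _ _ hV) conn_ring_tf (to_smooth sf).
  by rewrite -[in LHS]hs mxE.
rewrite rmorphM /= eval_hess; congr (_ * _).
by rewrite mxE /eval_in to_smoothE.
Qed.

Lemma eval_ric i j x (Vx : V x) : eval_in Vx (ricm d conn_ring i j) = ricci G i j x.
Proof.
rewrite mxE rmorph_sum /ricci; apply: eq_bigr => k _.
rewrite /curv !entE rmorphD rmorphB rmorphB /= /riemann.
have D a b c e : eval_in Vx (Dm d a (conn_ring b) c e) = partial a (christoffel G e b c) x.
  rewrite [Dm _ _ _ _ _]mxE [conn_ring _ _ _]mxE /eval_in; exact: partial_to_smooth.
rewrite !D -!addrA; congr (_ + (_ + _)).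
rewrite ![((_ *m _) _ _)]mxE !rmorph_sum /= sumrB [LHS]addrC; congr (_ + - _).
  by apply: eq_bigr => m _; rewrite rmorphM /= /eval_in !conn_ringE // mulrC.
by apply: eq_bigr => m _; rewrite rmorphM /= /eval_in !conn_ringE // mulrC.
Qed.
End LocalRing.

(** * Maximum principles *)

Section PositiveMatrices.
Context {R : realType}.

Definition posdef p (G : 'M[R]_p) := forall v : 'rV[R]_p, v != 0 -> 0 < (v *m G *m v^T) 0 0.

Lemma posdef_unit p (G : 'M[R]_p) : posdef G -> G \in unitmx.
Proof.
move=> pG; rewrite -row_free_unit -kermx_eq0; apply/eqP/row_matrixP => i; rewrite row0.
apply/eqP/contraT => ri; have := pG _ ri.
have -> : row i (kermx G) *m G = 0 by rewrite -row_mul mulmx_ker row0.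
by rewrite mul0mx mxE ltxx.
Qed.

Lemma posdef_inv p (G : 'M[R]_p) : G^T = G -> posdef G -> posdef (invmx G).
Proof.
move=> GT pG v v0; have uG := posdef_unit pG.
have w0 : v *m invmx G != 0.
  by apply: contraNneq v0 => e; rewrite -(mulmxKV uG v) e mul0mx.
have := pG _ w0; rewrite trmx_mul trmx_inv GT.
by rewrite (mulmxKV uG) mulmxA.
Qed.

Lemma posdef_ge0 p (G : 'M[R]_p) (v : 'rV[R]_p) : posdef G -> 0 <= (v *m G *m v^T) 0 0.
Proof.
move=> pG; have [->|v0] := eqVneq v 0; first by rewrite !mul0mx mxE.
exact/ltW/pG.
Qed.

(** Induction on the size. The Schur complement of the first entry is again positive definite: its
    value at w is that of the form at (s, w) with s = - a^-1 w b^T. *)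
Lemma cholesky p (G : 'M[R]_p) : G^T = G -> posdef G -> exists2 B : 'M[R]_p, B *m B^T = G & B \in unitmx.
Proof.
move=> GT pG; have uG := posdef_unit pG.
suff [B BB] : exists B : 'M[R]_p, B *m B^T = G.
  exists B => //; move: uG; rewrite -BB unitmx_mul => /andP[]; by [].
move=> {uG}; elim: p G GT pG => [|p IH] G GT pG; first by exists 0; apply/matrixP => -[].
rewrite -[p.+1]/(1 + p)%N in G GT pG *.
pose a := ulsubmx G; pose b := ursubmx G; pose C := drsubmx G.
have dE : dlsubmx G = b^T by rewrite -[in LHS]GT -trmx_ursub.
have CT : C^T = C by rewrite -[in RHS]/C /C -[in RHS]GT trmx_drsub.
have GE : G = block_mx a b b^T C by rewrite -dE submxK.
have quad (s : 'M[R]_1) (w : 'rV[R]_p) :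
   row_mx s w *m G *m (row_mx s w)^T = s *m a *m s^T + w *m b^T *m s^T + (s *m b *m w^T + w *m C *m w^T).
  by rewrite GE tr_row_mx mul_row_block mul_row_col !mulmxDl.
have a0 : 0 < a 0 0.
  have /pG : row_mx 1%:M (0 : 'rV[R]_p) != 0.
    apply/eqP => /(congr1 lsubmx); rewrite row_mxKl => /matrixP /(_ 0 0).
    by rewrite !mxE => /eqP; rewrite oner_eq0.
  by rewrite quad !mul0mx !mul1mx trmx1 mulmx1 trmx0 mulmx0 !addr0.
have aE : a = (a 0 0)%:M by rewrite [LHS]mx11_scalar.
pose S := C - (a 0 0)^-1 *: (b^T *m b).
have ST : S^T = S.
  by rewrite /S linearB linearZ /= trmx_mul trmxK CT.
have [|B BB] := IH S ST.
  move=> w w0; set s := - (a 0 0)^-1 *: (w *m b^T).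
  have /pG : row_mx s w != 0.
    by apply: contraNneq w0 => /(congr1 rsubmx); rewrite row_mxKr => ->; apply/eqP/rowP => i; rewrite !mxE.
  suff -> : row_mx s w *m G *m (row_mx s w)^T = w *m S *m w^T by [].
  rewrite quad aE mul_mx_scalar /s scalerA mulrN divff ?gt_eqF // scaleN1r mulNmx addNr add0r.
  by rewrite /S mulmxBr mulmxBl -scalemxAr -!scalemxAl scaleNr addrC mulmxA.
pose r := Num.sqrt (a 0 0).
have r0 : r != 0 by rewrite gt_eqF // sqrtr_gt0.
have rr : r * r = a 0 0 by rewrite -expr2 sqr_sqrtr // ltW.
exists (block_mx r%:M 0 (r^-1 *: b^T) B).
rewrite GE (tr_block_mx r%:M) mulmx_block !trmx0 !mulmx0 !mul0mx !addr0 tr_scalar_mx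
  -scalar_mxM rr -aE !mul_mx_scalar mul_scalar_mx; congr (block_mx _ _ _ _).
- by rewrite linearZ /= trmxK scalerA divff // scale1r.
- by rewrite scalerA divff // scale1r.
- rewrite BB /S linearZ /= trmxK -scalemxAl -scalemxAr scalerA -invfM rr.
  by rewrite addrC subrK.
Qed.

Lemma mxtrace_sqr p (S : 'M[R]_p) : S^T = S -> \tr (S *m S) = \sum_i \sum_j S i j ^+ 2.
Proof.
move=> ST; rewrite /mxtrace; apply: eq_bigr => i _; rewrite mxE; apply: eq_bigr => j _.
by rewrite expr2 -[in X in _ * X = _]ST mxE.
Qed.

Lemma sum_sqr_eq0 (I J : finType) (F : I -> J -> R) : \sum_i \sum_j F i j ^+ 2 <= 0 -> forall i j, F i j = 0.
Proof.
move=> s0 i j; have /eqP : \sum_i \sum_j F i j ^+ 2 = 0.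
  apply/eqP; rewrite eq_le s0 sumr_ge0 // => k _; apply: sumr_ge0 => l _; exact: sqr_ge0.
rewrite psumr_eq0 => [/allP /(_ i (mem_index_enum _)) /=|k _]; last first.
  by apply: sumr_ge0 => l _; exact: sqr_ge0.
rewrite psumr_eq0 => [/allP /(_ j (mem_index_enum _)) /=|k _]; last exact: sqr_ge0.
by rewrite sqrf_eq0 => /eqP.
Qed.

Lemma mxtrace_congr p (B T : 'M[R]_p) : \tr ((B *m B^T *m T) *m (B *m B^T *m T)) = \tr ((B^T *m T *m B) *m (B^T *m T *m B)).
Proof. by rewrite -!mulmxA mxtrace_mulC -!mulmxA. Qed.

(** With H = B B^T the trace is that of the square of the symmetric matrix B^T T B, a sum of
    squares. *)
Lemma posdef_trace_sqr p (H T : 'M[R]_p) : H^T = H -> posdef H -> T^T = T ->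
  0 <= \tr ((H *m T) *m (H *m T)) /\ (\tr ((H *m T) *m (H *m T)) <= 0 -> T = 0).
Proof.
move=> HT pH TT; have [B BB uB] := cholesky HT pH.
have ST : (B^T *m T *m B)^T = B^T *m T *m B by rewrite !trmx_mul trmxK TT mulmxA.
rewrite -BB mxtrace_congr mxtrace_sqr //; split.
  by apply: sumr_ge0 => k _; apply: sumr_ge0 => l _; exact: sqr_ge0.
move=> /sum_sqr_eq0 S0.
have e : B^T *m T *m B = 0 by apply/matrixP => i j; rewrite S0 mxE.
have uBT : B^T \in unitmx by rewrite unitmx_tr.
by rewrite -(mulKmx uBT T) -(mulmxK uB (B^T *m T)) e mul0mx mulmx0.
Qed.

Lemma posdef_trace_le0 p (H D : 'M[R]_p) : H^T = H -> posdef H ->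
  (forall v : 'rV[R]_p, (v *m D *m v^T) 0 0 <= 0) -> \tr (H *m D) <= 0.
Proof.
move=> HT pH nD; have [B BB uB] := cholesky HT pH.
rewrite -BB -mulmxA mxtrace_mulC; apply: sumr_le0 => i _.
have -> : (B^T *m D *m B) i i = (row i B^T *m D *m (row i B^T)^T) 0 0.
  by rewrite tr_row trmxK -row_mul !mxE; apply: eq_bigr => k _; rewrite !mxE.
exact: nD.
Qed.

(** The columns of [B] form an orthonormal frame. In it the curvature endomorphisms are
    antisymmetric, so that - tr (K K) is a sum of squares of their entries; hence the sign in the
    definition of [kap]. *)
Lemma posdef_curvature p (G H : 'M[R]_p) (F : 'I_p -> 'I_p -> 'M[R]_p) :
  H^T = H -> posdef H -> G *m H = 1%:M ->
  (forall i j, (F i j *m G)^T = - (F i j *m G)) ->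
  let kap := - \tr (H *m \matrix_(j, l) \tr (H *m \matrix_(i, k) \tr (F i j *m F k l))) in
  0 <= kap /\ (kap <= 0 -> forall i j, F i j = 0).
Proof.
move=> HT pH GH Fa; have [B BB uB] := cholesky HT pH.
have uBT : B^T \in unitmx by rewrite unitmx_tr.
(* [P a b] is the curvature in the frame directions a, b, and [K a b] below its matrix in the
   frame. *)
pose P a b := \sum_i \sum_j (B i a * B j b) *: F i j.
pose K a b := B^T *m P a b *m invmx B^T.
have GE : G = invmx B^T *m invmx B.
  have uH : H \in unitmx by rewrite -BB unitmx_mul uB.
  have e : invmx B^T *m invmx B *m H = 1%:M.
    by rewrite -BB -mulmxA (mulmxA (invmx B)) mulVmx // mul1mx mulVmx.
  by rewrite -[LHS]mul1mx -e -(mulmxA (invmx B^T *m invmx B)) (mulmx1C GH) mulmx1.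
have Pa a b : (P a b *m G)^T = - (P a b *m G).
  rewrite /P mulmx_suml linear_sum -sumrN; apply: eq_bigr => i _.
  rewrite mulmx_suml linear_sum -sumrN; apply: eq_bigr => j _.
  by rewrite -scalemxAl linearZ /= Fa scalerN.
have Ka a b : (K a b)^T = - K a b.
  have KE : K a b = B^T *m (P a b *m G) *m B.
    by rewrite GE /K -!mulmxA mulVmx // mulmx1.
  move: Pa KE => /(_ a b); set X := P a b *m G => XT ->.
  rewrite /X in XT *; move: (P a b *m G) XT => {}X XT.
  by rewrite !trmx_mul XT trmxK mulNmx mulmxN -mulmxA.
have trK a b : \tr (P a b *m P a b) = - \sum_i \sum_j K a b i j ^+ 2.
  have -> : \tr (P a b *m P a b) = \tr (K a b *m K a b).
    rewrite /K mxtrace_mulC -!mulmxA [X in _ = \tr (_ *m (_ *m X))]mulmxA mulVmx // mul1mx.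
    by rewrite [RHS]mxtrace_mulC !mulmxA mulmxKV.
  rewrite /mxtrace -sumrN; apply: eq_bigr => i _; rewrite mxE -sumrN; apply: eq_bigr => j _.
  by have /matrixP /(_ i j) := Ka a b; rewrite !mxE => ->; ring.
have trH X : \tr (H *m X) = \sum_a \sum_i \sum_k B i a * B k a * X i k.
  rewrite -BB -mulmxA mxtrace_mulC /mxtrace; apply: eq_bigr => a _.
  rewrite -mulmxA mxE; apply: eq_bigr => i _; rewrite mxE !mxE mulr_sumr.
  by apply: eq_bigr => k _; rewrite -mulrA [B k a * _]mulrC.
have tr2 (c : 'I_p -> R) (X Y : 'I_p -> 'M[R]_p) :
    \tr ((\sum_i c i *: X i) *m (\sum_k c k *: Y k)) = \sum_i \sum_k c i * c k * \tr (X i *m Y k).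
  rewrite mulmx_suml linear_sum; apply: eq_bigr => i _ /=.
  rewrite mulmx_sumr linear_sum; apply: eq_bigr => k _ /=.
  by rewrite -scalemxAl -scalemxAr scalerA linearZ.
have exch (f : 'I_p -> 'I_p -> 'I_p -> R) : \sum_j \sum_l \sum_a f j l a = \sum_a \sum_j \sum_l f j l a.
  by rewrite [RHS]exchange_big; apply: eq_bigr => j _; rewrite exchange_big.
have PE a b : P a b = \sum_i B i a *: \sum_j B j b *: F i j.
  apply: eq_bigr => i _; rewrite scaler_sumr; apply: eq_bigr => j _.
  by rewrite scalerA.
have kapE : - \tr (H *m \matrix_(j, l) \tr (H *m \matrix_(i, k) \tr (F i j *m F k l))) =
   \sum_b \sum_a \sum_i \sum_j K a b i j ^+ 2.
  rewrite trH -sumrN; apply: eq_bigr => b _.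
  transitivity (- \sum_a \tr (P a b *m P a b)); last first.
    by rewrite -sumrN; apply: eq_bigr => a _; rewrite trK opprK.
  congr (- _).
  under eq_bigr => j _ do under eq_bigr => l _ do rewrite mxE trH mulr_sumr.
  rewrite exch; apply: eq_bigr => a _; rewrite PE tr2.
  under eq_bigr => j _ do under eq_bigr => l _ do rewrite mulr_sumr.
  rewrite exch; apply: eq_bigr => i _.
  under eq_bigr => j _ do under eq_bigr => l _ do rewrite mulr_sumr.
  rewrite exch; apply: eq_bigr => k _; rewrite tr2 mulr_sumr; apply: eq_bigr => j _.
  rewrite mulr_sumr; apply: eq_bigr => l _; rewrite !mxE; ring.
split; first by rewrite kapE; do 4! (apply: sumr_ge0 => ? _); exact: sqr_ge0.
rewrite kapE => k0.
have P0 a b : P a b = 0.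
  have K0 : K a b = 0.
    apply/matrixP => i j; rewrite [RHS]mxE; move: i j; apply: sum_sqr_eq0.
    apply: le_trans k0; rewrite [leRHS](bigD1 b) //= [X in _ <= X + _](bigD1 a) //= -addrA lerDl addr_ge0 //.
      by apply: sumr_ge0 => ? _; do 2! (apply: sumr_ge0 => ? _); exact: sqr_ge0.
    by do 4! (apply: sumr_ge0 => ? _); exact: sqr_ge0.
  have := congr1 (fun X => invmx B^T *m X *m B^T) K0; rewrite /K mulmx0 mul0mx => <-.
  by rewrite !mulmxA mulVmx // mul1mx mulmxKV.
have inv (X : 'I_p -> 'M[R]_p) : (forall a, \sum_i B i a *: X i = 0) -> forall i, X i = 0.
  move=> h i; apply/matrixP => s t; rewrite mxE.
  have e : (\row_k X k s t) *m B = 0.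
    apply/rowP => a; have /matrixP /(_ s t) := h a; rewrite summxE [RHS]mxE => e.
    rewrite [RHS]mxE -e [LHS]mxE.
    by apply: eq_bigr => k _; rewrite !mxE mulrC.
  by have /rowP /(_ i) := congr1 (mulmxr (invmx B)) e; rewrite /= mulmxK // mul0mx !mxE.
move=> i j; apply: (inv (F i)) => b.
by apply: (inv (fun i => \sum_j B j b *: F i j)) => a; rewrite -PE.
Qed.
End PositiveMatrices.

(** * First and second order conditions at a maximum *)

Section SecondDerivative.
Context {R : realType} {n : nat}.
Implicit Types (f g : 'rV[R]_n -> R) (x v : 'rV[R]_n) (U : set 'rV[R]_n) (i : 'I_n).

Lemma pdM f g x i : differentiable f x -> differentiable g x ->
  pd i (fun y => f y * g y) x = pd i f x * g x + f x * pd i g x.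
Proof.
move=> df dg; rewrite !pdE (deriveM (diff_derivable _) (diff_derivable _)) // addrC.
by rewrite /GRing.scale /= [_ * g x]mulrC.
Qed.

Lemma pdD f g x i : differentiable f x -> differentiable g x ->
  pd i (fun y => f y + g y) x = pd i f x + pd i g x.
Proof. by move=> df dg; rewrite !pdE (deriveD (diff_derivable _) (diff_derivable _)). Qed.

Lemma pdB f g x i : differentiable f x -> differentiable g x ->
  pd i (fun y => f y - g y) x = pd i f x - pd i g x.
Proof. by move=> df dg; rewrite !pdE (deriveB (diff_derivable _) (diff_derivable _)). Qed.

Lemma pd_cst (c : R) x i : pd i (fun=> c) x = 0.
Proof. by rewrite pdE derive_cst. Qed.

Lemma pd_sum m (F : 'I_m -> 'rV[R]_n -> R) x i : (forall k : 'I_m, differentiable (F k) x) ->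
  pd i (fun y => \sum_k F k y) x = \sum_k pd i (F k) x.
Proof.
move=> dF; have -> : (fun y => \sum_k F k y) = \sum_k F k by apply/funext => y; rewrite fct_sumE.
rewrite pdE derive_sum => [|j]; last exact: diff_derivable.
by apply: eq_bigr => j _; rewrite pdE.
Qed.

Lemma pd_cmul f (c : R) x i : differentiable f x -> pd i (fun y => c * f y) x = c * pd i f x.
Proof. by move=> df; rewrite (pdM i (differentiable_cst c x) df) pd_cst mul0r add0r. Qed.

Lemma pos_deriv_right (h : R -> R) (l : R) : is_derive (0 : R) 1 h l -> 0 < l ->
  exists2 e : R, 0 < e & forall t : R, 0 < t <= e -> h 0 < h t.
Proof.
move=> [dh hl] l0.
have cv : (fun t : R => t^-1 *: ((h \o shift 0) (t *: 1) - h 0)) @ 0^' --> l by rewrite -hl; exact: dh.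
have /cvgrPdist_lt /(_ _ l0) [e /= e0 he] := cv.
exists (e / 2) => [|t /andP[t0 te]]; first by rewrite divr_gt0.
have := he t; rewrite /ball_ /= sub0r normrN gtr0_norm // => /(_ _).
have te' : t < e by lra.
move=> /(_ te').
move=> /(_ (lt0r_neq0 t0)); rewrite /shift /= addr0 [t *: 1]mulr1 => hd.
have : 0 < t^-1 *: (h t - h 0) by move: hd; rewrite ltr_norml => /andP[_]; lra.
by rewrite /GRing.scale /= pmulr_rgt0 ?invr_gt0 // subr_gt0.
Qed.

Lemma smooth_continuous U f x : smooth_open U f -> U x -> {for x, continuous f}.
Proof. by move=> sf Ux; apply/differentiable_continuous/(smooth_diff sf). Qed.

Lemma smooth_line_derive U f x v (s : R) : smooth_open U f -> U (x + s *: v) ->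
  is_derive s 1 (fun t : R => f (x + t *: v)) (\sum_i v 0 i * pd i f (x + s *: v)).
Proof.
move=> sf Ux; have df := smooth_diff sf Ux.
by rewrite -derive_pd //; exact: line_is_derive.
Qed.

Lemma open_line U x v : open U -> U x -> exists2 e : R, 0 < e & forall t : R, `|t| <= e -> U (x + t *: v).
Proof.
move=> oU Ux; have [e e0 he] := open_near_segment v 0 oU Ux.
exists e => // t te; have := he t 0 te; rewrite normr0 (ltW e0) scaler0 addr0; exact.
Qed.

Lemma max_critical U f x : open U -> smooth_open U f -> U x -> (forall y, U y -> f y <= f x) ->
  forall i, pd i f x = 0.
Proof.
move=> oU sf Ux mx i.
have key v : \sum_i v 0 i * pd i f x <= 0.
  rewrite leNgt; apply/negP => p0.
  have D : is_derive (0 : R) 1 (fun t : R => f (x + t *: v)) (\sum_i v 0 i * pd i f x).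
    by have := @smooth_line_derive U f x v 0 sf; rewrite scale0r addr0; exact.
  have [e e0 he] := pos_deriv_right D p0; have [e' e'0 he'] := open_line v oU Ux.
  set t := Order.min e e'; have t0 : 0 < t by rewrite lt_min e0.
  have /he : 0 < t <= e by rewrite t0 ge_min lexx.
  rewrite scale0r addr0 ltNge mx //; apply: he'.
  by rewrite gtr0_norm // ge_min lexx orbT.
have E (c : R) : \sum_j (c *: 'e_i : 'rV[R]_n) 0 j * pd j f x = c * pd i f x.
  rewrite (bigD1 i) //= !mxE !eqxx mulr1 big1 ?addr0 // => j ji.
  by rewrite !mxE (negPf ji) andbF mulr0 mul0r.
have := key (1 *: 'e_i); have := key (-1 *: 'e_i); rewrite !E; lra.
Qed.

Lemma pd_dir U f v x i : smooth_open U f -> U x ->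
  pd i (fun y => \sum_j v 0 j * pd j f y) x = \sum_j v 0 j * pd i (pd j f) x.
Proof.
move=> sf Ux; have dj j : differentiable (pd j f) x by exact: smooth_diff (smooth_pd j sf) Ux.
rewrite pd_sum => [|j]; first by apply: eq_bigr => j _; exact: pd_cmul.
by apply: differentiableM => //; exact: differentiable_cst.
Qed.

(** If the second derivative along v were positive, the first one, which vanishes at [x], would be
    positive just after, and f would exceed [f x]. *)
Lemma max_hessian U f x : open U -> smooth_open U f -> U x -> (forall y, U y -> f y <= f x) ->
  forall v, (v *m (\matrix_(i, j) pd i (pd j f) x) *m v^T) 0 0 <= 0.
Proof.
move=> oU sf Ux mx v; have crit := max_critical oU sf Ux mx.
pose g y := \sum_j v 0 j * pd j f y.
have sg : smooth_open U g.
  by apply: smooth_sum => // j _; apply: smooth_openM => //; [exact: smooth_cst|exact: smooth_pd].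
have D : is_derive (0 : R) 1 (fun t : R => g (x + t *: v)) (\sum_i v 0 i * pd i g x).
  by have := @smooth_line_derive U g x v 0 sg; rewrite scale0r addr0; exact.
have -> : (v *m (\matrix_(i, j) pd i (pd j f) x) *m v^T) 0 0 = \sum_i v 0 i * pd i g x.
  rewrite -mulmxA mxE; apply: eq_bigr => i _; rewrite (pd_dir v i sf Ux) mxE; congr (_ * _).
  by apply: eq_bigr => j _; rewrite !mxE mulrC.
rewrite leNgt; apply/negP => p0.
have [e e0 he] := pos_deriv_right D p0; have [e' e'0 he'] := open_line v oU Ux.
have g0 : g x = 0 by rewrite /g big1 // => i _; rewrite crit mulr0.
set t := Order.min e e'; have t0 : 0 < t by rewrite lt_min e0.
have inU (s : R) : 0 <= s <= t -> U (x + s *: v).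
  move=> /andP[s0 st]; apply: he'; rewrite ger0_norm //; apply: (le_trans st).
  by rewrite ge_min lexx orbT.
have [|s /andP[s0 st]] := @MVT0 R (fun t : R => f (x + t *: v)) (fun t => g (x + t *: v)) t t0.
  by move=> s /inU Us; exact: smooth_line_derive sf Us.
rewrite scale0r addr0 => e1.
have : 0 < g (x + s *: v) * t.
  rewrite mulr_gt0 //; have := he s; rewrite scale0r addr0 g0 s0 /=; apply.
  by apply: (le_trans (ltW st)); rewrite ge_min lexx.
rewrite -e1 subr_gt0 ltNge mx //; apply: inU; by rewrite ltW //= lexx.
Qed.
End SecondDerivative.

Section Elliptic.
Context {R : realType} {n : nat}.
Variables (U : set 'rV[R]_n) (a : 'rV[R]_n -> 'M[R]_n) (b : 'rV[R]_n -> 'rV[R]_n).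
Hypotheses (oU : open U) (aT : forall x, U x -> (a x)^T = a x) (ap : forall x, U x -> posdef (a x)).
Implicit Types (f g : 'rV[R]_n -> R) (x y z : 'rV[R]_n).

Definition elliptic f x := \sum_i \sum_j a x i j * pd i (pd j f) x + \sum_i b x 0 i * pd i f x.

Lemma elliptic_max f x : smooth_open U f -> U x -> (forall y, U y -> f y <= f x) -> elliptic f x <= 0.
Proof.
move=> sf Ux mx; rewrite /elliptic [X in _ + X]big1 ?addr0; last first.
  by move=> i _; rewrite (max_critical oU sf Ux mx) mulr0.
have := posdef_trace_le0 (aT Ux) (ap Ux) (max_hessian oU sf Ux mx).
congr (_ <= 0); apply: eq_bigr => i _; rewrite mxE; apply: eq_bigr => j _; rewrite mxE.
exact: (congr1 (fun t => a x i j * t) (pdC j i oU sf Ux)).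
Qed.

Lemma pd_lin f g x i (c : R) : differentiable f x -> differentiable g x ->
  pd i (fun y => f y + c * g y) x = pd i f x + c * pd i g x.
Proof.
move=> df dg; rewrite pdD ?pd_cmul //; apply: differentiableM => //; exact: differentiable_cst.
Qed.

Lemma pd_lin2 f g x i j (c : R) : smooth_open U f -> smooth_open U g -> U x ->
  pd i (pd j (fun y => f y + c * g y)) x = pd i (pd j f) x + c * pd i (pd j g) x.
Proof.
move=> sf sg Ux.
have sfg : smooth_open U (fun y => f y + c * g y).
  by apply: smooth_openD => //; apply: smooth_openM => //; exact: smooth_cst.
rewrite -pd_lin; [|exact: smooth_diff (smooth_pd j sf) Ux|exact: smooth_diff (smooth_pd j sg) Ux].
rewrite !pdE; apply: near_eq_derive; near=> y; apply: pd_lin; apply: smooth_diff; [exact: sf| |exact: sg|]; near: y; exact: open_nbhs_nbhs.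
Unshelve. all: by end_near. Qed.

Lemma ellipticD f g x (c : R) : smooth_open U f -> smooth_open U g -> U x ->
  elliptic (fun y => f y + c * g y) x = elliptic f x + c * elliptic g x.
Proof.
move=> sf sg Ux; rewrite /elliptic mulrDr addrACA; congr (_ + _).
  rewrite mulr_sumr -big_split; apply: eq_bigr => i _ /=; rewrite mulr_sumr -big_split; apply: eq_bigr => j _ /=.
  by rewrite (pd_lin2 _ _ _ sf sg Ux) mulrDr [X in _ + X]mulrCA.
rewrite mulr_sumr -big_split; apply: eq_bigr => i _ /=.
rewrite pd_lin; [by rewrite mulrDr [X in _ + X]mulrCA|exact: smooth_diff sf Ux|exact: smooth_diff sg Ux].
Qed.
End Elliptic.

Lemma compact_level {T : topologicalType} {R : realType} (K : set T) (f : T -> R) (m : R) :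
  hausdorff_space T -> compact K -> (forall x, K x -> {for x, continuous f}) ->
  compact (K `&` [set x | f x = m]).
Proof.
move=> hT cK cf; apply: (subclosed_compact _ cK); last by move=> x [].
have clK : closed K by exact: compact_closed.
move=> x hx; have Kx : K x by apply: clK => B /hx [y [[Ky _] By]]; exists y.
split => //=; apply/eqP; rewrite eq_sym -subr_eq0 -normr_le0 leNgt; apply/negP => d0.
have /(@cvgrPdist_lt _ _ _ (nbhs x)) /(_ _ d0) := cf x Kx.
move=> /hx [y [[_ /= fy]]]; by rewrite fy distrC ltxx.
Qed.

Section PartialRules.
Context {R : realType} {n : nat}.
Implicit Types (f g : 'rV[R]_n -> R) (x z : 'rV[R]_n) (i j : 'I_n).

Lemma pd_coord j x i : pd i (fun y => y 0 j) x = (i == j)%:R.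
Proof.
rewrite pdE; have h : forall t : R, (fun t : R => (x + t *: 'e_i) 0 j) t = x 0 j + t * (i == j)%:R.
  by move=> t; rewrite !mxE eqxx [j == i]eq_sym.
have D : is_derive (0 : R) 1 (fun t : R => (x + t *: 'e_i) 0 j) (i == j)%:R.
  rewrite (_ : (fun t : R => _) = cst (x 0 j) + (fun t : R => t * (i == j)%:R)); last by apply/funext => t; rewrite h.
  apply: is_derive_eq; rewrite add0r; by rewrite !(scaler0, scale1r, add0r, addr0) ?mulr1 // /GRing.scale /= mulr1.
have D2 : is_derive (x + 0 *: 'e_i) 'e_i (fun y : 'rV[R]_n => y 0 j) (i == j)%:R by exact/is_derive_lineP.
by move: D2; rewrite scale0r addr0 => -[_ ->].
Qed.

Lemma smooth_setT_diff f x : smooth_open setT f -> differentiable f x.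
Proof. by move=> sf; exact: smooth_diff sf Logic.I. Qed.

Lemma smooth_coordB z i : smooth_open setT (fun x => x 0 i - z 0 i).
Proof. by apply: (smooth_openB openT); [exact: (smooth_coord openT)|exact: (smooth_cst openT)]. Qed.

Lemma sqdistE z : (fun x => sqnorm (x - z)) = (fun x => \sum_i (x 0 i - z 0 i) * (x 0 i - z 0 i)).
Proof. by apply/funext => x; apply: eq_bigr => i _; rewrite !mxE expr2. Qed.

Lemma smooth_sqdist z : smooth_open setT (fun x => sqnorm (x - z)).
Proof. by rewrite sqdistE; apply: (smooth_sum openT) => i _; apply: (smooth_openM openT); exact: smooth_coordB. Qed.

Lemma pd_sqdist z i : pd i (fun x => sqnorm (x - z)) = (fun x => 2 * (x 0 i - z 0 i)).
Proof.
apply/funext => x; have dj j : differentiable (fun y : 'rV[R]_n => y 0 j - z 0 j) x.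
  exact: smooth_setT_diff (smooth_coordB z j).
have pj j : pd i (fun y : 'rV[R]_n => y 0 j - z 0 j) x = (i == j)%:R.
  by rewrite pdB ?pd_coord ?pd_cst ?subr0 //; exact: differentiable_coord.
rewrite sqdistE pd_sum => [|j]; last exact: differentiableM.
rewrite (bigD1 i) //= big1 ?addr0 => [|j ji]; last by rewrite pdM // pj eq_sym (negPf ji) mul0r mulr0 addr0.
by rewrite pdM // pj eqxx mulr1 mul1r; ring.
Qed.

Lemma sqnorm_ge0 (x : 'rV[R]_n) : 0 <= sqnorm x.
Proof. by apply: sumr_ge0 => i _; exact: sqr_ge0. Qed.

Lemma sqnorm0 : sqnorm (0 : 'rV[R]_n) = 0.
Proof. by rewrite /sqnorm big1 // => i _; rewrite mxE expr0n. Qed.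

Lemma sqnormN (x : 'rV[R]_n) : sqnorm (- x) = sqnorm x.
Proof. by apply: eq_bigr => i _; rewrite mxE sqrrN. Qed.

Lemma sqnormZ (c : R) (x : 'rV[R]_n) : sqnorm (c *: x) = c ^+ 2 * sqnorm x.
Proof. by rewrite /sqnorm mulr_sumr; apply: eq_bigr => i _; rewrite mxE exprMn. Qed.

Lemma sqnormB (x y : 'rV[R]_n) : sqnorm (x - y) = sqnorm (y - x).
Proof. by rewrite -sqnormN opprB. Qed.

Lemma sqnormD_le (x y : 'rV[R]_n) : sqnorm (x + y) <= 2 * (sqnorm x + sqnorm y).
Proof.
rewrite /sqnorm -big_split mulr_sumr; apply: ler_sum => i _; rewrite !mxE.
by have := sqr_ge0 (x 0 i - y 0 i); rewrite !expr2 /=; nra.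
Qed.

Lemma sqnorm_coord (x : 'rV[R]_n) i : x 0 i ^+ 2 <= sqnorm x.
Proof. by rewrite /sqnorm (bigD1 i) //= lerDl sumr_ge0 // => j _; exact: sqr_ge0. Qed.

Lemma sqnorm_eq0 (x : 'rV[R]_n) : sqnorm x = 0 -> x = 0.
Proof.
move=> x0; apply/rowP => i; rewrite mxE; apply/eqP; rewrite -sqrf_eq0 eq_le sqr_ge0 andbT -x0.
exact: sqnorm_coord.
Qed.

Lemma sqnorm_le_norm (x : 'rV[R]_n) (e : R) : 0 <= e -> sqnorm x <= e ^+ 2 -> `|x| <= e.
Proof.
move=> e0 h; apply: norm_le_coord => // i.
rewrite -(ler_pXn2r (n:=2)) ?nnegrE // real_normK ?num_real //.
exact: le_trans (sqnorm_coord _ _) h.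
Qed.

Lemma open_sqball (U : set 'rV[R]_n) x : open U -> U x ->
  exists2 d : R, 0 < d & forall y, sqnorm (y - x) < d -> U y.
Proof.
move=> oU Ux; have /nbhs_ballP [e /= e0 he] : nbhs x U by exact: open_nbhs_nbhs.
exists ((e / 2) ^+ 2) => [|y yd]; first by rewrite exprn_gt0 // divr_gt0.
apply: he; rewrite -ball_normE /ball_ /= distrC.
have : `|y - x| <= e / 2 by apply: sqnorm_le_norm; [rewrite divr_ge0 // ltW|exact: ltW].
move: e0; lra.
Qed.

Lemma compact_sqball z (r2 : R) : compact [set x | sqnorm (x - z) <= r2].
Proof.
have [r0|r0] := leP 0 r2; last first.
  suff -> : [set x | sqnorm (x - z) <= r2] = set0 by exact: compact0.
  by apply/seteqP; split => // x /= h; have := sqnorm_ge0 (x - z); lra.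
apply: (subclosed_compact _ (@compact_ccube R n z (r2 + 1))).
  apply: (@closed_comp _ _ (fun x => sqnorm (x - z)) [set t | t <= r2]); last exact: closed_le.
  by move=> x _; apply: smooth_continuous (smooth_sqdist z) _.
move=> x /= hx i; have := le_trans (sqnorm_coord (x - z) i) hx; rewrite !mxE => h.
rewrite -(ler_pXn2r (n:=2)) ?nnegrE ?addr_ge0 // real_normK ?num_real //.
by apply: (le_trans h); nra.
Qed.

Lemma closed_sqge z (c : R) : closed [set x | c <= sqnorm (x - z)].
Proof.
apply: (@closed_comp _ _ (fun x => sqnorm (x - z)) [set t | c <= t]); last exact: closed_ge.
by move=> x _; apply: smooth_continuous (smooth_sqdist z) _.
Qed.

Lemma open_sqlt z (c : R) : open [set x | sqnorm (x - z) < c].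
Proof.
apply: (@open_comp _ _ (fun x => sqnorm (x - z)) [set t | t < c]); last exact: open_lt.
by move=> x _; apply: smooth_continuous (smooth_sqdist z) _.
Qed.

Lemma near_sqball z (d : R) : 0 < d -> \forall x \near z, sqnorm (x - z) < d.
Proof. by move=> d0; apply: open_nbhs_nbhs; split; [exact: open_sqlt|rewrite /= subrr sqnorm0]. Qed.
End PartialRules.

(** * Hopf's lemma and the strong maximum principle *)

Section Hopf.
Context {R : realType} {n : nat}.
Variables (U : set 'rV[R]_n) (a : 'rV[R]_n -> 'M[R]_n) (b : 'rV[R]_n -> 'rV[R]_n).
Hypotheses (oU : open U) (aT : forall x, U x -> (a x)^T = a x) (ap : forall x, U x -> posdef (a x)).
Hypotheses (sa : forall i j, smooth_open U (fun x => a x i j)) (sb : forall i, smooth_open U (fun x => b x 0 i)).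
Variables (f : 'rV[R]_n -> R) (m : R).
Hypothesis sf : smooth_open U f.
Local Notation L := (elliptic a b).

Section Barrier.
Variables (z : 'rV[R]_n) (r2 K : R).
(* The barrier [q + K q^2], where [q] vanishes on the sphere: near the sphere [L q]
   is bounded, and the square contributes a large positive second-order term. *)
Definition hopf_q x : R := r2 - sqnorm (x - z).
Definition hopf_barrier x : R := hopf_q x + K * (hopf_q x * hopf_q x).
Local Notation q := hopf_q.

Lemma smooth_hopf_q : smooth_open setT q.
Proof. by apply: smooth_openB; [exact: openT|apply: smooth_cst; exact: openT|exact: smooth_sqdist]. Qed.

Lemma smooth_hopf_barrier : smooth_open setT hopf_barrier.
Proof.
have sq := smooth_hopf_q.
by apply: smooth_openD => //; [exact: openT|apply: smooth_openM; [exact: openT|apply: smooth_cst; exact: openT|apply: smooth_openM => //; exact: openT]].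
Qed.

Lemma pd_hopf_q i : pd i q = fun x => - 2 * (x 0 i - z 0 i).
Proof.
apply/funext => x; rewrite /q pdB; [|exact: differentiable_cst|exact: smooth_setT_diff (smooth_sqdist z)].
by rewrite pd_cst pd_sqdist; ring.
Qed.

Lemma pd_hopf_barrier i : pd i hopf_barrier = fun x => (1 + 2 * K * q x) * pd i q x.
Proof.
apply/funext => x; have dq : differentiable q x by exact: smooth_setT_diff smooth_hopf_q.
have dqq : differentiable (fun x => q x * q x) x by exact: differentiableM.
by rewrite /hopf_barrier pdD ?pd_cmul ?pdM //; [ring|apply: differentiableM => //; exact: differentiable_cst].
Qed.

Lemma pd2_hopf_barrier i j x : pd i (pd j hopf_barrier) x =
  (1 + 2 * K * q x) * pd i (pd j q) x + 2 * K * (pd i q x * pd j q x).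
Proof.
have sq := smooth_hopf_q; have dq : differentiable q x by exact: smooth_setT_diff sq.
have dc : differentiable (fun x => 2 * K * q x) x by apply: differentiableM => //; exact: differentiable_cst.
rewrite pd_hopf_barrier pdM; last 2 first.
- by apply: differentiableD => //; exact: differentiable_cst.
- by apply: smooth_setT_diff; exact: smooth_pd.
rewrite (pdD i (differentiable_cst _ _) dc) pd_cst pd_cmul //; move: (q x) (pd i q x) (pd j q x) (pd i (pd j q) x) => *; ring.
Qed.

Definition hopf_quad x : R := \sum_i \sum_j a x i j * ((x 0 i - z 0 i) * (x 0 j - z 0 j)).

Lemma elliptic_barrier x : L hopf_barrier x = (1 + 2 * K * q x) * L q x + 8 * K * hopf_quad x.
Proof.
have -> : L hopf_barrier x = \sum_i \sum_j a x i j * ((1 + 2 * K * q x) * pd i (pd j q) x)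
   + \sum_i \sum_j a x i j * (2 * K * (pd i q x * pd j q x)) + \sum_i b x 0 i * ((1 + 2 * K * q x) * pd i q x).
  rewrite /elliptic; congr (_ + _); last first.
    by apply: eq_bigr => i _; rewrite pd_hopf_barrier.
  rewrite -[RHS]big_split; apply: eq_bigr => i _; rewrite -[RHS]big_split; apply: eq_bigr => j _ /=.
  by rewrite pd2_hopf_barrier mulrDr.
rewrite addrAC; congr (_ + _).
  rewrite /elliptic [RHS]mulrDr; congr (_ + _); rewrite mulr_sumr.
    by apply: eq_bigr => i _; rewrite mulr_sumr; apply: eq_bigr => j _; rewrite mulrCA.
  by apply: eq_bigr => i _; rewrite mulrCA.
rewrite /hopf_quad mulr_sumr; apply: eq_bigr => i _; rewrite mulr_sumr; apply: eq_bigr => j _.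
by rewrite !pd_hopf_q; ring.
Qed.

Lemma smooth_hopf_quad : smooth_open U hopf_quad.
Proof.
have h i : smooth_open U (fun x => x 0 i - z 0 i) by apply: smooth_sub (smooth_coordB z i).
apply: smooth_sum => // i _; apply: smooth_sum => // j _.
by apply: smooth_openM => //; exact: smooth_openM.
Qed.

Lemma smooth_elliptic : smooth_open U (L q).
Proof.
have sq : smooth_open U q by apply: smooth_sub smooth_hopf_q.
apply: smooth_openD => //; apply: smooth_sum => // i _.
  by apply: smooth_sum => // j _; apply: smooth_openM => //; do 2! apply: smooth_pd.
by apply: smooth_openM => //; exact: smooth_pd.
Qed.

Lemma hopf_quad_gt0 x : U x -> x != z -> 0 < hopf_quad x.
Proof.
move=> Ux xz; have := ap Ux; move=> /(_ (x - z)); rewrite subr_eq0 => /(_ xz).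
congr (_ < _); rewrite -mulmxA mxE; apply: eq_bigr => i _; rewrite [(_ *m _) i 0]mxE mulr_sumr.
by apply: eq_bigr => j _; rewrite !mxE; ring.
Qed.
End Barrier.

(** On a thin shell inside the sphere, f plus a small multiple of the barrier is still at most m,
    with equality at p. Its derivative at p towards the centre is that of the barrier part alone,
    hence positive: a contradiction. *)
Lemma hopf z p (r2 : R) : 0 < r2 -> (forall x, sqnorm (x - z) <= r2 -> U x) ->
  (forall x, sqnorm (x - z) < r2 -> f x < m) -> (forall x, sqnorm (x - z) <= r2 -> f x <= m) ->
  (forall x, sqnorm (x - z) < r2 -> 0 <= L f x) ->
  sqnorm (p - z) = r2 -> f p = m -> (forall i, pd i f p = 0) -> False.
Proof.
move=> r20 BU fm fm' Lf pz fp dp.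
pose q := hopf_q z r2.
have [C C0 hC] : exists2 C : R, 0 <= C & forall x, sqnorm (x - z) <= r2 -> `|L q x| <= C.
  apply: within_compact_bounded; first exact: compact_sqball.
  apply: continuous_in_subspaceT => x; rewrite inE => /BU Ux.
  exact: smooth_continuous (smooth_elliptic z r2) Ux.
pose c1 := C + 1; have c10 : 0 < c1 by rewrite /c1; lra.
have Up : U p by apply: BU; rewrite pz.
(* The centre is kept out: the quadratic term is bounded below on the shell between r2 / 4 and
   r2. *)
have [lam lam0 hlam] : exists2 lam : R, 0 < lam & forall x, r2 / 4 <= sqnorm (x - z) <= r2 -> lam <= hopf_quad z x.
  pose A := [set x | sqnorm (x - z) <= r2] `&` [set x | r2 / 4 <= sqnorm (x - z)].
  have cA : compact A.
    apply: compact_closedI; first exact: compact_sqball.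
    exact: closed_sqge.
  have [||x0] := @EVT_min_rV R n (hopf_quad z) A _ cA.
  - by exists p; split => /=; rewrite pz; [|lra].
  - apply: continuous_in_subspaceT => x; rewrite inE => -[/BU Ux _].
    exact: smooth_continuous (smooth_hopf_quad z) Ux.
  rewrite inE => -[/= x0r x0l] mn.
  exists (hopf_quad z x0); last by move=> x /andP[h1 h2]; apply: mn; rewrite inE.
  apply: hopf_quad_gt0; first exact: BU.
  by apply: contraTneq x0l => ->; rewrite subrr sqnorm0 lt_geF ?divr_gt0.
(* So 8 K lam = 4 (C + 1), which beats (1 + 2 K q) L q >= - 2 C as long as 2 K q <= 1. *)
pose K := c1 / (2 * lam); have K0 : 0 < K by rewrite divr_gt0 // mulr_gt0.
(* The first bound keeps the shell at squared distance at least r2 / 4 from the centre, the second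
   one gives 2 K q0 <= 1. *)
pose q0 := Order.min (3 / 4 * r2) (lam / c1).
have q00 : 0 < q0 by rewrite lt_min divr_gt0 // andbT; lra.
pose v := hopf_barrier z r2 K.
have Kq : 2 * K * q0 <= 1.
  have : q0 <= lam / c1 by rewrite ge_min lexx orbT.
  move=> h; apply: (@le_trans _ _ (2 * K * (lam / c1))); first by rewrite ler_wpM2l // mulr_ge0 // ltW.
  by rewrite /K le_eqVlt; apply/orP; left; apply/eqP; field; rewrite !gt_eqF.
have qr : q0 <= 3 / 4 * r2 by rewrite ge_min lexx.
have Lv x : 0 <= q x <= q0 -> 0 < L v x.
  move=> /andP[qx0 qx1].
  have xr : r2 / 4 <= sqnorm (x - z) <= r2 by move: qx0 qx1; rewrite /q /hopf_q; lra.
  have := hlam x xr; have /hC : sqnorm (x - z) <= r2 by case/andP: xr.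
  rewrite elliptic_barrier -/q ler_norml => /andP[h1 _] h2.
  have k1 : 0 <= 2 * K * q x by rewrite mulr_ge0 // mulr_ge0 // ltW.
  have k2 : 2 * K * q x <= 1 by apply: le_trans Kq; rewrite ler_wpM2l // mulr_ge0 // ltW.
  have k3 : 8 * K * lam <= 8 * K * hopf_quad z x by rewrite ler_wpM2l // mulr_ge0 // ltW.
  have k4 : 8 * K * lam = 4 * c1 by rewrite /K; field; rewrite gt_eqF.
  rewrite k4 /c1 in k3; move: k1 k2 k3 h1.
  move: (2 * K * q x) (L q x) (8 * K * hopf_quad z x) => s l w k1 k2 k3 h1.
  have k5 : 0 <= (1 + s) * (l + C) by rewrite mulr_ge0 //; lra.
  have k6 : 0 <= (1 - s) * C by rewrite mulr_ge0 //; lra.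
  by lra.
pose A := [set x | sqnorm (x - z) <= r2] `&` [set x | r2 - q0 <= sqnorm (x - z)].
have [x1 hx1 mx1] : exists2 x, sqnorm (x - z) <= r2 - q0 & forall y, sqnorm (y - z) <= r2 - q0 -> f y <= f x.
  have [||x0] := @EVT_max_rV R n f [set x | sqnorm (x - z) <= r2 - q0] _ (@compact_sqball _ _ z _).
  - exists z => /=; rewrite subrr sqnorm0; lra.
  - apply: continuous_in_subspaceT => x; rewrite inE /= => hx; apply: smooth_continuous sf _.
    by apply: BU; lra.
  by rewrite inE /= => h1 h2; exists x0 => // y hy; apply: h2; rewrite inE.
have f1 : f x1 < m by apply: fm; lra.
pose v0 := q0 + K * (q0 * q0); have v00 : 0 < v0.
  by apply: addr_gt0 => //; apply: mulr_gt0 => //; apply: mulr_gt0.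
(* On the inner sphere the barrier equals [v0] and f <= f x1 < m, so this multiple brings the sum up
   to m at most. *)
pose eps := (m - f x1) / v0; have eps0 : 0 < eps by rewrite divr_gt0 // subr_gt0.
pose phi x := f x + eps * v x.
have sphi : smooth_open U phi.
  apply: smooth_openD => //; apply: smooth_openM => //; first exact: smooth_cst.
  by apply: smooth_sub (smooth_hopf_barrier z r2 K).
have cA : compact A.
  apply: compact_closedI; first exact: compact_sqball.
  exact: closed_sqge.
have [||y] := @EVT_max_rV R n phi A _ cA.
- by exists p; split => /=; rewrite pz //; lra.
- apply: continuous_in_subspaceT => x; rewrite inE => -[/BU Ux _].
  exact: smooth_continuous sphi Ux.
rewrite inE => -[/= y1 y2] my.
have phiy : phi y <= m.
  have [qy0|qy0] := eqVneq (q y) 0.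
    by rewrite /phi /v /hopf_barrier -/q qy0 mul0r mulr0 addr0 mulr0 addr0; exact: fm'.
  have [qyq|qyq] := eqVneq (q y) q0.
    have : f y <= f x1 by apply: mx1; move: qyq; rewrite /q /hopf_q; lra.
    rewrite /phi /v /hopf_barrier -/q qyq -/v0 /eps divfK ?gt_eqF //; lra.
  have qy : 0 < q y < q0.
    by rewrite !lt_neqAle eq_sym qy0 qyq /= /q /hopf_q; lra.
  pose U' := U `&` [set x | 0 < q x < q0].
  have cq : continuous q by move=> x; apply: smooth_continuous (smooth_hopf_q z r2) _.
  have oU' : open U'.
    apply: openI => //; rewrite (_ : [set x | _] = q @^-1` [set t | 0 < t] `&` q @^-1` [set t | t < q0]).
      by apply: openI; apply: open_comp => //.
    by apply/seteqP; split => x /= /andP.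
  have Uy : U y by exact: BU.
  have : L phi y <= 0.
    apply: (@elliptic_max R n U' a b oU') => //.
    - by move=> x [Ux _]; exact: aT.
    - by move=> x [Ux _]; exact: ap.
    - by apply: smooth_sub sphi => x [].
    - move=> x [Ux /= /andP[h1 h2]]; apply: my; rewrite inE; split => /=; move: h1 h2; rewrite /q /hopf_q; lra.
  rewrite (ellipticD a b oU eps sf) //; last by apply: smooth_sub (smooth_hopf_barrier z r2 K).
  have : 0 <= L f y by apply: Lf; move: qy; rewrite /q /hopf_q; lra.
  have : 0 < eps * L v y by rewrite mulr_gt0 // Lv //; case/andP: qy => h1 h2; rewrite !ltW.
  move: (eps * _) (L f y); rewrite -/v => s t h1 h2 h3; lra.
have phiA x : A x -> phi x <= m by move=> Ax; apply: le_trans phiy; apply: my; rewrite inE.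
have qp : q p = 0 by rewrite /q /hopf_q pz subrr.
have D : is_derive (0 : R) 1 (fun t : R => phi (p + t *: (z - p))) (\sum_i (z - p) 0 i * pd i phi p).
  by have := @smooth_line_derive R n U phi p (z - p) 0 sphi; rewrite scale0r addr0; exact.
have [|e e0 he] := pos_deriv_right D.
  have -> : \sum_i (z - p) 0 i * pd i phi p = 2 * eps * r2.
    rewrite -pz /sqnorm mulr_sumr; apply: eq_bigr => i _; rewrite /phi pd_lin; last 2 first.
    - exact: smooth_diff sf Up.
    - exact: smooth_setT_diff (smooth_hopf_barrier z r2 K).
    by rewrite dp pd_hopf_barrier -/q qp pd_hopf_q !mxE expr2; ring.
  by apply: mulr_gt0 => //; apply: mulr_gt0.
pose t := Order.min e (Order.min 1 (q0 / (2 * r2))).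
have t0 : 0 < t by rewrite !lt_min e0 ltr01 divr_gt0 // mulr_gt0.
have /he : 0 < t <= e by rewrite t0 ge_min lexx.
rewrite scale0r addr0 /phi {1}/v /hopf_barrier -/q qp mul0r mulr0 addr0 mulr0 addr0 fp ltNge.
move=> /negP; apply; apply: (phiA (p + t *: (z - p))).
have t1 : t <= 1 by rewrite !ge_min lexx orbT.
have tq : t * (2 * r2) <= q0 by rewrite -ler_pdivlMr ?mulr_gt0 // !ge_min lexx !orbT.
have E : sqnorm (p + t *: (z - p) - z) = (1 - t) ^+ 2 * r2.
  rewrite -pz -sqnormZ; congr sqnorm; apply/rowP => i; rewrite !mxE; ring.
have tr : 0 <= t * r2 by rewrite mulr_ge0 // ltW.
have ttr : 0 <= (t * (1 - t)) * r2 by apply: mulr_ge0; [apply: mulr_ge0; lra|lra].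
have ttr2 : 0 <= t ^+ 2 * r2 by rewrite mulr_ge0 ?sqr_ge0 // ltW.
by split; rewrite /= E; move: tr ttr ttr2 tq; rewrite !expr2; move: (t) (r2) (q0) => ? ? ?; nra.
Qed.

(** Take the first point of level m on a segment from a point below m, and step back slightly. The
    smallest sphere around the new point that meets the level set touches it at an interior maximum,
    where the differential vanishes, against [hopf]. *)
Lemma strong_max (Cv : set 'rV[R]_n) x1 : open Cv -> Cv `<=` U ->
  (forall x y (t : R), Cv x -> Cv y -> 0 <= t <= 1 -> Cv (x + t *: (y - x))) ->
  (forall x, Cv x -> 0 <= L f x) -> (forall x, Cv x -> f x <= m) -> Cv x1 -> f x1 = m ->
  forall x, Cv x -> f x = m.
Proof.
move=> oC CU cvx Lf fm Cx1 fx1 x2 Cx2; apply/eqP; rewrite eq_le fm //= leNgt; apply/negP => fx2.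
pose l (t : R) := x2 + t *: (x1 - x2).
have cl : continuous l by exact: continuous_line.
have cf x : Cv x -> {for x, continuous f} by move=> /CU; exact: smooth_continuous.
have cT : compact (`[0, 1]%classic `&` [set t | f (l t) = m]).
  apply: compact_level; [exact: Rhausdorff|exact: segment_compact|].
  move=> t /=; rewrite in_itv /= => t01.
  by apply: (@continuous_comp _ _ _ l f); [exact: cl|apply: cf; exact: cvx].
have [||ts] := @compact_EVT_min R R id _ _ cT.
- by exists 1; split; rewrite /= ?in_itv /= ?ler01 ?lexx // /l scale1r addrC subrK.
- by apply: continuous_subspaceT => x; exact: cvg_id.
rewrite inE /= in_itv /= => -[/andP[ts0 ts1] fts] mts.
have ts_gt0 : 0 < ts.
  rewrite lt_neqAle ts0 andbT; apply/eqP => t0; move: fts fx2; rewrite -t0 /l scale0r addr0 => ->.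
  by rewrite ltxx.
have ltC (t : R) : 0 <= t <= 1 -> Cv (l t) by exact: cvx.
have Cxs : Cv (l ts) by apply: ltC; rewrite ts0.
have [d d0 hd] := open_sqball oC Cxs.
pose D := sqnorm (x1 - x2); have D0 : 0 <= D by exact: sqnorm_ge0.
(* The step back is so short that the squared distance to [l ts] is below d / 4; by |a + b|^2 <= 2
   (|a|^2 + |b|^2) the whole ball up to [l ts] then stays in [Cv]. *)
pose t := ts - Order.min ts (Order.min 1 (d / (4 * (D + 1)))) / 2.
set w := Order.min _ _ in t *.
have w0 : 0 < w by rewrite !lt_min ts_gt0 ltr01 divr_gt0 //; lra.
have wts : w <= ts by rewrite ge_min lexx.
have w1 : w <= 1 by rewrite !ge_min lexx orbT.
have wd : w * (4 * (D + 1)) <= d by rewrite -ler_pdivlMr ?mulr_gt0 //; [rewrite !ge_min lexx !orbT|lra].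
have tin : 0 <= t <= 1 by rewrite /t; lra.
pose z := l t.
have zs : sqnorm (l ts - z) < d / 4.
  have -> : l ts - z = (w / 2) *: (x1 - x2).
    by rewrite /z /l /t; apply/rowP => i; rewrite !mxE; field.
  rewrite sqnormZ -/D expr2.
  have h1 : w * w <= w by rewrite ler_piMl // ltW.
  have h2 : w * w * D <= w * D by rewrite ler_wpM2r.
  move: h2 wd w0; rewrite !mulrDr mulr1 => h2 wd w0; nra.
have fz : f z != m.
  apply: contraTneq w0 => fz; have := mts t; rewrite inE /= in_itv /= => /(_ (conj tin fz)).
  by rewrite /t -leNgt; lra.
have BC x : sqnorm (x - z) <= sqnorm (l ts - z) -> Cv x.
  move=> hx; apply: hd.
  have -> : x - l ts = (x - z) + (z - l ts) by rewrite addrA subrK.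
  apply: (le_lt_trans (sqnormD_le _ _)); rewrite (sqnormB z); lra.
have cS : compact ([set x | sqnorm (x - z) <= sqnorm (l ts - z)] `&` [set x | f x = m]).
  apply: compact_level; [exact: norm_hausdorff|exact: compact_sqball|].
  by move=> x /BC; exact: cf.
have [||p] := @EVT_min_rV R n (fun x => sqnorm (x - z)) _ _ cS.
- by exists (l ts); split => /=.
- by apply: continuous_subspaceT => x; apply: smooth_continuous (smooth_sqdist z) _.
rewrite inE /= => -[pB fp] mp.
have Cp := BC _ pB.
apply: (@hopf z p (sqnorm (p - z))) => //.
- rewrite lt_neqAle sqnorm_ge0 andbT; apply/eqP => /esym /sqnorm_eq0 /eqP; rewrite subr_eq0 => /eqP pz.
  by move: fz; rewrite -pz fp eqxx.
- by move=> x hx; apply/CU/BC/(le_trans hx).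
- move=> x hx; rewrite lt_neqAle fm ?andbT; last by apply/BC/ltW/(lt_le_trans hx).
  apply/eqP => fx; have := mp x; rewrite inE /= => /(_ (conj (ltW (lt_le_trans hx pB)) fx)).
  by rewrite leNgt hx.
- by move=> x hx; apply/fm/BC/(le_trans hx).
- by move=> x hx; apply/Lf/BC/ltW/(lt_le_trans hx).
- apply: (max_critical oC) => //; first by apply: smooth_sub sf.
  by move=> y /fm; rewrite fp.
Qed.
End Hopf.

(** * Geometry of a static triple in one chart *)

Section InteriorSmooth.
Context {R : realType} {n : nat}.
Local Notation vec := 'rV[R]_n.+1.
Implicit Types (V W : set vec) (f : vec -> R).

Lemma smooth_on_open W V f : open W -> W `<=` V -> smooth_on V f -> smooth_open W f.
Proof.
move=> oW WV sf s x Wx; have [U [F [oU Ux sF fF]]] := sf x (WV x Wx).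
have : smooth_open (U `&` W) f.
  apply: (@smooth_eq _ _ _ _ F); first exact: openI.
    by move=> y [Uy /WV Vy]; rewrite fF.
  by apply: smooth_sub sF => y [].
by move=> h; exact: h.
Qed.

Lemma partial_pd W V f i x : hopen V -> open W -> W `<=` V -> smooth_on V f -> W x -> partial i f x = pd i f x.
Proof.
move=> hV oW WV sf Wx; apply: (partialE i hV oW Wx (WV x Wx)) => //.
exact: smooth_diff (smooth_on_open oW WV sf) Wx.
Qed.

Lemma partial_pd2 W V f i j x : hopen V -> open W -> W `<=` V -> smooth_on V f -> W x ->
  partial i (partial j f) x = pd i (pd j f) x.
Proof.
move=> hV oW WV sf Wx; rewrite (partial_pd i hV oW WV (smooth_on_partial hV j sf) Wx) !pdE.
apply: near_eq_derive; near=> y; apply: (partial_pd j hV oW WV sf); near: y; exact: open_nbhs_nbhs.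
Unshelve. all: by end_near. Qed.

(** This part is open in R^n: there right derivatives are ordinary ones and the maximum principles
    apply. *)
Definition interior_part V : set vec := V `&` [set x | 0 < x 0 0].

Lemma open_interior_part V : hopen V -> open (interior_part V).
Proof.
move=> [W oW ->].
rewrite (_ : interior_part _ = W `&` [set x : vec | 0 < x 0 0]).
  apply: openI => //; apply: (@open_comp _ _ (fun x : vec => x 0 0) [set t | 0 < t]); last exact: open_gt.
  by move=> x _; exact: continuous_coord.
apply/seteqP; split => x [] ; first by move=> [].
by move=> Wx /= x0; split => //; split => //; rewrite /half_space /= coord0E ltW.
Qed.

Lemma innerW V : interior_part V `<=` V. Proof. by move=> x []. Qed.
End InteriorSmooth.

Section EvalRules.
Context {R : realType} {n : nat} {V : set 'rV[R]_n.+1} {x : 'rV[R]_n.+1} (Vx : V x).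
Lemma evM (a b : smooth_ring V) : eval_in Vx (a * b) = eval_in Vx a * eval_in Vx b.
Proof. exact: rmorphM. Qed.
Lemma evD (a b : smooth_ring V) : eval_in Vx (a + b) = eval_in Vx a + eval_in Vx b.
Proof. by []. Qed.
Lemma evN (a : smooth_ring V) : eval_in Vx (- a) = - eval_in Vx a.
Proof. by []. Qed.
Lemma ev_nat k : eval_in Vx k%:R = k%:R.
Proof. exact: rmorph_nat. Qed.
Lemma ev_sum (I : Type) (r : seq I) (F : I -> smooth_ring V) :
  eval_in Vx (\sum_(i <- r) F i) = \sum_(i <- r) eval_in Vx (F i).
Proof. exact: rmorph_sum. Qed.
Lemma ev_to f (sf : smooth_on V f) : eval_in Vx (to_smooth sf) = f x.
Proof. exact: to_smoothE. Qed.
End EvalRules.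

Section LocalGeometryFacts.
Context {R : realType} {n : nat}.
Local Notation vec := 'rV[R]_n.+1.
Definition grad (f : vec -> R) x : 'cV[R]_n.+1 := \col_j partial j f x.
Definition gradsq (G : vec -> 'M[R]_n.+1) f x : R := ((grad f x)^T *m (invmx (G x) *m grad f x)) 0 0.
Definition hessm (G : vec -> 'M[R]_n.+1) f x : 'M[R]_n.+1 := \matrix_(i, j) hessian G f i j x.

Lemma gradsqE G f x : local_grad_norm G f x = Num.sqrt (gradsq G f x).
Proof.
rewrite /local_grad_norm /gradsq; congr Num.sqrt; rewrite mxE; apply: eq_bigr => i _.
rewrite !mxE mulr_sumr; apply: eq_bigr => j _; rewrite !mxE; ring.
Qed.

Variables (V : set vec) (hV : hopen V) (G : vec -> 'M[R]_n.+1).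
Hypotheses (sG : smooth_mx V G) (GT : forall x, V x -> (G x)^T = G x) (Gp : forall x, V x -> posdef (G x)).
Local Notation d := (deriv_ring hV).
Let Gu x : V x -> G x \in unitmx. Proof. by move=> Vx; exact/posdef_unit/Gp. Qed.
Local Notation Hr := (inverse_ring sG Gu).
Local Notation Gr := (metric_ring sG).
Local Notation Gamr := (conn_ring hV sG Gu).
Let GTr := metric_ringT sG GT.
Let GHr := metric_ringV sG Gu.
Let tfr := conn_ring_tf hV sG GT Gu.
Let mcr := conn_ring_mc hV sG GT Gu.
Let dDr := @deriv_ringD R n V hV.
Let dMr := @deriv_ringM R n V hV.
Let dCr := @deriv_ringC R n V hV.
Let twor := @smooth_ring_two_reg R n V.

Lemma eval_grad f (sf : smooth_on V f) x (Vx : V x) : map_mx (eval_in Vx) (grad_cov d (to_smooth sf)) = grad f x.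
Proof. by apply/colP => i; rewrite !mxE; exact: partial_to_smooth. Qed.

Lemma hessm_sym f x : smooth_on V f -> V x -> (hessm G f x)^T = hessm G f x.
Proof.
move=> sf Vx; apply/matrixP => i j; rewrite [LHS]mxE [LHS]mxE [RHS]mxE /hessian.
rewrite (partialC hV j i sf Vx); congr (_ - _); apply: eq_bigr => k _.
by rewrite (christoffel_sym hV sG GT k j i Vx).
Qed.

Lemma gradsq_ge0 f x : V x -> 0 <= gradsq G f x.
Proof.
move=> Vx; have := posdef_ge0 (grad f x)^T (posdef_inv (GT Vx) (Gp Vx)).
by rewrite trmxK /gradsq -mulmxA.
Qed.

Variables (u : vec -> R) (su : smooth_on V u).
Local Notation ur := (to_smooth su).
Definition energy x : R := gradsq G u x + u x * u x.
Let s_ring := ((grad_cov d ur)^T *m (Hr *m grad_cov d ur)) 0 0.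

Lemma s_ringE x : V x -> s_ring x = gradsq G u x.
Proof.
move=> Vx; rewrite -[LHS]/(eval_in Vx s_ring) /s_ring.
have <- : map_mx (eval_in Vx) ((grad_cov d ur)^T *m (Hr *m grad_cov d ur)) 0 0 =
   eval_in Vx (((grad_cov d ur)^T *m (Hr *m grad_cov d ur)) 0 0) by rewrite mxE.
by rewrite !map_mxM -map_trmx eval_grad ring_mxE.
Qed.

Lemma smooth_gradsq : smooth_on V (gradsq G u).
Proof. by apply: smooth_on_eq (smooth_ringP s_ring) => x Vx; rewrite s_ringE. Qed.

Lemma smooth_energy : smooth_on V energy.
Proof. by apply: smooth_onD; [exact: smooth_gradsq|exact: smooth_onM]. Qed.

Lemma s_ring_to : s_ring = to_smooth smooth_gradsq.
Proof. by apply: sring_eq => x Vx; rewrite s_ringE // to_smoothE. Qed.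

Lemma energy_ring : s_ring + ur * ur = to_smooth smooth_energy.
Proof. by apply: sring_eq => x Vx; rewrite smooth_addE smooth_mulE s_ringE // !to_smoothE. Qed.

Lemma partial_gradsq i x : V x -> partial i (gradsq G u) x = 2 * (hessm G u x *m (invmx (G x) *m grad u x)) i 0.
Proof.
move=> Vx; rewrite -(partial_to_smooth hV i smooth_gradsq Vx) -s_ring_to.
have := d_norm_grad dDr dMr dCr GTr GHr tfr mcr ur i.
move=> /(congr1 (eval_in Vx)); rewrite evM ev_nat => e; rewrite -[LHS]/(eval_in Vx (d i s_ring)) e; congr (_ * _).
rewrite !mxE ev_sum; apply: eq_bigr => j _; rewrite evM eval_hess !mxE; congr (_ * _).
rewrite ev_sum; apply: eq_bigr => k _; rewrite evM !mxE ev_to; congr (_ * _).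
exact: partial_to_smooth.
Qed.

Hypothesis ricE : forall x i j, V x -> u x * ricci G i j x = hessian G u i j x + n.+1%:R * u x * G x i j.
Hypothesis lapE : forall x, V x -> laplacian G u x = - n.+1%:R * u x.

(** Its trace vanishes because the Laplacian of u is - n u. *)
Definition trace_free_hess x : 'M[R]_n.+1 := hessm G u x + u x *: G x.

Lemma smooth_trace_free_hess : smooth_mx V trace_free_hess.
Proof.
move=> i j; apply: (@smooth_on_eq _ _ _ (fun x => hessian G u i j x + u x * G x i j)) => [x _|].
  by rewrite [RHS]mxE [hessm _ _ _ _ _]mxE [(u x *: G x) _ _]mxE.
apply: smooth_onD; last exact: smooth_onM (sG i j).
apply: (@smooth_on_eq _ _ _ (hess d Gamr ur i j)); last exact: smooth_ringP.
by move=> x Vx; rewrite -(eval_hess hV sG Gu su i j Vx).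
Qed.

Lemma static_bochner_at x : V x ->
  u x * laplacian G energy x - \sum_k (invmx (G x) *m grad u x) k 0 * partial k energy x =
  2 * (u x * \tr ((invmx (G x) *m trace_free_hess x) *m (invmx (G x) *m trace_free_hess x))).
Proof.
move=> Vx.
have rE : ur *: ricm d Gamr = hess d Gamr ur + (n.+1%:R * ur) *: Gr.
  apply/matrixP => i j; apply: sring_eq => y Vy; rewrite !entE.
  rewrite -[LHS]/(eval_in Vy _) -[RHS]/(eval_in Vy _) evD !evM ev_nat eval_ric eval_hess.
  by rewrite [Gr i j]mxE !ev_to ricE.
have lE : lap d Hr Gamr ur = - n.+1%:R * ur.
  apply: sring_eq => y Vy; rewrite -[LHS]/(eval_in Vy _) -[RHS]/(eval_in Vy _).
  by rewrite eval_lap // evM evN ev_nat ev_to lapE.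
have := static_bochner dDr dMr dCr GTr GHr tfr mcr rE lE.
rewrite energy_ring => /(congr1 (eval_in Vx)).
rewrite evD evN !evM eval_lap // ev_sum ev_nat.
have uE : eval_in Vx ur = u x by rewrite ev_to.
rewrite uE => e; transitivity (u x * laplacian G energy x -
  \sum_(i < n.+1) eval_in Vx ((Hr *m grad_cov d ur) i 0 * d i (to_smooth smooth_energy))).
  congr (_ - _); apply: eq_bigr => k _; rewrite evM; congr (_ * _); last first.
    by rewrite /eval_in partial_to_smooth.
  have <- : map_mx (eval_in Vx) (Hr *m grad_cov d ur) = invmx (G x) *m grad u x.
    by rewrite map_mxM ring_mxE eval_grad.
  by rewrite mxE.
rewrite e; congr (_ * (_ * _)).
have TE : map_mx (eval_in Vx) (hess d Gamr ur + ur *: Gr) = trace_free_hess x.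
  apply/matrixP => i j; rewrite [LHS]mxE !entE evD evM eval_hess uE [Gr i j]mxE ev_to.
  by rewrite [hessm _ _ _ _ _]mxE.
by rewrite -TE -(ring_mxE (smooth_mx_inv Gu sG) Vx) -!map_mxM -trace_map_mx.
Qed.

(** The gradient terms 2 u |Du|^2 cancel. Thus - u^2 is a strict subsolution of the operator of the
    Bochner formula, which serves to perturb W. *)
Lemma laplacian_sqr x : V x ->
  u x * laplacian G (fun y => u y * u y) x - \sum_k (invmx (G x) *m grad u x) k 0 * partial k (fun y => u y * u y) x =
  - (2 * n.+1%:R * u x ^+ 3).
Proof.
move=> Vx; have su2 := smooth_onM su su.
have e2 : ur * ur = to_smooth su2 by apply: sring_eq => y Vy; rewrite smooth_mulE !to_smoothE.
have := lap_sq dDr dMr Hr Gamr ur; rewrite e2 => /(congr1 (eval_in Vx)).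
rewrite (evM Vx 2) ev_nat evD evM !eval_lap //.
have uE : eval_in Vx ur = u x by rewrite ev_to.
rewrite uE => ->; rewrite lapE // -[eval_in Vx _]/(s_ring x) s_ringE //.
have -> : \sum_k (invmx (G x) *m grad u x) k 0 * partial k (fun y => u y * u y) x = 2 * u x * gradsq G u x.
  rewrite /gradsq mxE mulr_sumr; apply: eq_bigr => k _; rewrite (partialM hV) // !mxE; ring.
move: (u x) (gradsq G u x) => a b; rewrite !exprS expr0; ring.
Qed.

(** The first-order coefficients of f |-> lap f - u^-1 <Du, Df>: those of the Laplacian, and the
    drift, which is singular on the boundary. *)
Definition ell_coef x : vec :=
  \row_k (- (\sum_i \sum_j invmx (G x) i j * christoffel G k i j x) - (u x)^-1 * (invmx (G x) *m grad u x) k 0).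
Local Notation inner := (interior_part V).

Lemma elliptic_laplacian f x : smooth_on V f -> inner x ->
  elliptic (fun x => invmx (G x)) ell_coef f x =
  laplacian G f x - (u x)^-1 * \sum_k (invmx (G x) *m grad u x) k 0 * partial k f x.
Proof.
move=> sf Ix; have oI := open_interior_part hV.
pose H := invmx (G x); pose c k := \sum_i \sum_j H i j * christoffel G k i j x.
have -> : laplacian G f x = \sum_i \sum_j H i j * pd i (pd j f) x - \sum_k c k * partial k f x.
  rewrite /laplacian; under eq_bigr => i _ do under eq_bigr => j _ do
  rewrite /hessian mulrBr (partial_pd2 i j hV oI (@innerW _ _ V) sf Ix).
  under eq_bigr => i _ do rewrite sumrB.
  rewrite sumrB; congr (_ - _).
  under [RHS]eq_bigr => k _ do rewrite mulr_suml.
  rewrite [RHS]exchange_big /=; apply: eq_bigr => i _.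
  under [RHS]eq_bigr => k _ do rewrite mulr_suml.
  rewrite [RHS]exchange_big /=; apply: eq_bigr => j _.
  by rewrite mulr_sumr; apply: eq_bigr => k _; rewrite mulrA.
rewrite /elliptic -addrA; congr (_ + _); rewrite mulr_sumr -opprD -big_split -sumrN; apply: eq_bigr => k _ /=.
rewrite mxE -(partial_pd k hV oI (@innerW _ _ V) sf Ix) -/H -/(c k).
by move: (c k) ((u x)^-1) (_ k 0) (partial k f x) => p q r t; ring.
Qed.

Lemma smooth_grad : smooth_mx V (grad u).
Proof. by move=> i j; apply: (@smooth_on_eq _ _ _ (partial i u)) => [x _|]; [rewrite mxE|exact: smooth_on_partial]. Qed.

Lemma smooth_ell_coef k : (forall x, inner x -> u x != 0) -> smooth_open inner (fun x => ell_coef x 0 k).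
Proof.
move=> u0; have oI := open_interior_part hV.
have sub := @smooth_on_open _ _ _ _ _ oI (@innerW _ _ V).
have sH := smooth_mx_inv Gu sG.
apply: (@smooth_eq _ _ _ oI (fun x : vec => - (\sum_i \sum_j invmx (G x) i j * christoffel G k i j x) - (u x)^-1 * (invmx (G x) *m grad u x) k 0)) => //.
  by move=> x _; rewrite [RHS]mxE.
apply: smooth_openB => //.
  apply: smooth_openN => //; apply: smooth_sum => // i _; apply: smooth_sum => // j _.
  apply: smooth_openM => //; apply: sub; [exact: sH|exact: smooth_christoffel].
apply: smooth_openM => //; first by apply: smooth_openV => //; exact: sub.
by apply: sub; apply: smooth_mxM => //; exact: smooth_grad.
Qed.
End LocalGeometryFacts.

(** * The static triple on the manifold *)

Section HalfSpaceTopology.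
Context {R : realType} {n : nat}.
Local Notation vec := 'rV[R]_n.+1.
Implicit Types (S V : set vec) (x : vec).

Lemma hopen_cube V x : hopen V -> V x -> exists2 e : R, 0 < e & forall y, cube x e y -> half_space y -> V y.
Proof.
move=> [W oW ->] [Wx _]; have [e e0 he] := nbhs_cube (open_nbhs_nbhs (conj oW Wx)).
by exists e => // y /he.
Qed.

Lemma hopen_half V x : hopen V -> V x -> half_space x.
Proof. by move=> [W _ ->] []. Qed.

Lemma hopenP S : (forall x, S x -> half_space x /\ exists2 e : R, 0 < e & forall y, cube x e y -> half_space y -> S y) ->
  hopen S.
Proof.
move=> h; pose D := [set ce : vec * R | forall y, cube ce.1 ce.2 y -> half_space y -> S y].
exists (\bigcup_(ce in D) cube ce.1 ce.2); first by apply: bigcup_open => ce _; exact: open_cube.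
apply/seteqP; split => x; last by move=> [[ce hce cx] hx]; exact: hce.
move=> Sx; have [hx [e e0 he]] := h x Sx; split => //.
by exists (x, e) => //; exact: cube_center.
Qed.

Lemma half_spaceE x : half_space x = (0 <= x 0 0) :> Prop.
Proof. by rewrite /half_space /= coord0E. Qed.

Lemma partial_comp (m : nat) V (V' : set 'rV[R]_m.+1) (Phi : vec -> 'rV[R]_m.+1) h i x :
  hopen V -> hopen V' -> (forall j, smooth_on V (fun y => Phi y 0 j)) -> (forall y, V y -> V' (Phi y)) ->
  smooth_on V' h -> V x ->
  partial i (h \o Phi) x = \sum_j partial i (fun y => Phi y 0 j) x * partial j h (Phi x).
Proof.
move=> hV hV' sP PV sh Vx.
have [U' [F [oU' U'x sF hF]]] := sh (Phi x) (PV x Vx).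
have [U [P [oU Ux sPj PE]]] := smooth_on_ext sP Vx.
pose Pm y : 'rV[R]_m.+1 := \row_j P j y.
have PmE y : U y -> V y -> Phi y = Pm y by move=> Uy Vy; apply/rowP => j; rewrite mxE PE.
have dP j : differentiable (fun y => Pm y 0 j) x.
  rewrite (_ : (fun y => _) = P j); first exact: smooth_diff (sPj j) Ux.
  by apply/funext => y; rewrite mxE.
have cP : {for x, continuous Pm} by apply: differentiable_continuous; exact: differentiable_rowP.
have PmxE : Pm x = Phi x by rewrite PmE.
have oUP : nbhs x (U `&` Pm @^-1` U').
  apply: filterI; first exact: open_nbhs_nbhs.
  by apply: cP; apply: open_nbhs_nbhs; split => //; rewrite PmxE.
have [W [oW WU] ] : exists2 W : set vec, open W /\ W `<=` U `&` Pm @^-1` U' & W x.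
  by move: oUP; rewrite nbhsE => -[W [oW Wx] WU]; exists W.
move=> Wx.
have dF : differentiable F (Pm x) by rewrite PmxE; exact: smooth_diff sF U'x.
have -> : partial i (h \o Phi) x = pd i (F \o Pm) x.
  apply: (partialE i hV oW Wx Vx).
    by apply: differentiable_comp => //; exact: differentiable_rowP.
  move=> y Wy Vy /=; have [Uy U'y] := WU y Wy.
  by rewrite -PmE // hF //; [rewrite PmE|exact: PV].
rewrite pd_comp //; apply: eq_bigr => j _; congr (_ * _); last first.
  rewrite PmxE; apply/esym; apply: (partialE j hV' oU' U'x (PV x Vx)) => //.
  by rewrite -PmxE.
apply/esym; apply: (partialE i hV oU Ux Vx) => // y Uy Vy.
by rewrite PmE.
Qed.
End HalfSpaceTopology.

(** * Charts, transition maps and the boundary *)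

Section ManifoldBasics.
Context {R : realType} {n : nat} {M : topologicalType} {A : atlas R n.+1 M} (hm : is_manifold A).
Implicit Types (a b : chart_index A) (p q : M).
Local Notation V := (@chart_image R n.+1 M A).
Local Notation inv a := (@chart_inv R n.+1 M A a).
Local Notation dom a := (@chart_dom R n.+1 M A a).

Lemma chart_hopen a : hopen (V a). Proof. exact: chart_image_open hm a. Qed.

Lemma chart_in a p : dom a p -> V a (chart a p). Proof. by exists p. Qed.

Lemma chart_inv_dom a x : V a x -> dom a (inv a x).
Proof. by move=> [p dp <-]; rewrite (chartK hm dp). Qed.

Lemma chart_invK a x : V a x -> chart a (inv a x) = x.
Proof. by move=> [p dp <-]; rewrite (chartK hm dp). Qed.

Lemma chart_nbhs a p (O : set M) : dom a p -> nbhs p O ->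
  exists2 e : R, 0 < e & forall x, cube (chart a p) e x -> half_space x -> V a x /\ O (inv a x).
Proof.
move=> dp nO; have Vx := chart_in dp.
have [e e0 he] := hopen_cube (chart_hopen a) Vx.
have := @chart_inv_continuous _ _ _ _ hm a; rewrite subspace_continuousP => /(_ _ Vx).
rewrite /from_subspace (chartK hm dp) => /(_ O nO) hO.
have [e' e'0 he'] := nbhs_cube hO.
exists (Order.min e e'); first by rewrite lt_min e0.
move=> x cx hx; have Va : V a x.
  by apply: he => // i; apply: lt_le_trans (cx i) _; rewrite ge_min lexx.
by split => //; apply: he' => // i; apply: lt_le_trans (cx i) _; rewrite ge_min lexx orbT.
Qed.

Lemma chart_preim_open a (W : set 'rV[R]_n.+1) : open W -> open (dom a `&` chart a @^-1` W).
Proof.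
move=> oW; rewrite openE => p [dp Wp]; rewrite /interior.
apply: filterI; first by apply: open_nbhs_nbhs; split; [exact: chart_dom_open hm a|].
by apply: (chart_continuous hm dp); exact: open_nbhs_nbhs.
Qed.

Lemma chart_image_sub_hopen a (O : set M) : open O -> hopen [set x | V a x /\ O (inv a x)].
Proof.
move=> oO; apply: hopenP => x [Vx Ox]; split; first exact: hopen_half (chart_hopen a) Vx.
have [e e0 he] := chart_nbhs (chart_inv_dom Vx) (open_nbhs_nbhs (conj oO Ox)).
by rewrite (chart_invK Vx) in he; exists e.
Qed.

Lemma smooth_fun_continuous (f : M -> R) : smooth_fun A f -> continuous f.
Proof.
move=> sf p; have [a dp] := chart_cover hm p.
have [U [F [oU Ux sF fF]]] := sf a _ (chart_in dp).
have cF : {for p, continuous (F \o chart a)}.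
  apply: (@continuous_comp _ _ _ (chart a) F); first exact: (chart_continuous hm dp).
  exact: smooth_continuous sF Ux.
have nU : nbhs p (dom a `&` chart a @^-1` U).
  by apply: open_nbhs_nbhs; split; [exact: chart_preim_open|].
have fE q : (dom a `&` chart a @^-1` U) q -> (F \o chart a) q = f q.
  by move=> [dq Uq] /=; rewrite -fF //=; [rewrite (chartK hm dq)|exact: chart_in].
rewrite /prop_for /continuous_at -(fE p) //.
apply: cvg_trans cF; apply: near_eq_cvg.
by apply: filterS nU => q hq; rewrite fE.
Qed.

Definition overlap a b : set 'rV[R]_n.+1 := [set x | V a x /\ dom b (inv a x)].
Definition transition a b : 'rV[R]_n.+1 -> 'rV[R]_n.+1 := @local_rep R n.+1 M M A A id a b.
Definition jac a b x : 'M[R]_n.+1 := \matrix_(i, j) partial i (fun y => transition a b y 0 j) x.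

Lemma overlapE a b : overlap a b = @local_dom R n.+1 M M A A id a b.
Proof.
apply/seteqP; split => [x [Vx dx]|_ [p [dp dq] <-]].
  by exists (inv a x); [split => //; exact: chart_inv_dom|exact: chart_invK].
by split; [exact: chart_in|rewrite (chartK hm dp)].
Qed.

Lemma overlap_hopen a b : hopen (overlap a b).
Proof. by apply: chart_image_sub_hopen; exact: chart_dom_open hm b. Qed.

Lemma overlap_in a b p : dom a p -> dom b p -> overlap a b (chart a p).
Proof. by move=> da db; split; [exact: chart_in|rewrite (chartK hm da)]. Qed.

Lemma transition_chart a b p : dom a p -> transition a b (chart a p) = chart b p.
Proof. by move=> dp; rewrite /transition /local_rep /= (chartK hm dp). Qed.

Lemma transition_image a b x : overlap a b x -> V b (transition a b x).
Proof. by move=> [Vx dx]; exact: chart_in. Qed.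

Lemma transition_inv a b x : overlap a b x -> inv b (transition a b x) = inv a x.
Proof. by move=> [Vx dx]; rewrite /transition /local_rep /= (chartK hm dx). Qed.

Lemma smooth_transition a b j : smooth_on (overlap a b) (fun x => transition a b x 0 j).
Proof. by rewrite overlapE; exact: (transition_smooth hm).2. Qed.

Lemma smooth_overlap a b (f : M -> R) : smooth_fun A f -> smooth_on (overlap a b) (f \o inv a).
Proof. by move=> sf; apply: smooth_on_sub (sf a) => x []. Qed.

Lemma grad_transition a b (f : M -> R) x : smooth_fun A f -> overlap a b x ->
  grad (f \o inv a) x = jac a b x *m grad (f \o inv b) (transition a b x).
Proof.
move=> sf Wx; apply/colP => i; rewrite !mxE.
have hW := overlap_hopen a b.
have -> : partial i (f \o inv a) x = partial i ((f \o inv b) \o transition a b) x.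
  apply/esym; apply: (partial_eq hW i (smooth_overlap sf) Wx) => y Wy /=.
  by rewrite transition_inv.
rewrite (partial_comp i hW (chart_hopen b) (@smooth_transition a b) (@transition_image a b) (sf b) Wx).
by apply: eq_bigr => j _; rewrite !mxE.
Qed.

Variable (g : metric_components A).
Hypothesis hg : is_riemannian g.

Lemma metric_mx a : smooth_mx (V a) (g a). Proof. exact: metric_smooth hg a. Qed.
Lemma metricT a x : V a x -> (g a x)^T = g a x. Proof. by move=> Vx; exact: (Defs.metric_sym hg Vx). Qed.
Lemma metric_posdef a x : V a x -> posdef (g a x). Proof. by move=> Vx v v0; exact: (metric_pos hg Vx v0). Qed.
Lemma metric_unit a x : V a x -> g a x \in unitmx. Proof. by move=> Vx; exact/posdef_unit/metric_posdef. Qed.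

Lemma metric_transition a b x : overlap a b x ->
  g a x = jac a b x *m g b (transition a b x) *m (jac a b x)^T.
Proof. by rewrite overlapE => Wx; exact: (metric_compatible hg). Qed.

Lemma jac_unit a b x : overlap a b x -> jac a b x \in unitmx.
Proof.
move=> Wx; have := metric_unit Wx.1; rewrite (metric_transition Wx) unitmx_mul unitmx_mul.
by case/andP => /andP[].
Qed.

Lemma gradsq_transition a b (f : M -> R) x : smooth_fun A f -> overlap a b x ->
  gradsq (g a) (f \o inv a) x = gradsq (g b) (f \o inv b) (transition a b x).
Proof.
move=> sf Wx; rewrite /gradsq (grad_transition sf Wx) (metric_transition Wx).
have uJ := jac_unit Wx; have uG := metric_unit (transition_image Wx).
move: (jac a b x) (g b _) (grad _ _) uJ uG => J G c uJ uG.
have uJT : J^T \in unitmx by rewrite unitmx_tr.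
have -> : invmx (J *m G *m J^T) = invmx J^T *m invmx G *m invmx J.
  have u3 : J *m G *m J^T \in unitmx by rewrite !unitmx_mul uJ uG.
  rewrite -[RHS]mulmx1 -(mulmxV u3) mulmxA.
  have -> : invmx J^T *m invmx G *m invmx J *m (J *m G *m J^T) = 1%:M; last by rewrite mul1mx.
  rewrite -!mulmxA (mulmxA (invmx J) J) mulVmx // mul1mx.
  by rewrite (mulmxA (invmx G) G) mulVmx // mul1mx mulVmx.
rewrite trmx_mul -!mulmxA (mulmxA (invmx J) J) mulVmx // mul1mx.
by rewrite (mulmxA J^T) mulmxV // mul1mx.
Qed.

(** The set from which [get] picks is a singleton by [gradsq_transition]. *)
Lemma grad_normE a p (f : M -> R) : smooth_fun A f -> dom a p ->
  grad_norm g f p = Num.sqrt (gradsq (g a) (f \o inv a) (chart a p)).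
Proof.
move=> sf da; rewrite /grad_norm; case: xgetP => [r _|/(_ (Num.sqrt (gradsq (g a) (f \o inv a) (chart a p)))) []]; last first.
  by exists a => //; rewrite gradsqE.
move=> [b db ->]; rewrite gradsqE -(transition_chart b da) -gradsq_transition //.
exact: overlap_in.
Qed.

(** Invariance of the boundary. If an interior point of the chart a were sent to the boundary by the
    chart b, the first coordinate of the transition would have a minimum on an open set, so a column
    of its Jacobian would vanish; but the Jacobian is invertible because it relates two metrics. *)
Lemma boundaryE a p : dom a p -> boundary A p <-> (chart a p) 0 0 = 0.
Proof.
move=> da; split => [[b db]|e]; last by exists a => //; rewrite coord0E.
rewrite coord0E => Tb.
have Wx := overlap_in da db; have hW := overlap_hopen a b.
have : half_space (chart a p) by exact: hopen_half (chart_hopen a) (chart_in da).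
rewrite half_spaceE le_eqVlt => /orP[/eqP //|x0].
pose I := interior_part (overlap a b).
have oI : open I := open_interior_part hW.
pose t y := - transition a b y 0 0.
have st : smooth_on (overlap a b) t by apply: smooth_onN; exact: smooth_transition.
have sI := smooth_on_open oI (@innerW _ _ _) st.
have Ip : I (chart a p) by [].
have crit i : pd i t (chart a p) = 0.
  apply: (max_critical oI sI Ip) => y [Wy _].
  rewrite /t transition_chart // Tb oppr0 oppr_le0 -half_spaceE.
  exact: hopen_half (chart_hopen b) (transition_image Wy).
have J0 : jac a b (chart a p) *m delta_mx 0 0 = 0 :> 'cV_n.+1.
  apply/colP => i; rewrite !mxE (bigD1 0) //= big1 ?addr0 => [|k k0].
    rewrite !mxE !eqxx mulr1 (partial_pd i hW oI (@innerW _ _ _) (@smooth_transition a b 0) Ip).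
    have := crit i; rewrite (_ : pd i t (chart a p) = - pd i (fun y => transition a b y 0 0) (chart a p)).
      by move/eqP; rewrite oppr_eq0 => /eqP.
    rewrite !pdE deriveN //; apply: diff_derivable.
    exact: smooth_diff (smooth_on_open oI (@innerW _ _ _) (@smooth_transition a b 0)) Ip.
  by rewrite !mxE (negPf k0) mulr0.
have := congr1 (mulmx (invmx (jac a b (chart a p)))) J0.
rewrite mulKmx ?jac_unit // mulmx0 => /colP /(_ 0); rewrite !mxE !eqxx => /eqP.
by rewrite oner_eq0.
Qed.
End ManifoldBasics.

Section Components.
Context {T : topologicalType}.
Implicit Types (D N B : set T).

Lemma pi0_sub D N : pi0 D N -> N `<=` D.
Proof. by move=> [x Dx <-]; exact: connected_component_sub. Qed.

Lemma pi0_connected D N : pi0 D N -> connected N.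
Proof. by move=> [x Dx <-]; exact: component_connected. Qed.

Lemma pi0_neq0 D N : pi0 D N -> exists p, N p.
Proof. by move=> [x Dx <-]; exists x; exact: connected_component_refl. Qed.

Lemma pi0_max D N B p : pi0 D N -> connected B -> B `<=` D -> B p -> N p -> B `<=` N.
Proof.
move=> [x Dx <-] cB BD Bp Np.
by rewrite (same_connected_component Np); exact: connected_component_max.
Qed.
End Components.

(** * Components of open subsets of the manifold *)

Section ManifoldTopology.
Context {R : realType} {n : nat} {M : topologicalType} {A : atlas R n.+1 M} (hm : is_manifold A).
Local Notation V := (@chart_image R n.+1 M A).
Local Notation inv a := (@chart_inv R n.+1 M A a).
Local Notation dom a := (@chart_dom R n.+1 M A a).
Variables (D N : set M).
Hypotheses (oD : open D) (hN : pi0 D N).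

Lemma segment_component (a : chart_index A) x y :
  (forall t : R, 0 <= t <= 1 -> V a (x + t *: (y - x)) /\ D (inv a (x + t *: (y - x)))) ->
  N (inv a x) -> N (inv a y).
Proof.
move=> h Nx; pose l (t : R) := x + t *: (y - x).
have cl : continuous l by exact: continuous_line.
have c1 : connected (l @` `[0, 1]).
  by apply: connected_continuous_connected; [exact: segment_connected|exact: continuous_subspaceT].
have lV : l @` `[0, 1] `<=` V a by move=> _ [t /= + <-]; rewrite in_itv /= => /h [].
have c2 : connected (inv a @` (l @` `[0, 1])).
  apply: connected_continuous_connected => //; apply: continuous_subspaceW lV _.
  exact: (@chart_inv_continuous _ _ _ _ hm a).
have im (t : R) : 0 <= t <= 1 -> (inv a @` (l @` `[0, 1])) (inv a (l t)).
  by move=> t01; exists (l t) => //; exists t => //=; rewrite in_itv.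
apply: (pi0_max hN c2 (p := inv a x)) => //.
- by move=> _ [_ [t /= + <-] <-]; rewrite in_itv /= => /h [].
- by have := im 0; rewrite /l scale0r addr0; apply; rewrite lexx ler01.
- have <- : l 1 = y by rewrite /l scale1r addrC subrK.
  by apply: im; rewrite lexx ler01.
Qed.

Lemma half_segment (x y : 'rV[R]_n.+1) (t : R) : half_space x -> half_space y -> 0 <= t <= 1 ->
  half_space (x + t *: (y - x)).
Proof.
rewrite !half_spaceE !mxE => x0 y0 /andP[t0 t1].
by move: (x 0 0) (y 0 0) x0 y0 => p q; nra.
Qed.

Lemma component_cube (a : chart_index A) p : dom a p -> D p -> exists2 e : R, 0 < e &
  (forall x, cube (chart a p) e x -> half_space x -> V a x /\ D (inv a x)) /\
  forall x y, cube (chart a p) e x -> half_space x -> cube (chart a p) e y -> half_space y ->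
    N (inv a x) -> N (inv a y).
Proof.
move=> dp Dp; have [e e0 he] := chart_nbhs hm dp (open_nbhs_nbhs (conj oD Dp)).
exists e => //; split => // x y cx hx cy hy.
by apply: segment_component => t t01; apply: he; [exact: cube_convex|exact: half_segment].
Qed.

Lemma cube_open (a : chart_index A) p (e : R) : dom a p -> 0 < e ->
  nbhs p (dom a `&` chart a @^-1` cube (chart a p) e).
Proof.
move=> dp e0; apply: open_nbhs_nbhs; split; first by apply: chart_preim_open => //; exact: open_cube.
by split => //; exact: cube_center.
Qed.

Lemma component_nbhs (a : chart_index A) p : dom a p -> N p -> exists2 e : R, 0 < e &
  forall x, cube (chart a p) e x -> half_space x -> V a x /\ N (inv a x).
Proof.
move=> dp Np; have [e e0 [he1 he2]] := component_cube dp (pi0_sub hN Np).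
exists e => // x cx hx; split; first by have [] := he1 x cx hx.
apply: (he2 (chart a p)) => //; first exact: cube_center.
  exact: hopen_half (chart_hopen hm a) (chart_in dp).
by rewrite (chartK hm dp).
Qed.

Lemma chart_half (a : chart_index A) p : dom a p -> half_space (chart a p).
Proof. by move=> dp; exact: hopen_half (chart_hopen hm a) (chart_in dp). Qed.

Lemma component_open : open N.
Proof.
rewrite openE => p Np; have [a dp] := chart_cover hm p.
have [e e0 he] := component_nbhs dp Np.
apply: filterS (cube_open dp e0) => q [dq cq].
by have [_] := he _ cq (chart_half dq); rewrite (chartK hm dq).
Qed.

Lemma closure_component p : closure N p -> D p -> N p.
Proof.
move=> cp Dp; have [a dp] := chart_cover hm p.
have [e e0 [he1 he2]] := component_cube dp Dp.
have [q [Nq [dq cq]]] := cp _ (cube_open dp e0).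
have := he2 _ (chart a p) cq (chart_half dq) (cube_center _ e0) (chart_half dp).
by rewrite !(chartK hm) //; apply.
Qed.
End ManifoldTopology.

(** * The energy W and its elliptic inequality *)

Section Static.
Context {R : realType} {n : nat} {M : topologicalType} {A : atlas R n.+1 M}.
Variables (g : metric_components A) (u : M -> R).
Hypothesis hs : is_static_triple g u.
Local Notation V := (@chart_image R n.+1 M A).
Local Notation inv a := (@chart_inv R n.+1 M A a).
Local Notation dom a := (@chart_dom R n.+1 M A a).
Let hm := static_manifold hs.
Let hg := static_metric hs.
Let su := static_smooth hs.
Local Notation uc a := (u \o inv a).
Local Notation inner a := (interior_part (V a)).

Lemma static_u_ge0 p : 0 <= u p.
Proof.
have [bp|nbp] := pselect (boundary A p); first by rewrite (static_zero hs bp).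
by rewrite ltW // (static_pos hs).
Qed.

Lemma static_u_continuous : continuous u. Proof. exact: smooth_fun_continuous su. Qed.

Lemma interior_chart a p : dom a p -> ~ boundary A p -> inner a (chart a p).
Proof.
move=> dp nb; split; first exact: chart_in.
have := chart_half hm dp; rewrite half_spaceE /= le_eqVlt => /orP[/eqP e|//].
by case: nb; apply/(boundaryE hm hg dp).
Qed.

Lemma inner_not_boundary a x : inner a x -> ~ boundary A (inv a x).
Proof.
move=> [Vx x0] /(boundaryE hm hg (chart_inv_dom hm Vx)); rewrite (chart_invK hm Vx) => e.
by move: x0; rewrite /= e ltxx.
Qed.

Lemma inner_u a x : inner a x -> 0 < uc a x.
Proof. by move=> Ix; apply: (static_pos hs); exact: inner_not_boundary. Qed.

Definition total_energy p : R := grad_norm g u p ^+ 2 + u p * u p.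
Local Notation W := total_energy.
Local Notation E a := (energy (g a) (uc a)).

Lemma grad_norm_sqr a p : dom a p -> grad_norm g u p ^+ 2 = gradsq (g a) (uc a) (chart a p).
Proof.
move=> dp; rewrite (grad_normE hm hg su dp) sqr_sqrtr //.
apply: (gradsq_ge0 (V := V a)); [exact: metricT|exact: metric_posdef|exact: chart_in].
Qed.

Lemma grad_norm_ge0 p : 0 <= grad_norm g u p.
Proof. by have [a dp] := chart_cover hm p; rewrite (grad_normE hm hg su dp) sqrtr_ge0. Qed.

Lemma energy_chart a x : V a x -> W (inv a x) = E a x.
Proof.
move=> Vx; rewrite /W (grad_norm_sqr (chart_inv_dom hm Vx)) /energy.
by rewrite !(chart_invK hm Vx).
Qed.

Lemma smooth_chart_energy a : smooth_on (V a) (E a).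
Proof.
apply: (smooth_energy (chart_hopen hm a)); [exact: metric_mx|exact: metric_posdef|exact: su].
Qed.

Lemma smooth_total_energy : smooth_fun A W.
Proof. by move=> a; apply: smooth_on_eq (@smooth_chart_energy a) => x Vx /=; rewrite energy_chart. Qed.

Lemma total_energy_continuous : continuous W. Proof. exact: smooth_fun_continuous smooth_total_energy. Qed.

Local Notation ella a := (fun x => invmx (g a x)).
Local Notation ellb a := (ell_coef (g a) (uc a)).
Local Notation Th a := (trace_free_hess (g a) (uc a)).

Lemma chart_ricE a x i j : V a x ->
  uc a x * ricci (g a) i j x = hessian (g a) (uc a) i j x + n.+1%:R * uc a x * g a x i j.
Proof. by move=> Vx; exact: (static_ricci hs Vx). Qed.

Lemma chart_lapE a x : V a x -> laplacian (g a) (uc a) x = - n.+1%:R * uc a x.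
Proof. by move=> Vx; exact: (static_laplacian hs Vx). Qed.

Lemma hessmT a x : V a x -> (hessm (g a) (uc a) x)^T = hessm (g a) (uc a) x.
Proof.
by move=> Vx; apply: (hessm_sym (chart_hopen hm a)) => //; first [exact: metric_mx|exact: su|by move=> y; exact: (metricT hg)].
Qed.

Lemma elliptic_energy a x : inner a x ->
  elliptic (ella a) (ellb a) (E a) x = 2 * \tr ((invmx (g a x) *m Th a x) *m (invmx (g a x) *m Th a x)).
Proof.
move=> Ix; have Vx := Ix.1; have u0 := inner_u Ix.
rewrite (elliptic_laplacian (chart_hopen hm a) _ _ (@smooth_chart_energy a) Ix).
have := static_bochner_at (chart_hopen hm a) (metric_mx hg (a := a)) (metricT hg (a := a))
  (metric_posdef hg (a := a)) (@su a) (fun x i j => @chart_ricE a x i j) (@chart_lapE a) Vx.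
move=> e; apply: (mulfI (lt0r_neq0 u0)); rewrite mulrBr mulrA divff ?gt_eqF // mul1r e.
by rewrite mulrCA.
Qed.

Lemma trace_free_hessT a x : V a x -> (Th a x)^T = Th a x.
Proof. by move=> Vx; rewrite /trace_free_hess linearD linearZ /= hessmT // (metricT hg Vx). Qed.

Lemma inv_posdef a x : V a x -> (invmx (g a x))^T = invmx (g a x) /\ posdef (invmx (g a x)).
Proof.
move=> Vx; split; first by rewrite trmx_inv (metricT hg Vx).
by apply: posdef_inv; [exact: (metricT hg)|exact: (metric_posdef hg)].
Qed.

Lemma elliptic_energy_ge0 a x : inner a x -> 0 <= elliptic (ella a) (ellb a) (E a) x.
Proof.
move=> Ix; rewrite elliptic_energy // mulr_ge0 //.
have [HT pH] := inv_posdef Ix.1.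
by have [] := posdef_trace_sqr HT pH (trace_free_hessT Ix.1).
Qed.

Lemma elliptic_energy_le0 a x : inner a x -> elliptic (ella a) (ellb a) (E a) x <= 0 -> Th a x = 0.
Proof.
move=> Ix; rewrite elliptic_energy // pmulr_rle0 //.
have [HT pH] := inv_posdef Ix.1.
by have [_] := posdef_trace_sqr HT pH (trace_free_hessT Ix.1).
Qed.

Lemma elliptic_usq a x : inner a x ->
  elliptic (ella a) (ellb a) (fun y => uc a y * uc a y) x = - (2 * n.+1%:R * uc a x ^+ 2).
Proof.
move=> Ix; have Vx := Ix.1; have u0 := inner_u Ix.
have su2 := smooth_onM (@su a) (@su a).
rewrite (elliptic_laplacian (chart_hopen hm a) _ _ su2 Ix).
have := laplacian_sqr (chart_hopen hm a) (metric_mx hg (a := a)) (metricT hg (a := a))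
  (metric_posdef hg (a := a)) (@su a) (@chart_lapE a) Vx.
move=> e; apply: (mulfI (lt0r_neq0 u0)); rewrite mulrBr mulrA divff ?gt_eqF // mul1r e.
by move: (uc a x) => v; rewrite !exprS expr0; ring.
Qed.

Lemma inner_open a : open (inner a).
Proof. exact: open_interior_part (chart_hopen hm a). Qed.

Lemma inner_ella a : (forall x, inner a x -> (invmx (g a x))^T = invmx (g a x)) /\
  (forall x, inner a x -> posdef (invmx (g a x))).
Proof. by split => x [Vx _]; have [] := inv_posdef Vx. Qed.

Lemma inner_smooth a f : smooth_on (V a) f -> smooth_open (inner a) f.
Proof. by apply: smooth_on_open (@inner_open a) _; exact: innerW. Qed.

Lemma smooth_ella a i j : smooth_open (inner a) (fun x => invmx (g a x) i j).
Proof.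
apply: inner_smooth; apply: (smooth_mx_inv _ (metric_mx hg (a := a))) => x Vx.
exact: (metric_unit hg).
Qed.

Lemma smooth_ellb a i : smooth_open (inner a) (fun x => ellb a x 0 i).
Proof.
apply: (smooth_ell_coef (chart_hopen hm a)); [exact: metric_mx|move=> y; exact: (metric_posdef hg)|exact: su|].
by move=> x Ix; rewrite gt_eqF // inner_u.
Qed.

(* [W - eps u^2] has no interior local maximum, because
   [L (- u^2) = 2 n u^2 > 0] for the operator [L] of the Bochner formula. *)
Lemma no_interior_max p (eps : R) (O : set M) : 0 < eps -> ~ boundary A p -> open O -> O p ->
  (forall q, O q -> W q - eps * (u q * u q) <= W p - eps * (u p * u p)) -> False.
Proof.
move=> e0 nb oO Op mx; have [a dp] := chart_cover hm p.
have Ix := interior_chart dp nb; set x := chart a p in Ix.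
pose I := interior_part [set x | V a x /\ O (inv a x)].
have oI : open I by apply: open_interior_part; exact: chart_image_sub_hopen.
have II : I `<=` inner a by move=> y [[Vy _] y0].
have IIx : I x by split; [split; [exact: Ix.1|rewrite (chartK hm dp)]|exact: Ix.2].
have sE := inner_smooth (@smooth_chart_energy a).
have su2 := inner_smooth (smooth_onM (@su a) (@su a)).
have [aT ap] := inner_ella a.
have := @elliptic_max R n.+1 I (ella a) (ellb a) oI
  (fun y Iy => aT y (II y Iy)) (fun y Iy => ap y (II y Iy)) (fun y => E a y + (- eps) * (uc a y * uc a y)) x.
rewrite (ellipticD (ella a) (ellb a) (@inner_open a) (- eps) sE su2 Ix) elliptic_usq //.
have h1 := elliptic_energy_ge0 Ix; have h2 := inner_u Ix.
have h3 : 0 < eps * (2 * n.+1%:R * uc a x ^+ 2).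
  by rewrite mulr_gt0 // mulr_gt0 ?exprn_gt0 // mulr_gt0 // ltr0n.
move=> h; suff : elliptic (ella a) (ellb a) (E a) x + - eps * - (2 * n.+1%:R * uc a x ^+ 2) <= 0.
  by move: h1 h3; rewrite mulrNN; lra.
apply: h => //.
  apply: smooth_sub II _; apply: smooth_openD => //; first exact: inner_open.
  by apply: smooth_openM => //; [exact: inner_open|apply: smooth_cst; exact: inner_open].
move=> y [[Vy Oy] _]; have := mx _ Oy.
rewrite (energy_chart Vy) -(chartK hm dp) -/x (energy_chart Ix.1) !mulNr /=; exact.
Qed.
End Static.

(** * Rigidity of the energy *)

Section HalfSpaceClosure.
Context {R : realType} {n : nat}.

(** Every point of [V] is a limit of points of the open part, obtained by moving inwards along
    e_0. *)
Lemma smooth_on_const (V : set 'rV[R]_n.+1) f (c : R) : hopen V -> smooth_on V f ->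
  (forall x, interior_part V x -> f x = c) -> forall x, V x -> f x = c.
Proof.
move=> hV sf fc x Vx; have [U [F [oU Ux sF fF]]] := sf x Vx.
rewrite fF //; apply/eqP; rewrite -subr_eq0 -normr_le0 leNgt; apply/negP => F0.
have cF : {for (0 : R), continuous (fun t : R => F (x + t *: 'e_0))}.
  apply: (@continuous_comp _ _ _ (fun t : R => x + t *: 'e_0) F).
    exact: continuous_line.
  by rewrite scale0r addr0; exact: smooth_continuous sF Ux.
have cl : {for (0 : R), continuous (fun t : R => x + t *: 'e_0 : 'rV[R]_n.+1)}.
  exact: continuous_line.
have /(@cvgrPdist_lt _ _ _ (nbhs (0 : R))) /(_ _ F0) [e1 /= e10 h1] := cF.
have nU : nbhs (x + 0 *: 'e_0) U by rewrite scale0r addr0; exact: open_nbhs_nbhs.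
have [e2 /= e20 h2] := cl _ nU.
have [e3 /= e30 h3] := hopen_right ord0 hV Vx.
pose t := Order.min e1 (Order.min e2 e3) / 2.
have m0 : 0 < Order.min e1 (Order.min e2 e3) by rewrite !lt_min e10 e20.
have t0 : 0 < t by rewrite divr_gt0.
have tm : t < Order.min e1 (Order.min e2 e3) by rewrite /t; lra.
have [t1 t2 t3] : [/\ t < e1, t < e2 & t < e3].
  by move: tm; rewrite !lt_min => /andP[? /andP[]].
have bt (e : R) : t < e -> ball_ Num.norm 0 e t by rewrite /ball_ /= sub0r normrN gtr0_norm.
have := h1 t (bt _ t1); rewrite scale0r addr0 -(fF (x + t *: 'e_0)); [|exact: (h2 t (bt _ t2))|exact: (h3 t (bt _ t3) t0)].
rewrite fc ?ltxx //; split; first exact: (h3 t (bt _ t3) t0).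
have := hopen_half hV Vx; rewrite half_spaceE /= !mxE !eqxx mulr1; lra.
Qed.
End HalfSpaceClosure.

Section StrictMax.
Context {R : realType} {n : nat}.

Lemma posdef_coercive (P : 'M[R]_n) : P^T = P -> posdef P ->
  exists2 C : R, 0 < C & forall v : 'rV[R]_n, sqnorm v <= C * (v *m P *m v^T) 0 0.
Proof.
move=> PT pP; have [B BB uB] := cholesky PT pP.
pose K := \sum_k \sum_i invmx B k i ^+ 2.
have K0 : 0 <= K by apply: sumr_ge0 => k _; apply: sumr_ge0 => i _; exact: sqr_ge0.
exists (n%:R * (n%:R * K) + 1); first by rewrite ltr_wpDl // !mulr_ge0.
move=> v; pose w := v *m B.
have wE : (v *m P *m v^T) 0 0 = sqnorm w.
  rewrite -BB mulmxA -/w -mulmxA -trmx_mul -/w mxE; apply: eq_bigr => i _.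
  by rewrite [w^T i 0]mxE expr2.
have vi i : v 0 i ^+ 2 <= n%:R * K * sqnorm w.
  have -> : v 0 i = \sum_k w 0 k * invmx B k i by rewrite -{1}(mulmxK uB v) mxE.
  apply: (le_trans (sqr_sum_le _)); rewrite card_ord -mulrA ler_wpM2l // /sqnorm mulr_sumr.
  apply: ler_sum => k _; rewrite exprMn mulrC ler_wpM2r ?sqr_ge0 //.
  rewrite /K (bigD1 k) //= (bigD1 i) //= -addrA lerDl addr_ge0 //.
    by apply: sumr_ge0 => j _; exact: sqr_ge0.
  by apply: sumr_ge0 => j _; apply: sumr_ge0 => l _; exact: sqr_ge0.
rewrite wE mulrDl mul1r; apply: (@le_trans _ _ (n%:R * (n%:R * K) * sqnorm w)); last by rewrite lerDl sqnorm_ge0.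
rewrite -mulrA mulr_natl -[X in _ *+ X]card_ord -sumr_const; apply: ler_sum => i _; exact: vi.
Qed.

(** The second derivatives stay so close to their values at the critical point that the coercivity
    of the Hessian survives along the segment to y; two mean value theorems then give f y < f x. *)
Lemma strict_max U (f : 'rV[R]_n -> R) x : open U -> smooth_open U f -> U x -> (forall i, pd i f x = 0) ->
  posdef (- \matrix_(i, j) pd i (pd j f) x) ->
  exists2 d : R, 0 < d & forall y, 0 < sqnorm (y - x) < d -> U y /\ f y < f x.
Proof.
move=> oU sf Ux crit pH; set P := - _ in pH.
have PT : P^T = P by apply/matrixP => i j; rewrite !mxE (pdC j i oU sf Ux).
have [C C0 hC] := posdef_coercive PT pH.
(* With the coercivity constant C and Q = v P v^T, the error eta n |v|^2 is at most eta n C Q = Q /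
   2 - eta Q, which is less than Q. *)
pose eta := (2 * (n%:R * C + 1))^-1.
have eta0 : 0 < eta by rewrite invr_gt0 mulr_gt0 // ltr_wpDl // mulr_ge0 // ltW.
have [d0 d00 hd0] := open_sqball oU Ux.
have [d1 d10 hd1] : exists2 d : R, 0 < d & forall y, sqnorm (y - x) < d -> forall i j, `|pd i (pd j f) y - pd i (pd j f) x| < eta.
  have nE : nbhs x [set y | forall ij : 'I_n * 'I_n, `|pd ij.1 (pd ij.2 f) y - pd ij.1 (pd ij.2 f) x| < eta].
    apply: (@filter_forall _ _ (fun (ij : 'I_n * 'I_n) y => `|pd ij.1 (pd ij.2 f) y - pd ij.1 (pd ij.2 f) x| < eta) (nbhs x) _) => -[i j] /=.
    have s2 := smooth_pd i (smooth_pd j sf).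
    have /(@cvgrPdist_lt _ _ _ (nbhs x)) /(_ _ eta0) := smooth_continuous s2 Ux.
    by move=> h; apply: filterS h => y h; rewrite distrC; exact: h.
  move: nE; rewrite nbhsE => -[Q [oQ Qx] hQ].
  have [d d_0 hd] := open_sqball oQ Qx; exists d => // y /hd Qy i j.
  exact: (hQ _ Qy (i, j)).
exists (Order.min d0 d1); first by rewrite lt_min d00.
move=> y /andP[y0]; rewrite lt_min => /andP[yd0 yd1]; split; first exact: hd0.
set v := y - x in y0 yd0 yd1.
have xv : x + v = y by rewrite /v addrC subrK.
move: v y0 yd0 yd1 xv => v y0 yd0 yd1 xv; pose g z := \sum_j v 0 j * pd j f z.
have sg : smooth_open U g.
  by apply: smooth_sum => // j _; apply: smooth_openM => //; [exact: smooth_cst|exact: smooth_pd].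
have ln (t : R) : 0 <= t <= 1 -> sqnorm (x + t *: v - x) <= sqnorm v.
  move=> /andP[t0 t1]; rewrite addrAC subrr add0r sqnormZ ler_piMl ?sqnorm_ge0 //.
  by rewrite expr_le1.
have inU (t : R) : 0 <= t <= 1 -> U (x + t *: v) by move=> /ln h; apply: hd0; exact: le_lt_trans h yd0.
have [|s /andP[s0 s1]] := @MVT0 R (fun t : R => f (x + t *: v)) (fun t => g (x + t *: v)) 1 ltr01.
  by move=> t /inU Ut; exact: smooth_line_derive sf Ut.
rewrite scale1r xv scale0r addr0 mulr1 => e1.
have [|s' /andP[s'0 s's]] := @MVT0 R (fun t : R => g (x + t *: v)) (fun t => \sum_i v 0 i * pd i g (x + t *: v)) s s0.
  move=> t /andP[t0 ts]; apply: smooth_line_derive sg _; apply: inU.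
  by rewrite t0 (le_trans ts) // ltW.
have g0 : g x = 0 by rewrite /g big1 // => j _; rewrite crit mulr0.
rewrite scale0r addr0 g0 subr0 => e2.
rewrite -subr_lt0 e1 e2 nmulr_rlt0 //.
have s'01 : 0 <= s' <= 1 by rewrite ltW //= (le_trans (ltW s's)) // ltW.
set z := x + s' *: v.
have dg i := pd_dir v i sf (inU _ s'01 : U z).
have zd : sqnorm (z - x) < d1 by apply: le_lt_trans (ln _ s'01) yd1.
have main : (v *m P *m v^T) 0 0 + \sum_i v 0 i * pd i g z <= eta * (n%:R * sqnorm v).
  have -> : (v *m P *m v^T) 0 0 + \sum_i v 0 i * pd i g z =
     \sum_i \sum_j v 0 i * v 0 j * (pd i (pd j f) z - pd i (pd j f) x).
    rewrite -mulmxA mxE -big_split; apply: eq_bigr => i _ /=; rewrite dg [(P *m _) i 0]mxE !mulr_sumr -big_split.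
    apply: eq_bigr => j _; rewrite !mxE /=.
    by move: (v 0 i) (v 0 j) (pd i (pd j f) z) (pd i (pd j f) x) => *; ring.
  apply: (@le_trans _ _ (\sum_i \sum_j eta * ((v 0 i ^+ 2 + v 0 j ^+ 2) / 2))).
    apply: ler_sum => i _; apply: ler_sum => j _.
    have := hd1 z zd i j; move: (pd i (pd j f) z - _) => q /ltW hq.
    apply: (le_trans (ler_norm _)); rewrite normrM mulrC ler_pM // normrM.
    have := sqr_ge0 (`|v 0 i| - `|v 0 j|); rewrite -[v 0 i ^+ 2]real_normK ?num_real // -[v 0 j ^+ 2]real_normK ?num_real //.
    by rewrite !expr2; move: (`|v 0 i|) (`|v 0 j|) => p r; nra.
  rewrite le_eqVlt; apply/orP; left; apply/eqP.
  under eq_bigr => i _ do rewrite -mulr_sumr.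
  rewrite -mulr_sumr; congr (_ * _).
  under eq_bigr => i _ do rewrite -mulr_suml big_split /= sumr_const card_ord.
  rewrite -mulr_suml big_split /= sumr_const card_ord -/(sqnorm v) sumrMnl -/(sqnorm v).
  by rewrite -mulr_natl; field.
have hv := hC v.
have e3 : eta * (2 * (n%:R * C + 1)) = 1 by rewrite mulVf // gt_eqF // mulr_gt0 // ltr_wpDl // mulr_ge0 // ltW.
have q0 : 0 < (v *m P *m v^T) 0 0.
  by rewrite -(pmulr_rgt0 _ C0); exact: lt_le_trans hv.
have e4 : eta * (n%:R * sqnorm v) <= eta * (n%:R * (C * (v *m P *m v^T) 0 0)).
  by rewrite ler_wpM2l ?(ltW eta0) // ler_wpM2l.
move: main e3 e4 q0 eta0; move: (\sum_i _) ((v *m P *m v^T) 0 0) (n%:R * sqnorm v) => S Q T main e3 e4 q0 eta0.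
have e5 : eta * (n%:R * (C * Q)) = Q / 2 - eta * Q.
  have -> : eta * (n%:R * (C * Q)) = (eta * (2 * (n%:R * C + 1))) * Q / 2 - eta * Q by field.
  by rewrite e3 mul1r.
have h6 : 0 < eta * Q by rewrite mulr_gt0.
lra.
Qed.
End StrictMax.

(** * Consequences of kappa <= 1 on one component *)

Section Rigidity.
Context {R : realType} {n : nat} {M : topologicalType} {A : atlas R n.+1 M}.
Local Notation vec := 'rV[R]_n.+1.
Variables (g : metric_components A) (u : M -> R).
Hypothesis hs : is_static_triple g u.
Local Notation V := (@chart_image R n.+1 M A).
Local Notation inv a := (@chart_inv R n.+1 M A a).
Local Notation dom a := (@chart_dom R n.+1 M A a).
Let hm := static_manifold hs.
Let hg := static_metric hs.
Let su := static_smooth hs.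
Local Notation uc a := (u \o inv a).
Local Notation inner a := (interior_part (V a)).
Local Notation W := (total_energy g u).
Local Notation E a := (energy (g a) (uc a)).
Local Notation Th a := (trace_free_hess (g a) (uc a)).
Local Notation um := (u_max u).

Lemma u_max_attained : exists2 p0, u p0 = um & forall p, u p <= um.
Proof.
have [b hb] := static_boundary hs.
have [||p0 _ h] := @compact_EVT_max M R u setT _ (static_compact hs).
- by exists b.
- exact/continuous_subspaceT/(static_u_continuous hs).
suff umE : um = u p0 by exists p0 => // p; rewrite umE; apply: h; rewrite inE.
apply/eqP; rewrite eq_le; apply/andP; split.
  by apply: ge_sup; [exists (u p0), p0|move=> _ [p _ <-]; apply: h; rewrite inE].
by apply: sup_upper_bound; [split; [exists (u p0), p0|exists (u p0) => _ [p _ <-]; apply: h; rewrite inE]|exists p0].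
Qed.

Lemma u_le_max p : u p <= um. Proof. by have [_ _] := u_max_attained. Qed.

Variable N : set M.
Hypothesis hN : pi0 (~` MAX u) N.

Lemma u_max_gt0 : 0 < um.
Proof.
have [p Np] := pi0_neq0 hN; have pM := pi0_sub hN Np.
apply: (le_lt_trans (static_u_ge0 hs p)); rewrite lt_neqAle u_le_max andbT.
by apply/eqP.
Qed.

Lemma open_notMAX : open (~` MAX u).
Proof.
rewrite openC; apply: (@closed_comp _ _ u [set t | t = um]); last exact: closed_eq.
by move=> p _; exact: (static_u_continuous hs).
Qed.

Lemma MAX_not_boundary p : MAX u p -> ~ boundary A p.
Proof. by move=> mp /(static_zero hs) u0; have := u_max_gt0; rewrite -mp u0 ltxx. Qed.

Lemma N_open : open N. Proof. exact: (component_open hm open_notMAX hN). Qed.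

Lemma closure_N p : closure N p -> N p \/ MAX u p.
Proof.
move=> cp; have [|mp] := pselect (MAX u p); first by right.
by left; exact: (closure_component hm open_notMAX hN cp mp).
Qed.

Lemma compact_closure_N : compact (closure N).
Proof. by apply: (subclosed_compact _ (static_compact hs)) => //; exact: closed_closure. Qed.

Lemma critical_at a (c : R) x : inner a x -> (forall y, inner a y -> c * uc a y <= c * uc a x) -> c != 0 ->
  grad (uc a) x = 0.
Proof.
move=> Ix mx c0; have sI := inner_smooth hs (@su a).
have sc : smooth_open (inner a) (fun y => c * uc a y).
  by apply: smooth_openM => //; [exact: inner_open hs a|apply: smooth_cst; exact: inner_open hs a].
apply/colP => i; rewrite !mxE.
rewrite (partial_pd i (chart_hopen hm a) (inner_open hs (a := a)) (@innerW _ _ _) (@su a) Ix).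
have := max_critical (inner_open hs (a := a)) sc Ix mx i.
rewrite pdM; [|exact: differentiable_cst|exact: smooth_diff sI Ix].
by rewrite pd_cst mul0r add0r => /eqP; rewrite mulf_eq0 (negPf c0) => /eqP.
Qed.

Lemma MAX_grad a x : V a x -> MAX u (inv a x) -> inner a x /\ grad (uc a) x = 0.
Proof.
move=> Vx mx; have Ix : inner a x.
  by rewrite -(chart_invK hm Vx); apply: (interior_chart hs (chart_inv_dom hm Vx)); exact: MAX_not_boundary.
split => //; apply: (@critical_at a 1 x Ix _ (oner_neq0 _)).
by move=> y _; rewrite !mul1r /= mx; exact: u_le_max.
Qed.

Lemma MAX_energy p : MAX u p -> W p = um * um.
Proof.
move=> mp; have [a dp] := chart_cover hm p.
have [|_ g0] := @MAX_grad a (chart a p) (chart_in dp); first by rewrite (chartK hm dp).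
rewrite /total_energy (grad_norm_sqr hs dp) /gradsq g0 !mulmx0 mxE add0r.
by rewrite mp.
Qed.

(** The condition kappa <= 1 on the boundary of N. It covers both the case kappa < 1, to be refuted,
    and the case of equality. *)
Hypothesis kN : forall p, boundary A p -> N p -> W p <= um * um.

(** The inequality for W is not strict, so W - eps u^2 is used: it has no maximum inside N, equals W
    <= u_max^2 on the boundary, and is at most u_max^2 on MAX(u). *)
Lemma energy_le p : closure N p -> W p <= um * um.
Proof.
move: p.
have key (eps : R) : 0 < eps -> forall p, closure N p -> W p <= um * um + eps * (u p * u p).
  move=> e0; pose F p := W p - eps * (u p * u p).
  have cF : continuous F.
    move=> q; apply: continuousB; first exact: (total_energy_continuous hs).
    apply: continuousM; first exact: cst_continuous.
    by apply: continuousM; exact: (static_u_continuous hs).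
  have [q0 Nq0] := pi0_neq0 hN.
  have [||q] := @compact_EVT_max M R F (closure N) _ compact_closure_N.
  - by exists q0; exact: subset_closure.
  - exact: continuous_subspaceT.
  rewrite inE => cq mq.
  have Fq : F q <= um * um.
    have [Nq|mq'] := closure_N cq.
      have [bq|nb] := pselect (boundary A q).
        by rewrite /F (static_zero hs bq) mulr0 mulr0 subr0; exact: kN.
      exfalso; apply: (no_interior_max hs e0 nb N_open Nq) => r Nr.
      by apply: (mq r); rewrite inE; exact: subset_closure.
    by rewrite /F (MAX_energy mq') gerBl mulr_ge0 ?(ltW e0) // -expr2 sqr_ge0.
  move=> p cp; rewrite -lerBlDr; apply: le_trans Fq; apply: (mq p); by rewrite inE.
move=> p cp; rewrite leNgt; apply/negP => lt.
have u2 : 0 <= u p * u p by rewrite -expr2 sqr_ge0.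
(* Small enough for eps u^2 to stay below the supposed excess W - u_max^2 at p. *)
pose eps := (W p - um * um) / (2 * (u p * u p + 1)).
have e0 : 0 < eps by rewrite divr_gt0 ?subr_gt0 //; lra.
have := key eps e0 p cp.
have h : eps * (2 * (u p * u p + 1)) = W p - um * um by rewrite divfK // gt_eqF //; lra.
move: h e0 lt; move: (eps) (u p * u p) (W p) (um * um) u2 => e v w m; nra.
Qed.

(** Otherwise u would have its minimum over the closure of N at an interior point, where the
    Laplacian is - n u < 0. *)
Lemma boundary_in_component : exists2 p, boundary A p & N p.
Proof.
apply: contrapT => nex; have [q0 Nq0] := pi0_neq0 hN.
have [||q] := @compact_EVT_min M R u (closure N) _ compact_closure_N.
- by exists q0; exact: subset_closure.
- exact/continuous_subspaceT/(static_u_continuous hs).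
rewrite inE => cq mq.
have [Nq|mq'] := closure_N cq; last first.
  have := mq q0; rewrite inE mq' => /(_ (subset_closure Nq0)) h.
  by apply: (pi0_sub hN Nq0); apply/eqP; rewrite eq_le u_le_max.
have nb : ~ boundary A q by move=> b; apply: nex; exists q.
have [a dq] := chart_cover hm q; have Ix := interior_chart hs dq nb.
pose I := interior_part [set x | V a x /\ N (inv a x)].
have oI : open I by apply: open_interior_part; apply: chart_image_sub_hopen => //; exact: N_open.
have II : I `<=` inner a by move=> y [[Vy _] y0].
have Iq : I (chart a q) by split; [split; [exact: Ix.1|rewrite (chartK hm dq)]|exact: Ix.2].
have sI := inner_smooth hs (@su a).
have sc : smooth_open (inner a) (fun y => 0 + (- 1) * uc a y).
  apply: smooth_openD; [exact: inner_open hs a|apply: smooth_cst; exact: inner_open hs a|].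
  by apply: smooth_openM => //; [exact: inner_open hs a|apply: smooth_cst; exact: inner_open hs a].
have mx y : I y -> 0 + (- 1) * uc a y <= 0 + (- 1) * uc a (chart a q).
  move=> [[Vy Ny] _]; rewrite !add0r !mulN1r lerN2 /= (chartK hm dq).
  by apply: mq; rewrite inE; exact: subset_closure.
have s0 : smooth_open (inner a) (fun=> 0) by apply: smooth_cst; exact: inner_open hs a.
have [aT ap] := inner_ella hs a.
have := @elliptic_max R n.+1 I (fun x => invmx (g a x)) (ell_coef (g a) (uc a)) oI
  (fun y Iy => aT y (II y Iy)) (fun y Iy => ap y (II y Iy)) _ _ (smooth_sub II sc) Iq mx.
rewrite (ellipticD _ _ (inner_open hs (a := a)) (- 1) s0 sI Ix)
  (elliptic_laplacian (chart_hopen hm a) _ _ (@su a) Ix) (chart_lapE hs Ix.1).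
have g0 : grad (uc a) (chart a q) = 0.
  apply/colP => i; rewrite !mxE.
  rewrite (partial_pd i (chart_hopen hm a) (inner_open hs (a := a)) (@innerW _ _ _) (@su a) Ix).
  have := max_critical oI (smooth_sub II sc) Iq mx i.
  rewrite pd_lin; [|exact: differentiable_cst|exact: smooth_diff sI Ix].
  by rewrite pd_cst add0r mulN1r => /eqP; rewrite oppr_eq0 => /eqP.
have -> : elliptic (fun x => invmx (g a x)) (ell_coef (g a) (uc a)) (fun=> 0) (chart a q) = 0.
  have pd0 j : pd j (fun _ : vec => 0 : R) = (fun=> 0) by apply/funext => z; rewrite pd_cst.
  rewrite /elliptic big1 => [|i _]; last by rewrite big1 // => j _; rewrite !pd0 mulr0.
  by rewrite big1 ?addr0 // => i _; rewrite pd0 mulr0.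
have -> : \sum_k (invmx (g a (chart a q)) *m grad (uc a) (chart a q)) k 0 * partial k (uc a) (chart a q) = 0.
  by apply: big1 => k _; rewrite g0 mulmx0 mxE mul0r.
rewrite mulr0 subr0 add0r mulN1r mulNr opprK leNgt; apply/negP; rewrite negbK mulr_gt0 ?ltr0n //.
exact: (inner_u hs Ix).
Qed.

(** Otherwise N would be open and closed, hence all of M, although the maximum is attained. *)
Lemma closure_meets_MAX : exists2 p, closure N p & MAX u p.
Proof.
apply: contrapT => nex; have [q0 Nq0] := pi0_neq0 hN.
have cl : closure N `<=` N.
  by move=> p cp; have [//|mp] := closure_N cp; case: nex; exists p.
have NT : N = setT.
  apply: (static_connected hs); first by exists q0.
    by exists N; [exact: N_open|rewrite setTI].
  exists (closure N); first exact: closed_closure.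
  by rewrite setTI; apply/seteqP; split => //; exact: subset_closure.
have [p0 mp0 _] := u_max_attained.
have : (~` MAX u) p0 by apply: (pi0_sub hN); rewrite NT.
by apply.
Qed.

Local Notation ella a := (fun x => invmx (g a x)).
Local Notation ellb a := (ell_coef (g a) (uc a)).

Lemma sqball_convex (z x y : vec) (r2 t : R) : sqnorm (x - z) < r2 -> sqnorm (y - z) < r2 ->
  0 <= t <= 1 -> sqnorm (x + t *: (y - x) - z) < r2.
Proof.
move=> hx hy /andP[t0 t1].
have : sqnorm (x + t *: (y - x) - z) <= (1 - t) * sqnorm (x - z) + t * sqnorm (y - z).
  rewrite /sqnorm !mulr_sumr -big_split; apply: ler_sum => i _; rewrite !mxE /=.
  have -> : x 0 i + t * (y 0 i - x 0 i) - z 0 i = (1 - t) * (x 0 i - z 0 i) + t * (y 0 i - z 0 i) by ring.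
  move: (x 0 i - z 0 i) (y 0 i - z 0 i) => p q.
  have : 0 <= t * (1 - t) * (p - q) ^+ 2 by rewrite mulr_ge0 ?sqr_ge0 // mulr_ge0 // subr_ge0.
  rewrite !expr2; nra.
move=> h; apply: (le_lt_trans h).
have [->|tn] := eqVneq t 1; first by rewrite subrr mul0r add0r mul1r.
have : 0 < (1 - t) * (r2 - sqnorm (x - z)) by rewrite mulr_gt0 // subr_gt0 // lt_neqAle tn.
have : 0 <= t * (r2 - sqnorm (y - z)) by rewrite mulr_ge0 // subr_ge0 ltW.
lra.
Qed.

(* A ball of [N] touching [MAX u]: by Hopf's lemma [W] cannot stay below its
   value at the touching point, where [D W = 0]. *)
Lemma energy_max_attained : exists a x, [/\ inner a x, N (inv a x) & E a x = um * um].
Proof.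
have [q0 cq0 mq0] := closure_meets_MAX; have [a dq0] := chart_cover hm q0.
have Ix0 := interior_chart hs dq0 (MAX_not_boundary mq0); set x0 := chart a q0 in Ix0.
have [d d0 hd] := open_sqball (inner_open hs (a := a)) Ix0.
have [z [Nz [dz hz]]] : exists z, N z /\ dom a z /\ sqnorm (chart a z - x0) < d / 4.
  have oB := @open_sqlt R n.+1 x0 (d / 4).
  have h0 : sqnorm (chart a q0 - x0) < d / 4.
    by rewrite /x0 subrr sqnorm0 divr_gt0.
  have [z [Nz [dz hz]]] := cq0 _ (open_nbhs_nbhs (conj (chart_preim_open hm a oB) (conj dq0 h0))).
  by exists z.
set z' := chart a z in hz.
have BI x : sqnorm (x - z') <= sqnorm (x0 - z') -> inner a x.
  move=> hx; apply: hd.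
  have -> : x - x0 = (x - z') + (z' - x0) by rewrite addrA subrK.
  apply: (le_lt_trans (sqnormD_le _ _)); rewrite (sqnormB x0) in hx; move: d0 hz hx; lra.
have sI := inner_smooth hs (@su a).
have cS : compact ([set x | sqnorm (x - z') <= sqnorm (x0 - z')] `&` [set x | uc a x = um]).
  apply: compact_level; [exact: norm_hausdorff|exact: compact_sqball|].
  by move=> x /BI Ix; exact: smooth_continuous sI Ix.
(* The point of MAX(u) nearest to the centre z', where the ball touches. *)
have [||p] := @EVT_min_rV R n.+1 (fun x => sqnorm (x - z')) _ _ cS.
- by exists x0; split => //=; rewrite /x0 (chartK hm dq0).
- by apply: continuous_subspaceT => x; apply: smooth_continuous (smooth_sqdist z') _.
rewrite inE => -[/= pB up] mp; set r2 := sqnorm (p - z') in mp.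
have Vp : V a p := (BI p pB).1.
have [Ip gp] := MAX_grad Vp up.
have r20 : 0 < r2.
  rewrite lt_neqAle sqnorm_ge0 andbT; apply/eqP => /esym /sqnorm_eq0 /eqP; rewrite subr_eq0 => /eqP pz.
  by apply: (pi0_sub hN Nz); rewrite /MAX /= -(chartK hm dz) -/z' -pz.
have BI' x : sqnorm (x - z') <= r2 -> inner a x by move=> h; apply: BI; exact: le_trans h pB.
have nM x : sqnorm (x - z') < r2 -> (~` MAX u) (inv a x).
  move=> h mx; have := mp x; rewrite inE => /(_ (conj (le_trans (ltW h) pB) mx)).
  by rewrite /= leNgt h.
have zz : sqnorm (z' - z') < r2 by rewrite subrr sqnorm0.
have BN x : sqnorm (x - z') < r2 -> N (inv a x).
  move=> h; apply: (segment_component hm hN (x := z')); last by rewrite /z' (chartK hm dz).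
  move=> t t01; have ht := sqball_convex zz h t01.
  by split; [exact: (BI' _ (ltW ht)).1|exact: nM].
apply: contrapT => nex.
have lt x : sqnorm (x - z') < r2 -> E a x < um * um.
  move=> h; have Ix := BI' x (ltW h).
  rewrite lt_neqAle; apply/andP; split.
    by apply/eqP => e; apply: nex; exists a, x; split => //; exact: BN.
  by rewrite -(energy_chart hs Ix.1); apply/energy_le/subset_closure/BN.
have sE := inner_smooth hs (smooth_chart_energy hs (a := a)).
(* A point of the sphere is in the closure of N: moved a little towards the centre it lies in the
   open ball, which is contained in N. *)
have le x : sqnorm (x - z') <= r2 -> E a x <= um * um.
  move=> h; rewrite -(energy_chart hs (BI' x h).1); apply: energy_le => O nO.
  have [e e0 he] := chart_nbhs hm (chart_inv_dom hm (BI' x h).1) nO.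
  rewrite (chart_invK hm (BI' x h).1) in he.
  have oL : nbhs (x + 0 *: (z' - x)) (cube x e) by rewrite scale0r addr0; exact: cube_nbhs.
  have cl : {for (0 : R), continuous (fun t : R => x + t *: (z' - x))}.
    exact: continuous_line.
  have [e' /= e'0 he'] := cl _ oL.
  pose t := Order.min (e' / 2) 1.
  have t0 : 0 < t by rewrite lt_min divr_gt0 //=.
  have t1 : t <= 1 by rewrite ge_min lexx orbT.
  have te : t < e' by apply: (@le_lt_trans _ _ (e' / 2)); [rewrite ge_min lexx|lra].
  have ct : cube x e (x + t *: (z' - x)) by apply: he'; rewrite /ball_ /= sub0r normrN gtr0_norm.
  have bt : sqnorm (x + t *: (z' - x) - z') < r2.
    have -> : x + t *: (z' - x) - z' = (1 - t) *: (x - z') by apply/rowP => i; rewrite !mxE; ring.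
    rewrite sqnormZ; apply: (@le_lt_trans _ _ ((1 - t) ^+ 2 * r2)); first by rewrite ler_wpM2l ?sqr_ge0.
    rewrite -[ltRHS]mul1r ltr_pM2r // expr2.
    by move: t0 t1; nra.
  exists (inv a (x + t *: (z' - x))); split; first exact: BN.
  by have [] := he _ ct (hopen_half (chart_hopen hm a) (BI' _ (ltW bt)).1).
have [aT ap] := inner_ella hs a.
apply: (@hopf R n.+1 (inner a) (ella a) (ellb a) (inner_open hs (a := a)) aT ap
  (smooth_ella hs (a := a)) (smooth_ellb hs (a := a)) (E a) (um * um) sE z' p r2) => //.
- by move=> x h; apply: (elliptic_energy_ge0 hs); exact: (BI' _ (ltW h)).
- by rewrite -(energy_chart hs Vp) MAX_energy.
move=> i; rewrite -(partial_pd i (chart_hopen hm a) (inner_open hs (a := a)) (@innerW _ _ _) (smooth_chart_energy hs (a := a)) Ip).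
rewrite /energy (partialD (chart_hopen hm a)) //; last 2 first.
- by apply: (smooth_gradsq (chart_hopen hm a)); [exact: metric_mx|move=> y; exact: (metric_posdef hg)|exact: su].
- by apply: smooth_onM; exact: su.
rewrite (partialM (chart_hopen hm a) i (@su a) (@su a) Vp).
have := gp => /colP /(_ i); rewrite !mxE => ->; rewrite mul0r mulr0 addr0 addr0.
rewrite (partial_gradsq (chart_hopen hm a) (metric_mx hg (a := a)) (metricT hg (a := a)) (metric_posdef hg (a := a)) (@su a)) //.
by rewrite gp !mulmx0 mxE mulr0.
Qed.

(** The strong maximum principle on the convex interior part of the cube, then continuity up to its
    boundary face. *)
Lemma energy_cube a x0 (e : R) x1 : (forall x, cube x0 e x -> half_space x -> V a x /\ N (inv a x)) ->
  cube x0 e x1 -> inner a x1 -> E a x1 = um * um ->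
  forall x, cube x0 e x -> half_space x -> E a x = um * um.
Proof.
move=> hc cx1 Ix1 Ex1 x cx hx.
have hB : hopen (V a `&` cube x0 e) by apply: hopenI; [exact: open_cube|exact: chart_hopen].
have sE : smooth_on (V a `&` cube x0 e) (E a).
  by apply: smooth_on_sub (smooth_chart_energy hs (a := a)) => y [].
apply: (smooth_on_const hB sE) => [y Iy|]; last by split => //; have [] := hc x cx hx.
have [aT ap] := inner_ella hs a.
pose Cv := cube x0 e `&` [set y : vec | 0 < y 0 0].
have CI : Cv `<=` inner a.
  move=> z [cz z0]; split => //; have [] // := hc z cz _.
  by rewrite half_spaceE ltW.
apply: (@strong_max R n.+1 (inner a) (ella a) (ellb a) (inner_open hs (a := a)) aT ap
  (smooth_ella hs (a := a)) (smooth_ellb hs (a := a)) (E a) (um * um) (inner_smooth hs (smooth_chart_energy hs (a := a))) Cv x1) => //.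
- apply: openI; first exact: open_cube.
  apply: (@open_comp _ _ (fun x : vec => x 0 0) [set t | 0 < t]); last exact: open_gt.
  by move=> z _; exact: continuous_coord.
- move=> z w t [cz /= z0] [cw /= w0] t01; split; first exact: cube_convex.
  rewrite /= !mxE; move: t01 => /andP[t0 t1]; have [->|tn] := eqVneq t 0; first by rewrite mul0r addr0.
  have h1 : 0 < t * w 0 0 by rewrite mulr_gt0 // lt0r tn.
  have h2 : 0 <= (1 - t) * z 0 0 by rewrite mulr_ge0 // ?subr_ge0 // ltW.
  have -> : z 0 0 + t * (w 0 0 - z 0 0) = (1 - t) * z 0 0 + t * w 0 0 by ring.
  lra.
- by move=> z /CI; exact: elliptic_energy_ge0.
- move=> z Cz; have Iz := CI z Cz; rewrite -(energy_chart hs Iz.1); apply/energy_le/subset_closure.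
  by have [] := hc z Cz.1 (hopen_half (chart_hopen hm a) Iz.1).
- by split => //; exact: Ix1.2.
- by split; [exact: Iy.1.2|exact: Iy.2].
Qed.

(** The interior of the level set W = u_max^2 is closed in N because one interior point of that
    level in a cube fills the cube. *)
Lemma energy_const p : N p -> W p = um * um.
Proof.
pose Z := N `&` [set q | nbhs q [set r | W r = um * um]].
suff ZN : Z = N by rewrite -{1}ZN => -[_ /nbhs_singleton].
have loc q a (e : R) : dom a q -> 0 < e -> (forall x, cube (chart a q) e x -> half_space x -> V a x /\ N (inv a x)) ->
    (exists x1, [/\ cube (chart a q) e x1, inner a x1 & E a x1 = um * um]) -> nbhs q [set r | W r = um * um].
  move=> dq e0 hc [x1 [cx1 Ix1 Ex1]]; apply: filterS (cube_open hm dq e0) => r [dr cr] /=.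
  rewrite -(chartK hm dr) (energy_chart hs (chart_in dr)).
  exact: (energy_cube hc cx1 Ix1 Ex1 cr (chart_half hm dr)).
have oW : open [set q | nbhs q [set r | W r = um * um]].
  by rewrite openE => q hq; rewrite /interior; exact: nbhs_interior.
apply: (pi0_connected hN).
- have [a [x [Ix Nx Ex]]] := energy_max_attained; exists (inv a x); split => //=.
  have [e e0 he] := component_nbhs hm open_notMAX hN (chart_inv_dom hm Ix.1) Nx.
  apply: (loc _ a e) => //; first exact: chart_inv_dom Ix.1.
  by exists x; split => //; rewrite (chart_invK hm Ix.1); exact: cube_center.
- by exists [set q | nbhs q [set r | W r = um * um]].
exists (closure Z); first exact: closed_closure.
apply/seteqP; split => q; first by move=> Zq; split; [exact: Zq.1|exact: subset_closure].
move=> [Nq cq]; split => //=.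
have [a dq] := chart_cover hm q.
have [e e0 he] := component_nbhs hm open_notMAX hN dq Nq.
apply: (loc _ a e) => //.
have [r [[Nr nr] [dr cr]]] := cq _ (cube_open hm dq e0).
pose O := [set s | W s = um * um] `&` (dom a `&` chart a @^-1` cube (chart a q) e).
have nO : nbhs r O.
  apply: filterI => //; apply: open_nbhs_nbhs; split => //.
  by apply: chart_preim_open => //; exact: open_cube.
have [e' e'0 he'] := chart_nbhs hm dr nO.
(* The point [r] may lie on the boundary of M; a small inward shift gives an interior point on the
   same level. *)
pose y := chart a r + (e' / 2) *: 'e_0.
have cy : cube (chart a r) e' y.
  move=> i; rewrite !mxE addrAC subrr add0r eqxx /=; case: (i == 0); rewrite ?mulr1 ?mulr0 ?normr0 //.
  by rewrite gtr0_norm ?divr_gt0 //; lra.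
have hr := chart_half hm dr; rewrite half_spaceE in hr.
have y0 : 0 < y 0 0 by rewrite !mxE !eqxx mulr1; lra.
have hy : half_space y by rewrite half_spaceE ltW.
have [Vy [Wy [_ cy']]] := he' y cy hy.
exists y; split => //.
- by move: cy'; rewrite /= (chart_invK hm Vy).
- by rewrite -(energy_chart hs Vy).
Qed.

(** Inside, W is maximal at every point, so L W <= 0 and the square vanishes. On the boundary u = 0
    and the static equation itself reads D^2 u = 0. *)
Lemma trace_free_component a q : dom a q -> N q -> Th a (chart a q) = 0.
Proof.
move=> dq Nq; have Vq := chart_in dq.
have [bq|nb] := pselect (boundary A q).
  have u0 : uc a (chart a q) = 0 by rewrite /= (chartK hm dq) (static_zero hs bq).
  apply/matrixP => i j; have := chart_ricE hs i j Vq.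
  rewrite u0 !mul0r mulr0 mul0r addr0 => h; rewrite !mxE u0 mul0r addr0.
  by rewrite -h.
have Ix := interior_chart hs dq nb.
apply: (elliptic_energy_le0 hs Ix).
pose I := interior_part [set x | V a x /\ N (inv a x)].
have oI : open I by apply: open_interior_part; apply: chart_image_sub_hopen => //; exact: N_open.
have II : I `<=` inner a by move=> y [[Vy _] y0].
have Iq : I (chart a q) by split; [split; [exact: Ix.1|rewrite (chartK hm dq)]|exact: Ix.2].
have sE := inner_smooth hs (smooth_chart_energy hs (a := a)).
have [aT ap] := inner_ella hs a.
apply: (@elliptic_max R n.+1 I (ella a) (ellb a) oI
  (fun y Iy => aT y (II y Iy)) (fun y Iy => ap y (II y Iy)) _ _ (smooth_sub II sE) Iq).
move=> y [[Vy Ny] _]; rewrite -(energy_chart hs Vy) -(energy_chart hs Vq) (chartK hm dq).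
by rewrite !energy_const.
Qed.

Lemma trace_free_closure a q : dom a q -> closure N q -> Th a (chart a q) = 0.
Proof.
move=> dq cq; apply/matrixP => i j; rewrite [RHS]mxE.
have sT : smooth_on (V a) (fun x => Th a x i j).
  apply: (smooth_trace_free_hess (chart_hopen hm a)); [exact: metric_mx|move=> y; exact: (metric_posdef hg)|exact: su].
have [U [F [oU Ux sF fF]]] := sT _ (chart_in dq).
rewrite fF //; last exact: chart_in.
apply/eqP; rewrite -normr_le0 leNgt; apply/negP => F0.
have /(@cvgrPdist_lt _ _ _ (nbhs (chart a q))) /(_ _ F0) nF := smooth_continuous sF Ux.
have nU : nbhs (chart a q) (U `&` [set y | `|F (chart a q) - F y| < `|F (chart a q)|]).
  by apply: filterI => //; exact: open_nbhs_nbhs.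
have nq : nbhs q (dom a `&` chart a @^-1` (U `&` [set y | `|F (chart a q) - F y| < `|F (chart a q)|])).
  apply: filterI; first by apply: open_nbhs_nbhs; split => //; exact: chart_dom_open hm a.
  exact: (chart_continuous hm dq).
have [r [Nr [dr [Ur /=]]]] := cq _ nq.
rewrite -(fF _ Ur (chart_in dr)) (trace_free_component dr Nr) mxE subr0.
by rewrite ltxx.
Qed.

(** The dimension is [n.+1], so it is at least 2: this is what makes a punctured ball connected. *)
Hypothesis n0 : (0 < n)%N.

(** At a point of MAX(u) in the closure of N the Hessian is - u_max g, so a punctured ball around it
    misses MAX(u). Being connected and meeting N, it lies in N. *)
Lemma closure_open : open (closure N).
Proof.
rewrite openE => q cq; rewrite /interior.
have [Nq|mq] := closure_N cq.
  apply: filterS (open_nbhs_nbhs (conj N_open Nq)); exact: subset_closure.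
have [a dq] := chart_cover hm q; set x0 := chart a q.
have Vq := chart_in dq; have [|Ix gx] := @MAX_grad a x0 Vq; first by rewrite /x0 (chartK hm dq).
have sI := inner_smooth hs (@su a); have oI := inner_open hs (a := a).
have crit i : pd i (uc a) x0 = 0.
  rewrite -(partial_pd i (chart_hopen hm a) oI (@innerW _ _ _) (@su a) Ix).
  by have := gx => /colP /(_ i); rewrite !mxE.
have hess0 : \matrix_(i, j) pd i (pd j (uc a)) x0 = - (um *: g a x0).
  apply/matrixP => i j; have := trace_free_closure dq cq => /matrixP /(_ i j).
  rewrite !mxE /hessian big1 => [|k _]; last by have := gx => /colP /(_ k); rewrite !mxE => ->; rewrite mulr0.
  rewrite subr0 (partial_pd2 i j (chart_hopen hm a) oI (@innerW _ _ _) (@su a) Ix).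
  by rewrite -/x0 /= /x0 (chartK hm dq) mq => /eqP; rewrite addr_eq0 => /eqP ->.
have pH : posdef (- \matrix_(i, j) pd i (pd j (uc a)) x0).
  move=> v v0; rewrite hess0 opprK -scalemxAr -scalemxAl mxE mulr_gt0 ?u_max_gt0 //.
  exact: (metric_posdef hg Vq).
have [d d0 hd] := strict_max oI sI Ix crit pH.
have um0 : uc a x0 = um by rewrite /= /x0 (chartK hm dq).
have nM y : y != x0 -> sqnorm (y - x0) < d -> V a y /\ (~` MAX u) (inv a y).
  move=> yx hy; have y0 : 0 < sqnorm (y - x0) < d.
    rewrite hy andbT lt_neqAle sqnorm_ge0 andbT; apply: contraNneq yx => /esym /sqnorm_eq0 /eqP.
    by rewrite subr_eq0.
  have [Iy lt] := hd y y0; split; first exact: Iy.1.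
  by move=> my; move: lt; rewrite um0 /= my ltxx.
have oB := chart_preim_open hm a (@open_sqlt R n.+1 x0 d).
have nB : nbhs q (dom a `&` chart a @^-1` [set x | sqnorm (x - x0) < d]).
  apply: open_nbhs_nbhs; split => //; split => //=.
  by rewrite -/x0 subrr sqnorm0.
have [z [Nz [dz hz]]] := cq _ nB; set z' := chart a z in hz.
have zx : z' != x0.
  apply: contraPneq (pi0_sub hN Nz) => e; apply: contrapT => h; apply: h => h; apply: h.
  by rewrite /MAX /= -(chartK hm dz) -/z' e.
have Nz' : N (inv a z') by rewrite /z' (chartK hm dz).
have seg x y : N (inv a x) -> sqnorm (x - x0) < d -> sqnorm (y - x0) < d ->
    (forall t : R, 0 <= t <= 1 -> x + t *: (y - x) != x0) -> N (inv a y).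
  move=> Nx hx hy h; apply: (segment_component hm hN (x := x)) => // t t01.
  by apply: nM; [exact: h|exact: sqball_convex].
apply: filterS nB => r [dr hr]; have [rx|rx] := eqVneq (chart a r) x0.
  by rewrite -(chartK hm dr) rx /x0 (chartK hm dq).
apply: subset_closure; rewrite -(chartK hm dr); set r' := chart a r in hr rx *.
(* Connectedness by hand: the segment from [z'] to [r'] serves unless it runs into the centre [x0];
   then a detour is made through a point [w] off that line. *)
have [dir|nodir] := pselect (forall t : R, 0 <= t <= 1 -> z' + t *: (r' - z') != x0); first exact: (seg z').
have [t0 t0x] : exists t0 : R, z' + t0 *: (r' - z') = x0.
  apply: contrapT => h; apply: nodir => t _; apply/eqP => e; apply: h; by exists t.
have dn0 : r' - z' != 0.
  by apply: contraNneq zx => e; rewrite -t0x e scaler0 addr0.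
have [i di] : exists i, (r' - z') 0 i != 0.
  apply: contrapT => h; move/eqP: dn0; apply; apply/rowP => i; rewrite [RHS]mxE.
  by apply/eqP; apply: contrapT => /negP h'; apply: h; exists i.
have [j ji] : exists j : 'I_n.+1, j != i.
  have [i0|i0] := eqVneq i ord0; last by exists ord0; rewrite eq_sym.
  by exists ord_max; rewrite i0 -val_eqE /= -lt0n.
(* The bound by 1 turns s <= d / 2 into s^2 < d. *)
pose s := Order.min d 1 / 2.
have m0 : 0 < Order.min d 1 by rewrite lt_min d0 /=.
have s0 : 0 < s by rewrite divr_gt0.
pose w := x0 + s *: 'e_j.
have wd : sqnorm (w - x0) < d.
  rewrite /w addrAC subrr add0r sqnormZ.
  have -> : sqnorm ('e_j : vec) = 1.
    rewrite /sqnorm (bigD1 j) //= big1 ?addr0 => [|k kj]; first by rewrite mxE !eqxx expr1n.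
    by rewrite mxE (negPf kj) andbF expr0n.
  have s1 : s <= 1 / 2 by rewrite /s ler_pM2r ?invr_gt0 // ge_min lexx orbT.
  have sd : s <= d / 2 by rewrite /s ler_pM2r ?invr_gt0 // ge_min lexx.
  by rewrite mulr1 expr2; nra.
have avoid x (t : R) : x = x0 + t *: (r' - z') -> x != x0 -> forall t1 : R, x + t1 *: (w - x) != x0.
  move=> xE xx t1; apply/eqP => e.
  have tn0 : t != 0 by apply: contraNneq xx => h; rewrite xE h scale0r addr0.
  have e1 : (1 - t1) * t * (r' - z') 0 i = 0.
    have := congr1 (fun m : vec => m 0 i) e; rewrite xE /w !mxE eqxx (negPf _ : (i == j) = false) /=; last by rewrite eq_sym.
    move: (r' 0 i) (z' 0 i) (x0 0 i) => p1 p2 p3 h.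
    have -> : (1 - t1) * t * (p1 - p2) = (p3 + t * (p1 - p2) + t1 * (p3 + s * 0 - (p3 + t * (p1 - p2)))) - p3 by ring.
    by rewrite h subrr.
  have t11 : t1 = 1.
    by move/eqP: e1; rewrite mulf_eq0 (negPf di) orbF mulf_eq0 (negPf tn0) orbF subr_eq0 => /eqP.
  move: e; rewrite t11 scale1r addrC subrK /w => /(congr1 (fun m : vec => m 0 j)) /eqP.
  by rewrite !mxE !eqxx mulr1 -subr_eq0 addrAC subrr add0r gt_eqF.
have zE : z' = x0 + (- t0) *: (r' - z').
  by rewrite -t0x scaleNr addrK.
have rE : r' = x0 + (1 - t0) *: (r' - z').
  by apply/rowP => k; rewrite -t0x !mxE; ring.
have Nw : N (inv a w) by apply: (seg z') => // t _; exact: (avoid z' _ zE).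
apply: (seg w) => // t _.
have -> : w + t *: (r' - w) = r' + (1 - t) *: (w - r').
  by apply/rowP => k; rewrite !mxE; ring.
exact: (avoid r' _ rE).
Qed.

Lemma closure_N_setT : closure N = setT.
Proof.
have [q0 Nq0] := pi0_neq0 hN.
apply: (static_connected hs); first by exists q0; exact: subset_closure.
  by exists (closure N); [exact: closure_open|rewrite setTI].
by exists (closure N); [exact: closed_closure|rewrite setTI].
Qed.

Lemma rigid_hessian a x : V a x -> Th a x = 0.
Proof.
move=> Vx; rewrite -(chart_invK hm Vx); apply: trace_free_closure; first exact: chart_inv_dom.
by rewrite closure_N_setT.
Qed.

Lemma rigid_energy p : W p = um * um.
Proof.
have cp : closure N p by rewrite closure_N_setT.
have [Np|mp] := closure_N cp; [exact: energy_const|exact: MAX_energy].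
Qed.
End Rigidity.

(** * The flat conformal metric *)

Section EvalMatrices.
Context {R : realType} {n : nat} {V : set 'rV[R]_n.+1} {x : 'rV[R]_n.+1} (Vx : V x).
Local Notation ev := (map_mx (eval_in Vx)).
Lemma ev1 : eval_in Vx 1 = 1. Proof. exact: rmorph1. Qed.
Lemma evmx p q (N : 'M[smooth_ring V]_(p, q)) i j : (ev N) i j = eval_in Vx (N i j).
Proof. by rewrite mxE. Qed.
Lemma eval_mxM p q r (N : 'M[smooth_ring V]_(p, q)) (P : 'M[smooth_ring V]_(q, r)) : ev (N *m P) = ev N *m ev P.
Proof. exact: map_mxM. Qed.
Lemma eval_mxD p q (N P : 'M[smooth_ring V]_(p, q)) : ev (N + P) = ev N + ev P.
Proof. exact: map_mxD. Qed.
Lemma eval_mxZ p q c (N : 'M[smooth_ring V]_(p, q)) : ev (c *: N) = eval_in Vx c *: ev N.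
Proof. by apply/matrixP => i j; rewrite !mxE evM. Qed.
Lemma eval_mxN p q (N : 'M[smooth_ring V]_(p, q)) : ev (- N) = - ev N.
Proof. by apply/matrixP => i j; rewrite !mxE evN. Qed.
Lemma eval_mxT p q (N : 'M[smooth_ring V]_(p, q)) : ev N^T = (ev N)^T.
Proof. by apply/matrixP => i j; rewrite !mxE. Qed.
Lemma eval_tr p (N : 'M[smooth_ring V]_p) : eval_in Vx (\tr N) = \tr (ev N).
Proof. by rewrite /mxtrace ev_sum; apply: eq_bigr => i _; rewrite mxE. Qed.
Lemma eval_delta p q i j : ev (delta_mx i j : 'M[smooth_ring V]_(p, q)) = delta_mx i j.
Proof. by apply/matrixP => a b; rewrite !mxE; exact: ev_nat. Qed.

Lemma eval_curv (d : 'I_n.+1 -> smooth_ring V -> smooth_ring V) (Gam : 'I_n.+1 -> 'M[smooth_ring V]_n.+1) i j :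
  ev (curv d Gam i j) = ev (Dm d i (Gam j)) - ev (Dm d j (Gam i)) - ev (Gam i) *m ev (Gam j) + ev (Gam j) *m ev (Gam i).
Proof. by rewrite /curv !eval_mxD !eval_mxN !eval_mxM. Qed.

Lemma eval_kappa (d : 'I_n.+1 -> smooth_ring V -> smooth_ring V) H (Gam : 'I_n.+1 -> 'M[smooth_ring V]_n.+1) :
  eval_in Vx (kappa d H Gam) = - \tr (ev H *m \matrix_(j, l) \tr (ev H *m
     \matrix_(i, k) \tr (ev (curv d Gam i j) *m ev (curv d Gam k l)))).
Proof.
rewrite /kappa evN eval_tr eval_mxM; congr (- \tr (_ *m _)).
apply/matrixP => j l; rewrite evmx [RHS]mxE [kapS _ _ _ _ _]mxE eval_tr eval_mxM; congr (\tr (_ *m _)).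
by apply/matrixP => i k; rewrite evmx [RHS]mxE [kapT _ _ _ _ _ _]mxE eval_tr eval_mxM.
Qed.
End EvalMatrices.

Section HeightChart.
Context {R : realType} {n : nat}.
Local Notation vec := 'rV[R]_n.+1.
Implicit Types (V W : set vec) (G : vec -> 'M[R]_n.+1) (v : vec -> R).

(** What rigidity says of v = u / u_max: [hc_hess] is D^2 u = - u g and [hc_norm] is the constancy
    of W, both after normalization. *)
Record height_chart V G v : Prop := HeightChart {
  hc_open : hopen V;
  hc_smooth : smooth_mx V G;
  hc_sym : forall x, V x -> (G x)^T = G x;
  hc_pos : forall x, V x -> posdef (G x);
  hc_height : smooth_on V v;
  hc_ge0 : forall x, V x -> 0 <= v x;
  hc_hess : forall x i j, V x -> hessian G v i j x = - v x * G x i j;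
  hc_norm : forall x, V x -> gradsq G v x = 1 - v x * v x }.

(* The metric [G / (1 + v)^2], its Levi-Civita connection and its curvature. *)
Definition flat_metric G v x : 'M[R]_n.+1 := ((1 + v x)^-1 * (1 + v x)^-1) *: G x.
Definition flat_inverse G v x : 'M[R]_n.+1 := ((1 + v x) * (1 + v x)) *: invmx (G x).
Definition flat_conn G v (i : 'I_n.+1) x : 'M[R]_n.+1 :=
  (\matrix_(j, k) christoffel G k i j x) - (1 + v x)^-1 *:
    ((partial i v x)%:M + grad v x *m (delta_mx i 0 : 'cV_n.+1)^T - col i (G x) *m (invmx (G x) *m grad v x)^T).
Definition flat_field G v x : 'cV[R]_n.+1 := - (invmx (G x) *m grad v x).
Definition flat_curv G v (i j : 'I_n.+1) x : 'M[R]_n.+1 :=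
  (\matrix_(a, b) partial i (fun y => flat_conn G v j y a b) x)
  - (\matrix_(a, b) partial j (fun y => flat_conn G v i y a b) x)
  - flat_conn G v i x *m flat_conn G v j x + flat_conn G v j x *m flat_conn G v i x.
Definition flat_kappa G v x : R :=
  - \tr (flat_inverse G v x *m \matrix_(j, l) \tr (flat_inverse G v x *m
     \matrix_(i, k) \tr (flat_curv G v i j x *m flat_curv G v k l x))).

Lemma height_chart_sub V W G v : hopen W -> W `<=` V -> height_chart V G v -> height_chart W G v.
Proof.
move=> hW WV [hV sG GT Gp sv v0 hE nE]; split => //.
- by move=> i j; apply: smooth_on_sub WV (sG i j).
- by move=> x /WV; exact: GT.
- by move=> x /WV; exact: Gp.
- exact: smooth_on_sub WV sv.
- by move=> x /WV; exact: v0.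
- by move=> x i j /WV; exact: hE.
- by move=> x /WV; exact: nE.
Qed.

Section Fixed.
Context {V : set vec} {G : vec -> 'M[R]_n.+1} {v : vec -> R} (h : height_chart V G v).
Let hV := hc_open h.
Let sG := hc_smooth h.
Let GT := hc_sym h.
Let Gu x (Vx : V x) : G x \in unitmx := posdef_unit (hc_pos h Vx).
Let sv := hc_height h.
Local Notation d := (deriv_ring hV).
Local Notation Gr := (metric_ring sG).
Local Notation Hr := (inverse_ring sG Gu).
Local Notation Gamr := (conn_ring hV sG Gu).
Local Notation vr := (to_smooth sv).

Lemma height1_neq0 x : V x -> 1 + v x != 0.
Proof. by move=> Vx; rewrite gt_eqF // ltr_wpDr // (hc_ge0 h). Qed.

Lemma smooth_height1 : smooth_on V (fun x => 1 + v x).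
Proof. by apply: smooth_onD => //; exact: smooth_on_cst. Qed.

Definition iom_ring : smooth_ring V := to_smooth (smooth_onV height1_neq0 smooth_height1).

Lemma iom_ringE : iom_ring * (1 + vr) = 1.
Proof.
apply: sring_eq => x Vx; rewrite -[LHS]/(eval_in Vx _) -[RHS]/(eval_in Vx 1) evM evD.
by rewrite ev1 !ev_to mulVf // height1_neq0.
Qed.

Lemma hess_ring : hess d Gamr vr = - vr *: Gr.
Proof.
apply/matrixP => i j; apply: sring_eq => x Vx; rewrite entE.
rewrite -[LHS]/(eval_in Vx _) -[RHS]/(eval_in Vx _) eval_hess evM evN ev_to (hc_hess h) //.
by congr (_ * _); rewrite mxE ev_to.
Qed.

Lemma norm_ring : ((grad_cov d vr)^T *m (Hr *m grad_cov d vr)) 0 0 = 1 - vr * vr.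
Proof.
apply: sring_eq => x Vx; rewrite -[LHS]/(eval_in Vx _) -[RHS]/(eval_in Vx _).
rewrite evD evN evM ev1 !ev_to -(hc_norm h) // -evmx !eval_mxM eval_mxT eval_grad.
by rewrite (ring_mxE _ Vx).
Qed.

Let dDr := @deriv_ringD R n V hV.
Let dMr := @deriv_ringM R n V hV.
Let dCr := @deriv_ringC R n V hV.
Let twor := @smooth_ring_two_reg R n V.
Let GTr := metric_ringT sG GT.
Let GHr := metric_ringV sG Gu.
Let tfr := conn_ring_tf hV sG GT Gu.
Let mcr := conn_ring_mc hV sG GT Gu.

Definition fmetric := conf_metric Gr iom_ring.
Definition finv := conf_inv Hr vr.
Definition fconn := conf_conn d Gr Hr Gamr vr iom_ring.
Definition ffield := conf_field d Hr vr.

Lemma fmetricT : fmetric^T = fmetric. Proof. exact: conf_metric_sym. Qed.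
Lemma fmetricV : fmetric *m finv = 1%:M. Proof. exact: (conf_metric_inv GHr iom_ringE). Qed.
Lemma fconn_tf i j k : fconn i j k = fconn j i k. Proof. exact: (conf_conn_tf d Hr GTr tfr). Qed.
Lemma fconn_mc i : Dm d i fmetric = fconn i *m fmetric + fmetric *m (fconn i)^T.
Proof. exact: (conf_conn_mc dDr dMr GTr GHr mcr iom_ringE). Qed.
Lemma ffield_cov i : Dm d i ffield + (fconn i)^T *m ffield = delta_mx i 0.
Proof. exact: (conf_field_cov dDr dMr dCr GTr GHr tfr mcr iom_ringE hess_ring norm_ring). Qed.

Section At.
Variables (x : vec) (Vx : V x).
Local Notation ev := (map_mx (eval_in Vx)).

Lemma eval_iom : eval_in Vx iom_ring = (1 + v x)^-1. Proof. by rewrite ev_to. Qed.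

Lemma eval_H : ev Hr = invmx (G x). Proof. by rewrite ring_mxE. Qed.

Lemma eval_fmetric : ev fmetric = flat_metric G v x.
Proof. by rewrite eval_mxZ ring_mxE evM eval_iom. Qed.

Lemma eval_finv : ev finv = flat_inverse G v x.
Proof. by rewrite eval_mxZ ring_mxE evM evD ev_to ev1. Qed.

Lemma eval_ffield : ev ffield = flat_field G v x.
Proof. by rewrite eval_mxN eval_mxM eval_grad ring_mxE. Qed.

Lemma eval_fconn i : ev (fconn i) = flat_conn G v i x.
Proof.
rewrite /fconn /conf_conn eval_mxD eval_mxN eval_mxZ eval_iom !eval_mxD eval_mxN !eval_mxM !eval_mxT
  eval_mxM eval_grad eval_H eval_delta; congr (_ - _ *: (_ + _ - _)).
- by apply/matrixP => a b; rewrite evmx [Gamr i a b]mxE ev_to mxE.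
- apply/matrixP => a b; rewrite evmx !mxE; case: (a == b); rewrite ?mulr1n ?mulr0n //.
  by rewrite -[LHS]/((deriv_ring hV i vr) x) partial_to_smooth.
- congr (_ *m _); apply/matrixP => a b; rewrite evmx [(col i Gr) a b]mxE [Gr a i]mxE ev_to mxE.
  by [].
Qed.
End At.

(** Couples the objects of the differential ring with their values at points, so that algebraic
    identities can be evaluated without unfolding the conformal formulas. *)
Lemma flat_ring_data : exists (Gm Hm : 'M[smooth_ring V]_n.+1) (Gam : 'I_n.+1 -> 'M[smooth_ring V]_n.+1)
    (E : 'cV[smooth_ring V]_n.+1),
  [/\ Gm^T = Gm /\ Gm *m Hm = 1%:M, forall i j k, Gam i j k = Gam j i k,
      forall i, Dm d i Gm = Gam i *m Gm + Gm *m (Gam i)^T,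
      forall i, Dm d i E + (Gam i)^T *m E = delta_mx i 0 &
      (E^T *m Gm *m E) 0 0 = (1 - vr) * iom_ring] /\
  forall x (Vx : V x), [/\ map_mx (eval_in Vx) Gm = flat_metric G v x,
     forall i j, map_mx (eval_in Vx) (curv d Gam i j) = flat_curv G v i j x,
     map_mx (eval_in Vx) E = flat_field G v x, forall i, map_mx (eval_in Vx) (Gam i) = flat_conn G v i x &
     eval_in Vx (kappa d Hm Gam) = flat_kappa G v x].
Proof.
exists fmetric, finv, fconn, ffield; split.
  split; [split; [exact: fmetricT|exact: fmetricV]|exact: fconn_tf|exact: fconn_mc|exact: ffield_cov|].
  exact: (conf_field_norm GTr GHr iom_ringE norm_ring).
move: fmetric finv fconn ffield (@eval_fmetric) (@eval_finv) (@eval_fconn) (@eval_ffield) => Gm Hm Gam E e1 e2 e4 e3 x Vx.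
have eD i j : map_mx (eval_in Vx) (Dm d i (Gam j)) = \matrix_(a, b) partial i (fun y => flat_conn G v j y a b) x.
  rewrite eval_Dm; apply/matrixP => a b; rewrite [LHS]mxE [RHS]mxE.
  apply/esym; apply: (partial_eq hV i (smooth_ringP _) Vx) => y Vy.
  by rewrite -(e4 y Vy) evmx.
have eC i j : map_mx (eval_in Vx) (curv d Gam i j) = flat_curv G v i j x.
  by rewrite eval_curv (eD i j) (eD j i) (e4 x Vx i) (e4 x Vx j).
split => //; rewrite eval_kappa e2 /flat_kappa; congr (- \tr (_ *m _)).
apply/matrixP => j l; rewrite [LHS]mxE [RHS]mxE; congr (\tr (_ *m _)).
by apply/matrixP => i k; rewrite [LHS]mxE [RHS]mxE; congr (\tr (_ *m _)); exact: eC.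
Qed.

Lemma smooth_flat_conn i : smooth_mx V (flat_conn G v i).
Proof.
have [Gm [Hm [Gam [E [_ he]]]]] := flat_ring_data.
by apply: smooth_mx_eq (smooth_mx_ring (Gam i)) => x Vx; have [_ _ _ /(_ i)] := he x Vx.
Qed.

Lemma smooth_flat_field : smooth_mx V (flat_field G v).
Proof.
have [Gm [Hm [Gam [E [_ he]]]]] := flat_ring_data.
by apply: smooth_mx_eq (smooth_mx_ring E) => x Vx; have [_ _ ] := he x Vx.
Qed.

Lemma smooth_flat_kappa : smooth_on V (flat_kappa G v).
Proof.
have [Gm [Hm [Gam [E [_ he]]]]] := flat_ring_data.
by apply: smooth_on_eq (smooth_ringP (kappa d Hm Gam)) => x Vx; have [_ _ _ _] := he x Vx.
Qed.

Lemma flat_kappa_field x : V x ->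
  \sum_m flat_field G v x m 0 * partial m (flat_kappa G v) x = - 4 * flat_kappa G v x.
Proof.
move=> Vx; have [Gm [Hm [Gam [E [[[mT mV] tf mc cE _] he]]]]] := flat_ring_data.
have [_ _ e3 _ e5] := he x Vx.
have := dE_kappa dDr dMr dCr twor mT mV tf mc cE.
move=> /(congr1 (eval_in Vx)); rewrite evM evN (ev_nat Vx 4) e5 => <-.
rewrite /dE ev_sum; apply: eq_bigr => m _; rewrite evM; congr (_ * _).
  by rewrite -e3 evmx.
rewrite /eval_in deriv_ringE //; apply: (partial_eq hV m (smooth_ringP _) Vx) => y Vy.
by have [_ _ _ _] := he y Vy.
Qed.

Lemma flat_inverse_pos x : V x -> (flat_inverse G v x)^T = flat_inverse G v x /\ posdef (flat_inverse G v x).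
Proof.
move=> Vx; split; first by rewrite linearZ /= trmx_inv GT.
move=> w w0; rewrite -scalemxAr -scalemxAl mxE pmulr_rgt0.
  exact: (posdef_inv (GT Vx) (hc_pos h Vx)).
by have h1 := height1_neq0 Vx; rewrite -expr2 exprn_even_gt0.
Qed.

Lemma flat_metricT x : V x -> (flat_metric G v x)^T = flat_metric G v x.
Proof. by move=> Vx; rewrite linearZ /= GT. Qed.

Lemma flat_metricV x : V x -> flat_metric G v x *m flat_inverse G v x = 1%:M.
Proof.
move=> Vx; have h1 := height1_neq0 Vx; rewrite -scalemxAl -scalemxAr scalerA mulmxV ?Gu //.
have -> : (1 + v x)^-1 * (1 + v x)^-1 * ((1 + v x) * (1 + v x)) = 1 by field.
by rewrite scale1r.
Qed.

Lemma flat_metric_pos x : V x -> posdef (flat_metric G v x).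
Proof.
move=> Vx w w0; rewrite -scalemxAr -scalemxAl mxE pmulr_rgt0; first exact: (hc_pos h Vx).
by have h1 := height1_neq0 Vx; rewrite -expr2 exprn_even_gt0 // invr_neq0.
Qed.

Lemma flat_kappa_pos x : V x -> 0 <= flat_kappa G v x /\
  (flat_kappa G v x <= 0 -> forall i j, flat_curv G v i j x = 0).
Proof.
move=> Vx; have [HT pH] := flat_inverse_pos Vx.
apply: (posdef_curvature HT pH (flat_metricV Vx)) => i j.
have [Gm [Hm [Gam [E [[[mT mV] tf mc _ _] he]]]]] := flat_ring_data.
have [e1 e4 _ _ _] := he x Vx.
have := curv_anti dDr dMr dCr mT mc i j => /(congr1 (map_mx (eval_in Vx))).
by rewrite eval_mxT eval_mxN !eval_mxM e4 e1.
Qed.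

Lemma flat_field_cov i x : V x ->
  (\matrix_(a, b) partial i (fun y => flat_field G v y a b) x : 'cV_n.+1) + (flat_conn G v i x)^T *m flat_field G v x
  = delta_mx i 0.
Proof.
move=> Vx; have [Gm [Hm [Gam [E [[_ _ _ cE _] he]]]]] := flat_ring_data.
have [_ _ e3 e4 _] := he x Vx; have := congr1 (map_mx (eval_in Vx)) (cE i).
rewrite eval_mxD eval_mxM eval_mxT e4 e3 eval_delta => <-.
congr (_ + _); rewrite eval_Dm; apply/matrixP => a b; rewrite [LHS]mxE [RHS]mxE.
apply: (partial_eq hV i (smooth_ringP _) Vx) => y Vy.
by have [_ _ <- _ _] := he y Vy; rewrite evmx.
Qed.

Lemma flat_field_norm x : V x ->
  ((flat_field G v x)^T *m flat_metric G v x *m flat_field G v x) 0 0 = (1 - v x) / (1 + v x).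
Proof.
move=> Vx; have [Gm [Hm [Gam [E [[_ _ _ _ nE] he]]]]] := flat_ring_data.
have [e1 _ e3 _ _] := he x Vx; have := congr1 (eval_in Vx) nE.
rewrite evM evD evN ev_to eval_iom ev1 => <-.
by rewrite -evmx !eval_mxM eval_mxT e1 e3.
Qed.
End Fixed.
End HeightChart.

(** * Invariance of the curvature norm under coordinate changes *)

Section PullbackRing.
Context {R : realType} {n : nat}.
Local Notation vec := 'rV[R]_n.+1.
Variables (W V' : set vec) (hW : hopen W) (hV' : hopen V') (Phi : vec -> vec).
Hypotheses (sPhi : forall j, smooth_on W (fun x => Phi x 0 j)) (PhiV : forall x, W x -> V' (Phi x)).

Definition pull_ring (f : smooth_ring V') : smooth_ring W :=
  to_smooth (smooth_on_comp sPhi PhiV (smooth_ringP f)).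

Lemma pull_ringE f x (Wx : W x) : eval_in Wx (pull_ring f) = eval_in (PhiV Wx) f.
Proof. by rewrite ev_to. Qed.

Fact pull_ring_additive : zmod_morphism pull_ring.
Proof.
move=> f f'; apply: sring_eq => x Wx; rewrite -[LHS]/(eval_in Wx _) -[RHS]/(eval_in Wx _).
by rewrite [RHS]evD evN !pull_ringE.
Qed.
Fact pull_ring_multiplicative : monoid_morphism pull_ring.
Proof.
split => [|f f']; apply: sring_eq => x Wx; rewrite -[LHS]/(eval_in Wx _) -[RHS]/(eval_in Wx _).
  by rewrite pull_ringE !ev1.
by rewrite [RHS]evM !pull_ringE evM.
Qed.
HB.instance Definition _ := GRing.isZmodMorphism.Build _ _ pull_ring pull_ring_additive.
HB.instance Definition _ := GRing.isMonoidMorphism.Build _ _ pull_ring pull_ring_multiplicative.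

Definition jacm x : 'M[R]_n.+1 := \matrix_(i, j) partial i (fun y => Phi y 0 j) x.

Lemma smooth_jacm : smooth_mx W jacm.
Proof.
move=> i j; apply: (@smooth_on_eq _ _ _ (partial i (fun y => Phi y 0 j))); first by move=> x _; rewrite mxE.
exact: (smooth_on_partial hW i (sPhi j)).
Qed.

Lemma pull_deriv i f : deriv_ring hW i (pull_ring f) =
  \sum_m ring_mx smooth_jacm i m * pull_ring (deriv_ring hV' m f).
Proof.
apply: sring_eq => x Wx; rewrite -[RHS]/(eval_in Wx _) ev_sum partial_to_smooth //.
rewrite (partial_comp i hW hV' sPhi PhiV (smooth_ringP f) Wx); apply: eq_bigr => j _.
rewrite evM pull_ringE mxE ev_to mxE; congr (_ * _).
by rewrite /eval_in deriv_ringE //; exact: PhiV.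
Qed.

Lemma jacm_sym i j k :
  deriv_ring hW k (ring_mx smooth_jacm i j) = deriv_ring hW i (ring_mx smooth_jacm k j).
Proof.
have E a b : ring_mx smooth_jacm a b = deriv_ring hW a (to_smooth (sPhi b)).
  by apply: sring_eq => x Wx; rewrite partial_to_smooth // mxE to_smoothE // mxE.
by rewrite !E deriv_ringC.
Qed.

Variables (G G' : vec -> 'M[R]_n.+1) (v v' : vec -> R).
Hypotheses (h : height_chart W G v) (h' : height_chart V' G' v').
Hypotheses (GJ : forall x, W x -> G x = jacm x *m G' (Phi x) *m (jacm x)^T)
  (vPhi : forall x, W x -> v x = v' (Phi x)).

Lemma jacm_unit x : W x -> jacm x \in unitmx.
Proof.
move=> Wx; have := posdef_unit (hc_pos h Wx); rewrite GJ // !unitmx_mul.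
by case/andP => /andP[].
Qed.

Lemma flat_kappa_pull x : W x -> flat_kappa G v x = flat_kappa G' v' (Phi x).
Proof.
move=> Wx.
have [Gm [Hm [Gam [E [[[mT mV] tf mc _ _] he]]]]] := flat_ring_data h.
have [Gm' [Hm' [Gam' [E' [[[mT' mV'] tf' mc' _ _] he']]]]] := flat_ring_data h'.
have [_ _ _ _ <-] := he x Wx; have [_ _ _ _ <-] := he' _ (PhiV Wx).
rewrite -pull_ringE; congr (eval_in Wx _).
(* The derivations depend on the proof that the domain is relatively open; the two proofs at hand
   must be identified. *)
have eW : hc_open h = hW by exact: Prop_irrelevance.
have eV : hc_open h' = hV' by exact: Prop_irrelevance.
rewrite eW eV in tf mc tf' mc' *.
have JK : ring_mx smooth_jacm *m ring_mx (smooth_mx_inv jacm_unit smooth_jacm) = 1%:M.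
  by apply: ring_mx_inj => y Wy; rewrite map_mxM !ring_mxE map_mx1 mulmxV // jacm_unit.
apply: (pull_kappa (@deriv_ringD _ _ _ hW) (@deriv_ringM _ _ _ hW) (@deriv_ringC _ _ _ hW) (@smooth_ring_two_reg _ _ W)
  (phi := pull_ring) pull_deriv jacm_sym JK mT mV tf mc mV' tf' mc').
apply: ring_mx_inj => y Wy; rewrite !eval_mxM eval_mxT ring_mxE.
have [-> _ _ _ _] := he y Wy.
have -> : map_mx (eval_in Wy) (map_mx pull_ring Gm') = flat_metric G' v' (Phi y).
  have [<- _ _ _ _] := he' _ (PhiV Wy).
  by apply/matrixP => a b; rewrite !mxE pull_ringE.
by rewrite /flat_metric GJ // vPhi // -scalemxAr -scalemxAl.
Qed.
End PullbackRing.

(** * One-sided derivative tests on the half-space *)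

Section Rays.
Context {R : realType} {n : nat}.
Local Notation vec := 'rV[R]_n.+1.

(** The direction has to stay in the half-space for small positive t: either it points inwards or
    the base point is interior. *)
Lemma partial_ray (V : set vec) f x (w : vec) : hopen V -> smooth_on V f -> V x ->
  (0 <= w 0 0 \/ 0 < x 0 0) -> (forall t : R, 0 < t -> V (x + t *: w) -> f x <= f (x + t *: w)) ->
  0 <= \sum_m w 0 m * partial m f x.
Proof.
move=> hV sf Vx hw mn; have [Q [F [oQ Qx sF FE]]] := partialP hV ord0 sf Vx.
have pF m : partial m f x = pd m F x.
  apply: (partialE m hV oQ Qx Vx (smooth_diff sF Qx)) => y Qy Vy.
  by have [] := FE y Qy Vy.
rewrite leNgt; apply/negP => p0.
have D : is_derive (0 : R) 1 (fun t : R => - F (x + t *: w)) (- \sum_m w 0 m * partial m f x).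
  apply: is_deriveN; have := @smooth_line_derive R n.+1 Q F x w 0 sF; rewrite scale0r addr0 => /(_ Qx).
  by congr is_derive; apply: eq_bigr => m _; rewrite pF.
have [|e e0 he] := pos_deriv_right D; first by rewrite oppr_gt0.
have [e' e'0 he'] := open_line w oQ Qx.
have [W oW VE] := hV; have Wx : W x by move: Vx; rewrite VE => -[].
have [e2 e20 he2] := open_line w oW Wx.
have [e3 e30 he3] : exists2 e3 : R, 0 < e3 & forall t : R, 0 <= t <= e3 -> half_space (x + t *: w).
  have hx := hopen_half hV Vx; rewrite half_spaceE in hx.
  case: hw => [w0|x0].
    by exists 1 => // t /andP[t0 _]; rewrite half_spaceE !mxE addr_ge0 // mulr_ge0.
  have oP : open [set y : vec | 0 < y 0 0].
    apply: (@open_comp _ _ (fun x : vec => x 0 0) [set t | 0 < t]); last exact: open_gt.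
    by move=> z _; exact: continuous_coord.
  have [e3 e30 he3] := open_line w oP x0.
  exists e3 => // t /andP[t0 te]; rewrite half_spaceE ltW //; apply: (he3 t).
  by rewrite ger0_norm.
pose t := Order.min (Order.min e e') (Order.min e2 e3).
have t0 : 0 < t by rewrite !lt_min e0 e'0 e20.
have [te te' te2 te3] : [/\ t <= e, t <= e', t <= e2 & t <= e3].
  by split; rewrite !ge_min lexx ?orbT.
have /he : 0 < t <= e by rewrite t0.
have Qt : Q (x + t *: w) by apply: he'; rewrite gtr0_norm.
have Vt : V (x + t *: w).
  by rewrite VE; split; [apply: he2; rewrite gtr0_norm|apply: he3; rewrite ltW].
rewrite scale0r addr0 ltrN2 -(FE x Qx Vx).1 -(FE _ Qt Vt).1 ltNge mn //.
Qed.

Lemma sum_delta (w : 'I_n.+1 -> R) i : \sum_m ('e_i : vec) 0 m * w m = w i.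
Proof.
rewrite (bigD1 i) //= mxE !eqxx mul1r big1 ?addr0 // => m mi.
by rewrite mxE eqxx (negbTE mi) mul0r.
Qed.

(** Tangential steps of both signs remain in the boundary, where f vanishes; the normal derivative
    only inherits the sign of f. *)
Lemma boundary_partial (V : set vec) f x : hopen V -> smooth_on V f ->
  (forall y, V y -> 0 <= f y) -> (forall y, V y -> y 0 0 = 0 -> f y = 0) -> V x -> x 0 0 = 0 ->
  0 <= partial ord0 f x /\ forall i, i != 0 -> partial i f x = 0.
Proof.
move=> hV sf f0 fb Vx x0; have fx := fb x Vx x0; split => [|i i0].
  rewrite -(sum_delta (fun m => partial m f x)); apply: (partial_ray hV sf Vx); first by left; rewrite mxE !eqxx ler01.
  by move=> t _ Vt; rewrite fx f0.
have P (c : R) : 0 <= c * partial i f x.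
  have -> : c * partial i f x = \sum_m (c *: 'e_i : vec) 0 m * partial m f x.
    by rewrite -(sum_delta (fun m => partial m f x)) mulr_sumr; apply: eq_bigr => m _; rewrite mulrA [X in _ = X * _]mxE.
  have w0 : (c *: 'e_i : vec) 0 0 = 0 by rewrite !mxE eqxx eq_sym (negbTE i0) mulr0.
  apply: (partial_ray hV sf Vx); first by left; rewrite w0.
  by move=> t _ Vt; rewrite fx fb //; rewrite mxE [X in _ + X]mxE w0 mulr0 x0 addr0.
by apply/eqP; rewrite eq_le -{2}[partial i f x]mul1r P -oppr_ge0 -mulN1r P.
Qed.
End Rays.

(** * Vanishing of the curvature *)

Section FlatGlobal.
Context {R : realType} {n : nat} {M : topologicalType} {A : atlas R n.+1 M}.
Variables (g : metric_components A) (v : M -> R).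
Hypotheses (hm : is_manifold A) (hg : is_riemannian g) (cM : compact [set: M]).
Local Notation V := (@chart_image R n.+1 M A).
Local Notation inv a := (@chart_inv R n.+1 M A a).
Local Notation dom a := (@chart_dom R n.+1 M A a).
Hypothesis hc : forall a, height_chart (V a) (g a) (v \o inv a).
Hypothesis vb : forall p, boundary A p -> v p = 0.
Local Notation kap a := (flat_kappa (g a) (v \o inv a)).

Lemma flat_kappa_transition a b x : overlap a b x -> kap a x = kap b (transition a b x).
Proof.
move=> Wx; have hW := overlap_hopen hm a b.
have hs := height_chart_sub hW (fun y (Wy : overlap a b y) => Wy.1) (hc a).
apply: (flat_kappa_pull hW (chart_hopen hm b) (@smooth_transition _ _ _ _ hm a b)
  (@transition_image _ _ _ A a b) hs (hc b)) => // y Wy.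
- by apply: metric_transition.
- by rewrite /= transition_inv.
Qed.

(** From a maximum k cannot increase along the admissible direction grad v = - E. Hence E k >= 0,
    and E k = - 4 k forces k <= 0. *)
Lemma flat_kappa_max a x : V a x -> (forall y, V a y -> kap a y <= kap a x) -> kap a x <= 0.
Proof.
move=> Vx mx; pose U := invmx (g a x) *m grad (v \o inv a) x.
have hV := chart_hopen hm a.
have sk := smooth_flat_kappa (hc a).
have key : 0 <= \sum_m U^T 0 m * - partial m (kap a) x.
  have E m : - partial m (kap a) x = partial m (fun y => - kap a y) x.
    have := partialM hV m (smooth_on_cst (-1)) sk Vx.
    rewrite (partial_cst hV (-1) m Vx) mul0r add0r mulN1r => <-.
    by congr (partial m _ x); apply/funext => y; rewrite mulN1r.
  under eq_bigr do rewrite E.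
  apply: (partial_ray hV (smooth_onN sk) Vx) => [|t _ Vt]; last by rewrite lerN2 mx.
  have hx := hopen_half hV Vx; rewrite half_spaceE le_eqVlt in hx.
  case/orP: hx => [/eqP/esym x0|x0]; [left|by right].
  have [p0 pi] : 0 <= partial ord0 (v \o inv a) x /\ forall i, i != 0 -> partial i (v \o inv a) x = 0.
    apply: (boundary_partial hV (hc_height (hc a))) => // [y Vy|y Vy y0]; first exact: (hc_ge0 (hc a)).
    by rewrite /= vb //; apply/(boundaryE hm hg (chart_inv_dom hm Vy)); rewrite (chart_invK hm Vy).
  rewrite !mxE (bigD1 0) //= big1 ?addr0 => [|i i0]; last by rewrite [X in _ * X]mxE pi // mulr0.
  (* On the boundary dv is a nonnegative multiple of dx_0, so the first component of grad v is a
     diagonal entry of the inverse metric times that multiple. *)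
  rewrite [X in _ * X]mxE mulr_ge0 //.
  have := posdef_inv (metricT hg Vx) (metric_posdef hg Vx) (v := 'e_0).
  have e00 : ('e_0 : 'rV[R]_n.+1) != 0 by apply/negP => /eqP /matrixP /(_ 0 0); rewrite !mxE eqxx => /eqP; rewrite oner_eq0.
  move=> /(_ e00); rewrite -rowE trmx_delta -colE !mxE => /ltW.
  by [].
have := flat_kappa_field (hc a) Vx.
have -> : \sum_m flat_field (g a) (v \o inv a) x m 0 * partial m (kap a) x = - \sum_m U m 0 * partial m (kap a) x.
  by rewrite -sumrN; apply: eq_bigr => m _; rewrite /flat_field -/U mxE mulNr.
have {}key : \sum_m U m 0 * partial m (kap a) x <= 0.
  by rewrite -oppr_ge0 -sumrN; apply: le_trans key _; rewrite le_eqVlt (eq_bigr (fun m => - (U m 0 * partial m (kap a) x))) ?eqxx // => m _; rewrite mxE mulrN.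
move=> e; have : 0 <= - 4 * kap a x by rewrite -e oppr_ge0.
lra.
Qed.

Lemma flat_curv0 a x i j : V a x -> flat_curv (g a) (v \o inv a) i j x = 0.
Proof.
have /choice [c hcv] := chart_cover hm.
have [K KE] : exists K : M -> R, forall b y, V b y -> K (inv b y) = kap b y.
  exists (fun p => kap (c p) (chart (c p) p)) => b y Vy.
  have db := chart_inv_dom hm Vy; have dc := hcv (inv b y).
  by rewrite -(transition_chart hm (c (inv b y)) db) (chart_invK hm Vy) -flat_kappa_transition //.
have cK : continuous K.
  apply: (smooth_fun_continuous hm) => b.
  apply: smooth_on_eq (smooth_flat_kappa (hc b)) => y Vy; rewrite /= KE //.
move=> Vx.
have [||p [_ mp]] := @compact_EVT_max M R K setT _ cM.
- by exists (inv a x).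
- exact: continuous_subspaceT.
have Vp := chart_in (hcv p).
have Kp : K p = kap (c p) (chart (c p) p) by rewrite -KE // (chartK hm (hcv p)).
have Kp0 : K p <= 0.
  by rewrite Kp; apply: (flat_kappa_max Vp) => y Vy; rewrite -KE // -Kp; apply: mp; rewrite inE.
have [_] := flat_kappa_pos (hc a) Vx; apply.
rewrite -KE //; apply: le_trans Kp0; apply: mp; by rewrite inE.
Qed.
End FlatGlobal.

(** * Local developing maps *)

Section LinearUniqueness.
Context {R : realType}.

(** The sum of the squares of h times e^{-Cs} is nonincreasing for C = 2 K N and vanishes at 0.
    Derivatives are required in the open interval only, as for functions restricted to a segment
    ending on the boundary. *)
Lemma linear_unique01 (I : finType) (h : I -> R -> R) (b : I -> I -> R -> R) (K : R) :
  (forall a, {within `[0, 1], continuous h a}) ->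
  (forall a (s : R), 0 < s < 1 -> is_derive s 1 (h a) (\sum_c b a c s * h c s)) ->
  (forall a c (s : R), 0 < s < 1 -> `|b a c s| <= K) -> (forall a, h a 0 = 0) -> forall a, h a 1 = 0.
Proof.
move=> ch dh bK h0 a; pose N : R := #|I|%:R; pose C : R := 2 * K * N.
pose f (s : R) := (\sum_c h c s * h c s) * expR (- C * s).
have df (s : R) : 0 < s < 1 -> is_derive s 1 f
    (expR (- C * s) * (\sum_c (h c s * (\sum_e b c e s * h e s) + h c s * (\sum_e b c e s * h e s)) - C * \sum_c h c s * h c s)).
  move=> s01.
  have dS : is_derive s 1 (fun s => \sum_c h c s * h c s) (\sum_c (h c s * (\sum_e b c e s * h e s) + h c s * (\sum_e b c e s * h e s))).
    have [bi ei] : bijective (@enum_val I predT) /\ True by split=> //; exact: enum_val_bij.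
    rewrite (reindex (@enum_val I predT)) /=; last exact: onW_bij.
    rewrite (_ : (fun s => _) = \sum_(i < #|I|) (fun s => h (enum_val i) s * h (enum_val i) s)); last first.
      by apply/funext => t; rewrite fct_sumE (reindex (@enum_val I predT)) //; exact: onW_bij.
    by apply: is_derive_sum => i; have hc := dh (enum_val i) s s01; apply: is_deriveM.
  have dE : is_derive s 1 (fun s => expR (- C * s)) (- C * expR (- C * s)).
    by apply: is_derive_eq; rewrite /GRing.scale /=; ring.
  have := @is_deriveM _ _ (fun s => \sum_c h c s * h c s) (fun s => expR (- C * s)) s 1 _ _ dS dE.
  by rewrite /GRing.scale /=; congr is_derive; ring.
have cf : {within `[0, 1], continuous f}.
  move=> s; apply: cvgM.
    rewrite (_ : (fun s => _) = \sum_c (fun s => h c s * h c s)); last by apply/funext => t; rewrite fct_sumE.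
    have : {within `[0, 1], continuous (\sum_c (fun s => h c s * h c s))}.
      apply: (big_ind (fun k : R -> R => {within `[0, 1], continuous k})) => [t|k l ck cl t|c _ t].
      - exact: cvg_cst.
      - by apply: cvgD; [exact: ck|exact: cl].
      - by apply: cvgM; exact: ch.
    move=> /(_ s) ck; apply: (cvg_trans ck).
    rewrite /from_subspace fct_sumE; exact: cvg_id.
  apply: continuous_subspaceT => t; apply: differentiable_continuous; apply/derivable1_diffP.
  by apply: ex_derive.
have f1 : f 1 <= f 0.
  apply: (ler0_derive1_le_cc (a := 0) (b := 1)) => //; rewrite ?in_itv /= ?lexx ?ler01 //.
  - by move=> s; rewrite in_itv /= => /df hs; apply: ex_derive.
  - move=> s; rewrite in_itv /= => s01; rewrite derive1E; have hd := df s s01; rewrite derive_val.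
    rewrite pmulr_rle0 ?expR_gt0 // subr_le0.
    apply: (@le_trans _ _ (\sum_c \sum_e K * (h c s * h c s + h e s * h e s))).
      apply: ler_sum => c _; rewrite -mulrDr -big_split mulr_sumr /=; apply: ler_sum => e _.
      rewrite -mulr2n -mulr_natr; apply: le_trans (ler_norm _) _; rewrite !normrM.
      have := bK c e s s01; have := normr_ge0 (b c e s).
      have -> : h c s * h c s = `|h c s| * `|h c s| by rewrite -normrM ger0_norm // -expr2 sqr_ge0.
      have -> : h e s * h e s = `|h e s| * `|h e s| by rewrite -normrM ger0_norm // -expr2 sqr_ge0.
      rewrite normr_nat; have := normr_ge0 (h c s); have := normr_ge0 (h e s).
      move: `|h c s| `|h e s| `|b c e s| => x y z y0 x0 z0 zK.
      have : 0 <= (K - z) * (x * y) by rewrite mulr_ge0 ?mulr_ge0 ?subr_ge0.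
      have : 0 <= K * (x - y) ^+ 2 by rewrite mulr_ge0 ?sqr_ge0 // (le_trans z0).
      nra.
    rewrite le_eqVlt; apply/orP; left; apply/eqP.
    under eq_bigr do rewrite -mulr_sumr big_split /= sumr_const -mulr_natr.
    by rewrite -mulr_sumr big_split /= -mulr_suml sumr_const -mulr_natr /C /N; ring.
have f00 : f 0 = 0 by rewrite /f big1 ?mul0r // => c _; rewrite h0 mul0r.
rewrite f00 /f pmulr_lle0 ?expR_gt0 // in f1.
have P0 c : 0 <= h c 1 * h c 1 by rewrite -expr2 sqr_ge0.
have /eqP : \sum_c h c 1 * h c 1 == 0 by rewrite eq_le f1 sumr_ge0.
by move=> /(psumr_eq0P (fun c _ => P0 c)) /(_ a isT) /eqP; rewrite mulf_eq0 orbb => /eqP.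
Qed.

Context {n : nat}.

Lemma line_within (S : set 'rV[R]_n.+1) (f : 'rV[R]_n.+1 -> R) (x w : 'rV[R]_n.+1) : {within S, continuous f} ->
  (forall t : R, 0 <= t <= 1 -> S (x + t *: w)) -> {within `[0, 1], continuous (fun t : R => f (x + t *: w))}.
Proof.
move=> /subspace_continuousP cf h; apply/subspace_continuousP => t /=; rewrite in_itv /= => t01.
apply: (@cvg_comp _ _ _ (fun t : R => x + t *: w) f _ (within S (nbhs (x + t *: w)))); last exact: cf (h t t01).
have cl : (fun t : R => x + t *: w) @ t --> x + t *: w.
  exact: continuous_line.
move=> P /= /cl; rewrite /within /= !nbhs_simpl /= => hP; near=> u => u01.
by have := near hP u; apply => //; apply: h; move: u01; rewrite in_itv.
Unshelve. all: by end_near. Qed.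

Lemma line_bounded (h : R -> R) : {within `[0, 1], continuous h} -> exists2 K : R, 0 <= K & forall t : R, 0 < t < 1 -> `|h t| <= K.
Proof.
move=> ch; have ch' : {within `[0, 1], continuous (fun t => `|h t|)}.
  by move=> t; apply: cvg_norm; exact: ch.
have [c _ hc] := EVT_max (ler01) ch'.
by exists `|h c| => // t /andP[t0 t1]; apply: hc; rewrite in_itv /= !ltW.
Qed.

Lemma convex_line_derive (S : set 'rV[R]_n.+1) f x y (s : R) : hopen S -> smooth_on S f ->
  (forall t : R, 0 <= t <= 1 -> S (x + t *: (y - x))) -> 0 < s < 1 ->
  is_derive s 1 (fun t : R => f (x + t *: (y - x))) (\sum_i (y - x) 0 i * partial i f (x + s *: (y - x))).
Proof.
move=> hS sf hl s01; have /andP[s0 s1] := s01.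
have Ss : S (x + s *: (y - x)) by apply: hl; rewrite !ltW.
have [U [F [oU Us sF fF]]] := sf _ Ss.
have pE i : partial i f (x + s *: (y - x)) = pd i F (x + s *: (y - x)).
  by apply: (partialE i hS oU Us Ss (smooth_diff sF Us)) => z; exact: fF.
have D : is_derive s 1 (fun t : R => F (x + t *: (y - x))) (\sum_i (y - x) 0 i * partial i f (x + s *: (y - x))).
  have := smooth_line_derive sF Us; congr is_derive; by apply: eq_bigr => i _; rewrite pE.
apply: near_eq_is_derive D.
have cl : (fun t : R => x + t *: (y - x)) @ s --> x + s *: (y - x).
  exact: continuous_line.
have nU := cl _ (open_nbhs_nbhs (conj oU Us)); rewrite nbhs_simpl /= in nU.
near=> t; apply/esym/fF; first by near: t.
have t0 : 0 < t by near: t; exact: lt_nbhsr.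
have t1 : t < 1 by near: t; exact: lt_nbhsl.
by apply: hl; rewrite !ltW.
Unshelve. all: by end_near. Qed.

Lemma partial0_const (S : set 'rV[R]_n.+1) f x y : hopen S -> smooth_on S f ->
  (forall t : R, 0 <= t <= 1 -> S (x + t *: (y - x))) ->
  (forall i (t : R), 0 <= t <= 1 -> partial i f (x + t *: (y - x)) = 0) -> f y = f x.
Proof.
move=> hS sf hl f0; have [|||c _] := @MVT R (fun t => f (x + t *: (y - x))) (fun=> 0) 0 1.
- exact: ltr01.
- move=> t; rewrite in_itv /= => t01; have := convex_line_derive hS sf hl t01.
  by rewrite big1 // => i _; rewrite f0 ?mulr0 //; have /andP[? ?] := t01; rewrite !ltW.
- by apply: (line_within _ hl); exact: smooth_on_within.
by rewrite mul0r scale1r scale0r addr0 addrC [x + _]addrC subrK => /eqP; rewrite addrC subr_eq0 => /eqP.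
Qed.
End LinearUniqueness.

(** * Integration of a flat linear system *)

Section Frobenius.
Context {R : realType} {n : nat}.
Local Notation vec := 'rV[R]_n.+1.

Lemma pd_sumM m (F G : 'I_m -> vec -> R) (x : vec) i :
  (forall k, differentiable (F k) x) -> (forall k, differentiable (G k) x) ->
  pd i (fun y => \sum_k F k y * G k y) x = \sum_k (pd i (F k) x * G k x + F k x * pd i (G k) x).
Proof.
move=> dF dG; rewrite pd_sum; first by apply: eq_bigr => k _; rewrite pdM.
by move=> k; exact: differentiableM.
Qed.

Lemma smooth_sumM m (Q : set vec) (F G : 'I_m -> vec -> R) : open Q ->
  (forall k, smooth_open Q (F k)) -> (forall k, smooth_open Q (G k)) ->
  smooth_open Q (fun y => \sum_k F k y * G k y).
Proof. by move=> oQ sF sG; apply: smooth_sum => // k _; apply: smooth_openM. Qed.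

Lemma smooth_within (Q : set vec) (f : vec -> R) : smooth_open Q f -> {within Q, continuous f}.
Proof. by move=> sf; apply: continuous_in_subspaceT => z /set_mem Qz; exact: smooth_continuous sf Qz. Qed.

Section Step.
Variables (c : vec) (r : R) (m : nat) (B : 'I_n.+1 -> 'I_m -> 'I_m -> vec -> R).
Local Notation Q := (cube c r).
Hypothesis sB : forall i a b, smooth_open Q (B i a b).
Hypothesis flat : forall i j a b x, Q x -> half_space x ->
  pd i (B j a b) x - pd j (B i a b) x - \sum_e B i a e x * B j e b x + \sum_e B j a e x * B i e b x = 0.

Let cQ : open Q. Proof. exact: open_cube. Qed.

Lemma pd_line_eq i f h (y : vec) : Q y -> (forall s, Q (y + s *: 'e_i) -> f (y + s *: 'e_i) = h (y + s *: 'e_i)) ->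
  pd i f y = pd i h y.
Proof.
move=> Qy e; have [d d0 hd] := open_line 'e_i cQ Qy.
have fy : f y = h y by have := e 0; rewrite scale0r addr0; apply.
rewrite !pdE /derive.
have E : \forall t \near (0 : R)^', t^-1 *: ((f \o shift y) (t *: 'e_i) - f y) = t^-1 *: ((h \o shift y) (t *: 'e_i) - h y).
  near=> t; rewrite fy /= (addrC (t *: _)) e //; apply: hd; rewrite ltW //.
  by near: t; exact: dnbhs0_lt.
congr (lim _); apply/seteqP; split; apply: near_eq_cvg; first exact: E.
by apply: filterS E => t ->.
Unshelve. all: by end_near. Qed.

(** The defect Z of the i-th equation, i < k, vanishes on the slice x_k = c_k; by the integrability
    condition it solves along e_k the linear system with coefficients [B k], hence vanishes. *)
Lemma frobenius_step (k : 'I_n.+1) (V V' : 'I_m -> vec -> R) :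
  (forall a, smooth_open Q (V a)) -> (forall a, smooth_open Q (V' a)) ->
  (forall x, Q x -> half_space x -> (forall j : 'I_n.+1, (k <= j)%N -> x 0 j = c 0 j) ->
    forall (i : 'I_n.+1) a, (i < k)%N -> pd i (V a) x = \sum_b B i a b x * V b x) ->
  (forall a x, Q x -> x 0 k = c 0 k -> V' a x = V a x) ->
  (forall a x, Q x -> pd k (V' a) x = \sum_b B k a b x * V' b x) ->
  forall x, Q x -> half_space x -> (forall j : 'I_n.+1, (k < j)%N -> x 0 j = c 0 j) ->
    forall (i : 'I_n.+1) a, (i <= k)%N -> pd i (V' a) x = \sum_b B i a b x * V' b x.
Proof.
move=> sV sV' hV V'V odeV' x Qx Hx xc i a; rewrite leq_eqVlt => /orP[/eqP/val_inj -> |ik]; first exact: odeV'.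
(* Lines in a direction other than e_0 preserve the half-space, the only place where the
   integrability condition is available. *)
have k0 : k != 0 by apply: contraTneq ik => ->; rewrite ltn0.
have [y yE] : exists y : vec, forall j, y 0 j = if j == k then c 0 k else x 0 j.
  exists (x + (c 0 k - x 0 k) *: 'e_k) => j; rewrite !mxE eqxx /=; case: eqVneq => [->|_]; first by rewrite mulr1 addrC subrK.
  by rewrite mulr0 addr0.
have Qy : Q y by move=> j; rewrite yE; case: eqP => [->|_]; [rewrite subrr normr0 (le_lt_trans _ (Qx k))|exact: Qx].
have lQ (t : R) : 0 <= t <= 1 -> Q (y + t *: (x - y)) by exact: cube_convex.
have lE (z w : vec) (t : R) j : (z + t *: w) 0 j = z 0 j + t * w 0 j by rewrite mxE [X in _ + X]mxE.
have l0 (t : R) : (y + t *: (x - y)) 0 0 = x 0 0.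
  by rewrite lE !mxE yE eq_sym (negbTE k0) subrr mulr0 addr0.
have lH (t : R) : half_space (y + t *: (x - y)) by rewrite half_spaceE l0 -half_spaceE.
have dV e z : Q z -> differentiable (V' e) z by move=> Qz; exact: smooth_diff (sV' e) Qz.
have dB j e f z : Q z -> differentiable (B j e f) z by move=> Qz; exact: smooth_diff (sB j e f) Qz.
pose Z e z := pd i (V' e) z - \sum_b B i e b z * V' b z.
suff : Z a x = 0 by move/eqP; rewrite subr_eq0 => /eqP.
have sZ e : smooth_open Q (Z e).
  exact: (smooth_openB cQ (smooth_pd i (sV' e)) (smooth_sumM cQ (sB i e) sV')).
have pZ e z : Q z -> half_space z -> pd k (Z e) z = \sum_b B k e b z * Z b z.
  move=> Qz Hz.
  have dBV j f : differentiable (fun y => \sum_b B j f b y * V' b y) z.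
    exact: smooth_diff (smooth_sumM cQ (sB j f) sV') Qz.
  have pS j l f : pd l (fun y => \sum_b B j f b y * V' b y) z = \sum_b (pd l (B j f b) z * V' b z + B j f b z * pd l (V' b) z).
    by apply: pd_sumM => b; [exact: dB|exact: dV].
  have pp : pd k (pd i (V' e)) z = \sum_b (pd i (B k e b) z * V' b z + B k e b z * pd i (V' b) z).
    rewrite (pdC k i cQ (sV' e) Qz) -pS; apply: near_eq_derive.
    by near=> w; apply: odeV'; near: w; exact: open_nbhs_nbhs.
  rewrite /Z pdB //; last by apply: smooth_diff Qz; exact: smooth_pd.
  rewrite pp pS.
  have -> : \sum_b (pd k (B i e b) z * V' b z + B i e b z * pd k (V' b) z) =
     \sum_b (pd k (B i e b) z + \sum_f B i e f z * B k f b z) * V' b z.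
    rewrite big_split /= [X in _ + X](eq_bigr (fun b => \sum_f B i e b z * (B k b f z * V' f z))); last first.
      by move=> b _; rewrite odeV' // mulr_sumr.
    rewrite [X in _ + X]exchange_big /= -big_split; apply: eq_bigr => b _ /=; rewrite mulrDl mulr_suml; congr (_ + _).
    by apply: eq_bigr => f _; rewrite mulrA.
  have -> : \sum_b B k e b z * (pd i (V' b) z - \sum_f B i b f z * V' f z) =
     \sum_b B k e b z * pd i (V' b) z - \sum_b (\sum_f B k e f z * B i f b z) * V' b z.
    rewrite (eq_bigr (fun b => B k e b z * pd i (V' b) z - \sum_f B k e b z * (B i b f z * V' f z))).
    rewrite sumrB exchange_big /=; congr (_ - _); apply: eq_bigr => b _; rewrite mulr_suml.
      by apply: eq_bigr => f _; rewrite mulrA.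
    by move=> b _; rewrite mulrBr mulr_sumr.
  rewrite big_split /= addrAC [RHS]addrC; congr (_ + _).
  rewrite -!sumrB -sumrN; apply: eq_bigr => b _; rewrite -mulrBl -mulNr; congr (_ * _).
  have /eqP := flat i k e b Qz Hz; lra.
have Zy e : Z e y = 0.
  apply/eqP; rewrite subr_eq0; apply/eqP.
  have -> : pd i (V' e) y = pd i (V e) y.
    apply: pd_line_eq => // s Qs; apply: V'V => //.
    by rewrite lE yE eqxx mxE eqxx eq_sym /= -val_eqE (ltn_eqF ik) mulr0 addr0.
  rewrite hV //.
  - by apply: eq_bigr => b _; rewrite V'V // yE eqxx.
  - by have := lH 0; rewrite scale0r addr0.
  - by move=> j kj; rewrite yE; case: eqP => [->|/eqP jk] //; apply: xc; rewrite ltn_neqAle eq_sym jk.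
rewrite (_ : x = y + 1 *: (x - y)); last by rewrite scale1r addrC subrK.
have cb e f : {within `[0, 1], continuous (fun t : R => (x 0 k - c 0 k) * B k e f (y + t *: (x - y)))}.
  have h : smooth_open Q (fun z => (x 0 k - c 0 k) * B k e f z) by apply: smooth_openM => //; exact: smooth_cst.
  exact: line_within (smooth_within h) lQ.
have /choice [K hK] : forall q : 'I_m * 'I_m, exists K : R, forall t : R, 0 < t < 1 -> `|(x 0 k - c 0 k) * B k q.1 q.2 (y + t *: (x - y))| <= K.
  by move=> q; have [K _ hK] := line_bounded (cb q.1 q.2); exists K.
apply: (@linear_unique01 R 'I_m (fun e t => Z e (y + t *: (x - y))) (fun e f t => (x 0 k - c 0 k) * B k e f (y + t *: (x - y)))
  (\sum_q `|K q|)).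
- move=> e; exact: line_within (smooth_within (sZ e)) lQ.
- move=> e s /andP[s0 s1]; have s01 : 0 <= s <= 1 by rewrite !ltW.
  have := smooth_line_derive (sZ e) (lQ s s01); congr is_derive.
  have wE j : (x - y) 0 j = x 0 j - y 0 j by rewrite mxE [X in _ + X]mxE.
  rewrite (bigD1 k) //= big1 ?addr0 => [|j jk]; last by rewrite wE yE (negbTE jk) subrr mul0r.
  rewrite wE yE eqxx (pZ e _ (lQ s s01) (lH s)) mulr_sumr; apply: eq_bigr => f _; by rewrite mulrA.
- move=> e f s s01; apply: le_trans (hK (e, f) s s01) _.
  by apply: (le_trans (ler_norm _)); rewrite (bigD1 (e, f)) //= ler_wpDr // sumr_ge0.
- by move=> e; rewrite scale0r addr0.
Unshelve. all: by end_near. Qed.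
End Step.

(** One direction after the other, starting with e_0, for which no earlier equation has to be
    preserved. Each solution needs data on a neighbourhood of a closed cube, so the cube shrinks at
    each step, by an arbitrary amount. *)
Lemma frobenius (c : vec) (r : R) (m : nat) (B : 'I_n.+1 -> 'I_m -> 'I_m -> vec -> R) (V0 : 'I_m -> R) :
  (forall i a b, smooth_open (cube c r) (B i a b)) ->
  (forall i j a b x, cube c r x -> half_space x ->
    pd i (B j a b) x - pd j (B i a b) x - \sum_e B i a e x * B j e b x + \sum_e B j a e x * B i e b x = 0) ->
  forall rho : R, 0 < rho < r -> exists V : 'I_m -> vec -> R,
  [/\ forall a, smooth_open (cube c rho) (V a), forall a, V a c = V0 a &
    forall i a x, cube c rho x -> half_space x -> pd i (V a) x = \sum_b B i a b x * V b x].
Proof.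
move=> sB flat; suff H k : (k <= n.+1)%N -> forall rho : R, 0 < rho < r ->
  exists V : 'I_m -> vec -> R, [/\ forall a, smooth_open (cube c rho) (V a), forall a, V a c = V0 a &
    forall x, cube c rho x -> half_space x -> (forall j : 'I_n.+1, (k <= j)%N -> x 0 j = c 0 j) ->
     forall (i : 'I_n.+1) a, (i < k)%N -> pd i (V a) x = \sum_b B i a b x * V b x].
  move=> rho hr; have [V [sV V0c hV]] := H n.+1 (leqnn _) rho hr.
  by exists V; split => // i a x Qx Hx; apply: hV => // j; rewrite leqNgt ltn_ord.
elim: k => [_ rho _|k IH kn rho /andP[r0 rr]].
  by exists (fun a _ => V0 a); split => // a; apply: smooth_cst; exact: open_cube.
pose rho' := (rho + r) / 2.
have [r1 r2] : rho < rho' /\ rho' < r by rewrite /rho'; split; lra.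
have [|V [sV V0c hV]] := IH (ltnW kn) rho'; first by rewrite r2 (lt_trans r0).
have sub x : ccube c rho x -> cube c rho' x by move=> h j; exact: le_lt_trans (h j) r1.
have sub1 x : cube c rho x -> cube c r x by move=> h j; exact: lt_trans (h j) rr.
have sub2 x : cube c rho' x -> cube c r x by move=> h j; exact: lt_trans (h j) r2.
have sB' a b : smooth_open (cube c rho') (B (Ordinal kn) a b) by apply: smooth_sub sub2 (sB (Ordinal kn) a b).
have oC : open (cube c rho') by exact: open_cube.
have [V' [sV' V'V ode]] := @linear_ode_smooth R n.+1 (cube c rho') c rho (Ordinal kn) oC r0 sub _ (B (Ordinal kn)) V sB' sV.
exists V'; split => // [a|x Qx Hx xc i a ik].
  by rewrite V'V // => j; rewrite subrr normr0.
apply: (@frobenius_step c rho m B _ _ (Ordinal kn) V V') => //.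
- by move=> j e f; exact: smooth_sub sub1 (sB j e f).
- by move=> j l e f z /sub1; exact: flat.
- by move=> e; apply: smooth_sub (sV e) => z /cubeW /sub.
- by move=> z Qz; apply: hV; exact/sub/cubeW.
Qed.
End Frobenius.

Section PartialSum.
Context {R : realType} {n : nat}.

Lemma partial_sumM (V : set 'rV[R]_n.+1) m (F G : 'I_m -> 'rV[R]_n.+1 -> R) x i : hopen V ->
  (forall k, smooth_on V (F k)) -> (forall k, smooth_on V (G k)) -> V x ->
  partial i (fun y => \sum_k F k y * G k y) x = \sum_k (partial i (F k) x * G k x + F k x * partial i (G k) x).
Proof.
move=> hV sF sG Vx; have [U [F' [oU Ux sF' FF']]] := smooth_on_ext sF Vx.
have [U' [G' [oU' Ux' sG' GG']]] := smooth_on_ext sG Vx.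
have dF k : differentiable (F' k) x := smooth_diff (sF' k) Ux.
have dG k : differentiable (G' k) x := smooth_diff (sG' k) Ux'.
have pF k : partial i (F k) x = pd i (F' k) x by apply: (partialE i hV oU Ux Vx (dF k)) => y; exact: FF'.
have pG k : partial i (G k) x = pd i (G' k) x by apply: (partialE i hV oU' Ux' Vx (dG k)) => y; exact: GG'.
have s : smooth_open (U `&` U') (fun y => \sum_k F' k y * G' k y).
  apply: smooth_sumM => [|k|k]; first exact: openI.
    by apply: smooth_sub (sF' k) => y [].
  by apply: smooth_sub (sG' k) => y [].
rewrite (partialE i hV (openI oU oU') (conj Ux Ux') Vx (smooth_diff s (conj Ux Ux'))); last first.
  by move=> y [Uy Uy'] Vy; apply: eq_bigr => k _; rewrite FF' // GG'.
by rewrite pd_sumM //; apply: eq_bigr => k _; rewrite pF pG FF' // GG'.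
Qed.
End PartialSum.

(** * Developing maps in one chart: existence and uniqueness *)

Section Developing.
Context {R : realType} {n : nat}.
Local Notation vec := 'rV[R]_n.+1.
Implicit Types (V W : set vec) (G : vec -> 'M[R]_n.+1) (v : vec -> R) (Y : vec -> vec).

Lemma ring_mx_const V (hV : hopen V) p q (P : 'M[smooth_ring V]_(p, q)) x y (Vx : V x) (Vy : V y) :
  (forall i, Dm (deriv_ring hV) i P = 0) -> (forall t : R, 0 <= t <= 1 -> V (x + t *: (y - x))) ->
  map_mx (eval_in Vy) P = map_mx (eval_in Vx) P.
Proof.
move=> dP hl; apply/matrixP => a b; rewrite [LHS]mxE [RHS]mxE.
apply: (partial0_const hV (smooth_ringP (P a b)) hl) => i t /hl Vz.
have := congr1 (fun N => map_mx (eval_in Vz) N a b) (dP i); rewrite eval_Dm [LHS]mxE => ->.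
by rewrite !mxE rmorph0.
Qed.

(* [Y] is an isometry from the conformal metric [G / (1 + v)^2] to the Euclidean one. *)
Record developing V G v Y : Prop := Developing {
  dev_smooth : forall j, smooth_on V (fun x => Y x 0 j);
  dev_metric : forall x, V x -> jacm Y x *m (jacm Y x)^T = flat_metric G v x;
  dev_norm : forall x, V x -> sqnorm (Y x) = (1 - v x) / (1 + v x) }.

Section Fixed.
Context {V : set vec} {G : vec -> 'M[R]_n.+1} {v : vec -> R} (h : height_chart V G v).
Let hV := hc_open h.

Lemma dev_unit Y x : developing V G v Y -> V x -> jacm Y x \in unitmx.
Proof.
move=> hY Vx; have := posdef_unit (flat_metric_pos h Vx); rewrite -(dev_metric hY Vx) unitmx_mul.
by case/andP.
Qed.

(** The matrices (D_i J) J^-1 are torsion-free because second derivatives commute, and compatible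
    with the metric J J^T; by uniqueness they are the connection. In other words the differentials
    of the components of Y are parallel. *)
Lemma dev_conn Y (hY : developing V G v Y) (Gm Hm : 'M[smooth_ring V]_n.+1)
    (Gam : 'I_n.+1 -> 'M[smooth_ring V]_n.+1) i : Gm^T = Gm -> Gm *m Hm = 1%:M ->
  (forall i j k, Gam i j k = Gam j i k) ->
  (forall i, Dm (deriv_ring hV) i Gm = Gam i *m Gm + Gm *m (Gam i)^T) ->
  (forall x (Vx : V x), map_mx (eval_in Vx) Gm = flat_metric G v x) ->
  Dm (deriv_ring hV) i (ring_mx (smooth_jacm hV (dev_smooth hY))) = Gam i *m ring_mx (smooth_jacm hV (dev_smooth hY)).
Proof.
move=> mT mV tf mc he; pose sJ := smooth_jacm hV (dev_smooth hY).
pose J := ring_mx sJ; pose K := ring_mx (smooth_mx_inv (fun y (Vy : V y) => dev_unit hY Vy) sJ).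
have JK : J *m K = 1%:M.
  by apply: ring_mx_inj => y Vy; rewrite map_mxM !ring_mxE map_mx1 mulmxV // (dev_unit hY).
have KJ : K *m J = 1%:M by exact: mulmx1C.
pose Gam' i := Dm (deriv_ring hV) i J *m K.
have GJ : Gm = J *m J^T.
  by apply: ring_mx_inj => y Vy; rewrite eval_mxM eval_mxT ring_mxE (dev_metric hY Vy) he.
rewrite -/sJ -/J -(koszul (@smooth_ring_two_reg _ _ V) mT mV tf mc (Gam' := Gam') _ _ i) /Gam'.
- by rewrite -mulmxA KJ mulmx1.
- move=> p q k; rewrite !mxE; apply: eq_bigr => s _; congr (_ * _).
  by rewrite [LHS]mxE [RHS]mxE; exact: (jacm_sym hV (dev_smooth hY)).
- move=> p; rewrite GJ (DmM (@deriv_ringD _ _ _ hV) (@deriv_ringM _ _ _ hV)) DmT -mulmxA (mulmxA K) KJ mul1mx.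
  by rewrite trmx_mul -!mulmxA (mulmxA _^T) -trmx_mul KJ trmx1 mul1mx.
Qed.

(** The derivative of (1 + v) |Y|^2 = 1 - v. Since the Jacobian is invertible, Y is determined by
    it, which excludes translations in [dev_rigid]. *)
Lemma dev_radial Y x : developing V G v Y -> V x ->
  jacm Y x *m (Y x)^T = - ((1 + v x)^-1 * (1 + v x)^-1) *: grad v x.
Proof.
move=> hY Vx; apply/colP => i; rewrite [LHS]mxE [RHS]mxE mxE.
have sN : smooth_on V (fun y => \sum_j Y y 0 j * Y y 0 j).
  by apply: smooth_on_sum => j _; apply: smooth_onM; exact: (dev_smooth hY).
have s1 := smooth_height1 h.
have E : partial i (fun y => (1 + v y) * \sum_j Y y 0 j * Y y 0 j) x = partial i (fun y => 1 + (-1) * v y) x.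
  apply/esym/(partial_eq hV i _ Vx); first by apply: smooth_onM.
  move=> y Vy; have := dev_norm hY Vy; rewrite /sqnorm (eq_bigr (fun j => Y y 0 j * Y y 0 j)) => [->|j _]; last exact: expr2.
  by have v1 := height1_neq0 h Vy; field.
have s2 : smooth_on V (fun y => -1 * v y) by apply: smooth_onM (hc_height h); exact: smooth_on_cst.
move: E; rewrite (partialM hV i s1 sN Vx) !(partialD hV i _ _ Vx) ?(partialM hV i _ (hc_height h) Vx) ?(partial_cst hV _ i Vx);
  try solve [exact: smooth_on_cst|exact: (hc_height h)|exact: s2].
rewrite (partial_sumM i hV (dev_smooth hY) (dev_smooth hY) Vx) big_split /=.
have -> : \sum_j Y x 0 j * Y x 0 j = (1 - v x) / (1 + v x).
  by rewrite -(dev_norm hY Vx); apply: eq_bigr => j _; rewrite expr2.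
have -> : \sum_i0 jacm Y x i i0 * (Y x)^T i0 0 = \sum_k partial i (fun y => Y y 0 k) x * Y x 0 k.
  by apply: eq_bigr => k _; rewrite !mxE.
rewrite [in X in _ + X](_ : \sum_j Y x 0 j * _ = \sum_j partial i (fun y => Y y 0 j) x * Y x 0 j); last by apply: eq_bigr => k _; rewrite mulrC.
have v1 := height1_neq0 h Vx; move: (\sum_k _) (partial i v x) v1; set w := v x => S p v1 e.
have {}e : (1 + w) * (S + S) = - p - p * ((1 - w) / (1 + w)) by move: e; rewrite mul0r !add0r mulN1r => <-; rewrite [X in _ = X - _]addrC addrK.
have -> : S = (1 + w)^-1 * ((1 + w) * (S + S)) / 2 by field.
by rewrite e; field.
Qed.

(** Both Jacobians satisfy D_i J = Gam_i J, so J1^-1 J2 is constant along segments and orthogonal;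
    [dev_radial] passes from the Jacobians to the maps. *)
Lemma dev_rigid Y1 Y2 x : developing V G v Y1 -> developing V G v Y2 -> V x ->
  exists2 C : 'M[R]_n.+1, C *m C^T = 1%:M & forall y,
  (forall t : R, 0 <= t <= 1 -> V (x + t *: (y - x))) -> Y2 y = Y1 y *m C.
Proof.
move=> h1 h2 Vx; pose C := invmx (jacm Y1 x) *m jacm Y2 x.
have u1 := dev_unit h1 Vx.
have CC : C *m C^T = 1%:M.
  rewrite /C trmx_mul !mulmxA -(mulmxA _ (jacm Y2 x)) (dev_metric h2 Vx) -(dev_metric h1 Vx).
  by rewrite mulmxA mulVmx // mul1mx -trmx_mul mulVmx // trmx1.
exists C => // y hl.
have Vy : V y by have := hl 1; rewrite scale1r addrC subrK; apply; rewrite lexx ler01.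
have [Gm [Hm [Gam [E [[[mT mV] tf mc _ _] he]]]]] := flat_ring_data h.
have DJ Y (hY : developing V G v Y) i := dev_conn hY i mT mV tf mc (fun z Vz => let: And5 e _ _ _ _ := he z Vz in e).
pose J1 := ring_mx (smooth_jacm hV (dev_smooth h1)); pose J2 := ring_mx (smooth_jacm hV (dev_smooth h2)).
pose K := ring_mx (smooth_mx_inv (fun y (Vy : V y) => dev_unit h1 Vy) (smooth_jacm hV (dev_smooth h1))).
have KJ : K *m J1 = 1%:M.
  by apply: ring_mx_inj => z Vz; rewrite map_mxM !ring_mxE map_mx1 mulVmx // (dev_unit h1).
have DK i : Dm (deriv_ring hV) i K = - (K *m Gam i).
  have DM := DmM (@deriv_ringD _ _ _ hV) (@deriv_ringM _ _ _ hV) i.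
  have := DM _ _ _ K J1; rewrite KJ (Dm1 (@deriv_ringD _ _ _ hV) (@deriv_ringM _ _ _ hV)) DJ mulmxA -mulmxDl => /esym e.
  by apply/eqP; rewrite -addr_eq0 -[_ + _]mulmx1 -(mulmx1C KJ) mulmxA e mul0mx.
have dP i : Dm (deriv_ring hV) i (K *m J2) = 0.
  by rewrite (DmM (@deriv_ringD _ _ _ hV) (@deriv_ringM _ _ _ hV)) DK DJ mulmxA mulNmx addNr.
have := ring_mx_const Vx Vy dP hl; rewrite !eval_mxM !ring_mxE.
move=> J12; have {}J12 : jacm Y2 y = jacm Y1 y *m C by rewrite /C -J12 mulKVmx // (dev_unit h1).
have e : jacm Y2 y *m (Y2 y)^T = jacm Y1 y *m (Y1 y)^T by rewrite !dev_radial.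
rewrite J12 -mulmxA in e; have {}e := congr1 (mulmx (invmx (jacm Y1 y))) e.
rewrite !mulKmx ?(dev_unit h1) // in e.
rewrite -[Y1 y]trmxK -e trmx_mul trmxK -mulmxA (mulmx1C _) ?mulmx1 //.
Qed.

(** Flatness gives, through [frobenius], a parallel coframe that is orthonormal at [x0] by the
    Cholesky factor of the metric, hence everywhere. Y is E paired with this coframe: as D E = id,
    its differential is the coframe, and |Y|^2 = |E|^2. *)
Lemma dev_exists x0 : (forall x i j, V x -> flat_curv G v i j x = 0) -> V x0 ->
  exists2 e : R, 0 < e & exists2 Y, (forall x, cube x0 e x -> half_space x -> V x) &
    developing (cube x0 e `&` half_space) G v Y.
Proof.
move=> fl V0.
have sB (q : 'I_n.+1 * 'I_n.+1 * 'I_n.+1) : smooth_on V (fun x => flat_conn G v q.1.1 x q.1.2 q.2) by exact: smooth_flat_conn.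
have [U [B' [oU U0 sB' BB]]] := smooth_on_ext sB V0.
have [e1 e10 he1] := hopen_cube hV V0; have [e2 e20 he2] := nbhs_cube (open_nbhs_nbhs (conj oU U0)).
pose r := Order.min e1 e2; have r0 : 0 < r by rewrite lt_min e10.
have qV x : cube x0 r x -> half_space x -> V x.
  by move=> qx; apply: he1 => j; apply: lt_le_trans (qx j) _; rewrite ge_min lexx.
have qU x : cube x0 r x -> U x by move=> qx; apply: he2 => j; apply: lt_le_trans (qx j) _; rewrite ge_min lexx orbT.
pose B i a b := B' (i, a, b).
have BE i a b x : cube x0 r x -> half_space x -> B i a b x = flat_conn G v i x a b.
  by move=> qx hx; rewrite /B -(BB (i, a, b) x (qU x qx) (qV x qx hx)).
have dB i a b x : cube x0 r x -> differentiable (B i a b) x.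
  by move=> qx; exact: smooth_diff (sB' _) (qU x qx).
have pB i j a b x : cube x0 r x -> half_space x -> partial j (fun y => flat_conn G v i y a b) x = pd j (B i a b) x.
  move=> qx hx; apply: (partialE j hV oU (qU x qx) (qV x qx hx) (dB i a b x qx)) => y Uy Vy.
  exact: (BB (i, a, b) y Uy Vy).
have [B0 B0E uB0] := cholesky (flat_metricT h V0) (flat_metric_pos h V0).
pose e := r / 2; have e0 : 0 < e by rewrite divr_gt0.
have er : 0 < e < r by rewrite e0 /e; lra.
have /choice [A hA] : forall j : 'I_n.+1, exists A : 'I_n.+1 -> vec -> R,
  [/\ forall a, smooth_open (cube x0 e) (A a), forall a, A a x0 = B0 a j &
    forall i a x, cube x0 e x -> half_space x -> pd i (A a) x = \sum_b B i a b x * A b x].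
  move=> j; apply: (@frobenius R n x0 r n.+1 B (fun a => B0 a j)) er.
    by move=> i a b; apply: smooth_sub (sB' _); exact: qU.
  move=> i j' a b x qx hx; have := fl x i j' (qV x qx hx) => /matrixP /(_ a b).
  have gen (P P' C C' : 'M[R]_n.+1) : (P - P' - C *m C' + C' *m C) a b =
      P a b - P' a b - \sum_e C a e * C' e b + \sum_e C' a e * C e b by rewrite !mxE.
  rewrite /flat_curv gen [X in X - _ - _ + _]mxE [X in _ - X - _ + _]mxE [RHS]mxE !pB // => flE; rewrite -[RHS]flE.
  by congr (_ - _ + _); apply: eq_bigr => k _; rewrite !BE.
pose S := cube x0 e `&` half_space.
have hS : hopen S by exists (cube x0 e) => //; exact: open_cube.
have QS x : cube x0 e x -> cube x0 r x by move=> qx j; apply: lt_trans (qx j) _; case/andP: er.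
have SV : S `<=` V by move=> x [/QS qx hx]; exact: qV.
have sAo a j : smooth_open (cube x0 e) (A j a) by have [] := hA j.
have sA a j : smooth_on S (fun x => A j a x).
  by move=> x [qx hx]; exists (cube x0 e), (A j a); split => //; exact: open_cube.
have pA i a j x : S x -> partial i (A j a) x = \sum_b flat_conn G v i x a b * A j b x.
  move=> [qx hx]; have [_ _ hj] := hA j; have oC : open (cube x0 e) by exact: open_cube.
  rewrite (partialE i hS oC qx (conj qx hx) (smooth_diff (sAo a j) qx)) // hj //.
  by apply: eq_bigr => b _; rewrite BE //; exact: QS.
have S0 : S x0 by split; [exact: cube_center|exact: hopen_half hV V0].
have hSl x y t : S x -> S y -> 0 <= t <= 1 -> S (x + t *: (y - x)).
  by move=> [qx hx] [qy hy] t01; split; [exact: cube_convex|exact: half_segment].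
pose Am x : 'M[R]_n.+1 := \matrix_(a, j) A j a x.
have AA x : S x -> Am x *m (Am x)^T = flat_metric G v x.
  move=> Sx; have [Gm [Hm [Gam [E [[[mT mV] tf mc _ _] he]]]]] := flat_ring_data (height_chart_sub hS SV h).
  have sAm : smooth_mx S Am by move=> a j; apply: smooth_on_eq (sA a j) => z _; rewrite mxE.
  set D := deriv_ring _ in mc; pose Ar := ring_mx sAm.
  have DA i : Dm D i Ar = Gam i *m Ar.
    apply: ring_mx_inj => z Sz; rewrite eval_Dm_ring eval_mxM ring_mxE; have [_ _ _ -> _] := he z Sz.
    apply/matrixP => a j; rewrite [LHS]mxE [RHS]mxE; under eq_fun do rewrite mxE.
    by rewrite pA //; apply: eq_bigr => b _; rewrite [X in _ = _ * X]mxE.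
  have DM := DmM (@deriv_ringD _ _ _ _) (@deriv_ringM _ _ _ _) : forall i p q r M N, _.
  (* The inner products of a parallel coframe are constant. *)
  have P0 i : Dm D i (Ar^T *m Hm *m Ar) = 0.
    rewrite !DM DmT DA (Dm_inv (@deriv_ringD _ _ _ _) (@deriv_ringM _ _ _ _) mV mc) trmx_mul.
    by rewrite mulmxDr !mulmxN !mulmxDl !mulNmx !mulmxA; apply/matrixP => a b; rewrite !mxE; ring.
  have := ring_mx_const S0 Sx P0 (fun t t01 => hSl x0 x t S0 Sx t01).
  rewrite !eval_mxM !eval_mxT !ring_mxE.
  have Am0 : Am x0 = B0 by apply/matrixP => a j; have [_ h0 _] := hA j; rewrite mxE h0.
  have HG z (Sz : S z) : map_mx (eval_in Sz) Hm *m flat_metric G v z = 1%:M.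
    have [<- _ _ _ _] := he z Sz; rewrite -eval_mxM (mulmx1C mV) map_mx1 //.
  rewrite Am0 (mulmx1C (_ : B0 *m (B0^T *m map_mx (eval_in S0) Hm) = 1%:M)); last first.
    by rewrite mulmxA B0E; exact: mulmx1C (HG _ S0).
  move=> /mulmx1C eA; have := congr1 (mulmx^~ (flat_metric G v x)) eA.
  by rewrite -!mulmxA HG mulmx1 mul1mx.
pose Y x : vec := (flat_field G v x)^T *m Am x.
have YE j x : Y x 0 j = \sum_m flat_field G v x m 0 * A j m x by rewrite mxE; apply: eq_bigr => m _; rewrite !mxE.
have sF m : smooth_on S (fun x => flat_field G v x m 0) by apply: smooth_on_sub SV _; exact: smooth_flat_field.
have sY j : smooth_on S (fun x => Y x 0 j).
  apply: (@smooth_on_eq _ _ _ (fun x => \sum_m flat_field G v x m 0 * A j m x)); first by move=> x _; rewrite YE.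
  by apply: smooth_on_sum => m _; exact: smooth_onM.
have YA x : S x -> jacm Y x = Am x.
  move=> Sx; apply/matrixP => i j; rewrite mxE [RHS]mxE.
  under eq_fun do rewrite YE.
  rewrite (partial_sumM i hS sF (fun m => sA m j) Sx) (eq_bigr (fun k => partial i (fun y => flat_field G v y k 0) x * A j k x +
    \sum_b flat_field G v x k 0 * flat_conn G v i x k b * A j b x)); last first.
    by move=> k _; rewrite pA // mulr_sumr; congr (_ + _); apply: eq_bigr => b _; rewrite mulrA.
  rewrite big_split /= exchange_big /= -big_split /= (eq_bigr (fun b => (delta_mx i 0 : 'cV[R]_n.+1) b 0 * A j b x)).
  rewrite (bigD1 i) //= mxE !eqxx mul1r big1 ?addr0 // => b bi; by rewrite mxE (negbTE bi) mul0r.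
  move=> b _; rewrite -mulr_suml -mulrDl -(flat_field_cov h i (SV x Sx)); congr (_ * _).
  rewrite [RHS]mxE; congr (_ + _); first by rewrite mxE.
  by rewrite [RHS]mxE; apply: eq_bigr => k _; rewrite [X in _ = X * _]mxE mulrC.
exists e => //; exists Y; first by move=> x qx hx; apply: SV.
split => // x Sx; first by rewrite YA // AA.
rewrite -(flat_field_norm h (SV x Sx)) -AA // /sqnorm.
have -> : \sum_i Y x 0 i ^+ 2 = (Y x *m (Y x)^T) 0 0 by rewrite mxE; apply: eq_bigr => i _; rewrite [X in _ * X]mxE expr2.
by rewrite /Y trmx_mul trmxK !mulmxA.
Qed.
End Fixed.
End Developing.

(** * The inverse function theorem *)

Section LocalInverse.
Context {R : realType} {n : nat}.
Local Notation vec := 'rV[R]_n.+1.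
Implicit Types (U : set vec) (F : vec -> vec).

Lemma mulmx_bounded (K : 'M[R]_n.+1) : exists2 k : R, 0 < k & forall w : vec, `|w *m K| <= k * `|w|.
Proof.
exists (1 + \sum_i \sum_j `|K i j|).
  by rewrite ltr_wpDr // sumr_ge0 // => i _; rewrite sumr_ge0.
move=> w; apply: norm_le_coord => [|j].
  by rewrite mulr_ge0 // addr_ge0 // sumr_ge0 // => i _; rewrite sumr_ge0.
rewrite mxE; apply: le_trans (ler_norm_sum _ _ _) _; rewrite mulrDl mul1r ler_wpDl // mulr_suml.
apply: ler_sum => i _; rewrite normrM mulrC; apply: ler_pM => //; last exact: coord_le_norm.
by rewrite (bigD1 j) //= lerDl sumr_ge0.
Qed.

Definition Jac F x : 'M[R]_n.+1 := \matrix_(i, j) pd i (fun y => F y 0 j) x.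

Lemma strict_diff U F x (eps : R) : open U -> (forall j, smooth_open U (fun y => F y 0 j)) -> U x -> 0 < eps ->
  exists2 d : R, 0 < d & forall a b, cube x d a -> cube x d b -> U a /\ `|F b - F a - (b - a) *m Jac F x| <= eps * `|b - a|.
Proof.
move=> oU sF Ux e0; pose N : R := n.+1%:R; have N0 : 0 < N by rewrite ltr0n.
have [|d d0 hd] := @nbhs_cube R n.+1 x (U `&` [set y | forall ij : 'I_n.+1 * 'I_n.+1, `|pd ij.1 (fun y => F y 0 ij.2) y - Jac F x ij.1 ij.2| <= eps / N]).
  apply: filterI; first exact: open_nbhs_nbhs.
  apply: (@filter_forall _ _ (fun (ij : 'I_n.+1 * 'I_n.+1) (y : vec) => `|pd ij.1 (fun y => F y 0 ij.2) y - Jac F x ij.1 ij.2| <= eps / N) (nbhs x) _) => -[i j] /=.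
  have cf := smooth_continuous (smooth_pd i (sF j)) Ux.
  have : \forall y \near x, `|pd i (fun y => F y 0 j) x - pd i (fun y => F y 0 j) y| < eps / N.
    by move/cvgrPdist_lt : cf => /(_ (eps / N)); apply; rewrite divr_gt0.
  by apply: filterS => y; rewrite mxE distrC => /ltW.
exists d => // a b ca cb; split; first by have [] := hd a ca.
apply: norm_le_coord => [|j]; first by rewrite mulr_ge0 // ltW.
have Ul (s : R) : 0 <= s <= 1 -> cube x d (a + s *: (b - a)) by exact: cube_convex.
have [|s s01] := @MVT_line R n.+1 (fun y => F y 0 j) a (b - a).
  by move=> s s01; apply: smooth_diff (sF j) _; have [] := hd _ (Ul s s01).
have s01' : 0 <= s <= 1 by case/andP: s01 => s0 s1; rewrite !ltW.
have [Us hs] := hd _ (Ul s s01').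
rewrite subrKC derive_pd; last exact: smooth_diff (sF j) Us.
have -> : (F b - F a - (b - a) *m Jac F x) 0 j = F b 0 j - F a 0 j - \sum_i (b - a) 0 i * Jac F x i j by rewrite !mxE.
move=> ->; rewrite -sumrB; apply: le_trans (ler_norm_sum _ _ _) _.
apply: (@le_trans _ _ (\sum_(i < n.+1) `|b - a| * (eps / N))).
  apply: ler_sum => i _; rewrite -mulrBr normrM; apply: ler_pM => //; first exact: coord_le_norm.
  exact: (hs (i, j)).
by rewrite sumr_const card_ord -mulr_natr -mulrA divfK ?gt_eqF // mulrC.
Qed.

Lemma norm_sqr_le (w : vec) : `|w| ^+ 2 <= sqnorm w.
Proof.
rewrite -[leRHS]sqr_sqrtr ?sqnorm_ge0 // ler_pXn2r ?nnegrE ?sqrtr_ge0 //.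
by apply: sqnorm_le_norm; rewrite ?sqrtr_ge0 // sqr_sqrtr ?sqnorm_ge0.
Qed.

Section Inverse.
Variables (U : set vec) (F : vec -> vec) (x0 : vec).
Hypotheses (oU : open U) (sF : forall j, smooth_open U (fun y => F y 0 j)) (U0 : U x0) (uJ : Jac F x0 \in unitmx).

(** Strict differentiability makes F injective with a Lipschitz inverse. To solve F x = z, minimize
    |F - z|^2 on a closed cube: the minimum is interior, and there J (F x - z)^T = 0 with J
    invertible. *)
Lemma local_inverse_cont : exists e r k : R, exists g : vec -> vec,
  [/\ [/\ 0 < e, 0 < r & 0 < k],
    forall x, cube x0 e x -> U x /\ Jac F x \in unitmx,
    forall x y, cube x0 e x -> cube x0 e y -> `|y - x| <= k * `|F y - F x| &
    forall z, sqnorm (z - F x0) < r -> cube x0 e (g z) /\ F (g z) = z].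
Proof.
have [k k0 hk] := mulmx_bounded (invmx (Jac F x0)).
have sJ i j : smooth_open U (fun x => Jac F x i j).
  by apply: (@smooth_eq _ _ _ oU _ _ _ (smooth_pd i (sF j))) => x _; rewrite mxE.
have e0 : 0 < (2 * k)^-1 by rewrite invr_gt0 mulr_gt0.
have [d d0 hd] := strict_diff oU sF U0 e0.
have [|d' d'0 hd'] := @nbhs_cube R n.+1 x0 [set x | U x /\ \det (Jac F x) != 0].
  apply: filterI; first exact: open_nbhs_nbhs.
  have c := smooth_continuous (smooth_det oU sJ) U0.
  apply: (c [set t | t != 0]); apply: open_nbhs_nbhs; split; first exact: open_neq.
  by move: uJ; rewrite unitmxE unitfE.
pose e2 := Order.min d d'; have e20 : 0 < e2 by rewrite lt_min d0.
have lip x y : cube x0 e2 x -> cube x0 e2 y -> `|y - x| <= (2 * k) * `|F y - F x|.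
  move=> cx cy.
  have cd z : cube x0 e2 z -> cube x0 d z by move=> h i; apply: lt_le_trans (h i) _; rewrite ge_min lexx.
  have [_ h] := hd x y (cd _ cx) (cd _ cy).
  have : `|(y - x) *m Jac F x0| <= `|F y - F x| + (2 * k)^-1 * `|y - x|.
    rewrite -[X in `|X|](subKr (F y - F x)); apply: le_trans (ler_normB _ _) _.
    by rewrite lerD2l; exact: h.
  move=> h2; have := hk ((y - x) *m Jac F x0); rewrite mulmxK // => h3.
  have := ler_wpM2l (ltW k0) h2; rewrite mulrDr invfM mulrA => h4.
  have : k * (2^-1 * k^-1) * `|y - x| = `|y - x| / 2 by field; rewrite gt_eqF.
  move: h4; rewrite mulrA => h4 h5; rewrite h5 in h4.
  have := le_trans h3 h4; move: `|F y - F x| `|y - x| => p q; lra.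
pose e := e2 / 2; have e_0 : 0 < e by rewrite divr_gt0.
have sub x : ccube x0 e x -> cube x0 e2 x.
  by move=> h i; apply: le_lt_trans (h i) _; rewrite /e; lra.
(* At a minimum on the faces of the cube one would have e^2 <= (2 k)^2 |F x - F x0|^2 < (2 k)^2 4 r
   = e^2 / 2. *)
pose r := e ^+ 2 / (32 * k ^+ 2).
have r0 : 0 < r by rewrite divr_gt0 ?mulr_gt0 ?exprn_gt0.
have onto z : sqnorm (z - F x0) < r -> exists x, cube x0 e x /\ F x = z.
  move=> zr; pose m x := \sum_j (F x 0 j - z 0 j) * (F x 0 j - z 0 j).
  have mE x : m x = sqnorm (F x - z) by apply: eq_bigr => j _; rewrite !mxE expr2.
  have sd j : smooth_open U (fun x => F x 0 j - z 0 j) by apply: smooth_openB => //; exact: smooth_cst.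
  have sm : smooth_open U m by apply: smooth_sum => // j _; apply: smooth_openM.
  have cU : ccube x0 e `<=` U by move=> x /sub cx; have [] := hd' x _; [move=> i; apply: lt_le_trans (cx i) _; rewrite ge_min lexx orbT|].
  have c0 : ccube x0 e x0 by move=> i; rewrite subrr normr0 ltW.
  have cC : compact (ccube x0 e) by exact: compact_ccube.
  have [||x] := @EVT_min_rV R n.+1 m (ccube x0 e) _ cC.
  - by exists x0.
  - by apply: continuous_in_subspaceT => x /set_mem cx; exact: smooth_continuous sm (cU x cx).
  move=> /set_mem cx mx.
  have mx0 : m x <= m x0 by apply: mx; exact: mem_set.
  have ix : cube x0 e x.
    move=> i; rewrite lt_neqAle cx andbT; apply/negP => /eqP ei.
    have h1 : e <= (2 * k) * `|F x - F x0|.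
      by rewrite -ei; apply: le_trans (lip x0 x (sub _ c0) (sub _ cx)); have := coord_le_norm (x - x0) i; rewrite !mxE.
    have h2 : e ^+ 2 <= (2 * k) ^+ 2 * sqnorm (F x - F x0).
      apply: (@le_trans _ _ (((2 * k) * `|F x - F x0|) ^+ 2)).
        by rewrite ler_pXn2r ?nnegrE ?(ltW e_0) // mulr_ge0 // mulr_ge0 // ltW.
      by rewrite exprMn ler_wpM2l ?sqr_ge0 ?norm_sqr_le.
    have h3 : sqnorm (F x - F x0) <= 4 * m x0.
      rewrite -(subrKA z); apply: le_trans (sqnormD_le _ _) _.
      by rewrite [X in _ + X]sqnormB -!mE; lra.
    have h4 : m x0 < r by rewrite mE sqnormB.
    have : e ^+ 2 < (2 * k) ^+ 2 * (4 * r).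
      apply: le_lt_trans h2 _; rewrite ltr_pM2l ?exprn_gt0 ?mulr_gt0 //; lra.
    have -> : (2 * k) ^+ 2 * (4 * r) = e ^+ 2 / 2 by rewrite /r; field; rewrite gt_eqF.
    have e2p : 0 < e ^+ 2 by rewrite exprn_gt0.
    lra.
  exists x; split => //.
  have Ux := cU x cx; have oC : open (cube x0 e) by exact: open_cube.
  have sNm : smooth_open (cube x0 e) (fun y => - m y).
    by apply: smooth_openN => //; apply: smooth_sub sm => y /cubeW /cU.
  have cr i : pd i (fun y => - m y) x = 0.
    by apply: (max_critical oC sNm ix) => y cy; rewrite lerN2; apply: mx; exact/mem_set/cubeW.
  have J0 : Jac F x *m (F x - z)^T = 0.
    apply/colP => i; rewrite [RHS]mxE mxE; have := cr i.
    have -> : pd i (fun y => - m y) x = - pd i m x by rewrite !pdE deriveN //; apply/diff_derivable/(smooth_diff sm).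
    have dj j : differentiable (fun x => F x 0 j - z 0 j) x by exact: smooth_diff (sd j) Ux.
    have pj j : pd i (fun x => F x 0 j - z 0 j) x = Jac F x i j.
      by rewrite pdB ?pd_cst ?subr0 ?mxE //; first exact: smooth_diff (sF j) Ux.
    rewrite pd_sumM // => /eqP; rewrite oppr_eq0 => /eqP h.
    have : (\sum_j Jac F x i j * (F x - z)^T j 0) * 2 = 0.
      rewrite mulr_suml -[RHS]h; apply: eq_bigr => j _; rewrite pj !mxE; ring.
    by move=> /eqP; rewrite mulf_eq0 => /orP[/eqP //|]; rewrite pnatr_eq0.
  have ux : Jac F x \in unitmx.
    rewrite unitmxE unitfE; have [] // := hd' x; move=> i; apply: lt_le_trans (sub _ cx i) _; by rewrite ge_min lexx orbT.
  have := congr1 (mulmx (invmx (Jac F x))) J0; rewrite mulKmx // mulmx0 => /(congr1 trmx).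
  by rewrite trmxK trmx0 => /eqP; rewrite subr_eq0 => /eqP.
have /choice [g hg] : forall z, exists x, sqnorm (z - F x0) < r -> cube x0 e x /\ F x = z.
  by move=> z; have [/onto [x hx]|nz] := pselect (sqnorm (z - F x0) < r); [exists x|exists x0].
exists e, r, (2 * k), g; split => //; first by rewrite e_0 r0 mulr_gt0.
- move=> x /cubeW /sub cx; rewrite unitmxE unitfE; have [] // := hd' x.
  by move=> i; apply: lt_le_trans (cx i) _; rewrite ge_min lexx orbT.
- by move=> x y /cubeW /sub cx /cubeW /sub cy; exact: lip.
Qed.

(** The Lipschitz bound for g and strict differentiability of F show that g is differentiable, with
    Jacobian the inverse of that of F; smoothness then propagates by itself. *)
Lemma local_inverse : exists e r : R, exists g : vec -> vec,
  [/\ 0 < e /\ 0 < r, forall x, cube x0 e x -> U x,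
    forall x y, cube x0 e x -> cube x0 e y -> F x = F y -> x = y,
    forall z, sqnorm (z - F x0) < r -> cube x0 e (g z) /\ F (g z) = z &
    forall j, smooth_open [set z | sqnorm (z - F x0) < r] (fun z => g z 0 j)].
Proof.
have [e [r [k [g [[e0 r0 k0] uF lip hg]]]]] := local_inverse_cont.
exists e, r, g; split => //; first by move=> x /uF [].
  move=> x y cx cy Fxy; apply/esym/eqP; rewrite -subr_eq0 -normr_le0.
  by have := lip x y cx cy; rewrite Fxy subrr normr0 mulr0.
set B := [set z | _]; have oB : open B by exact: open_sqlt.
have dg z : B z -> differentiable g z.
  move=> Bz; have [cx Fx] := hg z Bz; set x := g z in cx Fx.
  have [Ux ux] := uF x cx; pose K := invmx (Jac F x).
  have [c c0 hc] := mulmx_bounded K.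
  have dL : differentiable (fun y : vec => y *m K) z.
    apply: differentiable_rowP => j; have : smooth_open setT (fun y : vec => (y *m K) 0 j).
      rewrite (_ : (fun y => _) = fun y : vec => \sum_i y 0 i * K i j); last by apply/funext => y; rewrite mxE.
      apply: smooth_sumM => [|i|i]; [exact: openT|exact: smooth_coord openT i|exact: smooth_cst openT _].
    by move=> s; exact: smooth_diff s _.
  have -> : g = (fun y => g y - y *m K) + (fun y => y *m K) by apply/funext => y; rewrite fctE subrK.
  apply: differentiableD => //; apply: differentiable_o => eps eps0.
  have eps1 : 0 < eps / (c * k) by rewrite divr_gt0 // mulr_gt0.
  have [d d0 hd] := strict_diff oU sF Ux eps1.
  have nB : \forall h \near (0 : vec), B (h + z) /\ k * `|h| < d.
    apply: filterI.
      have : \forall y \near z, B y by exact: open_nbhs_nbhs.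
      by rewrite (near_shift 0) subr0; apply: filterS => y.
    have : \forall h \near (0 : vec), `|h| < d / k by apply: nbhs0_lt; rewrite divr_gt0.
    by apply: filterS => h; rewrite ltr_pdivlMr // mulrC.
  apply: filterS nB => h [Bh kh]; have [cy Fy] := hg (h + z) Bh; set y := g (h + z) in cy Fy *.
  have hh : h = F y - F x by rewrite Fy Fx addrK.
  have l1 := lip x y cx cy; rewrite -hh in l1.
  have cy' : cube x d y.
    by move=> i; apply: le_lt_trans (le_lt_trans l1 kh); have := coord_le_norm (y - x) i; rewrite !mxE.
  have cx' : cube x d x by move=> i; rewrite subrr normr0.
  have [_ h1] := hd x y cx' cy'; rewrite -hh in h1.
  have -> : y - (h + z) *m K - (x - z *m K) = - ((h - (y - x) *m Jac F x) *m K).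
    by rewrite mulmxBl /K mulmxK // -/K mulmxDl; move: (h *m K) (z *m K) => b c'; apply/rowP => i; rewrite !mxE; ring.
  rewrite normrN; apply: le_trans (hc _) _.
  apply: (@le_trans _ _ (c * (eps / (c * k) * (k * `|h|)))).
    rewrite ler_pM2l //; apply: le_trans h1 _; by rewrite ler_pM2l.
  by rewrite le_eqVlt; apply/orP; left; apply/eqP; field; rewrite !gt_eqF.
have dgj j z : B z -> differentiable (fun z => g z 0 j) z.
  move=> Bz; apply: (@differentiable_comp _ _ _ _ g (fun y : vec => y 0 j)); first exact: dg.
  exact: smooth_diff (smooth_coord openT j) _.
(* Closed under derivatives, since the Jacobian of g is a smooth function composed with g. *)
pose S : set (vec -> R) := [set f | exists2 h, smooth_open (cube x0 e) h & f = h \o g].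
have oC : open (cube x0 e) by exact: open_cube.
have sFC j : smooth_open (cube x0 e) (fun y => F y 0 j) by apply: smooth_sub (sF j) => x /uF [].
have sJ i j : smooth_open (cube x0 e) (fun x => invmx (Jac F x) i j).
  apply: smooth_invmx => // [x /uF [] //|a b].
  by apply: (smooth_eq oC _ (smooth_pd a (sFC b))) => x _; rewrite mxE.
have Jg z : B z -> \matrix_(i, j) pd i (fun z => g z 0 j) z = invmx (Jac F (g z)).
  move=> Bz; have [cx Fx] := hg z Bz; have [_ ux] := uF _ cx.
  set X := \matrix_(i, j) _; suff h : X *m Jac F (g z) = 1%:M by rewrite -[LHS](mulmxK ux) h mul1mx.
  apply/matrixP => i j; rewrite [LHS]mxE.
  have := @pd_comp R n.+1 n.+1 g (fun y => F y 0 j) z i (fun l => dgj l z Bz) (smooth_diff (sFC j) cx).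
  have -> : pd i ((fun y => F y 0 j) \o g) z = pd i (fun y => y 0 j) z.
    by apply: near_eq_derive; near=> w; rewrite /= (hg w _).2 //; near: w; exact: open_nbhs_nbhs.
  rewrite pd_coord mxE => ->; apply: eq_bigr => l _; by rewrite !mxE.
move=> j; apply: (@smooth_coind R n.+1 S B oB) => [f z [h sh ->] Bz|f i [h sh ->]|].
- apply: differentiable_comp; first exact: dg.
  exact: smooth_diff sh (hg z Bz).1.
- exists ((fun x => \sum_l invmx (Jac F x) i l * pd l h x) \o g).
    eexists; last by []; apply: smooth_sum => // l _; apply: smooth_openM => //; exact: smooth_pd.
  move=> z Bz; rewrite pd_comp; last exact: smooth_diff sh (hg z Bz).1.
    by apply: eq_bigr => l _; rewrite -Jg // mxE.
  by move=> l; exact: dgj.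
- by exists (fun x => x 0 j) => //; exact: smooth_coord.
Unshelve. all: by end_near.
Qed.
End Inverse.
End LocalInverse.

Section SmoothInverse.
Context {R : realType} {n : nat}.
Local Notation vec := 'rV[R]_n.+1.
Implicit Types (V W : set vec) (f g : vec -> vec).

Lemma smooth_ext_row V f x : hopen V -> (forall j, smooth_on V (fun y => f y 0 j)) -> V x ->
  exists U, exists F : vec -> vec, [/\ open U, U x, forall j, smooth_open U (fun y => F y 0 j), forall y, U y -> V y -> f y = F y &
    forall y, U y -> V y -> jacm f y = Jac F y].
Proof.
move=> hV sf Vx; have [U [F [oU Ux sF fF]]] := smooth_on_ext sf Vx.
have E j : (fun y : vec => (\row_j F j y) 0 j) = F j by apply/funext => y; rewrite mxE.
exists U, (fun y => \row_j F j y); split => //.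
- by move=> j; rewrite E.
- by move=> y Uy Vy; apply/rowP => j; rewrite mxE fF.
- move=> y Uy Vy; apply/matrixP => i j; rewrite !mxE E.
  by apply: (partialE i hV oU Uy Vy (smooth_diff (sF j) Uy)) => z; exact: fF.
Qed.

(** Near a point f extends to a smooth map across the boundary, which has a smooth local inverse.
    Continuity of g keeps its values in the cube where that extension is injective, so g is the
    restriction of this inverse. *)
Lemma smooth_inverse V V' f g : hopen V -> (forall j, smooth_on V (fun x => f x 0 j)) ->
  (forall x, V x -> jacm f x \in unitmx) -> (forall y, V' y -> V (g y) /\ f (g y) = y) ->
  {within V', continuous g} -> forall j, smooth_on V' (fun y => g y 0 j).
Proof.
move=> hV sf uf gV /subspace_continuousP cg j y V'y.
have [Vx fx] := gV y V'y; set x := g y in Vx fx.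
have [U [F [oU Ux sF fF JF]]] := smooth_ext_row hV sf Vx.
have uJ : Jac F x \in unitmx by rewrite -JF // uf.
have [e [r [G [[e0 r0] cU inj hG sG]]]] := local_inverse oU sF Ux uJ.
have Fx : F x = y by rewrite -fF.
have : \forall z \near y, V' z -> cube x e (g z).
  by have := cg y V'y _ (cube_nbhs x e0); rewrite /within /= nbhs_simpl.
move=> nW; have [e' e'0 hW] := nbhs_cube nW.
have oW : open (cube y e') by exact: open_cube.
have Wy : cube y e' y by exact: cube_center.
set W := cube y e' in oW Wy hW.
have oB : open [set z | sqnorm (z - F x) < r] by exact: open_sqlt.
exists (W `&` [set z | sqnorm (z - F x) < r]), (fun z => G z 0 j); split.
- exact: openI.
- by split => //=; rewrite Fx subrr sqnorm0.
- by apply: smooth_sub (sG j) => z [].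
- move=> z [Wz Bz] V'z; have [Vg fg] := gV z V'z; have [cG FG] := hG z Bz.
  have cz := hW z Wz V'z.
  by congr ((_ : 'rV__) 0 j); apply: inj => //; rewrite FG -fF //; exact: cU.
Qed.
End SmoothInverse.

(** * Developing maps as charts with values in the closed unit ball *)

Section DevelopingChart.
Context {R : realType} {n : nat}.
Local Notation vec := 'rV[R]_n.+1.
Variables (V : set vec) (G : vec -> 'M[R]_n.+1) (v : vec -> R).
Hypotheses (h : height_chart V G v) (flat : forall x i j, V x -> flat_curv G v i j x = 0)
  (vb : forall x, V x -> x 0 0 = 0 -> v x = 0).
Let hV := hc_open h.

Lemma developing_sub W W' Y : W `<=` W' -> developing W' G v Y -> developing W G v Y.
Proof.
move=> WW [sY mY nY]; split => [j|x /WW|x /WW]; [exact: smooth_on_sub WW (sY j)|exact: mY|exact: nY].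
Qed.

(** On the boundary |Dv| = 1, while the tangential derivatives of v vanish. *)
Lemma boundary_slope x : V x -> x 0 0 = 0 -> 0 < partial ord0 v x.
Proof.
move=> Vx x0; have [p0 pi] := boundary_partial hV (hc_height h) (hc_ge0 h) vb Vx x0.
rewrite lt_neqAle p0 andbT; apply/eqP => p00; have := hc_norm h Vx.
have -> : gradsq G v x = 0.
  have g0 : grad v x = 0.
    by apply/colP => i; rewrite !mxE; have [->|/pi ->//] := eqVneq i ord0; rewrite -p00.
  by rewrite /gradsq g0 trmx0 mul0mx mxE.
by rewrite (vb Vx x0) mul0r subr0 => /eqP; rewrite eq_sym oner_eq0.
Qed.

(** The difficulty is that the local inverse of an extension of Y must take the unit ball into the
    half-space. Near a boundary point |F|^2 is strictly decreasing in x_0 and equals 1 on the face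
    x_0 = 0, so |F| <= 1 forces x_0 >= 0. *)
Lemma dev_chart x0 : V x0 -> exists e r : R, exists Y g : vec -> vec,
  [/\ [/\ 0 < e, 0 < r & forall x, cube x0 e x -> half_space x -> V x],
    developing (cube x0 e `&` half_space) G v Y,
    forall x y, cube x0 e x -> half_space x -> cube x0 e y -> half_space y -> Y x = Y y -> x = y,
    forall z, sqnorm z <= 1 -> sqnorm (z - Y x0) < r -> [/\ cube x0 e (g z), half_space (g z) & Y (g z) = z] &
    forall z, sqnorm (z - Y x0) < r -> {for z, continuous g}].
Proof.
move=> V0; have [e1 e10 [Y cV dY]] := dev_exists h flat V0.
pose S := cube x0 e1 `&` half_space.
have hS : hopen S by exists (cube x0 e1) => //; exact: open_cube.
have S0 : S x0 by split; [exact: cube_center|exact: hopen_half hV V0].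
have hS' := height_chart_sub hS (fun x (Sx : S x) => cV x Sx.1 Sx.2) h.
have [U [F [oU U0 sF YF JF]]] := smooth_ext_row hS (dev_smooth dY) S0.
pose N x := \sum_j F x 0 j * F x 0 j.
have NE x : U x -> S x -> N x = (1 - v x) / (1 + v x).
  by move=> Ux Sx; rewrite -(dev_norm dY Sx) YF //; apply: eq_bigr => j _; rewrite expr2.
have sN : smooth_open U N by exact: smooth_sumM.
have [e2 e20 he2] : exists2 e2 : R, 0 < e2 & forall x, cube x0 e2 x -> N x <= 1 -> half_space x.
  have := hopen_half hV V0; rewrite half_spaceE le_eqVlt => /orP[/eqP/esym x00|x00]; last first.
    exists (x0 0 0) => // x cx _; rewrite half_spaceE; have := cx 0; rewrite ltr_norml => /andP[].
    by lra.
  (* By [dev_radial] at v = 0 this derivative is - 2 times the slope of v. *)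
  have n0 : pd ord0 N x0 < 0.
    have dF j : differentiable (fun y => F y 0 j) x0 by exact: smooth_diff (sF j) U0.
    rewrite pd_sumM // (eq_bigr (fun j => 2 * (jacm Y x0 ord0 j * (Y x0)^T j 0))); last first.
      by move=> j _; rewrite JF // YF // !mxE; ring.
    rewrite -mulr_sumr; have := dev_radial hS' dY S0 => /colP /(_ ord0); rewrite [LHS]mxE => ->.
    rewrite (vb V0 x00) addr0 invr1 mulr1 scaleN1r !mxE mulrN oppr_lt0 mulr_gt0 //.
    exact: boundary_slope.
  have nb : nbhs x0 (U `&` [set x | pd ord0 N x < 0]).
    apply: filterI; first exact: open_nbhs_nbhs.
    have c := smooth_continuous (smooth_pd ord0 sN) U0.
    by apply: (c [set t | t < 0]); apply: open_nbhs_nbhs; split; [exact: open_lt|].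
  have [e3 e30 he3] := nbhs_cube nb.
  exists (Order.min e1 e3) => [|x cx Nx]; first by rewrite lt_min e10.
  rewrite half_spaceE leNgt; apply/negP => xneg.
  have cx1 : cube x0 e1 x by move=> i; apply: lt_le_trans (cx i) _; rewrite ge_min lexx.
  have cx3 : cube x0 e3 x by move=> i; apply: lt_le_trans (cx i) _; rewrite ge_min lexx orbT.
  have [y yE] : exists y : vec, forall j, y 0 j = if j == 0 then 0 else x 0 j.
    by exists (\row_j if j == 0 then 0 else x 0 j) => j; rewrite mxE.
  have cy e : 0 < e -> cube x0 e x -> cube x0 e y.
    by move=> e0 c i; rewrite yE; case: eqP => [->|_]; [rewrite x00 subrr normr0|exact: c].
  have hy : half_space y by rewrite half_spaceE yE eqxx.
  have Sy : S y by split => //; exact: cy.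
  have cl (s : R) : 0 <= s <= 1 -> cube x0 e3 (y + s *: (x - y)) by apply: cube_convex => //; exact: cy.
  have Ny : N y = 1.
    by rewrite NE ?(vb _ _) ?yE ?eqxx ?subr0 ?addr0 ?divr1 //; [exact: cV Sy.1 Sy.2|have [] := he3 y (cy _ e30 cx3)].
  have [|s s01] := @MVT_line R n.+1 N y (x - y).
    by move=> s s01; have [Us _] := he3 _ (cl s s01); exact: smooth_diff sN Us.
  have s01' : 0 <= s <= 1 by case/andP: s01 => s0 s1; rewrite !ltW.
  have [Us ns] := he3 _ (cl s s01').
  rewrite subrKC derive_pd; last exact: smooth_diff sN Us.
  rewrite (bigD1 0) //= big1 ?addr0 => [|i i0]; last by rewrite !mxE yE (negbTE i0) subrr mul0r.
  rewrite !mxE yE eqxx subr0 Ny => e; have : 0 < x 0 0 * pd ord0 N (y + s *: (x - y)) by rewrite nmulr_rgt0.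
  by rewrite -e; move: Nx; lra.
have uJ : Jac F x0 \in unitmx by rewrite -JF //; exact: (dev_unit hS' dY S0).
pose C := cube x0 e1 `&` cube x0 e2.
have oC : open C by apply: openI; exact: open_cube.
have [|||e [r [g [[e0 r0] cU inj hg sg]]]] := @local_inverse R n (U `&` C) F x0 _ _ _ uJ.
- exact: openI.
- by move=> j; apply: smooth_sub (sF j) => x [].
- by split => //; split; exact: cube_center.
exists e, r, Y, g.
have cS x : cube x0 e x -> half_space x -> S x /\ U x.
  by move=> /cU [Ux [c1 c2]] hx; split => //; split.
have Y0 : Y x0 = F x0 by exact: YF.
split.
- by split => // x cx hx; have [[c1 _] _] := cS x cx hx; exact: cV.
- by apply: developing_sub dY => x [cx hx]; have [] := cS x cx hx.
- move=> x y cx hx cy hy; have [Sx Ux] := cS x cx hx; have [Sy Uy] := cS y cy hy.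
  by rewrite !YF // => e3; exact: inj.
- move=> z z1; rewrite Y0 => zr; have [cg Fg] := hg z zr.
  have [Ug [c1 c2]] := cU _ cg.
  have hgz : half_space (g z).
    by apply: he2 => //; rewrite /N Fg; move: z1; rewrite /sqnorm; under eq_bigr do rewrite expr2.
  by split => //; rewrite YF.
- move=> z; rewrite Y0 => zr; apply: differentiable_continuous; apply: differentiable_rowP => j.
  exact: smooth_diff (sg j) zr.
Qed.
End DevelopingChart.

(** * The global developing map *)

Lemma near_open (T : topologicalType) (z : T) (P : set T) : nbhs z P -> exists2 W, open W /\ W z & W `<=` P.
Proof. by move=> nP; exists (interior P); [split => //; exact: open_interior|exact: interior_subset]. Qed.

Section BallGeometry.
Context {R : realType} {n : nat}.
Local Notation E := 'rV[R]_n.+1.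
Local Notation D := (@closed_ball1 R n.+1).

Lemma convex_connected (X : set E) : (forall x y (t : R), X x -> X y -> 0 <= t <= 1 -> X (x + t *: (y - x))) -> connected X.
Proof.
move=> cX; have [->|/set0P [b Xb]] := eqVneq X set0; first exact: connected0.
suff -> : X = connected_component X b by exact: component_connected.
apply/seteqP; split; last exact: connected_component_sub.
move=> y Xy; pose l (t : R) := b + t *: (y - b).
have cl : continuous l by exact: continuous_line.
have c1 : connected (l @` `[0, 1]).
  by apply: connected_continuous_connected; [exact: segment_connected|exact: continuous_subspaceT].
apply: (connected_component_max _ _ c1).
- by exists 0; rewrite /= ?in_itv /= ?lexx ?ler01 // /l scale0r addr0.
- by move=> _ [t /= + <-]; rewrite in_itv /= => t01; exact: cX.
- by exists 1; rewrite /= ?in_itv /= ?lexx ?ler01 // /l scale1r addrC subrK.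
Qed.

Lemma sqnorm_convex (x y z : E) (t : R) : 0 <= t <= 1 ->
  sqnorm (x + t *: (y - x) - z) <= (1 - t) * sqnorm (x - z) + t * sqnorm (y - z).
Proof.
move=> /andP[t0 t1]; rewrite /sqnorm !mulr_sumr -big_split; apply: ler_sum => i _ /=; rewrite !mxE.
move: (x 0 i) (y 0 i) (z 0 i) => a b c; have : 0 <= t * (1 - t) * (a - b) ^+ 2 by rewrite mulr_ge0 ?sqr_ge0 // mulr_ge0 // subr_ge0.
nra.
Qed.

Lemma ball1_convex x y (t : R) : D x -> D y -> 0 <= t <= 1 -> D (x + t *: (y - x)).
Proof.
rewrite /closed_ball1 /= => x1 y1 t01; rewrite -[X in sqnorm X]subr0; apply: le_trans (sqnorm_convex _ _ _ t01) _.
by rewrite !subr0; case/andP: t01 => t0 t1; nra.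
Qed.

Lemma sqnorm_orth (K' : 'M[R]_n.+1) (y : E) : K' *m K'^T = 1%:M -> sqnorm (y *m K') = sqnorm y.
Proof.
have E (w : E) : sqnorm w = (w *m w^T) 0 0 by rewrite mxE; apply: eq_bigr => i _; rewrite [X in _ * X]mxE expr2.
by move=> eK; rewrite !E trmx_mul mulmxA -(mulmxA y) eK mulmx1.
Qed.

(** Relative neighbourhoods in the ball span the space, even at its boundary points: from z one can
    move towards 0 and towards each e_i. This makes the rotation attached to a germ unique. *)
Lemma ball1_matrix0 (P : 'M[R]_n.+1) z : D z -> (\forall y \near z, D y -> y *m P = 0) -> P = 0.
Proof.
move=> Dz /near_open [W [oW Wz] hW].
have key (w : E) : D w -> exists2 t : R, 0 < t & forall s : R, 0 <= s <= t -> (z + s *: (w - z)) *m P = 0.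
  move=> Dw; have [e e0 he] := open_line (w - z) oW Wz.
  exists (Order.min e 1) => [|s /andP[s0 st]]; first by rewrite lt_min e0 ltr01.
  move: st; rewrite le_min => /andP[se s1].
  by apply: hW; [apply: he; rewrite ger0_norm|apply: ball1_convex => //; rewrite s0].
have zP : z *m P = 0 by have [t t0 /(_ 0)] := key z Dz; rewrite scale0r addr0; apply; rewrite lexx ltW.
apply/row_matrixP => i; rewrite rowE row0.
have Di : D 'e_i.
  rewrite /closed_ball1 /= /sqnorm (bigD1 i) //= mxE !eqxx expr1n big1 ?addr0 // => j ji.
  by rewrite mxE (negbTE ji) andbF expr0n.
have [t t0 /(_ t)] := key _ Di; rewrite lexx ltW // => /(_ isT).
rewrite mulmxDl zP add0r -scalemxAl mulmxBl zP subr0 => /eqP; rewrite scaler_eq0 (gt_eqF t0) /= => /eqP //.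
Qed.

Lemma orth_near (K' : 'M[R]_n.+1) (z : E) (d : R) : K' *m K'^T = 1%:M -> 0 < d ->
  \forall y \near z, sqnorm (y *m K' - z *m K') < d.
Proof.
move=> eK d0; apply: (@filterS _ _ _ [set y | sqnorm (y - z) < d]) => [y|]; first by rewrite /= -mulmxBl sqnorm_orth.
exact: near_sqball.
Qed.
End BallGeometry.

(** * Continuation of inverse developing maps over the ball *)

Section DevelopingTheorem.
Context {R : realType} {n : nat} {M : topologicalType}.
Local Notation E := 'rV[R]_n.+1.
Local Notation D := (@closed_ball1 R n.+1).
(** [F p] maps the patch [V p] injectively onto a relatively open subset of the closed unit ball,
    and two patches differ by an orthogonal map near a common point. *)
Variables (V : M -> set M) (F : M -> M -> E) (p0 : M).
Hypotheses (hM : hausdorff_space M) (cM : compact [set: M]) (kM : connected [set: M]).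
Hypotheses (oV : forall p, open (V p)) (Vp : forall p, V p p) (FD : forall p q, V p q -> D (F p q))
  (Finj : forall p q q', V p q -> V p q' -> F p q = F p q' -> q = q')
  (Fcont : forall p q, V p q -> {for q, continuous (F p)})
  (Fopen : forall p q U, V p q -> nbhs q U -> exists2 d : R, 0 < d &
     forall z, D z -> sqnorm (z - F p q) < d -> exists q', [/\ U q', V p q' & F p q' = z])
  (Ftrans : forall p p' q, V p q -> V p' q -> exists2 K' : 'M[R]_n.+1, K' *m K'^T = 1%:M &
     \forall q' \near q, F p' q' = F p q' *m K')
  (F0 : F p0 p0 = 0).

(* [S] is near [z] the inverse of the chart [F p] followed by a rotation. *)
Definition dev_at p (K' : 'M[R]_n.+1) (S : E -> M) (z : E) := K' *m K'^T = 1%:M /\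
  \forall y \near z, D y -> V p (S y) /\ F p (S y) = y *m K'.
Definition dgerm (S : E -> M) (z : E) := exists p K', dev_at p K' S z.

(** Continuity is automatic: near z the map S is the inverse of an injective open map, up to a
    rotation. *)
Lemma dgerm_cont S z (U : set M) : D z -> dgerm S z -> nbhs (S z) U -> \forall y \near z, D y -> U (S y).
Proof.
move=> Dz [p [K' [eK hS]]] nU; have [Vz Fz] := nbhs_singleton hS Dz.
have [d d0 hd] := Fopen Vz nU.
apply: filterS2 hS (orth_near z eK d0) => y hy yz Dy; have [Vy Fy] := hy Dy.
have [||q' [Uq Vq Fq]] := hd (y *m K').
- by rewrite /closed_ball1 /= sqnorm_orth.
- by rewrite Fz.
by rewrite (Finj Vy Vq) // Fq.
Qed.

Lemma dgerm_patch S z p : D z -> dgerm S z -> V p (S z) -> exists K', dev_at p K' S z.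
Proof.
move=> Dz gS Vz; have [p' [K' [eK hS]]] := gS; have [Vz' Fz'] := nbhs_singleton hS Dz.
have [K2 eK2 hT] := Ftrans Vz' Vz; exists (K' *m K2); split.
  by rewrite trmx_mul mulmxA -(mulmxA K') eK2 mulmx1.
have c1 := dgerm_cont Dz gS (open_nbhs_nbhs (conj (@oV p) Vz)).
have c2 := dgerm_cont Dz gS hT.
apply: filterS3 hS c1 c2 => y hy h1 h2 Dy; have [Vy Fy] := hy Dy.
by split; [exact: h1|rewrite h2 // Fy mulmxA].
Qed.

(* This is where compactness of [M] enters. *)
Lemma uniform_radius : exists2 r : R, 0 < r & forall q, exists2 p, V p q &
  forall z, D z -> sqnorm (z - F p q) < r -> exists2 q', V p q' & F p q' = z.
Proof.
pose P (r : R) q := exists2 p, V p q & forall z, D z -> sqnorm (z - F p q) < r -> exists2 q', V p q' & F p q' = z.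
have /compact_near_coveringP cov := cM.
have : \forall r \near (0 : R)^'+, [set: M] `<=` P r.
  apply: cov => q _; have [d d0 hd] := Fopen (Vp q) (open_nbhs_nbhs (conj (@oV q) (Vp q))).
  have n1 : \forall q' \near q, V q q' /\ sqnorm (F q q' - F q q) < d / 4.
    apply: filterI; first exact: open_nbhs_nbhs.
    apply: (@Fcont _ _ (Vp q) ([set w | sqnorm (w - F q q) < d / 4])).
    by apply: near_sqball; rewrite divr_gt0.
  have n2 : \forall r \near (0 : R)^'+, r < d / 4 by apply: nbhs_right_lt; rewrite divr_gt0.
  (* One patch serves all points whose image is at squared distance less than d / 4, with radius d /
     4: |a + b|^2 <= 2 (|a|^2 + |b|^2) < d. *)
  exists ([set q' | V q q' /\ sqnorm (F q q' - F q q) < d / 4], [set r | r < d / 4]) => //.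
  move=> [q' r] /= [[Vq' Fq'] rd]; exists q => // z Dz zr.
  have [|q2 [_ V2 F2]] := hd z Dz; last by exists q2.
  rewrite -(subrKA (F q q')); apply: le_lt_trans (sqnormD_le _ _) _; lra.
move=> nP; have [r [r0 hr]] : exists r : R, 0 < r /\ [set: M] `<=` P r.
  by near (0 : R)^'+ => r; exists r; split; [|near: r].
by exists r => // q; exact: hr.
Unshelve. all: by end_near. Qed.

(** Around S z some patch is onto the ball of the uniform radius; its inverse, composed with the
    rotation of the germ, is the extension. *)
Lemma dgerm_ext : exists2 r : R, 0 < r & forall z S, D z -> dgerm S z -> exists S',
  (forall y, D y -> sqnorm (y - z) < r -> dgerm S' y) /\ \forall y \near z, D y -> S' y = S y.
Proof.
have [r r0 hr] := uniform_radius; exists r => // z S Dz gS.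
have [p Vz hp] := hr (S z); have [K' [eK hS]] := dgerm_patch Dz gS Vz.
have [_ Fz] := nbhs_singleton hS Dz.
have /choice [S' hS'] : forall y, exists q, D y -> sqnorm (y - z) < r -> V p q /\ F p q = y *m K'.
  move=> y; have [[Dy yz]|ny] := pselect (D y /\ sqnorm (y - z) < r); last by exists p => Dy yz; case: ny.
  have [||q Vq Fq] := hp (y *m K').
  - by rewrite /closed_ball1 /= sqnorm_orth.
  - by rewrite Fz -mulmxBl sqnorm_orth.
  by exists q.
have nb y : sqnorm (y - z) < r -> \forall w \near y, sqnorm (w - z) < r.
  by move=> yz; apply: open_nbhs_nbhs; split => //; exact: open_sqlt.
exists S'; split => [y Dy yz|].
  exists p, K'; split => //; apply: filterS (nb y yz) => w wz Dw; exact: hS'.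
have zz : sqnorm (z - z) < r by rewrite subrr sqnorm0.
apply: filterS2 hS (nb z zz) => y hy yz Dy; have [Vy Fy] := hy Dy; have [Vy' Fy'] := hS' y Dy yz.
by apply: Finj Vy' Vy _; rewrite Fy' Fy.
Qed.

(** Uniqueness of continuation. At a limit of points of agreement the values agree since M is
    Hausdorff; both germs can then be read in one patch, and their rotations agree because they do
    so on a nearby relatively open set. *)
Lemma dgerm_unique (W : set E) S1 S2 z0 : connected (D `&` W) ->
  (forall z, D z -> W z -> dgerm S1 z /\ dgerm S2 z) -> D z0 -> W z0 ->
  (\forall y \near z0, D y -> S1 y = S2 y) -> forall z, D z -> W z -> S1 z = S2 z.
Proof.
move=> kW gW D0 W0 h0 z Dz Wz.
pose C := interior [set y | D y -> S1 y = S2 y]; pose B := (D `&` W) `&` C.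
have BE : B = D `&` W.
  apply: kW; first by exists z0.
  - by exists C => //; exact: open_interior.
  exists (closure B); first exact: closed_closure.
  apply/seteqP; split => [y By|y [[Dy Wy] cy]]; first by split; [case: By|exact: subset_closure].
  split => //; have [g1 g2] := gW y Dy Wy.
  have e : S1 y = S2 y.
    apply: contrapT => ne; have := hM; rewrite open_hausdorff => /(_ (S1 y) (S2 y)) [|[U1 U2] /= [U1y U2y] [oU1 oU2 U12]].
      exact/eqP.
    have c1 := dgerm_cont Dy g1 (open_nbhs_nbhs (conj oU1 (set_mem U1y))).
    have c2 := dgerm_cont Dy g2 (open_nbhs_nbhs (conj oU2 (set_mem U2y))).
    have [w [[[Dw Ww] Cw] [h1 h2]]] := cy _ (filterI c1 c2).
    have := nbhs_singleton (Cw : nbhs w _) Dw => ew.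
    have : (U1 `&` U2) (S1 w) by split; [exact: h1|rewrite ew; exact: h2].
    by rewrite (eqP U12).
  have [p [K1 [eK1 h1]]] := g1; have [Vy _] := nbhs_singleton h1 Dy.
  have [|K2 [eK2 h2]] := dgerm_patch (p := p) Dy g2; first by rewrite -e.
  have [Q [oQ Qy] hQ] := near_open (filterI h1 h2).
  have [w [[[Dw Ww] Cw] Qw]] := cy _ (open_nbhs_nbhs (conj oQ Qy)).
  have K12 : K1 = K2.
    apply/eqP; rewrite -subr_eq0; apply/eqP; apply: (ball1_matrix0 Dw).
    apply: filterS2 (Cw : nbhs w _) (open_nbhs_nbhs (conj oQ Qw)) => x hx Qx Dx.
    have [k1 k2] := hQ x Qx; have [_ F1] := k1 Dx; have [_ F2] := k2 Dx.
    by rewrite mulmxBr -F1 -F2 hx // subrr.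
  apply: filterS2 h1 h2 => x k1 k2 Dx; have [V1 F1] := k1 Dx; have [V2 F2] := k2 Dx.
  by apply: Finj V1 V2 _; rewrite F1 F2 K12.
have : B z by rewrite BE.
by move=> [_ Cz]; exact: (nbhs_singleton (Cz : nbhs z _)).
Qed.

Lemma ball_connected (c1 c2 : E) (r1 r2 : R) : connected (D `&` [set y | sqnorm (y - c1) < r1 /\ sqnorm (y - c2) < r2]).
Proof.
apply: convex_connected => x y t [Dx [x1 x2]] [Dy [y1 y2]] t01; split; first exact: ball1_convex.
by split; apply: sqball_convex.
Qed.

(* The germs continuing [S] at the points [c y] for [c < 1] are evaluated at [y];
   uniqueness on intersections of balls makes the result locally coherent, and
   the radius grows by the factor [1 / c]. *)
Lemma dev_step (S : E -> M) (r c rho : R) : 0 < c < 1 -> (1 - c) ^+ 2 < r / 4 -> 0 < r ->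
  (forall z S, D z -> dgerm S z -> exists S',
    (forall y, D y -> sqnorm (y - z) < r -> dgerm S' y) /\ \forall y \near z, D y -> S' y = S y) ->
  (forall y, D y -> sqnorm y < rho -> dgerm S y) -> 0 < rho ->
  exists2 S', S' 0 = S 0 & forall y, D y -> sqnorm y < rho / c ^+ 2 -> dgerm S' y.
Proof.
move=> /andP[c0 c1] cr r0 ext gS rho0.
have /choice [T hT] : forall z, exists S', D z -> sqnorm z < rho ->
    (forall y, D y -> sqnorm (y - z) < r -> dgerm S' y) /\ \forall y \near z, D y -> S' y = S y.
  move=> z; have [[Dz zr]|nz] := pselect (D z /\ sqnorm z < rho); last by exists S => Dz zr; case: nz.
  by have [S' hS'] := ext z S Dz (gS z Dz zr); exists S'.
have Dc y : D y -> D (c *: y).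
  rewrite /closed_ball1 /= sqnormZ => y1; apply: le_trans y1; rewrite ler_piMl ?sqnorm_ge0 //.
  by rewrite expr_le1 // ltW.
have rc (y : E) : sqnorm y < rho / c ^+ 2 -> sqnorm (c *: y) < rho.
  by rewrite sqnormZ ltr_pdivlMr ?exprn_gt0 // mulrC.
have yc y : D y -> sqnorm (y - c *: y) < r / 4.
  rewrite /closed_ball1 /= -{2}[y]scale1r -scalerBl sqnormZ => y1; apply: le_lt_trans cr.
  by rewrite ler_piMr // sqr_ge0.
have s0 := @sqnorm0 R n.+1.
have D0 : D 0 by rewrite /closed_ball1 /= s0 ler01.
exists (fun y => T (c *: y) y).
  rewrite scaler0; have [|_ h] := hT 0 D0; first by rewrite s0.
  exact: nbhs_singleton h D0.
move=> y Dy yr; have [gT eT] := hT (c *: y) (Dc y Dy) (rc y yr).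
have [p [K' [eK hg]]] : dgerm (T (c *: y)) y by apply: gT => //; apply: lt_le_trans (yc y Dy) _; lra.
exists p, K'; split => //.
have nb (d : R) : 0 < d -> \forall w \near y, sqnorm (w - y) < d.
  move=> d0; exact: near_sqball.
have [W [oW Wy] hW] := near_open eT; have [d d0 hd] := open_sqball oW Wy.
have n1 : \forall w \near y, W (c *: w).
  apply: filterS (nb d d0) => w wd; apply: hd; rewrite -scalerBr sqnormZ; apply: le_lt_trans wd.
  by rewrite ler_piMl ?sqnorm_ge0 // expr_le1 // ltW.
have n2 : \forall w \near y, sqnorm w < rho / c ^+ 2.
  have h0 : open [set w : E | sqnorm (w - 0) < rho / c ^+ 2] by exact: open_sqlt.
  have h1 : [set w : E | sqnorm (w - 0) < rho / c ^+ 2] y by rewrite /= subr0.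
  by apply: filterS (open_nbhs_nbhs (conj h0 h1)) => w; rewrite /= subr0.
have r4 : 0 < r / 4 by rewrite divr_gt0.
near=> w => Dw.
have wr : sqnorm w < rho / c ^+ 2 by near: w.
have wy : sqnorm (w - y) < r / 4 by near: w; exact: nb.
have Ww : W (c *: w) by near: w.
have e1 : \forall u \near c *: w, D u -> T (c *: y) u = S u by apply: filterS hW _; exact: open_nbhs_nbhs.
have [gw ew] := hT (c *: w) (Dc w Dw) (rc w wr).
have -> : T (c *: w) w = T (c *: y) w.
  apply: (@dgerm_unique [set u | sqnorm (u - c *: w) < r /\ sqnorm (u - c *: y) < r] (T (c *: w)) (T (c *: y)) (c *: w)) => //.
  - exact: ball_connected.
  - by move=> u Du [u1 u2]; split; [exact: gw|exact: gT].
  - exact: Dc.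
  - split; first by rewrite subrr s0.
    rewrite -scalerBr sqnormZ; apply: le_lt_trans (_ : sqnorm (w - y) < r); last by apply: lt_le_trans wy _; lra.
    by rewrite ler_piMl ?sqnorm_ge0 // expr_le1 // ltW.
  - by apply: filterS2 e1 ew => u h1 h2 Du; rewrite h1 // h2.
  - split; first by apply: lt_le_trans (yc w Dw) _; lra.
    rewrite -(subrKA y); apply: le_lt_trans (sqnormD_le _ _) _; have := yc y Dy; lra.
by move: Dw; near: w.
Unshelve. all: by end_near. Qed.

Lemma dev_global : exists2 S : E -> M, S 0 = p0 & forall y, D y -> dgerm S y.
Proof.
have [r r0 ext] := dgerm_ext.
have s0 := @sqnorm0 R n.+1.
have D0 : D 0 by rewrite /closed_ball1 /= s0 ler01.
have [S0 S00 gS0] : exists2 S : E -> M, S 0 = p0 & dgerm S 0.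
  have [d d0 hd] := Fopen (Vp p0) (open_nbhs_nbhs (conj (@oV p0) (Vp p0))).
  have /choice [S hS] : forall y, exists q, D y -> sqnorm y < d -> V p0 q /\ F p0 q = y.
    move=> y; have [[Dy yd]|ny] := pselect (D y /\ sqnorm y < d); last by exists p0 => Dy yd; case: ny.
    by have [|q [_ Vq Fq]] := hd y Dy; [rewrite F0 subr0|exists q].
  exists S; first by have [|V0 e] := hS 0 D0; [rewrite s0|apply: Finj V0 (Vp p0) _; rewrite e F0].
  exists p0, 1%:M; split; first by rewrite trmx1 mulmx1.
  have : \forall y \near (0 : E), sqnorm (y *m 1%:M - 0 *m 1%:M) < d by apply: orth_near => //; rewrite trmx1 mulmx1.
  by apply: filterS => y; rewrite mul0mx subr0 mulmx1 => yd Dy; exact: hS.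
have [S1 [gS1 eS1]] := ext 0 S0 D0 gS0.
have [c [c01 cr]] : exists c : R, 0 < c < 1 /\ (1 - c) ^+ 2 < r / 4.
  (* With c = 1 - d this gives (1 - c)^2 = d^2 <= d / 2 <= r / 16. *)
  pose d := Order.min (1 / 2) (r / 8); have d0 : 0 < d by rewrite lt_min !divr_gt0.
  have [d1 d2] : d <= 1 / 2 /\ d <= r / 8 by split; rewrite ge_min lexx ?orbT.
  by exists (1 - d); split; [apply/andP; split|]; nra.
have [c0 c1] := andP c01; have c2 : 0 < c ^+ 2 by rewrite exprn_gt0.
have H k : exists2 S : E -> M, S 0 = p0 & forall y, D y -> sqnorm y < r / (c ^+ 2) ^+ k -> dgerm S y.
  elim: k => [|k [S S0' gS]].
    exists S1; first by rewrite (nbhs_singleton eS1).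
    by move=> y Dy; rewrite expr0 divr1 => yr; apply: gS1; rewrite ?subr0.
  have [|S' e' gS'] := dev_step c01 cr r0 ext gS; first by rewrite divr_gt0 // exprn_gt0.
  exists S'; first by rewrite e'.
  by move=> y Dy; rewrite exprSr invfM mulrA => yr; exact: gS'.
have [k hk] : exists k, (c ^+ 2) ^+ k < r.
  have cv : (fun k => (c ^+ 2) ^+ k) @ \oo --> (0 : R).
    by apply: cvg_expr; rewrite ger0_norm ?ltW // expr_lt1 // ltW.
  move/cvgrPdist_lt : cv => /(_ r r0) [N _ /(_ N (leqnn _))]; rewrite /= sub0r normrN ger0_norm ?exprn_ge0 ?ltW //.
  by move=> h; exists N.
have [S e gS] := H k; exists S => // y Dy; apply: gS => //.
by apply: le_lt_trans Dy _; rewrite ltr_pdivlMr ?exprn_gt0 // mul1r.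
Qed.

(** If S y = S z, comparing the rotations of the two germs gives an orthogonal T with y T = z and S
    (x T) = S x near y, hence on the whole ball. At the centre, fixed by T, injectivity of a patch
    forces T = 1. The image is compact, and open since patches are, so it is M. *)
Theorem developing_bijection : exists S : E -> M,
  [/\ forall y, D y -> dgerm S y, forall y z, D y -> D z -> S y = S z -> y = z & forall q, exists2 y, D y & S y = q].
Proof.
have [S S0 gS] := dev_global; exists S.
have s0 := @sqnorm0 R n.+1.
have D0 : D 0 by rewrite /closed_ball1 /= s0 ler01.
have kD : connected (D `&` setT) by rewrite setIT; apply: convex_connected => x y t; exact: ball1_convex.
split => //.
  move=> y z Dy Dz Syz; have [p [K1 [eK1 h1]]] := gS y Dy; have [V1 F1] := nbhs_singleton h1 Dy.
  have [|K2 [eK2 h2]] := dgerm_patch (p := p) Dz (gS z Dz); first by rewrite -Syz.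
  have [V2 F2] := nbhs_singleton h2 Dz.
  pose T := K1 *m K2^T; have OT : T *m T^T = 1%:M.
    by rewrite trmx_mul trmxK mulmxA -(mulmxA K1) (mulmx1C eK2) mulmx1.
  have TK2 : T *m K2 = K1 by rewrite -mulmxA (mulmx1C eK2) mulmx1.
  have yT : y *m T = z.
    by rewrite mulmxA -F1 Syz F2 -mulmxA eK2 mulmx1.
  have DT w : D w -> D (w *m T) by rewrite /closed_ball1 /= sqnorm_orth.
  have near_T w (P : set E) : nbhs (w *m T) P -> \forall x \near w, P (x *m T).
    move=> /near_open [W [oW Ww] hW]; have [d d0 hd] := open_sqball oW Ww.
    by apply: filterS (orth_near w OT d0) => x xd; apply/hW/hd.
  have gST w : D w -> dgerm (fun x => S (x *m T)) w.
    move=> Dw; have [p' [K' [eK' h']]] := gS (w *m T) (DT w Dw).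
    exists p', (T *m K'); split; first by rewrite trmx_mul mulmxA -(mulmxA T) eK' mulmx1.
    by apply: filterS (near_T w _ h') => x hx Dx; have [Vx Fx] := hx (DT x Dx); rewrite Fx mulmxA.
  have eST w : D w -> S (w *m T) = S w.
    move=> Dw; apply: (@dgerm_unique setT (fun x => S (x *m T)) S y kD) => //; first by move=> x Dx _; split; [exact: gST|exact: gS].
    rewrite -yT in h2; have h2' := near_T y _ h2.
    apply: filterS2 h1 h2' => x k1 k2 Dx; have [V1' F1'] := k1 Dx; have [V2' F2'] := k2 (DT x Dx).
    by apply: Finj V2' V1' _; rewrite F2' F1' -mulmxA TK2.
  have [p' [K' [eK' h']]] := gS 0 D0.
  have T1 : T = 1%:M.
    apply/eqP; rewrite -subr_eq0; apply/eqP; apply: (ball1_matrix0 D0).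
    have h0 : nbhs ((0 : E) *m T) [set w | D w -> V p' (S w) /\ F p' (S w) = w *m K'] by rewrite mul0mx.
    apply: filterS2 h' (near_T 0 _ h0) => x k1 k2 Dx; have [_ F1'] := k1 Dx; have [_ F2'] := k2 (DT x Dx).
    move: F2'; rewrite eST // F1' => /(congr1 (mulmx^~ K'^T)); rewrite -!mulmxA eK' !mulmx1 => e.
    by rewrite mulmxBr mulmx1 -e subrr.
  by rewrite -yT T1 mulmx1.
have cS : {within D, continuous S}.
  apply/subspace_continuousP => z Dz U nU; have := dgerm_cont Dz (gS z Dz) nU.
  by rewrite /within /= nbhs_simpl.
have cI : compact (S @` D).
  apply: continuous_compact => //; have := @compact_sqball R n.+1 0 1; congr compact.
  by apply/seteqP; split => x; rewrite /closed_ball1 /= subr0.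
have : S @` D = setT.
  apply: kM; first by exists (S 0), 0.
  - exists (S @` D); last by rewrite setTI.
    rewrite openE => _ [z Dz <-]; rewrite /interior; have [p [K' [eK hg]]] := gS z Dz.
    have [Vz Fz] := nbhs_singleton hg Dz.
    have [W [oW Wz] hW] := near_open hg; have [d d0 hd] := open_sqball oW Wz.
    have c1 : \forall q \near S z, sqnorm (F p q - F p (S z)) < d.
      apply: (@Fcont _ _ Vz ([set w | sqnorm (w - F p (S z)) < d])).
      exact: near_sqball.
    apply: filterS2 c1 (open_nbhs_nbhs (conj (@oV p) Vz)) => q qd Vq.
    have eK2 : K'^T *m K'^T^T = 1%:M by rewrite trmxK; exact: mulmx1C.
    have Dq : D (F p q *m K'^T) by rewrite /closed_ball1 /= sqnorm_orth //; exact: FD Vq.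
    have [|Vy Fy] := hW (F p q *m K'^T) _ Dq.
      by apply: hd; rewrite -(mulmx1 z) -eK mulmxA -Fz -mulmxBl sqnorm_orth.
    exists (F p q *m K'^T) => //; apply: Finj Vy Vq _.
    by rewrite Fy -mulmxA (mulmx1C eK) mulmx1.
  - exists (S @` D); last by rewrite setTI.
    by apply: compact_closed.
move=> SD q; have : (S @` D) q by rewrite SD.
by move=> [y Dy <-]; exists y.
Qed.
End DevelopingTheorem.

Section DevelopingLocal.
Context {R : realType} {n : nat}.
Implicit Types (V W : set 'rV[R]_n.+1) (G : 'rV[R]_n.+1 -> 'M[R]_n.+1) (v : 'rV[R]_n.+1 -> R) (Y : 'rV[R]_n.+1 -> 'rV[R]_n.+1).

Lemma developing_orth V G v Y (K : 'M[R]_n.+1) : hopen V -> K *m K^T = 1%:M -> developing V G v Y ->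
  developing V G v (fun x => Y x *m K).
Proof.
move=> hV KK dY; have sK k j : smooth_on V (fun=> K k j) by exact: smooth_on_cst.
have E j : (fun y => (Y y *m K) 0 j) = fun y => \sum_k Y y 0 k * K k j by apply/funext => y; rewrite mxE.
have JE x : V x -> jacm (fun x => Y x *m K) x = jacm Y x *m K.
  move=> Vx; apply/matrixP => i j; rewrite !mxE E (partial_sumM i hV (dev_smooth dY) (fun k => sK k j) Vx).
  by apply: eq_bigr => k _; rewrite (partial_cst hV _ i Vx) mulr0 addr0 mxE.
split => [j|x Vx|x Vx].
- by rewrite E; apply: smooth_on_sum => k _; apply: smooth_onM => //; exact: (dev_smooth dY).
- by rewrite JE // trmx_mul mulmxA -(mulmxA _ K) KK mulmx1 (dev_metric dY).
- by rewrite sqnorm_orth // (dev_norm dY).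
Qed.

Lemma developing_local V G v Y : hopen V -> (forall x, V x -> exists2 e : R, 0 < e & exists2 Y',
  developing (cube x e `&` half_space) G v Y' & forall y, cube x e y -> half_space y -> Y y = Y' y) ->
  developing V G v Y.
Proof.
move=> hV loc.
have S0 x e : V x -> 0 < e -> (cube x e `&` half_space) x by move=> Vx e0; split; [exact: cube_center|exact: hopen_half hV Vx].
split => [j x Vx|x Vx|x Vx]; have [e e0 [Y' dY' YY]] := loc x Vx; have Sx := S0 x e Vx e0.
- have [U [F [oU Ux sF FF]]] := dev_smooth dY' j Sx.
  exists (U `&` cube x e), F; split.
  + by apply: openI => //; exact: open_cube.
  + by split => //; exact: cube_center.
  + by apply: smooth_sub sF => y [].
  + move=> y [Uy cy] Vy; have hy := hopen_half hV Vy.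
    by rewrite YY // FF.
- have hS : hopen (cube x e `&` half_space) by exists (cube x e) => //; exact: open_cube.
  rewrite -(dev_metric dY' Sx); suff -> : jacm Y x = jacm Y' x by [].
  apply/matrixP => i j; rewrite !mxE; apply: (partial_eq hS i (dev_smooth dY' j) Sx).
  by move=> y [cy hy]; rewrite YY.
- by rewrite YY ?(dev_norm dY') //; [exact: cube_center|exact: hopen_half hV Vx].
Qed.
End DevelopingLocal.

(** * The developing map of the manifold *)

Section DevelopingManifold.
Context {R : realType} {n : nat} {M : topologicalType} {A : atlas R n.+1 M}.
Variables (g : metric_components A) (v : M -> R) (p0 : M).
Hypotheses (hm : is_manifold A) (hg : is_riemannian g) (cM : compact [set: M]) (kM : connected [set: M]).
Local Notation V := (@chart_image R n.+1 M A).
Local Notation inv a := (@chart_inv R n.+1 M A a).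
Local Notation dom a := (@chart_dom R n.+1 M A a).
Local Notation D := (@closed_ball1 R n.+1).
Hypothesis hc : forall a, height_chart (V a) (g a) (v \o inv a).
Hypothesis vb : forall p, boundary A p -> v p = 0.
Hypothesis v1 : v p0 = 1.

Lemma developing_transition a b (W V' : set 'rV[R]_n.+1) Y : hopen W -> W `<=` overlap b a -> hopen V' -> V' `<=` V a ->
  (forall x, W x -> V' (transition b a x)) -> developing V' (g a) (v \o inv a) Y ->
  developing W (g b) (v \o inv b) (Y \o transition b a).
Proof.
move=> hW Wo hV' VV TV dY.
have sT j : smooth_on W (fun x => transition b a x 0 j) by apply: smooth_on_sub Wo _; exact: smooth_transition.
have JE x : W x -> jacm (Y \o transition b a) x = jac b a x *m jacm Y (transition b a x).
  move=> Wx; apply/matrixP => i j; rewrite [LHS]mxE [RHS]mxE.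
  rewrite -[fun y => _]/((fun y => Y y 0 j) \o transition b a).
  rewrite (partial_comp i hW hV' sT TV (dev_smooth dY j) Wx); apply: eq_bigr => k _.
  by rewrite mxE [X in _ = _ * X]mxE.
have vE x : W x -> (v \o inv a) (transition b a x) = (v \o inv b) x.
  by move=> /Wo ox; rewrite /= transition_inv.
split => [j|x Wx|x Wx].
- exact: (smooth_on_comp sT TV (dev_smooth dY j)).
- rewrite JE // trmx_mul mulmxA -(mulmxA (jac b a x)) (dev_metric dY (TV x Wx)) /flat_metric vE //.
  by rewrite -scalemxAr -scalemxAl -(metric_transition hm hg (Wo x Wx)).
- by rewrite /= (dev_norm dY (TV x Wx)) vE.
Qed.

(** All charts around [q] are quantified because two patches, built from different charts, have to
    be compared in a common one. *)
Definition dev_near (F : M -> 'rV[R]_n.+1) q := forall b, dom b q -> exists2 e : R, 0 < e &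
  (forall x, cube (chart b q) e x -> half_space x -> V b x) /\
  developing (cube (chart b q) e `&` half_space) (g b) (v \o inv b) (F \o inv b).

Lemma smooth_chart_continuous a (S : set 'rV[R]_n.+1) (Y : 'rV[R]_n.+1 -> 'rV[R]_n.+1) q :
  (forall j, smooth_on S (fun x => Y x 0 j)) -> dom a q -> S (chart a q) ->
  (\forall q' \near q, S (chart a q')) -> {for q, continuous (Y \o chart a)}.
Proof.
move=> sY dq Sq nS; have [U [F [oU Ux sF FF]]] := smooth_on_ext sY Sq.
have cF : {for q, continuous (fun q' => \row_j F j (chart a q'))}.
  apply: (@continuous_comp _ _ _ (chart a) (fun x => \row_j F j x)); first exact: (chart_continuous hm dq).
  apply: differentiable_continuous; apply: differentiable_rowP => j.
  have -> : (fun y => (\row_j0 F j0 y) 0 j) = F j by apply/funext => y; rewrite mxE.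
  exact: smooth_diff (sF j) Ux.
have e : {near q, (fun q' => \row_j F j (chart a q')) =1 Y \o chart a}.
  have nU := chart_continuous hm dq (open_nbhs_nbhs (conj oU Ux)).
  apply: filterS2 nS nU => q' Sq' Uq'; apply/rowP => j; rewrite mxE -FF //.
have e0 := nbhs_singleton e.
move=> P nP; have := cF P; rewrite e0 => /(_ nP); rewrite !nbhs_simpl /= => h.
by apply: filterS2 h e => q' hq eq'; rewrite -[_ q']/(P ((Y \o chart a) q')) -eq'.
Qed.

(** Transports [dev_chart] to the manifold in the form required by the continuation argument. *)
Lemma patch_exists p : exists W, exists F : M -> 'rV[R]_n.+1,
  [/\ [/\ open W, W p & forall q, W q -> dev_near F q],
   forall q q', W q -> W q' -> F q = F q' -> q = q',
   forall q, W q -> {for q, continuous F} &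
   forall q U, W q -> nbhs q U -> exists2 d : R, 0 < d &
     forall z, D z -> sqnorm (z - F q) < d -> exists q', [/\ U q', W q' & F q' = z]].
Proof.
have [a dp] := chart_cover hm p; have hV := chart_hopen hm a.
have vb' x : V a x -> x 0 0 = 0 -> (v \o inv a) x = 0.
  by move=> Vx x0; rewrite /= vb //; apply/(boundaryE hm hg (chart_inv_dom hm Vx)); rewrite (chart_invK hm Vx).
have [e [r [Y [G [[e0 r0 cV] dY inj hG cG]]]]] :=
  dev_chart (hc a) (fun x i j => flat_curv0 hm hg cM hc vb i j) vb' (chart_in dp).
pose S := cube (chart a p) e `&` half_space.
pose W0 := dom a `&` chart a @^-1` cube (chart a p) e.
have oW0 : open W0 by apply: chart_preim_open => //; exact: open_cube.
have W0S q : W0 q -> S (chart a q) by move=> [dq cq]; split => //; exact: (chart_half hm).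
pose F := Y \o chart a.
have cF q : W0 q -> {for q, continuous F}.
  move=> Wq; apply: (smooth_chart_continuous (dev_smooth dY) Wq.1 (W0S q Wq)).
  by apply: filterS (open_nbhs_nbhs (conj oW0 Wq)) => q'; exact: W0S.
(* The local inverse is controlled over the ball of radius r only; on the preimage of this ball the
   map is open at every point, not just at [p]. *)
pose W := W0 `&` F @^-1` [set z | sqnorm (z - Y (chart a p)) < r].
have W0p : W0 p by split => //; exact: cube_center.
have s0 := @sqnorm0 R n.+1.
have oW : open W.
  rewrite openE => q [Wq Fq]; rewrite /interior; apply: filterI; first exact: open_nbhs_nbhs.
  by apply: (cF q Wq); apply: open_nbhs_nbhs; split => //; exact: open_sqlt.
have hS : hopen S by exists (cube (chart a p) e) => //; exact: open_cube.
exists W, F; split.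
- split => // [|q [Wq Fq] b db]; first by split => //=; rewrite subrr s0.
  have hO := chart_image_sub_hopen hm b oW0.
  have Oq : V b (chart b q) /\ W0 (inv b (chart b q)) by split; [exact: chart_in|rewrite (chartK hm db)].
  have [e' e'0 he'] := hopen_cube hO Oq; exists e' => //; split; first by move=> x cx hx; have [] := he' x cx hx.
  apply: (@developing_transition a b _ S).
  + by exists (cube (chart b q) e') => //; exact: open_cube.
  + by move=> x [cx hx]; have [Vx [dx _]] := he' x cx hx.
  + exact: hS.
  + by move=> x [cx hx]; exact: cV.
  + by move=> x [cx hx]; have [_ /W0S] := he' x cx hx.
  + exact: dY.
- move=> q q' [[dq cq] _] [[dq' cq'] _] e1; rewrite -(chartK hm dq) -(chartK hm dq'); congr (inv a _).
  by apply: inj e1 => //; exact: (chart_half hm).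
- by move=> q [Wq _]; exact: cF.
- move=> q U Wq nU; have [[dq cq] Fq] := Wq.
  have [x1 h1 x2] : [/\ cube (chart a p) e (G (F q)), half_space (G (F q)) & Y (G (F q)) = F q].
    have Sq := W0S q Wq.1; apply: hG => //; rewrite (dev_norm dY Sq).
    have h0 := hc_ge0 (hc a) (chart_in dq); rewrite ler_pdivrMr ?mul1r; last by rewrite ltr_wpDr.
    by lra.
  have Gq : G (F q) = chart a q by apply: inj => //; exact: (chart_half hm).
  have := chart_nbhs hm dq (filterI nU (open_nbhs_nbhs (conj oW Wq))) => -[e' e'0 he'].
  have := cG _ Fq _ (_ : nbhs _ (cube (chart a q) e')).
  rewrite Gq => /(_ (cube_nbhs _ e'0)); rewrite nbhs_simpl /= => nG.
  have nB : nbhs (F q) [set z | sqnorm (z - Y (chart a p)) < r].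
    by apply: open_nbhs_nbhs; split => //; exact: open_sqlt.
  have [Q [oQ Qz] hQ] := near_open (filterI nG nB).
  have [d d0 hd] := open_sqball oQ Qz; exists d => // z Dz zd.
  have [cz Bz] := hQ z (hd z zd); have [c1 h2 Yz] := hG z Dz Bz.
  have [Vz [Uz Wz]] := he' _ cz h2; exists (inv a (G z)); split => //.
  by rewrite /F /= (chart_invK hm Vz).
Qed.

Lemma dev_near_trans (F F' : M -> 'rV[R]_n.+1) q : dev_near F q -> dev_near F' q ->
  exists2 K : 'M[R]_n.+1, K *m K^T = 1%:M & \forall q' \near q, F' q' = F q' *m K.
Proof.
move=> hF hF'; have [b db] := chart_cover hm q.
have [e e0 [cV dF]] := hF b db; have [e' e'0 [cV' dF']] := hF' b db.
pose r := Order.min e e'; have r0 : 0 < r by rewrite lt_min e0.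
pose S := cube (chart b q) r `&` half_space.
have hS : hopen S by exists (cube (chart b q) r) => //; exact: open_cube.
have S1 : S `<=` cube (chart b q) e `&` half_space.
  by move=> x [cx hx]; split => // i; apply: lt_le_trans (cx i) _; rewrite ge_min lexx.
have S2 : S `<=` cube (chart b q) e' `&` half_space.
  by move=> x [cx hx]; split => // i; apply: lt_le_trans (cx i) _; rewrite ge_min lexx orbT.
have hS' := height_chart_sub hS (fun x (Sx : S x) => cV x (S1 x Sx).1 Sx.2) (hc b).
have Sq : S (chart b q) by split; [exact: cube_center|exact: (chart_half hm)].
have [K KK hK] := dev_rigid hS' (developing_sub S1 dF) (developing_sub S2 dF') Sq.
exists K => //; apply: filterS (cube_open hm db r0) => q' [dq' cq'].
have Sq' : S (chart b q') by split => //; exact: (chart_half hm).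
have := hK (chart b q'); rewrite /= (chartK hm dq'); apply => t t01.
by split; [apply: cube_convex => //; exact: Sq.1|apply: half_segment => //; [exact: Sq.2|exact: Sq'.2]].
Qed.

Lemma dev_near_norm F q : dev_near F q -> sqnorm (F q) = (1 - v q) / (1 + v q).
Proof.
move=> hF; have [b db] := chart_cover hm q; have [e e0 [cV dF]] := hF b db.
have Sq : (cube (chart b q) e `&` half_space) (chart b q) by split; [exact: cube_center|exact: (chart_half hm)].
by have := dev_norm dF Sq; rewrite /= (chartK hm db).
Qed.

Lemma height_ge0 p : 0 <= v p.
Proof.
by have [b db] := chart_cover hm p; have := hc_ge0 (hc b) (chart_in db); rewrite /= (chartK hm db).
Qed.

Lemma dev_near_ball F q : dev_near F q -> D (F q).
Proof.
move=> /dev_near_norm; rewrite /closed_ball1 /= => ->; have v0 := height_ge0 q.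
by rewrite ler_pdivrMr ?mul1r ?ltr_wpDr //; lra.
Qed.

(** Y is the inverse of the bijection S. Near each point S inverts some [F p] up to a rotation, so Y
    is there [F p] followed by the inverse rotation, and being developing is a local property stable
    under rotations. *)
Theorem global_developing : exists Y : M -> 'rV[R]_n.+1, exists S : 'rV[R]_n.+1 -> M,
  [/\ forall p, D (Y p), forall y, D y -> Y (S y) = y, forall p, S (Y p) = p,
    forall a, developing (V a) (g a) (v \o inv a) (Y \o inv a) & {within D, continuous S}].
Proof.
have /choice [W /choice [F hF]] := patch_exists.
have oW p : open (W p) by have [[]] := hF p.
have Wp p : W p p by have [[]] := hF p.
have dF p q : W p q -> dev_near (F p) q by have [[_ _ h] _ _ _] := hF p; exact: h.
have Finj p q q' : W p q -> W p q' -> F p q = F p q' -> q = q' by have [_ h _ _] := hF p; exact: h.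
have cF p q : W p q -> {for q, continuous (F p)} by have [_ _ h _] := hF p; exact: h.
have FD p q : W p q -> D (F p q) by move=> /dF; exact: dev_near_ball.
have [S [gS injS surS]] : exists S0 : 'rV[R]_n.+1 -> M,
  [/\ forall y, D y -> dgerm W F S0 y, forall y z, D y -> D z -> S0 y = S0 z -> y = z & forall q, exists2 y, D y & S0 y = q].
  apply: (@developing_bijection R n M W F p0 (manifold_hausdorff hm) cM kM oW Wp FD Finj cF) => //.
  - by move=> p q U Wq nU; have [_ _ _ h] := hF p; exact: h.
  - by move=> p p' q Wq Wq'; apply: dev_near_trans; exact: dF.
  - by apply: sqnorm_eq0; rewrite (dev_near_norm (dF p0 p0 (Wp p0))) v1 subrr mul0r.
have /choice [Y hY] : forall p, exists y, D y /\ S y = p by move=> p; have [y Dy e] := surS p; exists y.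
have YS y : D y -> Y (S y) = y by move=> Dy; apply: injS => //; have [] := hY (S y).
exists Y, S; split => //; [by move=> p; have [] := hY p|by move=> p; have [] := hY p| |]; last first.
  apply/subspace_continuousP => z Dz U nU.
  have Fopen p q U' : W p q -> nbhs q U' -> exists2 d : R, 0 < d &
     forall z, D z -> sqnorm (z - F p q) < d -> exists q', [/\ U' q', W p q' & F p q' = z].
    by move=> Wq nU'; have [_ _ _ h] := hF p; exact: h.
  by have := dgerm_cont Finj Fopen Dz (gS z Dz) nU; rewrite /within /= nbhs_simpl.
move=> a; have hV := chart_hopen hm a; apply: developing_local => // x Vx.
pose m := inv a x; have dm : dom a m by exact: chart_inv_dom.
have [Dm Sm] := hY m; have [p [K [KK hg']]] := gS _ Dm.
have [Wm Fm] := nbhs_singleton hg' Dm; rewrite Sm in Wm Fm.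
have KT : K^T *m K^T^T = 1%:M by rewrite trmxK; exact: mulmx1C.
have [Q [oQ Qm] hQ] := near_open hg'; have [d d0 hd] := open_sqball oQ Qm.
have near1 : \forall q \near m, Y q = F p q *m K^T.
  have s0 := @sqnorm0 R n.+1.
  have c1 : \forall q \near m, sqnorm (F p q - F p m) < d.
    apply: (@cF p m Wm [set w | sqnorm (w - F p m) < d]).
    by apply: open_nbhs_nbhs; split; [exact: open_sqlt|rewrite /= subrr s0].
  apply: filterS2 c1 (open_nbhs_nbhs (conj (oW p) Wm)) => q qd Wq.
  have Dq : D (F p q *m K^T) by rewrite /closed_ball1 /= sqnorm_orth //; exact: FD Wq.
  have [|Wy Fy] := hQ (F p q *m K^T) _ Dq.
    by apply: hd; rewrite -(mulmx1 (Y m)) -KK mulmxA -Fm -mulmxBl sqnorm_orth.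
  rewrite -[in LHS](Finj p _ q Wy Wq) ?YS // Fy -mulmxA (mulmx1C KK) mulmx1 //.
have [e e0 [cV dFp]] := dF p m Wm a dm; rewrite (chart_invK hm Vx) in cV dFp.
have [e' e'0 he'] := chart_nbhs hm dm near1; rewrite (chart_invK hm Vx) in he'.
pose r := Order.min e e'; have r0 : 0 < r by rewrite lt_min e0.
have sub1 y : cube x r y -> cube x e y by move=> cy i; apply: lt_le_trans (cy i) _; rewrite ge_min lexx.
have sub2 y : cube x r y -> cube x e' y by move=> cy i; apply: lt_le_trans (cy i) _; rewrite ge_min lexx orbT.
exists r => //; exists (fun y => F p (inv a y) *m K^T).
  apply: developing_orth => //; first by exists (cube x r) => //; exact: open_cube.
  by apply: developing_sub dFp => y [cy hy]; split => //; exact: sub1.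
by move=> y cy hy; have [_] := he' y (sub2 y cy) hy.
Qed.
End DevelopingManifold.

(** * The isometry with the hemisphere *)

Section DeSitterCharts.
Context {R : realType} {n : nat}.
Local Notation E := 'rV[R]_n.+1.
Local Notation D := (@closed_ball1 R n.+1).
Local Notation ball := (set_type D).

Lemma to_ballK (x : E) : D x -> set_val (to_ball x) = x.
Proof. by move=> Dx; rewrite set_valE /to_ball insubdK // inE. Qed.

Lemma ball_sqnorm (w : ball) : sqnorm (set_val w) <= 1.
Proof. by have /set_mem := valP w; rewrite set_valE. Qed.

Lemma pole_sqr s : pole s * pole s = 1 :> R.
Proof. by rewrite /pole; case: s; rewrite ?expr0 ?expr1 ?mulrNN mulr1. Qed.

Lemma split0 (F : 'I_n.+1 -> R) : \sum_j F j = F ord0 + \sum_(j | j != ord0) F j.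
Proof. by rewrite (bigD1 ord0). Qed.

(** In the stereographic charts the height takes the place of the coordinate of index 0, so sums
    over coordinates change in one term only. *)
Lemma sum_swap0 (F G : 'I_n.+1 -> R) : (forall j, j != ord0 -> F j = G j) ->
  \sum_j F j = \sum_j G j - G ord0 + F ord0.
Proof. by move=> FG; rewrite !split0 (eq_bigr G) //; ring. Qed.

Lemma sum4 (a b c d : R) (F1 F2 F3 F4 : 'I_n.+1 -> R) :
  \sum_j (a * F1 j + b * F2 j + c * F3 j + d * F4 j) =
  a * (\sum_j F1 j) + b * (\sum_j F2 j) + c * (\sum_j F3 j) + d * (\sum_j F4 j).
Proof. by rewrite !big_split /= -!mulr_sumr. Qed.

Lemma smooth_sqnorm : smooth_open setT (@sqnorm R n.+1).
Proof.
by have := @smooth_sqdist R n.+1 0; congr smooth_open; apply/funext => x; rewrite subr0.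
Qed.

(* [h] is the height of a point of the hemisphere, [t] its coordinate along [e0]
   and [N] the squared norm of its projection to the ball. *)
Lemma stereo_sqnorm (s h t N : R) : s * s = 1 -> 1 - s * t != 0 -> h * h = 1 - N ->
  1 + (N - t * t + h * h) / ((1 - s * t) * (1 - s * t)) = 2 / (1 - s * t).
Proof.
move=> ss; move e : (1 - s * t) => d d0 ->.
have -> : t * t = (1 - d) ^+ 2 by rewrite -e opprB addrC subrK exprMn expr2 ss mul1r expr2.
by field.
Qed.

Definition ball_coord (b : deSitter_index) (y : E) : E :=
  match b with
  | Inner => y - e0
  | Stereo s => \row_(i < n.+1) ((if val i == 0%N then pole s * (sqnorm y - 1) else 2 * y 0 i) / (sqnorm y + 1))
  end.

Lemma deSitter_chart_invE b (y : E) : deSitter_chart_inv b y = to_ball (ball_coord b y).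
Proof. by case: b. Qed.

Lemma ball_coord_chart b (w : ball) : deSitter_dom b w -> ball_coord b (deSitter_chart b w) = set_val w.
Proof.
case: b => [_|s] /=; first by rewrite addrK.
rewrite coord0E => hd; set x := set_val w in hd *.
have x1 : sqnorm x <= 1 := ball_sqnorm w.
pose d := 1 - pole s * x 0 ord0; have d0 : d != 0 by rewrite subr_eq0 gt_eqF.
pose z : E := \row_(i < n.+1) ((if val i == 0%N then deSitter_height x else x 0 i) / d).
rewrite -/d -/z; have h2 : deSitter_height x * deSitter_height x = 1 - sqnorm x.
  by rewrite -expr2 sqr_sqrtr // subr_ge0.
have zE j : z 0 j = (if j == ord0 then deSitter_height x else x 0 j) / d by rewrite mxE -(inj_eq val_inj).
have sz1 : sqnorm z + 1 = 2 / d.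
  rewrite addrC -(stereo_sqnorm (pole_sqr s) d0 h2); congr (1 + _).
  rewrite /sqnorm (eq_bigr (fun j => (if j == ord0 then deSitter_height x * deSitter_height x else x 0 j * x 0 j) / (d * d))).
  rewrite -mulr_suml; congr (_ / _); rewrite (@sum_swap0 _ (fun j => x 0 j ^+ 2)) ?eqxx ?expr2 //.
    by move=> j j0; rewrite (negbTE j0) expr2.
  by move=> j _; rewrite zE; case: ifP => _; rewrite expr2; field.
have sz2 : sqnorm z - 1 = 2 / d - 2 by rewrite -sz1; ring.
apply/rowP => i; rewrite mxE sz1 sz2; have [i0|i0] := eqVneq (val i) 0%N.
  have -> : i = ord0 by exact: val_inj.
  have -> : pole s * (2 / d - 2) / (2 / d) = pole s * (1 - d) by field.
  by rewrite /d opprB addrC subrK mulrA pole_sqr mul1r.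
by rewrite mxE (negbTE i0); field.
Qed.

Lemma continuous_ball_coord b : continuous (ball_coord b).
Proof.
move=> y; apply: differentiable_continuous; apply: differentiable_rowP => j.
have sq := smooth_sqnorm.
have sc (c : R) : smooth_open setT (fun _ : E => c) by exact: (smooth_cst openT).
have sX i : smooth_open setT (fun y : E => y 0 i) by exact: (smooth_coord openT).
suff s : smooth_open setT (fun y => ball_coord b y 0 j) by exact: smooth_diff s _.
case: b => [|s] /=.
  rewrite (_ : (fun y => _) = fun y : E => y 0 j - (e0 : E) 0 j); last by apply/funext => z; rewrite !mxE.
  exact: (smooth_openB openT (sX j) (sc _)).
have sV : smooth_open setT (fun y : E => (sqnorm y + 1)^-1).
  apply: (smooth_openV openT) => [x _|]; last exact: (smooth_openD openT sq (sc 1)).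
  by rewrite gt_eqF // ltr_wpDl // sqnorm_ge0.
have [j0|j0] := eqVneq (val j) 0%N.
  rewrite (_ : (fun y => _) = fun y : E => (pole s * (sqnorm y - 1)) * (sqnorm y + 1)^-1); last first.
    by apply/funext => z; rewrite mxE j0.
  exact: (smooth_openM openT (smooth_openM openT (sc _) (smooth_openB openT sq (sc 1))) sV).
rewrite (_ : (fun y => _) = fun y : E => (2 * y 0 j) * (sqnorm y + 1)^-1); last first.
  by apply/funext => z; rewrite mxE (negbTE j0).
exact: (smooth_openM openT (smooth_openM openT (sc _) (sX j)) sV).
Qed.
End DeSitterCharts.

(** * From the flat ball to the hemisphere *)

Section Isometry.
Context {R : realType} {n : nat} {M : topologicalType} {A : atlas R n.+1 M}.
Local Notation E := 'rV[R]_n.+1.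
Local Notation D := (@closed_ball1 R n.+1).
Local Notation ball := (set_type D).
Variables (g : metric_components A) (v : M -> R) (Y : M -> E) (S : E -> M).
Hypotheses (hm : is_manifold A) (hg : is_riemannian g).
Local Notation V := (@chart_image R n.+1 M A).
Local Notation inv a := (@chart_inv R n.+1 M A a).
Local Notation dom a := (@chart_dom R n.+1 M A a).
Hypothesis hc : forall a, height_chart (V a) (g a) (v \o inv a).
Hypotheses (DY : forall p, D (Y p)) (YS : forall y, D y -> Y (S y) = y) (SY : forall p, S (Y p) = p)
  (dY : forall a, developing (V a) (g a) (v \o inv a) (Y \o inv a)) (cS : {within D, continuous S}).

Lemma dev_height p : 0 <= v p /\ sqnorm (Y p) = (1 - v p) / (1 + v p).
Proof.
have [a da] := chart_cover hm p; have Va := chart_in da.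
by have := hc_ge0 (hc a) Va; have := dev_norm (dY a) Va; rewrite /= (chartK hm da).
Qed.

(** Inverse stereographic projection: |y|^2 = (1 - v) / (1 + v) means 1 + v = 2 / (1 + |y|^2). *)
Definition embed p : E := (1 + v p) *: Y p.

Lemma sqnorm_embed p : sqnorm (embed p) = 1 - v p * v p.
Proof.
have [v0 nY] := dev_height p; have v1 : 1 + v p != 0 by rewrite gt_eqF // ltr_wpDr.
by rewrite /embed sqnormZ nY; field.
Qed.

Lemma embed_ball p : D (embed p).
Proof. by rewrite /closed_ball1 /= sqnorm_embed lerBlDr lerDl -expr2 sqr_ge0. Qed.

Lemma height_embed p : deSitter_height (embed p) = v p.
Proof.
have [v0 _] := dev_height p.
by rewrite /deSitter_height sqnorm_embed opprB addrC subrK -expr2 sqrtr_sqr ger0_norm.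
Qed.

Definition Phi p : ball := to_ball (embed p).

Lemma val_Phi p : set_val (Phi p) = embed p. Proof. exact: to_ballK (embed_ball p). Qed.

Definition unembed (x : E) : M := S ((1 + deSitter_height x)^-1 *: x).
Definition Psi (w : ball) : M := unembed (set_val w).

Lemma PhiK : cancel Phi Psi.
Proof.
move=> p; have [v0 _] := dev_height p; have v1 : 1 + v p != 0 by rewrite gt_eqF // ltr_wpDr.
by rewrite /Psi /unembed val_Phi height_embed /embed scalerA mulVf // scale1r SY.
Qed.

Lemma height1_gt0 (x : E) : 0 < 1 + deSitter_height x.
Proof. by rewrite ltr_wpDr // sqrtr_ge0. Qed.

Lemma unembed_ball x : D x -> D ((1 + deSitter_height x)^-1 *: x).
Proof.
rewrite /closed_ball1 /= sqnormZ => x1; apply: le_trans x1; rewrite ler_piMl ?sqnorm_ge0 //.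
by rewrite expr_le1 // ?invr_ge0 ?(ltW (height1_gt0 x)) // invf_le1 ?height1_gt0 // lerDl sqrtr_ge0.
Qed.

Lemma PsiK : cancel Psi Phi.
Proof.
move=> w; apply: val_inj; rewrite -!set_valE val_Phi /embed /Psi /unembed; set x := set_val w.
have x1 : sqnorm x <= 1 := ball_sqnorm w.
have [v0 nv] := dev_height (S ((1 + deSitter_height x)^-1 *: x)).
move: nv; rewrite YS; last exact: unembed_ball.
set h := deSitter_height x; set t := v _ in v0 *.
have h2 : h ^+ 2 = 1 - sqnorm x by rewrite /h sqr_sqrtr // subr_ge0.
have h0 : 0 <= h by rewrite sqrtr_ge0.
have hh : 1 + h != 0 by rewrite gt_eqF // ltr_wpDr.
have tt : 1 + t != 0 by rewrite gt_eqF // ltr_wpDr.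
rewrite sqnormZ (_ : sqnorm x = 1 - h ^+ 2); last by rewrite h2; ring.
move=> e; have {}e : t = h.
  have : (1 + h)^-1 ^+ 2 * (1 - h ^+ 2) = (1 - h) / (1 + h) by field.
  rewrite e => /eqP; rewrite eqr_div // => /eqP; lra.
by rewrite e scalerA divff // scale1r.
Qed.

Lemma smooth_embed a j : smooth_on (V a) (fun x => embed (inv a x) 0 j).
Proof.
apply: (@smooth_on_eq _ _ _ (fun x => (1 + (v \o inv a) x) * (Y \o inv a) x 0 j)); first by move=> x _; rewrite mxE.
by apply: smooth_onM; [exact: (smooth_height1 (hc a))|exact: (dev_smooth (dY a))].
Qed.

Lemma continuous_embed : continuous embed.
Proof.
move=> p; have [a da] := chart_cover hm p.
have oV := open_nbhs_nbhs (conj (chart_dom_open hm a) da).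
have := @smooth_chart_continuous R n M A hm a (V a) (fun x => embed (inv a x)) p (@smooth_embed a) da (chart_in da).
move=> /(_ (filterS (fun q dq => chart_in dq) oV)) c P nP.
have := c P; rewrite /= (chartK hm da) => /(_ nP); rewrite !nbhs_simpl /= => h.
by apply: filterS2 h oV => q; rewrite /preimage /= => + dq; rewrite (chartK hm dq).
Qed.

Lemma Phi_continuous : continuous Phi.
Proof.
apply: continuous_comp_initial; rewrite (_ : _ \o _ = embed); first exact: continuous_embed.
by apply/funext => p; rewrite /= val_Phi.
Qed.

Lemma unembed_continuous : {within D, continuous unembed}.
Proof.
apply/subspace_continuousP => x Dx.
have /subspace_continuousP cS' := cS.
have c1 : {for x, continuous (fun x : E => (1 + deSitter_height x)^-1 *: x)}.
  have ch : {for x, continuous (@deSitter_height R n.+1)}.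
    apply: (@continuous_comp _ _ _ (fun x : E => 1 - sqnorm x) (@Num.sqrt R)); last exact: sqrt_continuous.
    have s1 : smooth_open setT (fun x : E => 1 - sqnorm x) := smooth_openB openT (smooth_cst openT 1) smooth_sqnorm.
    exact: smooth_continuous s1 (I : setT x).
  have cV : {for x, continuous (fun x : E => (1 + deSitter_height x)^-1)}.
    apply: (@continuous_comp _ _ _ (@deSitter_height R n.+1) (fun t : R => (1 + t)^-1)) => //.
    by apply: cvgV; [rewrite gt_eqF // height1_gt0|apply: cvgD; [exact: cvg_cst|exact: cvg_id]].
  by apply: (@continuousZ _ _ _ (fun x : E => (1 + deSitter_height x)^-1) id).
move=> P nP; have := cS' _ (unembed_ball Dx) P nP; rewrite /within /= !nbhs_simpl /= => h.
have h2 := c1 _ h; rewrite nbhs_simpl /= in h2.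
suff : nbhs x [set y | D y -> P (unembed y)] by [].
by apply: filterS h2 => y hy Dy; exact: (hy (unembed_ball Dy)).
Qed.

Lemma Psi_continuous : continuous Psi.
Proof. by have /subspace_sigL_continuousP := unembed_continuous. Qed.

Lemma deSitter_dom_open b : open (Phi @^-1` deSitter_dom b).
Proof.
case: b => [|s].
  rewrite (_ : _ @^-1` _ = embed @^-1` [set x | sqnorm (x - 0) < 1]).
    by apply: open_comp; [move=> p _; exact: continuous_embed|exact: open_sqlt].
  by apply/seteqP; split => p; rewrite /= val_Phi subr0.
rewrite (_ : _ @^-1` _ = embed @^-1` [set x : E | pole s * x 0 0 < 1]).
  apply: open_comp; first by move=> p _; exact: continuous_embed.
  apply: (@open_comp _ _ (fun x : E => pole s * x 0 0) [set t | t < 1]); last exact: open_lt.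
  move=> x _; have s1 : smooth_open setT (fun x : E => pole s * x 0 0) := smooth_openM openT (smooth_cst openT (pole s)) (smooth_coord openT 0).
  exact: smooth_continuous s1 (I : setT x).
by apply/seteqP; split => p; rewrite /= val_Phi coord0E.
Qed.

Lemma local_domE a b : @local_dom R n.+1 M ball A (@deSitter_atlas R n.+1) Phi a b =
  [set x | V a x /\ (Phi @^-1` deSitter_dom b) (inv a x)].
Proof.
apply/seteqP; split => [_ [p [dp dq] <-]|x [Vx dx]].
  by split; [exact: chart_in|rewrite (chartK hm dp)].
by exists (inv a x); [split => //; exact: chart_inv_dom|exact: chart_invK].
Qed.

Lemma local_dom_hopen a b : hopen (@local_dom R n.+1 M ball A (@deSitter_atlas R n.+1) Phi a b).
Proof. by rewrite local_domE; apply: chart_image_sub_hopen => //; exact: deSitter_dom_open. Qed.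

Local Notation rep a b := (@local_rep R n.+1 M ball A (@deSitter_atlas R n.+1) Phi a b).
Local Notation W a b := (@local_dom R n.+1 M ball A (@deSitter_atlas R n.+1) Phi a b).

Lemma rep_Inner a x j : rep a Inner x 0 j = embed (inv a x) 0 j + (e0 : E) 0 j.
Proof. by rewrite /local_rep /= val_Phi mxE. Qed.

Lemma rep_Stereo a s x j : rep a (Stereo s) x 0 j =
  (if j == 0 then v (inv a x) else embed (inv a x) 0 j) * (1 + (- pole s) * embed (inv a x) 0 0)^-1.
Proof. by rewrite /local_rep /= val_Phi mxE coord0E height_embed mulNr -(inj_eq val_inj). Qed.

Lemma smooth_rep a b j : smooth_on (W a b) (fun x => rep a b x 0 j).
Proof.
have WV : W a b `<=` V a by rewrite local_domE => x [].
have sE k : smooth_on (W a b) (fun x => embed (inv a x) 0 k) by apply: smooth_on_sub WV _; exact: smooth_embed.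
have sv : smooth_on (W a b) (v \o inv a) by apply: smooth_on_sub WV _; exact: (hc_height (hc a)).
case: b => [|s] in WV sE sv *.
  apply: (@smooth_on_eq _ _ _ (fun x => embed (inv a x) 0 j + (e0 : E) 0 j)); first by move=> x _; rewrite rep_Inner.
  by apply: smooth_onD => //; exact: smooth_on_cst.
have sd : smooth_on (W a (Stereo s)) (fun x => (1 + (- pole s) * embed (inv a x) 0 0)^-1).
  apply: smooth_onV => [x|].
    by rewrite local_domE => -[_ /=]; rewrite val_Phi coord0E mulNr subr_eq0 => /gt_eqF ->.
  by apply: smooth_onD; [exact: smooth_on_cst|apply: smooth_onM => //; exact: smooth_on_cst].
have [j0|j0] := eqVneq j 0.
  apply: (@smooth_on_eq _ _ _ (fun x => (v \o inv a) x * (1 + (- pole s) * embed (inv a x) 0 0)^-1)); last exact: smooth_onM.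
  by move=> x _; rewrite rep_Stereo j0 eqxx.
apply: (@smooth_on_eq _ _ _ (fun x => embed (inv a x) 0 j * (1 + (- pole s) * embed (inv a x) 0 0)^-1)); last exact: smooth_onM.
by move=> x _; rewrite rep_Stereo (negbTE j0).
Qed.

Section Derivatives.
Variables (a : chart_index A) (x : E).
Hypothesis Vx : V a x.
Local Notation q i := (partial i (v \o inv a) x).
Local Notation pX i j := (partial i (fun y => embed (inv a y) 0 j) x).
Local Notation Xc j := (embed (inv a x) 0 j).
Let hV := chart_hopen hm a.

Local Notation Yc j := (Y (inv a x) 0 j).
Local Notation vx := (v (inv a x)).
Lemma partial_embed i j : pX i j = q i * Yc j + (1 + vx) * partial i (fun y => Y (inv a y) 0 j) x.
Proof.
have -> : (fun y => embed (inv a y) 0 j) = fun y => (1 + (v \o inv a) y) * (Y \o inv a) y 0 j by apply/funext => y; rewrite mxE.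
rewrite (partialM hV i (smooth_height1 (hc a)) (dev_smooth (dY a) j) Vx) (partialD hV i (smooth_on_cst _) (hc_height (hc a)) Vx).
by rewrite (partial_cst hV _ i Vx) add0r.
Qed.

Let v1 : 1 + vx != 0. Proof. by have [v0 _] := dev_height (inv a x); rewrite gt_eqF // ltr_wpDr. Qed.

(** The pair (v, X) is a unit vector, and its differential is isometric: g = dv^2 + |dX|^2. Both
    coordinate expressions of the hemisphere metric are derived from these three sums. *)
Lemma embed_facts : [/\ \sum_j Xc j * Xc j = 1 - vx * vx,
  forall i, \sum_j pX i j * Xc j = - (vx * q i) &
  forall i k, \sum_j pX i j * pX k j = g a x i k - q i * q k].
Proof.
pose p i j := partial i (fun y => Y (inv a y) 0 j) x.
have nY : \sum_j Yc j * Yc j = (1 - vx) / (1 + vx).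
  by have [_ <-] := dev_height (inv a x); apply: eq_bigr => j _; rewrite expr2.
have rY i : \sum_j p i j * Yc j = - ((1 + vx)^-1 / (1 + vx)) * q i.
  have := dev_radial (hc a) (dY a) Vx => /colP /(_ i); rewrite [RHS]mxE [X in _ = _ * X]mxE => <-.
  by rewrite mxE; apply: eq_bigr => j _; rewrite !mxE.
have mY i k : \sum_j p i j * p k j = ((1 + vx)^-1 / (1 + vx)) * g a x i k.
  have := dev_metric (dY a) Vx => /matrixP /(_ i k); rewrite [RHS]mxE => <-.
  by rewrite mxE; apply: eq_bigr => j _; rewrite !mxE.
have XE j : Xc j = (1 + vx) * Yc j by rewrite mxE.
have v1' := v1; split.
- rewrite (eq_bigr (fun j => (1 + vx) ^+ 2 * (Yc j * Yc j))) => [|j _]; last by rewrite XE; ring.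
  by rewrite -mulr_sumr nY; field.
- move=> i; rewrite (eq_bigr (fun j => (1 + vx) * q i * (Yc j * Yc j) + (1 + vx) ^+ 2 * (p i j * Yc j))); last first.
    by move=> j _; rewrite XE partial_embed -/(p i j); ring.
  rewrite big_split /= -!mulr_sumr nY rY; move: (q i) (vx) v1' => r w w1; by field.
- move=> i k; rewrite (eq_bigr (fun j => q i * q k * (Yc j * Yc j) + (1 + vx) ^+ 2 * (p i j * p k j)
     + ((1 + vx) * q i * (p k j * Yc j) + (1 + vx) * q k * (p i j * Yc j)))); last first.
    by move=> j _; rewrite !partial_embed -/(p i j) -/(p k j); ring.
  rewrite !big_split /= -!mulr_sumr nY !rY mY; move: (q i) (q k) (g a x i k) (vx) v1' => r r' G w w1; by field.
Qed.
End Derivatives.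

Local Notation pE a x i j := (partial i (fun y => embed (inv a y) 0 j) x).

(** The Euclidean part gives g - dv dv. As 1 - |X|^2 = v^2 and X . dX = - v dv, the rank-one part
    restores dv dv. *)
Lemma metric_Inner a x : W a Inner x ->
  let J := \matrix_(i, j) partial i (fun y => rep a Inner y 0 j) x in
  g a x = J *m deSitter_metric Inner (rep a Inner x) *m J^T.
Proof.
move=> Wx J; have [Vx dx] : V a x /\ sqnorm (embed (inv a x)) < 1 by move: Wx; rewrite local_domE => -[Vx /=]; rewrite val_Phi.
have [f1 f2 f3] := embed_facts Vx; have hV := chart_hopen hm a.
pose X := embed (inv a x).
have xE : rep a Inner x - e0 = X by apply/rowP => j; rewrite [LHS]mxE [X in _ + X]mxE rep_Inner addrK.
have JE i j : J i j = pE a x i j.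
  rewrite mxE; under eq_fun do rewrite rep_Inner.
  by rewrite (partialD hV i (smooth_embed j) (smooth_on_cst _) Vx) (partial_cst hV _ i Vx) addr0.
have dv : v (inv a x) != 0.
  by move: dx; rewrite sqnorm_embed; apply: contraTneq => ->; rewrite mulr0 subr0 ltxx.
have JX i : (J *m X^T) i 0 = - (v (inv a x) * partial i (v \o inv a) x).
  by rewrite -f2 mxE; apply: eq_bigr => j _; rewrite JE [X in _ * X]mxE.
have -> : J *m deSitter_metric Inner (rep a Inner x) *m J^T =
    J *m J^T + (1 - sqnorm X)^-1 *: ((J *m X^T) *m (J *m X^T)^T).
  by rewrite /deSitter_metric xE trmx_mul trmxK mulmxDr mulmxDl mulmx1 -scalemxAr -scalemxAl !mulmxA.
apply/matrixP => i k; rewrite [RHS]mxE [X in _ = X + _]mxE [X in _ = _ + X]mxE [X in _ = _ + _ * X]mxE big_ord1 [X in _ = _ + _ * (_ * X)]mxE !JX.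
rewrite (eq_bigr (fun j => pE a x i j * pE a x k j)) => [|j _].
  rewrite f3; have -> : 1 - sqnorm X = v (inv a x) * v (inv a x) by rewrite sqnorm_embed; ring.
  by move: (g a x i k) (partial i _ x) (partial k _ x) => G r r'; field.
by rewrite [X in _ * X]mxE !JE.
Qed.

Lemma metric_Stereo a s x : W a (Stereo s) x ->
  let J := \matrix_(i, j) partial i (fun y => rep a (Stereo s) y 0 j) x in
  g a x = J *m deSitter_metric (Stereo s) (rep a (Stereo s) x) *m J^T.
Proof.
move=> Wx J; have [Vx dx] : V a x /\ pole s * embed (inv a x) 0 0 < 1.
  by move: Wx; rewrite local_domE => -[Vx /=]; rewrite val_Phi coord0E.
have [f1 f2 f3] := embed_facts Vx; have hV := chart_hopen hm a; have hW := local_dom_hopen a (Stereo s).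
pose X := embed (inv a x); pose c := 1 + (- pole s) * X 0 0.
have c0 : c != 0 by rewrite /c mulNr subr_eq0 gt_eqF.
pose q i := partial i (v \o inv a) x; pose q0 i := pE a x i 0.
(* The point (v, X) without its component along the pole; the chart is [w] divided by [c]. *)
pose w j := if j == 0 then v (inv a x) else X 0 j.
pose pw i j := if j == 0 then q i else pE a x i j.
have rE j : rep a (Stereo s) x 0 j = w j / c by rewrite rep_Stereo.
have WV : W a (Stereo s) `<=` V a by rewrite local_domE => y [].
have sd : smooth_on (W a (Stereo s)) (fun y => 1 + (- pole s) * embed (inv a y) 0 0).
  apply: smooth_onD; first exact: smooth_on_cst.
  by apply: smooth_onM; [exact: smooth_on_cst|apply: smooth_on_sub WV _; exact: smooth_embed].
have pd0 i : partial i (fun y => 1 + (- pole s) * embed (inv a y) 0 0) x = - pole s * q0 i.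
  have s1 : smooth_on (V a) (fun y => - pole s * embed (inv a y) 0 0).
    by apply: smooth_onM; [exact: smooth_on_cst|exact: smooth_embed].
  rewrite (partialD hV i (smooth_on_cst 1) s1 Vx) (partial_cst hV _ i Vx) add0r.
  by rewrite (partialM hV i (smooth_on_cst _) (smooth_embed 0) Vx) (partial_cst hV _ i Vx) mul0r add0r.
have den0 y : W a (Stereo s) y -> 1 + - pole s * embed (inv a y) 0 0 != 0.
  by rewrite local_domE => -[_ /=]; rewrite val_Phi coord0E mulNr subr_eq0 => /gt_eqF ->.
(* Obtained by differentiating c times the chart, which equals [w], and solving for the derivative
   of the chart. *)
have JE i j : J i j = pw i j / c + pole s * q0 i * w j / (c * c).
  have : partial i (fun y => (1 + (- pole s) * embed (inv a y) 0 0) * rep a (Stereo s) y 0 j) x = pw i j.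
    rewrite /pw; case: eqP => [j0|/eqP j0].
      apply: (partial_eq hW i (smooth_on_sub WV (hc_height (hc a))) Wx) => y Wy.
      by rewrite rep_Stereo j0 eqxx mulrC divfK ?den0.
    apply: (partial_eq hW i (smooth_on_sub WV (@smooth_embed a j)) Wx) => y Wy.
    by rewrite rep_Stereo (negbTE j0) mulrC divfK ?den0.
  rewrite (partialM hW i sd (smooth_rep j) Wx) pd0 rE [J i j]mxE
  -[1 + - pole s * embed _ 0 0]/c; move: (partial i _ x) => d <-; move: (q0 i) (w j) (pole s) c0 => r t z c0.
  by field.
have w2 : \sum_j w j * w j = 1 - X 0 0 * X 0 0.
  rewrite (@sum_swap0 _ _ _ (fun j => X 0 j * X 0 j)) => [|j j0]; last by rewrite /w (negbTE j0).
  by rewrite f1 /w eqxx; ring.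
have pw1 i : \sum_j pw i j * w j = - (X 0 0 * q0 i).
  rewrite (@sum_swap0 _ _ _ (fun j => pE a x i j * X 0 j)) => [|j j0]; last by rewrite /w /pw (negbTE j0).
  by rewrite f2 /w /pw eqxx -/(q0 i) /q; ring.
have pw2 i k : \sum_j pw i j * pw k j = g a x i k - q0 i * q0 k.
  rewrite (@sum_swap0 _ _ _ (fun j => pE a x i j * pE a x k j)) => [|j j0]; last by rewrite /pw (negbTE j0).
  by rewrite f3 /pw eqxx -/(q0 i) -/(q0 k) /q; ring.
have sX : pole s * X 0 0 = 1 - c by rewrite /c; ring.
have X2 : X 0 0 * X 0 0 = (1 - c) ^+ 2.
  by rewrite -sX exprMn [pole s ^+ 2]expr2 pole_sqr mul1r expr2.
(* Hence the conformal factor 4 / (1 + |y|^2)^2 is c^2. *)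
have s2 : 1 + sqnorm (rep a (Stereo s) x) = 2 / c.
  rewrite /sqnorm (eq_bigr (fun j => (c * c)^-1 * (w j * w j))) => [|j _]; last by rewrite rE expr2; field.
  by rewrite -mulr_sumr w2 X2; field.
rewrite /deSitter_metric s2 -scalemx1 -scalemxAr mulmx1 -scalemxAl.
apply/matrixP => i k; rewrite [RHS]mxE [X in _ = _ * X]mxE.
have prod (p p' r r' t b d : R) : d != 0 -> (p / d + t * r * b / (d * d)) * (p' / d + t * r' * b / (d * d)) =
  (d * d)^-1 * (p * p') + t / (d * d * d) * r' * (p * b) + t / (d * d * d) * r * (p' * b) + t * t * r * r' / (d * d * d * d) * (b * b).
  by move=> d0; field.
rewrite (eq_bigr (fun j => (c * c)^-1 * (pw i j * pw k j) + pole s / (c * c * c) * q0 k * (pw i j * w j)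
   + pole s / (c * c * c) * q0 i * (pw k j * w j)
   + pole s * pole s * q0 i * q0 k / (c * c * c * c) * (w j * w j))); last first.
  by move=> j _; rewrite [X in _ * X]mxE !JE prod.
rewrite (sum4 (c * c)^-1) pw2 !pw1 w2 pole_sqr X2.
have fin (G t z r r' d : R) : d != 0 -> t * z = 1 - d -> G = 4 / (2 / d) ^+ 2 * ((d * d)^-1 * (G - r * r') +
    t / (d * d * d) * r' * - (z * r) + t / (d * d * d) * r * - (z * r') + 1 * r * r' / (d * d * d * d) * (1 - (1 - d) ^+ 2)).
  move=> d0 tz; have -> : t / (d * d * d) * r' * - (z * r) = - (t * z) * r * r' / (d * d * d) by field.
  have -> : t / (d * d * d) * r * - (z * r') = - (t * z) * r * r' / (d * d * d) by field.
  by rewrite tz; field.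
exact: fin.
Qed.

Theorem hemisphere_isometry : exists F : M -> ball, riemannian_isometry g (@deSitter_metric R n.+1) F /\
  forall p, v p = deSitter_u (F p).
Proof.
exists Phi; split; last by move=> p; rewrite /deSitter_u val_Phi height_embed.
have pm : preserves_metric Phi g (@deSitter_metric R n.+1).
  by move=> a [|s] x Wx; [exact: metric_Inner|exact: metric_Stereo].
exists Psi; split => //; [exact: PhiK|exact: PsiK| |].
  by split; [exact: Phi_continuous|move=> a b j; exact: smooth_rep].
split; first exact: Psi_continuous.
(* The inverse is smooth because [Phi] preserves the metrics, so that its Jacobians are invertible,
   and because [Psi] is continuous. *)
move=> b a j; apply: (smooth_inverse (local_dom_hopen a b) (smooth_rep (a := a) (b := b))) => [x Wx|_ [w [dw da] <-]|].
- have Vx : V a x by move: Wx; rewrite local_domE => -[].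
  have := metric_unit hg Vx; rewrite (pm a b x Wx) !unitmx_mul => /andP[/andP[uJ _] _].
  by rewrite (_ : jacm _ _ = \matrix_(i, j) partial i (fun y => rep a b y 0 j) x).
- have -> : @local_rep _ _ _ _ (@deSitter_atlas R n.+1) A Psi b a (deSitter_chart b w) = chart a (Psi w).
    by rewrite /local_rep /= deSitter_chart_invE ball_coord_chart // (_ : to_ball (set_val w) = w) //; apply: val_inj; rewrite -!set_valE to_ballK //; exact: ball_sqnorm.
  split; last by rewrite /local_rep /= (chartK hm da) PsiK.
  by exists (Psi w) => //; split => //=; rewrite PsiK.
- have PE w' : @deSitter_chart_inv R n.+1 b (deSitter_chart b w') = to_ball (ball_coord b (deSitter_chart b w')).
    exact: deSitter_chart_invE.
  have gE w' : deSitter_dom b w' -> @local_rep _ _ _ _ (@deSitter_atlas R n.+1) A Psi b a (deSitter_chart b w') =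
    chart a (unembed (ball_coord b (deSitter_chart b w'))).
    by move=> dw'; rewrite /local_rep /= PE /Psi to_ballK // ball_coord_chart // /closed_ball1 /=; exact: ball_sqnorm.
  apply/subspace_continuousP => _ [w [dw da] <-] P; rewrite /from_subspace /= gE // => nP.
  have Dw : D (ball_coord b (deSitter_chart b w)) by rewrite ball_coord_chart //; exact: ball_sqnorm.
  have da' : dom a (unembed (ball_coord b (deSitter_chart b w))) by rewrite ball_coord_chart.
  have n1 := chart_continuous hm da' nP; rewrite nbhs_simpl /= in n1.
  have /subspace_continuousP cu := unembed_continuous.
  have n2 := cu _ Dw _ n1; rewrite nbhs_simpl /= in n2.
  have n3 := continuous_ball_coord n2; rewrite nbhs_simpl /= in n3.
  rewrite nbhs_simpl /= /within /=; apply: filterS n3 => z hz [w' [dw' da''] e].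
  rewrite -e in hz *; rewrite /preimage /= gE //; apply: hz.
  by rewrite ball_coord_chart //; exact: ball_sqnorm.
Qed.
End Isometry.

Section Scaling.
Context {R : realType} {n : nat}.
Variables (V : set 'rV[R]_n.+1) (hV : hopen V) (G : 'rV[R]_n.+1 -> 'M[R]_n.+1) (f : 'rV[R]_n.+1 -> R) (c : R).
Hypothesis sf : smooth_on V f.

Lemma partialZ h i x : smooth_on V h -> V x -> partial i (fun y => c * h y) x = c * partial i h x.
Proof.
move=> sh Vx; rewrite (partialM hV i (smooth_on_cst c) sh Vx) (partial_cst hV c i Vx).
by rewrite mul0r add0r.
Qed.

Lemma hessianZ i j x : V x -> hessian G (fun y => c * f y) i j x = c * hessian G f i j x.
Proof.
move=> Vx; rewrite /hessian mulrBr mulr_sumr; congr (_ - _); last first.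
  by apply: eq_bigr => k _; rewrite partialZ // mulrCA.
have sp := smooth_on_partial hV j sf.
rewrite -(partialZ i sp Vx); apply: (partial_eq hV i _ Vx).
  by apply: smooth_onM => //; exact: smooth_on_cst.
by move=> y Vy; rewrite partialZ.
Qed.

Lemma gradsqZ x : V x -> gradsq G (fun y => c * f y) x = c ^+ 2 * gradsq G f x.
Proof.
move=> Vx; rewrite /gradsq; have -> : grad (fun y => c * f y) x = c *: grad f x.
  by apply/colP => i; rewrite !mxE partialZ.
by rewrite linearZ /= -scalemxAr -scalemxAl -scalemxAr scalerA mxscaleE expr2.
Qed.
End Scaling.

Lemma locally_constant (T : topologicalType) (U : Type) (X : set T) (f : T -> U) : connected X ->
  (forall p, X p -> \forall q \near p, X q -> f q = f p) -> forall p q, X p -> X q -> f q = f p.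
Proof.
move=> kX lc p q Xp Xq; pose B := X `&` [set r | f r = f p].
suff BX : B = X by have : B q; [rewrite BX|case].
apply: kX; first by exists p.
- exists (interior [set r | X r -> f r = f p]); first exact: open_interior.
  apply/seteqP; split => r [Xr]; last by move=> /nbhs_singleton h; split => //; exact: h.
  by move=> fr; split => //; rewrite /interior; apply: filterS (lc r Xr) => s hs Xs; rewrite hs.
- exists (~` interior [set r | X r -> f r <> f p]); first by apply: open_closedC; exact: open_interior.
  apply/seteqP; split => r [Xr hr]; split => //.
    by move=> /nbhs_singleton /(_ Xr).
  apply: contrapT => ne; apply: hr; rewrite /interior; apply: filterS (lc r Xr) => s hs Xs; by rewrite hs.
Qed.

(** * Surface gravity and conclusion *)

Section SurfaceGravity.
Context {R : realType} {n : nat} {M : topologicalType} {A : atlas R n.+1 M}.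
Variables (g : metric_components A) (u : M -> R).
Hypothesis hs : is_static_triple g u.
Local Notation V := (@chart_image R n.+1 M A).
Local Notation inv a := (@chart_inv R n.+1 M A a).
Local Notation dom a := (@chart_dom R n.+1 M A a).
Local Notation ball := (set_type (@closed_ball1 R n.+1)).
Let hm := static_manifold hs.
Let hg := static_metric hs.
Let su := static_smooth hs.
Local Notation uc a := (u \o inv a).
Local Notation W := (total_energy g u).
Local Notation um := (u_max u).

Lemma rigid_isometry : 0 < um -> (forall a x, V a x -> trace_free_hess (g a) (uc a) x = 0) -> (forall p, W p = um * um) ->
  exists c : R, 0 < c /\ exists Phi : M -> ball, riemannian_isometry g (@deSitter_metric R n.+1) Phi /\
    forall p, u p = c * deSitter_u (Phi p).
Proof.
move=> um0 hT hW; pose v p := um^-1 * u p; have umN : um != 0 by rewrite gt_eqF.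
have hc a : height_chart (V a) (g a) (v \o inv a).
  have hV := chart_hopen hm a.
  split => //.
  - exact: metric_mx.
  - by move=> x; exact: (metricT hg).
  - by move=> x; exact: (metric_posdef hg).
  - by apply: (smooth_onM (smooth_on_cst um^-1) (su (a := a))).
  - by move=> x _; apply: mulr_ge0; [rewrite invr_ge0 ltW|exact: (static_u_ge0 hs)].
  - move=> x i j Vx; have := hT a x Vx => /matrixP /(_ i j); rewrite [LHS]mxE [X in X + _]mxE mxscaleE [RHS]mxE => e.
    rewrite (_ : v \o inv a = fun y => um^-1 * uc a y) // (hessianZ hV _ _ (su (a := a)) i j Vx).
    by rewrite (_ : hessian _ _ _ _ _ = - (uc a x * g a x i j)); [rewrite /= /v; ring|apply/eqP; rewrite -addr_eq0 e].
  - move=> x Vx; rewrite (_ : v \o inv a = fun y => um^-1 * uc a y) // (gradsqZ hV _ _ (su (a := a)) Vx).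
    have := energy_chart hs Vx; rewrite hW /energy => e.
    have -> : gradsq (g a) (uc a) x = um * um - uc a x * uc a x by rewrite e addrK.
    by rewrite /= /v; field.
have [p0 hp0 _] := u_max_attained hs.
have vb p : boundary A p -> v p = 0 by move=> bp; rewrite /v (static_zero hs bp) mulr0.
have v1 : v p0 = 1 by rewrite /v hp0 mulVf.
have [Y [S [DY YS SY dY cS]]] := global_developing hm hg (static_compact hs) (static_connected hs) hc vb v1.
have [F [iF hF]] := hemisphere_isometry hm hg hc YS SY dY cS.
exists um; split => //; exists F; split => // p.
by rewrite -hF /v mulrA divff // mul1r.
Qed.

Lemma boundary_zero p : boundary A p <-> u p = 0.
Proof.
split=> [/(static_zero hs) //|up].
by apply: contrapT => /(static_pos hs); rewrite up ltxx.
Qed.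

(** Where u = 0 the static equation gives D^2 u = 0, and the differential of |Du|^2 is 2 D^2 u (Du,
    .). In a chart the boundary is the face x_0 = 0, along which points can be joined by
    segments. *)
Lemma energy_locally_constant p : boundary A p -> \forall q \near p, boundary A q -> W q = W p.
Proof.
move=> bp; have [a dp] := chart_cover hm p; have hV := chart_hopen hm a.
have [e e0 he] := hopen_cube hV (chart_in dp).
apply: filterS (cube_open hm dp e0) => q [dq cq] bq.
pose s := gradsq (g a) (uc a).
have ss : smooth_on (V a) s by apply: (smooth_gradsq hV); [exact: metric_mx|exact: (metric_posdef hg)|exact: su].
have x0 := (boundaryE hm hg dp).1 bp; have y0 := (boundaryE hm hg dq).1 bq.
have WE r : dom a r -> boundary A r -> W r = s (chart a r).
  by move=> dr br; rewrite /total_energy (grad_norm_sqr hs dr) (static_zero hs br) mul0r addr0.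
rewrite !WE //; set x := chart a p in x0 cq he *; set y := chart a q in y0 cq *.
have hl (t : R) : 0 <= t <= 1 -> V a (x + t *: (y - x)).
  move=> t01; apply: he; first by apply: cube_convex => //; exact: cube_center.
  by rewrite half_spaceE !mxE x0 y0 subrr mulr0 addr0.
have s0 z : V a z -> z 0 0 = 0 -> forall i, partial i s z = 0.
  move=> Vz z0 i; rewrite (partial_gradsq hV (metric_mx hg (a := a)) (fun w => metricT hg (x := w)) (fun w => metric_posdef hg (x := w)) (su (a := a)) i Vz).
  have u0 : uc a z = 0.
    by rewrite /= (static_zero hs) //; apply/(boundaryE hm hg (chart_inv_dom hm Vz)); rewrite (chart_invK hm Vz).
  have -> : hessm (g a) (uc a) z = 0.
    apply/matrixP => k l; rewrite mxE [RHS]mxE; have := static_ricci hs Vz k l.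
    by rewrite /= -[u _]/(uc a z) u0 mulr0 !mul0r addr0 => <-.
  by rewrite mul0mx mxE mulr0.
apply: (partial0_const hV ss hl) => i t t01; apply: s0; first exact: hl.
by rewrite !mxE x0 y0 subrr mulr0 addr0.
Qed.

Lemma energy_boundary p : boundary A p -> W p = grad_norm g u p ^+ 2.
Proof. by move=> bp; rewrite /total_energy (static_zero hs bp) mul0r addr0. Qed.

Variable N : set M.
Hypothesis hN : pi0 (~` MAX u) N.
Local Notation dN := (boundary A `&` N).

(** MAX(u) is disjoint from the boundary, so the closure of N adds no zero of u. *)
Lemma compact_dN : compact dN.
Proof.
have -> : dN = closure N `&` [set p | u p = 0].
  apply/seteqP; split => p [].
    by move=> /boundary_zero bp Np; split => //; exact: subset_closure.
  move=> cp up; split; first exact/boundary_zero.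
  have [//|mp] := closure_N hs hN cp.
  by case: (MAX_not_boundary hs hN mp); exact/boundary_zero.
have cC : compact (closure N).
  by apply: (subclosed_compact _ (static_compact hs)) => //; exact: closed_closure.
apply: (compact_closedI cC).
apply: (@closed_comp _ _ u [set t | t = 0]); last exact: closed_eq.
by move=> p _; exact: (static_u_continuous hs).
Qed.

(** |Du| is locally constant on the boundary, hence constant on a connected component, and [get] has
    a single candidate. *)
Lemma surface_gravityE Sigma p : pi0 dN Sigma -> Sigma p -> surface_gravity g u Sigma = grad_norm g u p / um.
Proof.
move=> hS Sp; have SB q : Sigma q -> boundary A q by move=> /(pi0_sub hS) [].
have cst q : Sigma q -> grad_norm g u q = grad_norm g u p.
  move=> Sq; have e : W q = W p.
    apply: (@locally_constant _ _ Sigma W (pi0_connected hS)) => // r Sr.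
    by apply: filterS (energy_locally_constant (SB r Sr)) => t ht St; apply: ht; exact: SB.
  move: e; rewrite !energy_boundary; [|exact: SB|exact: SB].
  by move=> /eqP; rewrite eqrXn2 ?(grad_norm_ge0 hs) // => /eqP.
rewrite /surface_gravity; case: xgetP => [k _ hk|/(_ (grad_norm g u p / um)) []]; first exact: hk.
by move=> q Sq; rewrite cst.
Qed.

(** The maximum over the components is realized by the component of a point where W is maximal on
    the compact set [dN]. *)
Theorem surface_gravity_bound : (0 < n)%N -> exists kmax : R,
    [/\ is_max (surface_gravity g u @` pi0 dN) kmax, 1 <= kmax &
      kmax = 1 -> exists c : R, 0 < c /\ exists Phi : M -> ball,
        riemannian_isometry g (@deSitter_metric R n.+1) Phi /\ forall p, u p = c * deSitter_u (Phi p)].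
Proof.
move=> n0; have um0 := u_max_gt0 hs hN.
have [b bb Nb] := boundary_in_component hs hN.
have [||p1 /set_mem p1N hp1] := @compact_EVT_max M R W dN _ compact_dN.
- by exists b.
- by apply: continuous_subspaceT; exact: (smooth_fun_continuous hm (smooth_total_energy hs)).
have gle p : dN p -> grad_norm g u p <= grad_norm g u p1.
  move=> dp; have := hp1 p (mem_set dp); rewrite !energy_boundary; [|exact: p1N.1|exact: dp.1].
  by rewrite ler_pXn2r ?nnegrE ?(grad_norm_ge0 hs).
pose kmax := grad_norm g u p1 / um; exists kmax.
have kle : kmax <= 1 -> forall p, boundary A p -> N p -> W p <= um * um.
  move=> k1 p bp Np; rewrite energy_boundary // -expr2 ler_pXn2r ?nnegrE ?(grad_norm_ge0 hs) ?(ltW um0) //.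
  by apply: le_trans (gle p (conj bp Np)) _; rewrite -[um]mul1r -ler_pdivrMr.
split.
- split.
    exists (connected_component dN p1); first by exists p1.
    by apply: surface_gravityE; [exists p1|exact: connected_component_refl].
  move=> _ [Sigma hS <-]; have [p Sp] := pi0_neq0 hS.
  rewrite (surface_gravityE hS Sp) ler_pM2r ?invr_gt0 //; apply: gle; exact: (pi0_sub hS Sp).
(* If kmax < 1 the rigidity argument still applies and gives W = u_max^2 at [p1], that is kmax =
   1. *)
- rewrite leNgt; apply/negP => k1; have := rigid_energy hs hN (kle (ltW k1)) n0 p1.
  rewrite (energy_boundary p1N.1) -expr2 => /eqP; rewrite eqrXn2 ?(grad_norm_ge0 hs) ?(ltW um0) // => /eqP e.
  by move: k1; rewrite /kmax e divff ?ltxx // gt_eqF.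
- move=> k1; have kN : forall p, boundary A p -> N p -> W p <= um * um by apply: kle; rewrite k1.
  apply: rigid_isometry => // [a x|p]; [exact: (rigid_hessian hs hN kN n0)|exact: (rigid_energy hs hN kN n0)].
Qed.
End SurfaceGravity.

Theorem theorem2p2 (R : realType) (n : nat) (hn : (3 <= n)%N)
    (M : topologicalType) (A : atlas R n M) (g : metric_components A)
    (u : M -> R) (hu : is_static_triple g u)
    (N : set M) (hN : pi0 (~` MAX u) N) :
  let dN := boundary A `&` N in
  exists kmax : R,
    [/\ is_max (surface_gravity g u @` pi0 dN) kmax,
        1 <= kmax
      & kmax = 1 ->
        exists c : R, 0 < c /\
        exists Phi : M -> set_type (@closed_ball1 R n),
          riemannian_isometry g deSitter_metric Phi /\
          forall p, u p = c * deSitter_u (Phi p)].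
Proof.
(* Everything above is in dimension [n.+1], so that the coordinate of index 0, which defines the
   half-space, exists. *)
case: n => [//|n] in hn A g hu *.
have n0 : (0 < n)%N by rewrite -ltnS; apply: leq_trans hn.
exact: (surface_gravity_bound hu hN n0).
Qed.
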